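(* Let $A:\mathbb{R}\to \mathrm{GL}(N,\mathbb{R})$ be a smooth, faithful and closed representation such that each $A(t)$ with $t\neq 0$ has no eigenvalue of unit length, and let $\rho:\mathbb{R}^N\rtimes_A\mathbb{R}\to \mathrm{GL}(N+1,\mathbb{C})$ be the representation $$\rho(b,t)=\begin{pmatrix}A(t)&b\\0&1\end{pmatrix}.$$ Assume $G\subset \mathrm{PGL}(N+1,\mathbb{C})$ admits a lift $\tilde G\subset \mathrm{GL}(N+1,\mathbb{C})$ conjugate in $\mathrm{GL}(N+1,\mathbb{C})$ to $\rho(\mathbb{R}^N\rtimes_A\mathbb{R})$. Let $N_1$ (respectively $N_2$) be the number of eigenvalues of the matrix $A(1)$, counted with multiplicity, inside (respectively outside) the unit disk. Then the following holds. (1) If $N_i>0$, there is a $G$-invariant open set $\Omega_i\subset\mathbb{P}^N_{\mathbb{C}}$ on which the action of $G$ is equivariant to the action of $G$ on a product $G\times X$ given by $(h,(g,x))\mapsto (hg,x)$, where $X$ is diffeomorphic to the product of an $(N_i-1)$-sphere and a Euclidean space. (2) If $\Omega\subset\mathbb{P}^N_{\mathbb{C}}$ is a $G$-invariant open set where the action of $G$ is proper, then $\Omega\subset\Omega_i$ for some of the sets $\Omega_i$ of part (1). (3) If $G$ admits a lattice $\Gamma$, then $A$ is a representation into $\mathrm{SL}(N,\mathbb{R})$, there are exactly two open sets $\Omega_1$, $\Omega_2$ as in part (1), and the complement $\Lambda=\mathbb{P}^N_{\mathbb{C}}\setminus(\Omega_1\cup\Omega_2)$ is a closed, $G$-invariant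 set such that: (a) the set of points of $\Lambda$ with infinite isotropy is dense (in $\Lambda$); (b) for almost every $z\in\Lambda\cap\mathbb{P}^N_{\mathbb{R}}$ the set of accumulation points of the orbit $\Gamma z$ is dense in $\Lambda\cap\mathbb{P}^N_{\mathbb{R}}$.
   Context: $N$ is a positive integer. $\mathbb{R}^N\rtimes_A\mathbb{R}$ is the Lie group with underlying manifold $\mathbb{R}^N\times\mathbb{R}$ and product $(b,t)\cdot(b',t')=(b+A(t)b',\,t+t')$. A representation of $\mathbb{R}$ is closed if its image is a closed subgroup. A lift of $G\subset\mathrm{PGL}(N+1,\mathbb{C})$ is a subgroup $\tilde G\subset \mathrm{GL}(N+1,\mathbb{C})$ whose image under the projection $\mathrm{GL}(N+1,\mathbb{C})\to\mathrm{PGL}(N+1,\mathbb{C})$ is $G$. The group $\mathrm{PGL}(N+1,\mathbb{C})$, and hence $G$, acts on the complex projective space $\mathbb{P}^N_{\mathbb{C}}$ by $g[z]=[gz]$. Two actions are called equivariant when there is an equivariant diffeomorphism between the spaces acted on. An action of a Lie group $G$ on $\Omega$ is proper if for every sequence $(g_n,z_n)$ in $G\times\Omega$ such that $z_n$ and $g_nz_n$ converge in $\Omega$, the sequence $g_n$ has a convergent subsequence. A lattice is a discrete subgroup of finite covolume. A point has infinite isotropy if its stabilizer under the group action is infinite. $\mathbb{P}^N_{\mathbb{R}}\subset\mathbb{P}^N_{\mathbb{C}}$ is the set of points having real homogeneous coordinates. *)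

(* Defs.v *)
From HB Require Import structures.
From mathcomp Require Import all_boot all_order all_algebra all_fingroup.
From mathcomp Require Import generic_quotient complex.
From mathcomp Require Import all_classical all_reals all_analysis.

Set Implicit Arguments.
Unset Strict Implicit.
Unset Printing Implicit Defensive.

Import Order.TTheory GRing.Theory Num.Theory.
Import numFieldNormedType.Exports.

Local Open Scope classical_set_scope.
Local Open Scope ring_scope.
Local Open Scope quotient_scope.

(* R[i] seen through a [numClosedFieldType] head, so that the topology that
   MathComp-Analysis puts on number fields is found. *)
Definition Cx (R : realType) : numClosedFieldType := R[i].
Definition toC (R : realType) (x : R) : Cx R := x%:C%C.

Section Smooth.
Variable R : realType.

Fixpoint Ck (V W : normedModType R) (k : nat) (U : set V) (f : V -> W) : Prop :=
  match k with
  | 0 => forall x, U x -> {for x, continuous f}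
  | j.+1 => (forall x, U x -> differentiable f x) /\
            (forall v : V, Ck j U (fun x => 'D_v f x))
  end.

Definition smooth (V W : normedModType R) (U : set V) (f : V -> W) : Prop :=
  forall k, Ck k U f.

Record chart (E : normedModType R) (T : Type) := Chart {
  chart_dom : set T;
  chart_map :> T -> E
}.

Definition atlas (E : normedModType R) (T : Type) := set (chart E T).

Definition vect_atlas (E : normedModType R) : atlas E E :=
  [set @Chart E E setT id].

Definition prod_atlas (E F : normedModType R) (T U : Type)
    (a : atlas E T) (b : atlas F U) : atlas (E * F)%type (T * U)%type :=
  [set c | exists2 c1, a c1 & exists2 c2, b c2 &
     c = Chart (chart_dom c1 `*` chart_dom c2) (fun x => (c1 x.1, c2 x.2))].

(* A map defined on an arbitrary subset S of a manifold T is smooth when it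
   extends locally, around each point of S, to a smooth map on an open subset
   of T; the extension g is read in charts. *)
Definition smooth_on (E F : normedModType R) (T U : Type)
    (a : atlas E T) (b : atlas F U) (S : set T) (f : T -> U) : Prop :=
  forall x, S x ->
  exists2 c, a c & exists2 d, b d &
  [/\ chart_dom c x, chart_dom d (f x) &
   exists (V : set E) (g : E -> F),
   [/\ open V, V (c x), smooth V g &
    forall y, S y -> chart_dom c y -> V (c y) ->
      chart_dom d (f y) /\ g (c y) = d (f y)]].

Definition diffeo (E F : normedModType R) (T U : Type)
    (a : atlas E T) (b : atlas F U) (S : set T) (S' : set U)
    (f : T -> U) : Prop :=
  exists f' : U -> T,
  [/\ forall x, S x -> S' (f x) /\ f' (f x) = x,
      forall y, S' y -> S (f' y) /\ f (f' y) = y,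
      smooth_on a b S f & smooth_on b a S' f'].

Definition sphere (m : nat) : set 'rV[R]_m :=
  [set x | \sum_(i < m) x 0 i ^+ 2 = 1].

End Smooth.

Arguments vect_atlas {R} E _.
Arguments sphere R m _ : clear implicits.

Record GL (n : nat) (F : fieldType) :=
  MkGL { GLmx :> 'M[F]_n; GLmx_unit : GLmx \in unitmx }.

HB.instance Definition _ n (F : fieldType) := [isSub for @GLmx n F].
HB.instance Definition _ n (F : fieldType) := [Choice of GL n F by <:].

Section GLgroup.
Variables (n : nat) (F : fieldType).

Lemma GLmul_subproof (g h : GL n F) : g *m h \in unitmx.
Proof. by rewrite unitmx_mul !GLmx_unit. Qed.
Definition GLmul (g h : GL n F) := MkGL (GLmul_subproof g h).
Definition GLone : GL n F := MkGL (unitmx1 F n).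
Lemma GLinv_subproof (g : GL n F) : invmx g \in unitmx.
Proof. by rewrite unitmx_inv GLmx_unit. Qed.
Definition GLinv (g : GL n F) := MkGL (GLinv_subproof g).

Lemma GLmulA : associative GLmul.
Proof. by move=> x y z; apply/val_inj; rewrite /= mulmxA. Qed.
Lemma GLmul1 : left_id GLone GLmul.
Proof. by move=> x; apply/val_inj; rewrite /= mul1mx. Qed.
Lemma GLmulx1 : right_id GLone GLmul.
Proof. by move=> x; apply/val_inj; rewrite /= mulmx1. Qed.
Lemma GLmulV : left_inverse GLone GLinv GLmul.
Proof. by move=> x; apply/val_inj; rewrite /= mulVmx ?GLmx_unit. Qed.
Lemma GLmulxV : right_inverse GLone GLinv GLmul.
Proof. by move=> x; apply/val_inj; rewrite /= mulmxV ?GLmx_unit. Qed.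
HB.instance Definition _ :=
  isGroup.Build (GL n F) GLmulA GLmul1 GLmulx1 GLmulV GLmulxV.
HB.instance Definition _ := isPointed.Build (GL n F) GLone.

End GLgroup.

HB.instance Definition _ n (F : numFieldType) :=
  Topological.copy (GL n F) (initial_topology (@GLmx n F : GL n F -> 'M[F]_n)).

Definition is_subgroup (G : groupType) (H : set G) : Prop :=
  [/\ H 1%g, forall x y, H x -> H y -> H (x * y)%g
    & forall x, H x -> H x^-1%g].

Section Proportional.
Variables (F : fieldType) (m n : nat).

Definition proportional (M M' : 'M[F]_(m, n)) : bool :=
  `[< exists2 c : F, c != 0 & M' = c *: M >].

Lemma proportional_refl : reflexive proportional.
Proof. by move=> M; apply/asboolP; exists 1; rewrite ?oner_neq0 ?scale1r. Qed.
Lemma proportional_sym : symmetric proportional.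
Proof.
have H M M' : proportional M M' -> proportional M' M.
  move=> /asboolP[c c0 ->]; apply/asboolP; exists c^-1; rewrite ?invr_eq0//.
  by rewrite scalerA mulVf// scale1r.
by move=> M M'; apply/idP/idP; exact: H.
Qed.
Lemma proportional_trans : transitive proportional.
Proof.
move=> M' M M'' /asboolP[c c0 ->] /asboolP[d d0 ->]; apply/asboolP.
by exists (d * c); rewrite ?mulf_neq0 ?scalerA.
Qed.

End Proportional.

Section Projective.
Variables (R : realType) (n : nat).
Local Notation C := (Cx R).

Record nzvec := MkNz { nzvec_val :> 'cV[C]_n; nzvecP : nzvec_val != 0 }.
HB.instance Definition _ := [isSub for nzvec_val].
HB.instance Definition _ := [Choice of nzvec by <:].
HB.instance Definition _ := Topological.copy nzvec
  (initial_topology (nzvec_val : nzvec -> 'cV[C]_n)).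

Definition nzvec_rel (v w : nzvec) := proportional v w.
Lemma nzvec_rel_refl : reflexive nzvec_rel.
Proof. by move=> x; exact: proportional_refl. Qed.
Lemma nzvec_rel_sym : symmetric nzvec_rel.
Proof. by move=> x y; exact: proportional_sym. Qed.
Lemma nzvec_rel_trans : transitive nzvec_rel.
Proof. by move=> y x z; exact: proportional_trans. Qed.
Canonical nzvec_equiv :=
  EquivRel nzvec_rel nzvec_rel_refl nzvec_rel_sym nzvec_rel_trans.

(* [projsp R n] is the space of lines of C^n, so P^N is [projsp R (N + 1)]. *)
Definition projsp := quotient_topology {eq_quot nzvec_rel}.
HB.instance Definition _ := Topological.on projsp.
HB.instance Definition _ := Quotient.on projsp.

Definition GL_rel (g h : GL n C) := proportional g h.
Lemma GL_rel_refl : reflexive GL_rel.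
Proof. by move=> x; exact: proportional_refl. Qed.
Lemma GL_rel_sym : symmetric GL_rel.
Proof. by move=> x y; exact: proportional_sym. Qed.
Lemma GL_rel_trans : transitive GL_rel.
Proof. by move=> y x z; exact: proportional_trans. Qed.
Canonical GL_equiv := EquivRel GL_rel GL_rel_refl GL_rel_sym GL_rel_trans.

Definition PGL := quotient_topology {eq_quot GL_rel}.
HB.instance Definition _ := Topological.on PGL.
HB.instance Definition _ := Quotient.on PGL.

Definition toPGL (g : GL n C) : PGL := \pi_PGL g.
Definition toproj (v : nzvec) : projsp := \pi_projsp v.

Lemma toPGLP g h : reflect (exists2 c : C, c != 0 & GLmx h = c *: GLmx g)
  (toPGL g == toPGL h).
Proof.
have -> : (toPGL g == toPGL h) = GL_rel g h.
  apply/eqP/idP => [/(@eqmodP _ GL_equiv)//|gh].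
  exact/(@eqmodP _ GL_equiv).
exact: asboolP.
Qed.
Lemma toprojP v w : reflect
  (exists2 c : C, c != 0 & nzvec_val w = c *: nzvec_val v)
  (toproj v == toproj w).
Proof.
have -> : (toproj v == toproj w) = nzvec_rel v w.
  apply/eqP/idP => [/(@eqmodP _ nzvec_equiv)//|gh].
  exact/(@eqmodP _ nzvec_equiv).
exact: asboolP.
Qed.
Lemma toPGL_repr (x : PGL) : toPGL (repr x) = x. Proof. exact: reprK. Qed.
Lemma toproj_repr (z : projsp) : toproj (repr z) = z. Proof. exact: reprK. Qed.

Definition PGLmul (x y : PGL) : PGL := toPGL (repr x * repr y)%g.
Definition PGLinv (x : PGL) : PGL := toPGL (repr x)^-1%g.
Definition PGLone : PGL := toPGL 1%g.

Lemma repr_toPGL g :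
  exists2 c : C, c != 0 & GLmx (repr (toPGL g)) = c *: GLmx g.
Proof. by apply/toPGLP; rewrite toPGL_repr. Qed.

Lemma toPGLM g h : toPGL (g * h)%g = PGLmul (toPGL g) (toPGL h).
Proof.
have [c c0 cE] := repr_toPGL g; have [d d0 dE] := repr_toPGL h.
apply/eqP/toPGLP; exists (c * d); first exact: mulf_neq0.
by rewrite /= cE dE -scalemxAl -scalemxAr scalerA.
Qed.

Lemma toPGLV g : toPGL g^-1%g = PGLinv (toPGL g).
Proof.
have [c c0 cE] := repr_toPGL g.
apply/eqP/toPGLP; exists c^-1; first by rewrite invr_eq0.
by rewrite /= cE invmxZ// -cE GLmx_unit.
Qed.

Lemma PGLmulA : associative PGLmul.
Proof.
move=> x y z; rewrite -(toPGL_repr x) -(toPGL_repr y) -(toPGL_repr z).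
by rewrite -!toPGLM mulgA.
Qed.
Lemma PGLmul1 : left_id PGLone PGLmul.
Proof. by move=> x; rewrite -(toPGL_repr x) -toPGLM mul1g. Qed.
Lemma PGLmulx1 : right_id PGLone PGLmul.
Proof. by move=> x; rewrite -(toPGL_repr x) -toPGLM mulg1. Qed.
Lemma PGLmulV : left_inverse PGLone PGLinv PGLmul.
Proof. by move=> x; rewrite -(toPGL_repr x) -toPGLV -toPGLM mulVg. Qed.
Lemma PGLmulxV : right_inverse PGLone PGLinv PGLmul.
Proof. by move=> x; rewrite -(toPGL_repr x) -toPGLV -toPGLM mulgV. Qed.
HB.instance Definition _ :=
  isGroup.Build PGL PGLmulA PGLmul1 PGLmulx1 PGLmulV PGLmulxV.
HB.instance Definition _ := isPointed.Build PGL PGLone.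

Lemma GLact_subproof (g : GL n C) (v : nzvec) : g *m v != 0.
Proof.
apply: contraNneq (nzvecP v) => gv0.
by rewrite -[nzvec_val v](mulKmx (GLmx_unit g)) gv0 mulmx0.
Qed.
Definition GLact (g : GL n C) (v : nzvec) : nzvec := MkNz (GLact_subproof g v).

Definition act (x : PGL) (z : projsp) : projsp :=
  toproj (GLact (repr x) (repr z)).

Lemma actE g v : act (toPGL g) (toproj v) = toproj (GLact g v).
Proof.
have [c c0 cE] := repr_toPGL g.
have [d d0 dE] : exists2 d : C, d != 0 &
    nzvec_val (repr (toproj v)) = d *: nzvec_val v.
  by apply/toprojP; rewrite toproj_repr.
apply/esym/eqP/toprojP; exists (c * d); first exact: mulf_neq0.
by rewrite /= cE dE -scalemxAl -scalemxAr scalerA.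
Qed.

End Projective.

Section ProjectiveAtlas.
Variable R : realType.
Local Notation C := (Cx R).

Definition realify (m : nat) (u : 'rV[C]_m) : 'rV[R]_(m + m) :=
  row_mx (map_mx (@complex.Re R) u) (map_mx (@complex.Im R) u).

(* Real and imaginary parts of the affine coordinates M_l / M_k (l != k) of the class of M *)
Definition affine_coord (m n : nat) (k : 'I_(m * n)) (M : 'M[C]_(m, n)) :=
  realify (col' k ((mxvec M 0 k)^-1 *: mxvec M)).

Definition projsp_atlas (n : nat) : atlas _ (projsp R n) :=
  [set c | exists k, c =
    Chart [set z : projsp R n | mxvec (repr z) 0 k != 0]
          (fun z => affine_coord k (repr z))].

(* PGL(n) is open in the projective space of n x n matrices. *)
Definition PGL_atlas (n : nat) : atlas _ (PGL R n) :=
  [set c | exists k, c =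
    Chart [set g : PGL R n | mxvec (repr g) 0 k != 0]
          (fun g => affine_coord k (repr g))].

End ProjectiveAtlas.

Arguments projsp_atlas R n _ : clear implicits.
Arguments PGL_atlas R n _ : clear implicits.

Section Rho.
Variables (R : realType) (N : nat) (A : R -> GL N R).

Definition is_representation : Prop := forall s t, A (s + t) = (A s * A t)%g.

Definition sdprod_mul (x y : 'cV[R]_N * R) : 'cV[R]_N * R :=
  (x.1 + A x.2 *m y.1, x.2 + y.2).

Definition rho_mx (x : 'cV[R]_N * R) : 'M[R]_(N + 1) :=
  block_mx (A x.2) x.1 0 1%:M.

Lemma rho_subproof x : map_mx (@toC R) (rho_mx x) \in unitmx.
Proof.
rewrite -[toC (R:=R)]/(fun x : R => x%:C%C) map_unitmx unitmxE det_ublock det1.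
by rewrite mulr1 -unitmxE GLmx_unit.
Qed.

Definition rho (x : 'cV[R]_N * R) : GL (N + 1) (Cx R) := MkGL (rho_subproof x).

Lemma rhoM : is_representation ->
  forall x y, rho (sdprod_mul x y) = (rho x * rho y)%g.
Proof.
move=> repA x y; apply/val_inj; rewrite /= -map_mxM; congr map_mx.
rewrite /rho_mx /= mulmx_block repA !mulmx0 !mul0mx !mulmx1 !addr0 !add0r.
by rewrite [A x.2 *m y.1 + _]addrC.
Qed.

End Rho.

Definition eigenvalues (R : realType) (n : nat) (M : 'M[R]_n) : seq (Cx R) :=
  sval (closed_field_poly_normal (char_poly (map_mx (@toC R) M))).

Section Actions.
Variables (R : realType) (n : nat).
Implicit Types (G : set (PGL R n)) (O L : set (projsp R n)).

Definition is_lift (Gt : set (GL n (Cx R))) G : Prop :=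
  is_subgroup Gt /\ @toPGL R n @` Gt = G.

Definition is_invariant G O : Prop :=
  forall g z, G g -> O z -> O (act g z).

Definition proper_action G O : Prop :=
  forall (g : nat -> PGL R n) (z : nat -> projsp R n) (a b : projsp R n),
    (forall k, G (g k)) -> (forall k, O (z k)) -> O a -> O b ->
    z @ \oo --> a -> (fun k => act (g k) (z k)) @ \oo --> b ->
  exists (phi : nat -> nat) (h : PGL R n),
    [/\ {homo phi : i j / (i < j)%N}, G h & (g \o phi) @ \oo --> h].

(* The action of G on O is equivariant to left translation on G x X, with X
   diffeomorphic to S^(m-1) x R^k for some k.  G is a closed subgroup of
   PGL(n), with the smooth structure of an embedded submanifold. *)
Definition product_action G (m : nat) O : Prop :=
  exists (d k : nat) (X : set 'rV[R]_d),
    (exists f, diffeo (vect_atlas 'rV[R]_d)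
      (prod_atlas (vect_atlas 'rV[R]_m) (vect_atlas 'rV[R]_k))
      X (sphere R m `*` setT) f) /\
    (exists Phi : PGL R n * 'rV[R]_d -> projsp R n,
      diffeo (prod_atlas (PGL_atlas R n) (vect_atlas 'rV[R]_d))
        (projsp_atlas R n) (G `*` X) O Phi /\
      forall h g x, G h -> G g -> X x -> Phi ((h * g)%g, x) = act h (Phi (g, x))).

Definition infinite_isotropy G : set (projsp R n) :=
  [set z | infinite_set [set g | G g /\ act g z = z]].

Definition orbit_of G (z : projsp R n) : set (projsp R n) :=
  [set act g z | g in G].

Definition borelPGL := g_sigma_algebraType (@open (PGL R n)).

(* For closed G, the Borel subsets of G are the Borel subsets of PGL(n)
   contained in G; the values of mu on other sets play no role. *)
Definition left_haar G (mu : {measure set borelPGL -> \bar R}) : Prop :=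
  [/\ forall (B : set borelPGL) g, measurable B -> B `<=` G -> G g ->
        mu [set (g * x)%g | x in (B : set (PGL R n))] = mu B,
      forall K : set (PGL R n), compact K -> K `<=` G -> (mu K < +oo)%E
    & (0 < mu G)%E].

(* D is a strict fundamental domain for Gam acting on G by left translations,
   which preserve mu; this makes mu D the covolume. *)
Definition finite_covolume G (Gam : set (PGL R n)) : Prop :=
  exists (mu : {measure set borelPGL -> \bar R}) (D : set borelPGL),
    [/\ left_haar G mu, measurable D, D `<=` G,
        forall g, G g -> exists! gam, Gam gam /\ D (gam * g)%g
      & (mu D < +oo)%E].

Definition is_lattice G (Gam : set (PGL R n)) : Prop :=
  [/\ is_subgroup Gam, Gam `<=` G, Gam `<=` isolated Gam
    & finite_covolume G Gam].

End Actions.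

Definition dense_in (T : topologicalType) (Y D : set T) : Prop :=
  Y `<=` closure (Y `&` D).

Section RealPoints.
Variables (R : realType) (n : nat).

Definition real_points : set (projsp R n) :=
  [set z | exists w : nzvec R n, toproj w = z /\
    exists v : 'cV[R]_n, nzvec_val w = map_mx (@toC R) v].

Definition box (d : nat) (a b : 'rV[R]_d) : set 'rV[R]_d :=
  [set x | forall i, a 0 i <= x 0 i <= b 0 i].

Definition box_volume (d : nat) (a b : 'rV[R]_d) : R :=
  \prod_(i < d) Num.max 0 (b 0 i - a 0 i).

Definition lebesgue_null (d : nat) (Z : set 'rV[R]_d) : Prop :=
  forall e : R, 0 < e -> exists a b : nat -> 'rV[R]_d,
    Z `<=` \bigcup_k box (a k) (b k) /\
    (\sum_(0 <= k <oo) (box_volume (a k) (b k))%:E <= e%:E)%E.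

(* homogeneous coordinates: 1 in position j, the entries of x elsewhere *)
Definition affine_vec (j : 'I_n) (x : 'rV[R]_n.-1) : 'cV[Cx R]_n :=
  \col_i toC (if unlift j i is Some l then x 0 l else 1).

Lemma affine_vec_neq0 j x : affine_vec j x != 0.
Proof.
apply/eqP => /matrixP/(_ j 0); rewrite !mxE unlift_none => /eqP.
by rewrite fmorph_eq0 oner_eq0.
Qed.

Definition affine_point (j : 'I_n) (x : 'rV[R]_n.-1) : projsp R n :=
  toproj (MkNz (affine_vec_neq0 j x)).

(* The real points of Z have measure zero in the manifold P^(n-1)_R, read in
   its affine charts. *)
Definition real_null (Z : set (projsp R n)) : Prop :=
  forall j : 'I_n, lebesgue_null [set x | Z (affine_point j x)].

Definition ae_real (Y P : set (projsp R n)) : Prop := real_null (Y `\` P).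

End RealPoints.

Arguments real_points R n _ : clear implicits.

(* Main.v *)
(** Write a point of P^N as (p : q) in coordinates where G acts by p |-> A(t) p + q b, and put
  mom = Im(q^* p) in R^N, which G transforms by A(t) up to a positive factor.  Let R^N = E_s + E_u
  be the contracting and expanding subspaces of A(1).  Omega_1 (resp. Omega_2) is the set where the
  component of mom in E_s (resp. E_u) is nonzero.  There q is nonzero, and in the affine coordinate
  x + i y = p / q the group acts by x |-> A(t) x + b, y |-> A(t) y; a quadratic Lyapunov function on
  E_s (resp. E_u) is strictly monotone along the flow, so its unit sphere, times the complementary
  subspace, is a smooth cross-section for the action.
  Points with mom = 0 have noncompact stabilizers, and if y is in E_u and y' in E_s then
  y + A(n) y' -> y while A(-n) (y + A(n) y') -> y': so an open set with a proper action
  avoids mom = 0 and lies in one of the Omega_i.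
  A lattice of G meets R^N in a lattice L of R^N and contains an element g0 with t <> 0, whose linear
  part is a hyperbolic automorphism of L; hence det A = 1 and both subspaces are nonzero.  Torsion
  points of R^N / L are periodic under g0, which gives dense infinite isotropy.  A closed invariant
  set E of R^N differs from its translates by null sets, by contraction along E_s and E_u (Mautner);
  so E is null or everything, and almost every real point p / q has a dense orbit.  When P^N_R is not
  the set of real (p : q), it meets mom = 0 in finitely many hyperplanes, a null set. *)
From HB Require Import structures.
From mathcomp Require Import ring lra zify.
From mathcomp Require Import all_boot all_order all_algebra all_fingroup complex.
From mathcomp Require Import polydiv mxpoly.
From mathcomp Require Import all_classical all_reals all_analysis generic_quotient.
Require Import Defs.
Import Order.TTheory GRing.Theory Num.Theory numFieldNormedType.Exports.
Set Implicit Arguments.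
Unset Strict Implicit.
Unset Printing Implicit Defensive.
Local Open Scope classical_set_scope.
Local Open Scope ring_scope.

(** * Decay of powers of complex matrices *)

(** Two measures have to be compared. A lattice comes with an unspecified Haar measure of finite
    covolume, while the conclusion speaks of Lebesgue null sets, given by coverings with boxes.
    Restricting the Haar measure to the slab of times in [0, 1) gives a translation-invariant
    measure on R^N. Dyadic cells show that such a measure is unique up to a factor and that its
    compact null sets have Jordan content zero, a property that survives the Lipschitz passage to an
    affine chart. That a lattice contains translations spanning R^N and an element of nonzero time
    is obtained by packing: otherwise infinitely many disjoint sets, of measure bounded below, would
    inject into a domain of finite measure. Smoothness of the cross-section rests on the choice of
    the Lyapunov form: it solves Q g + g^T Q = -1, so its derivative along the backward flow is the
    squared norm, which never vanishes, and the implicit function theorem in one real unknown makes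
    the hitting time smooth. Convergence in G is read off from scale-invariant ratios of matrix
    entries, continuous on PGL. *)

Lemma cvg_sumr (K : numFieldType) (V : normedModType K) (I T : Type) (r : seq I) (F : set_system T)
    (FF : Filter F) (f : I -> T -> V) (l : I -> V) :
  (forall i, f i @ F --> l i) ->
  (fun x => \sum_(i <- r) f i x) @ F --> \sum_(i <- r) l i.
Proof.
move=> fl; elim: r => [|i r IH].
  by under eq_fun do rewrite big_nil; rewrite big_nil; exact: cvg_cst.
by under eq_fun do rewrite big_cons; rewrite big_cons; exact: cvgD.
Qed.

Lemma cvg_sumr0 (K : numFieldType) (V : normedModType K) (I T : Type) (r : seq I) (F : set_system T)
    (FF : Filter F) (f : I -> T -> V) :
  (forall i, f i @ F --> (0 : V)) -> (fun x => \sum_(i <- r) f i x) @ F --> (0 : V).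
Proof. by move=> /cvg_sumr -/(_ r _); rewrite big1. Qed.

Section Modulus.
Variable R : realType.
Local Notation C := (Cx R).

(** The norm of R[i] takes its values in R[i]; its real part is a modulus in R, to which the order
    and the limits of real sequences apply. *)
Definition nrm (z : C) : R := complex.Re `|z|.

Lemma normC_nrm (z : C) : `|z| = toC (nrm z).
Proof. by rewrite /nrm /toC RRe_real// normr_real. Qed.

Lemma ltC_toC (x y : R) : (toC x < toC y) = (x < y).
Proof. by rewrite /toC ltcR. Qed.

Lemma leC_toC (x y : R) : (toC x <= toC y) = (x <= y).
Proof. by rewrite /toC lecR. Qed.

Lemma nrm_ge0 z : 0 <= nrm z.
Proof. by rewrite -leC_toC -normC_nrm normr_ge0. Qed.

Lemma nrmM z w : nrm (z * w) = nrm z * nrm w.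
Proof.
have := normrM z w; rewrite !normC_nrm /toC -rmorphM/= => /complexI.
by [].
Qed.

Lemma nrmD z w : nrm (z + w) <= nrm z + nrm w.
Proof. by have := ler_normD z w; rewrite !normC_nrm /toC -rmorphD lecR. Qed.

Lemma nrm_toC (x : R) : nrm (toC x) = `|x|.
Proof. by rewrite /nrm /toC normc_def/= expr0n addr0 sqrtr_sqr. Qed.

Lemma nrm0 : nrm 0 = 0. Proof. by rewrite /nrm normr0. Qed.

Lemma nrm1 : nrm 1 = 1. Proof. by rewrite /nrm normr1. Qed.

Lemma nrm_lt1 z : (nrm z < 1) = (`|z| < 1).
Proof. by rewrite normC_nrm -(ltC_toC (nrm z) 1). Qed.

Lemma nrm_gt1 z : (1 < nrm z) = (1 < `|z|).
Proof. by rewrite normC_nrm -(ltC_toC 1 (nrm z)). Qed.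

(** Past an index K where v stays below (e / 2) (1 - r), the recurrence preserves the bound u (K +
    j) <= r^j u K + e / 2, because r (e / 2) + (1 - r) (e / 2) = e / 2. *)
Lemma contraction_cvg0 (u v : nat -> R) (r : R) : 0 <= r < 1 ->
  (forall k, 0 <= u k) -> (forall k, u k.+1 <= r * u k + v k) ->
  v @ \oo --> 0 -> u @ \oo --> 0.
Proof.
move=> /andP[r0 r1] u0 uv v0; apply/cvgrPdist_le => e e0.
have r1' : 0 < 1 - r by rewrite subr_gt0.
have /cvgrPdist_le/(_ (e / 2 * (1 - r))) := v0.
rewrite mulr_gt0// ?divr_gt0// => /(_ isT) [K _ HK].
have Hj j : u (K + j)%N <= r ^+ j * u K + e / 2.
  elim: j => [|j IH]; first by rewrite addn0 expr0 mul1r ler_wpDr// divr_ge0// ltW.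
  rewrite addnS (le_trans (uv _))//.
  have := HK (K + j)%N (leq_addr _ _); rewrite sub0r normrN => /ler_normlW hv.
  have := ler_wpM2l r0 IH; rewrite exprS; move: hv.
  set a := u (K + j)%N; set b := v _; set c := r ^+ j; set d := u K => hv hh.
  apply: (le_trans (lerD hh hv)); rewrite mulrDr mulrBr mulr1 mulrA.
  by rewrite [e / 2 * r]mulrC -addrA lerD2l addrC subrK.
have : (fun j => r ^+ j * u K) @ \oo --> 0 * u K.
  by apply: cvgMl; apply: cvg_expr; rewrite ger0_norm.
rewrite mul0r => /cvgrPdist_le/(_ (e / 2)); rewrite divr_gt0// => /(_ isT)[J _ HJ].
exists (K + J)%N => // k /= Kk.
have kE : k = (K + (k - K))%N by rewrite subnKC// (leq_trans _ Kk)// leq_addr.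
rewrite sub0r normrN ger0_norm// kE (le_trans (Hj _))//.
have /HJ : (J <= k - K)%N by lia.
rewrite /= sub0r normrN => /ler_normlW hx; lra.
Qed.

(* Induction on s: W (M - a) M^k, small by induction, is the forcing term of the recurrence W M^(k+1) = a W M^k + W (M - a) M^k. *)
Lemma row_decay n (M : 'M[C]_n.+1) (s : seq C) p (W : 'M[C]_(p, n.+1)) :
  all (fun a => nrm a < 1) s ->
  W *m horner_mx M (\prod_(a <- s) ('X - a%:P)) = 0 ->
  forall i j, (fun k => nrm ((W *m M ^+ k) i j)) @ \oo --> 0.
Proof.
elim: s W => [|a s IH] W /=.
  move=> _; rewrite big_nil rmorph1 mulmx1 => -> i j.
  rewrite (_ : (fun _ => _) = cst 0); first exact: cvg_cst.
  by apply/funext => k; rewrite mul0mx mxE nrm0.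
move=> /andP[a1 sa]; rewrite big_cons rmorphM/= rmorphB/= horner_mx_X horner_mx_C.
rewrite -mulmxE mulmxA => /IH H i j; have {}H := H sa i j.
apply: (@contraction_cvg0 _ _ (nrm a) _ _ _ H).
- by rewrite nrm_ge0.
- by move=> k; exact: nrm_ge0.
move=> k; rewrite -nrmM; apply: le_trans (nrmD _ _); rewrite le_eqVlt.
apply/orP; left; apply/eqP; congr nrm.
have -> : W *m M ^+ k.+1 = a *: (W *m M ^+ k) + W *m (M - a%:M) *m M ^+ k.
  by rewrite mulmxBr mulmxBl mul_mx_scalar -scalemxAl exprS -mulmxE mulmxA addrC subrK.
by rewrite !mxE.
Qed.

(** Here M M' = 1 gives W M'^(k+1) = a^-1 W M'^k - a^-1 W (M - a) M'^(k+1), a recurrence of ratio 1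
    / |a| < 1 whose forcing term is small by induction. *)
Lemma row_decay_inv n (M M' : 'M[C]_n.+1) (s : seq C) p (W : 'M[C]_(p, n.+1)) :
  M *m M' = 1%:M -> all (fun a => 1 < nrm a) s ->
  W *m horner_mx M (\prod_(a <- s) ('X - a%:P)) = 0 ->
  forall i j, (fun k => nrm ((W *m M' ^+ k) i j)) @ \oo --> 0.
Proof.
move=> MM'; elim: s W => [|a s IH] W /=.
  move=> _; rewrite big_nil rmorph1 mulmx1 => -> i j.
  rewrite (_ : (fun _ => _) = cst 0); first exact: cvg_cst.
  by apply/funext => k; rewrite mul0mx mxE nrm0.
move=> /andP[a1 sa]; rewrite big_cons rmorphM/= rmorphB/= horner_mx_X horner_mx_C.
rewrite -mulmxE mulmxA => /IH H i j; have {}H := H sa i j.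
have a0 : a != 0 by apply: contraTneq a1 => ->; rewrite nrm0 -leNgt ler01.
have nV : nrm a^-1 = (nrm a)^-1.
  apply: (mulfI (x := nrm a)); first by rewrite gt_eqF// (lt_trans _ a1).
  rewrite -nrmM mulfV// mulfV; last by rewrite gt_eqF// (lt_trans _ a1).
  by rewrite nrm1.
have H' : (fun k => nrm (a^-1) * nrm ((W *m (M - a%:M) *m M' ^+ k.+1) i j)) @ \oo --> 0.
  rewrite -[X in _ --> X](mulr0 (nrm a^-1)); apply: cvgMr.
  by move: H; rewrite -(cvg_shiftS (fun k => nrm ((W *m (M - a%:M) *m M' ^+ k) i j))).
apply: (@contraction_cvg0 _ _ (nrm a^-1) _ _ _ H').
- by rewrite nrm_ge0 nV invf_lt1// (lt_trans _ a1).
- by move=> k; exact: nrm_ge0.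
move=> k; rewrite -!nrmM.
have -> : W *m M' ^+ k.+1 = a^-1 *: (W *m M' ^+ k) +
    - (a^-1 *: (W *m (M - a%:M) *m M' ^+ k.+1)).
  rewrite -scalerBr mulmxBr mulmxBl mul_mx_scalar -scalemxAl {2}exprS -mulmxE.
  by rewrite mulmxA -(mulmxA W M M') MM' mulmx1 opprB addrC subrK scalerK.
rewrite [X in nrm X]mxE (le_trans (nrmD _ _))//.
by rewrite !mxE /nrm normrN.
Qed.

End Modulus.

(** * Hyperbolic splitting *)

Section Splitting.
Variable R : realType.
Local Notation C := (Cx R).

Lemma size_prod_eigenvalues n (M : 'M[R]_n) :
  char_poly (map_mx (@toC R) M) = \prod_(a <- eigenvalues M) ('X - a%:P).
Proof.
rewrite /eigenvalues; case: closed_field_poly_normal => s /= {1}->.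
by rewrite (monicP (char_poly_monic _)) scale1r.
Qed.

Lemma prod_XsubC_perm (F : fieldType) (s t : seq F) :
  \prod_(a <- s) ('X - a%:P) = \prod_(a <- t) ('X - a%:P) -> perm_eq s t.
Proof.
by move=> st; apply/allP => x _ /=; rewrite -!mu_prod_XsubC st.
Qed.

Lemma size_eigenvalues n (M : 'M[R]_n) : size (eigenvalues M) = n.
Proof.
apply/eqP; rewrite -eqSS -(size_prod_XsubC _ idfun) /= -size_prod_eigenvalues.
by rewrite size_char_poly.
Qed.

(** Conjugation permutes the spectrum of a real matrix with multiplicities and preserves the
    modulus, so it fixes any product of linear factors selected by modulus; the coefficients are
    therefore real. *)
Lemma real_eigenvalue_factor n (M : 'M[R]_n) (P : pred R) :
  exists p : {poly R}, map_poly (@toC R) p =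
    \prod_(a <- eigenvalues M | P (nrm a)) ('X - a%:P).
Proof.
set s := eigenvalues M; pose cj : C -> C := @conjc R.
have cjE (t : seq C) : map_poly (@conjc R) (\prod_(a <- t) ('X - a%:P)) =
    \prod_(a <- map cj t) ('X - a%:P).
  rewrite rmorph_prod big_map; apply: eq_bigr => a _.
  by rewrite rmorphB/= map_polyX map_polyC.
have ps : perm_eq (map cj s) s.
  apply: prod_XsubC_perm; rewrite -cjE -size_prod_eigenvalues.
  rewrite -(map_char_poly (@real_complex R)) -map_poly_comp.
  by apply: eq_map_poly => x /=; exact: conjc_real.
have pfs : perm_eq (map cj [seq a <- s | P (nrm a)]) [seq a <- s | P (nrm a)].
  have -> : map cj [seq a <- s | P (nrm a)] = [seq a <- map cj s | P (nrm a)].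
    rewrite filter_map; congr map; apply: eq_filter => a /=.
    by rewrite /nrm normcJ.
  exact: perm_filter.
have : map_poly (@conjc R) (\prod_(a <- s | P (nrm a)) ('X - a%:P)) =
    \prod_(a <- s | P (nrm a)) ('X - a%:P).
  by rewrite -big_filter cjE; exact: perm_big.
set q := \prod_(_ <- _ | _) _ => qE.
exists (map_poly (@complex.Re R) q); apply/polyP => i.
rewrite coef_map/= coef_map_id0//=.
have := congr1 (fun p : {poly C} => p`_i) qE; rewrite coef_map/=.
case: (q`_i) => x y /= [] /eqP; rewrite eq_sym -subr_eq0 opprK -mulr2n mulrn_eq0/=.
by move=> /eqP ->.
Qed.

(** The sizes are related by an equation because the use has m = n1 + n2, a sum of two ranks, which
    is not convertible to n. *)
Lemma char_poly_conj (F : fieldType) m n (B : 'M[F]_(m, n)) (T : 'M[F]_(n, m))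
  (M : 'M[F]_n) : m = n -> B *m T = 1%:M -> T *m B = 1%:M ->
  char_poly (B *m M *m T) = char_poly M.
Proof.
move=> e; subst m => BT TB; rewrite /char_poly.
have -> : char_poly_mx (B *m M *m T) =
    map_mx polyC B *m char_poly_mx M *m map_mx polyC T.
  rewrite /char_poly_mx mulmxBr mulmxBl -!map_mxM mul_mx_scalar -scalemxAl.
  by rewrite -map_mxM BT map_mx1 scalemx1.
rewrite !det_mulmx mulrAC -det_mulmx -map_mxM BT map_mx1.
by rewrite det1 mul1r.
Qed.

Lemma nrm_mulmx_cvg0 m n p (v : 'M[C]_(m, n)) (W : nat -> 'M[C]_(n, p)) :
  (forall i j, (fun k => nrm (W k i j)) @ \oo --> 0) ->
  forall i j, (fun k => nrm ((v *m W k) i j)) @ \oo --> 0.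
Proof.
move=> W0 i j.
have H : (fun k => \sum_l nrm (v i l) * nrm (W k l j)) @ \oo --> 0.
  rewrite -[X in _ --> X](_ : \sum_(l < n) 0 = 0); last by rewrite big1.
  apply: cvg_sumr => l; rewrite -[X in _ --> X](mulr0 (nrm (v i l))).
  by apply: cvgMr; exact: W0.
apply: (@squeeze_cvgr _ _ _ _ (cst 0) (fun k => \sum_l nrm (v i l) * nrm (W k l j))) => //.
  near=> k; rewrite nrm_ge0/= mxE.
  elim/big_ind2 : _ => //; first by rewrite nrm0.
    by move=> a b c d ab cd; apply: (le_trans (nrmD _ _)); exact: lerD.
  by move=> l _; rewrite nrmM.
exact: cvg_cst.
Unshelve. all: by end_near. Qed.

(** For a left eigenvector v of [Ms], v S M^k = a^k v S tends to 0, while v S is nonzero because v S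
    T = v. *)
Lemma eigenvalue_decay n m (M : 'M[C]_m.+1) (S : 'M[C]_(n, m.+1)) (T : 'M[C]_(m.+1, n))
    (Ms : 'M[C]_n) a : S *m T = 1%:M -> S *m M = Ms *m S ->
  (forall i j, (fun k => nrm ((S *m M ^+ k) i j)) @ \oo --> 0) ->
  eigenvalue Ms a -> nrm a < 1.
Proof.
move=> ST SM S0 /eigenvalueP[v vM v0].
have vk k : v *m (S *m M ^+ k) = a ^+ k *: (v *m S).
  elim: k => [|k IH]; first by rewrite !expr0 mulmx1 scale1r.
  rewrite exprSr -mulmxE !mulmxA -[v *m S *m _]mulmxA IH -scalemxAl -mulmxA SM.
  by rewrite mulmxA vM -scalemxAl scalerA exprSr.
have [j vj] : exists j, (v *m S) 0 j != 0.
  apply/existsP; apply: contraNT v0; rewrite negb_exists => /forallP vS0.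
  rewrite -[v]mulmx1 -ST mulmxA (_ : v *m S = 0) ?mul0mx//.
  by apply/rowP => j; have := vS0 j; rewrite negbK => /eqP ->; rewrite [RHS]mxE.
rewrite ltNge; apply/negP => a1.
have c0 : 0 < nrm ((v *m S) 0 j).
  rewrite lt_neqAle nrm_ge0 andbT eq_sym; apply: contra vj => /eqP c0.
  by rewrite -normr_eq0 normC_nrm c0.
have /cvgrPdist_lt/(_ _ c0)[k _ /(_ k (leqnn k))/=] := nrm_mulmx_cvg0 v S0 0 j.
rewrite vk mxE nrmM sub0r normrN ger0_norm ?mulr_ge0 ?nrm_ge0//.
rewrite ltNge; apply/negP; rewrite negbK ler_peMl ?nrm_ge0//.
elim: k => [|k IH]; first by rewrite expr0 nrm1.
by rewrite exprS nrmM mulr_ege1.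
Qed.

(** [Ss] and [Su] are bases of the kernels of the two coprime real factors of the characteristic
    polynomial, and [Ts], [Tu] are the dual columns. The clause about the commutant of M serves to
    split every A t, not only A 1. *)
Lemma hyperbolic_splitting n (M M' : 'M[R]_n.+1) N1 N2 : M *m M' = 1%:M ->
  (forall a : C, eigenvalue (map_mx (@toC R) M) a -> `|a| != 1) ->
  N1 = count (fun a => `|a| < 1) (eigenvalues M) ->
  N2 = count (fun a => 1 < `|a|) (eigenvalues M) ->
  exists (Ss : 'M[R]_(N1, n.+1)) (Ts : 'M[R]_(n.+1, N1))
         (Su : 'M[R]_(N2, n.+1)) (Tu : 'M[R]_(n.+1, N2)),
  [/\ [/\ Ss *m Ts = 1%:M, Ss *m Tu = 0, Su *m Ts = 0, Su *m Tu = 1%:M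
        & Ts *m Ss + Tu *m Su = 1%:M],
      forall X, comm_mx M X -> Ss *m X = Ss *m X *m Ts *m Ss /\
                            Su *m X = Su *m X *m Tu *m Su,
      forall i j, (fun k => (Ss *m M ^+ k) i j) @ \oo --> (0 : R)
    & forall i j, (fun k => (Su *m M' ^+ k) i j) @ \oo --> (0 : R)].
Proof.
move=> MM' hyp N1E N2E; pose toR := @real_complex R.
set E := eigenvalues M in N1E N2E *.
have EP a : a \in E -> nrm a != 1.
  move=> aE; have : eigenvalue (map_mx (@toC R) M) a.
    by rewrite eigenvalue_root_char size_prod_eigenvalues root_prod_XsubC.
  move=> /hyp; apply: contra; rewrite normC_nrm => /eqP ->.
  by [].
have [ps psE] := real_eigenvalue_factor M (fun x => x < 1).
have [pu puE] := real_eigenvalue_factor M (fun x => 1 < x).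
rewrite -/E in psE puE.
(* No eigenvalue has modulus 1, so the two selections exhaust the spectrum. *)
have pse : ps * pu = char_poly M.
  apply: (map_poly_inj toR); rewrite rmorphM/= [X in X * _]psE [X in _ * X]puE.
  rewrite -big_filter -[X in _ * X]big_filter -big_cat/=.
  rewrite map_char_poly size_prod_eigenvalues -/E; apply: perm_big.
  rewrite (_ : [seq a <- E | 1 < nrm a] = [seq a <- E | predC (fun a => nrm a < 1) a]).
    exact/permPl/perm_filterC.
  apply: eq_in_filter => a /EP a1 /=; rewrite -leNgt le_eqVlt eq_sym.
  by rewrite (negbTE a1).
have psR (x : C) : @root C (map_poly toR ps) x = (x \in [seq a <- E | nrm a < 1]).
  by rewrite -root_prod_XsubC big_filter -psE.
have puR (x : C) : @root C (map_poly toR pu) x = (x \in [seq a <- E | 1 < nrm a]).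
  by rewrite -root_prod_XsubC big_filter -puE.
have cop : coprimep ps pu.
  rewrite -(coprimep_map toR); apply: (@Pdiv.ClosedField.root_coprimep (Cx R)) => x.
  rewrite (psR x) mem_filter => /andP[x1 _].
  apply/negP => xu; have : root (map_poly toR pu) x by [].
  by rewrite (puR x) mem_filter => /andP[/(lt_trans x1)]; rewrite ltxx.
set V := kermxpoly M ps; set W := kermxpoly M pu.
have VW1 : (V + W :=: 1%:M)%MS.
  apply: eqmx_trans (eqmx_sym (kermxpolyM M cop)) _.
  by apply: kermxpoly_min; rewrite pse mxminpoly_dvd_char.
have VW0 : (V :&: W = 0)%MS by exact: mxdirect_kermxpoly.
set n1 := \rank V; set n2 := \rank W.
have e12 : (n1 + n2)%N = n.+1.
  have := mxrank_sum_cap V W; rewrite VW0 mxrank0 addn0 VW1 mxrank1 => <- //.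
pose Ss := row_base V; pose Su := row_base W.
pose B := col_mx Ss Su.
have Bfull : row_full B.
  rewrite /row_full -(addsmxE Ss Su) (adds_eqmx (eq_row_base V) (eq_row_base W)).
  by rewrite VW1 mxrank1.
have Bfree : row_free B.
  by move: Bfull; rewrite /row_free /row_full => /eqP ->; rewrite e12.
pose T := pinvmx B; pose Ts := lsubmx T; pose Tu := rsubmx T.
have BT : B *m T = 1%:M by rewrite mulmxVp.
have TB : T *m B = 1%:M by rewrite mulVpmx.
have TE : T = row_mx Ts Tu by rewrite hsubmxK.
have := BT; rewrite TE mul_col_row scalar_mx_block => /eq_block_mx[SsTs SsTu SuTs SuTu].
have stab (X : 'M[R]_n.+1) : comm_mx M X -> Ss *m X = Ss *m X *m Ts *m Ss /\
                            Su *m X = Su *m X *m Tu *m Su.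
  move=> MX; split.
    have /submxP[Y YE] : (Ss *m X <= Ss)%MS.
      rewrite eq_row_base (eqmxMr _ (eq_row_base V)).
      exact: comm_mx_stable_kermxpoly.
    by rewrite YE -(mulmxA Y) SsTs mulmx1.
  have /submxP[Y YE] : (Su *m X <= Su)%MS.
    rewrite eq_row_base (eqmxMr _ (eq_row_base W)).
    exact: comm_mx_stable_kermxpoly.
  by rewrite YE -(mulmxA Y) SuTu mulmx1.
have Vk : Ss *m horner_mx M ps = 0.
  by apply/sub_kermxP; rewrite eq_row_base.
have Wk : Su *m horner_mx M pu = 0.
  by apply/sub_kermxP; rewrite eq_row_base.
pose Mc := map_mx toR M; pose Mc' := map_mx toR M'.
have MMc : Mc *m Mc' = 1%:M by rewrite -map_mxM MM' map_mx1.
have M'Mc : Mc' *m Mc = 1%:M by exact: mulmx1C.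
have decs i j : (fun k => nrm ((map_mx toR Ss *m Mc ^+ k) i j)) @ \oo --> 0.
  apply: (@row_decay _ _ _ [seq a <- E | nrm a < 1]).
    by apply/allP => a; rewrite mem_filter => /andP[].
  by rewrite big_filter -psE -map_horner_mx -map_mxM Vk map_mx0.
have decu i j : (fun k => nrm ((map_mx toR Su *m Mc' ^+ k) i j)) @ \oo --> 0.
  apply: (@row_decay_inv _ _ Mc _ [seq a <- E | 1 < nrm a]) => //.
    by apply/allP => a; rewrite mem_filter => /andP[].
  by rewrite big_filter -puE -map_horner_mx -map_mxM Wk map_mx0.
pose Ms := Ss *m M *m Ts; pose Mu := Su *m M *m Tu.
have [SsM SuM] := stab M (erefl _).
have [SsM' SuM'] : Ss *m M' = Ss *m M' *m Ts *m Ss /\ Su *m M' = Su *m M' *m Tu *m Su.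
  by apply: stab; rewrite /comm_mx MM' (mulmx1C MM').
have BMT : B *m M *m T = block_mx Ms 0 0 Mu.
  rewrite TE mul_col_mx mul_col_row -/Ms -/Mu; congr block_mx.
    by rewrite SsM -mulmxA SsTu mulmx0.
  by rewrite SuM -mulmxA SuTs mulmx0.
have cE : char_poly (map_mx toR M) =
    char_poly (map_mx toR Ms) * char_poly (map_mx toR Mu).
  rewrite -!map_char_poly -rmorphM/=; congr map_poly.
  rewrite -(char_poly_conj M e12 BT TB) BMT /char_poly char_block_diag_mx.
  by rewrite det_ublock.
have pE : perm_eq E (eigenvalues Ms ++ eigenvalues Mu).
  apply: prod_XsubC_perm; rewrite big_cat/= -!size_prod_eigenvalues.
  exact: cE.
(* The ranks are found without a Jordan form: decay puts the eigenvalues of each diagonal block on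
   its side of the unit circle, and the two blocks together carry the spectrum of M, so counting by
   modulus recovers the sizes. *)
have ins a : a \in eigenvalues Ms -> nrm a < 1.
  rewrite -root_prod_XsubC -size_prod_eigenvalues -eigenvalue_root_char.
  apply: (@eigenvalue_decay _ _ Mc (map_mx toR Ss) (map_mx toR Ts)) => //.
    by rewrite -map_mxM SsTs map_mx1.
  by rewrite -!map_mxM /Ms -SsM.
have outs a : a \in eigenvalues Mu -> 1 < nrm a.
  rewrite -root_prod_XsubC -size_prod_eigenvalues -eigenvalue_root_char => /eigenvalueP[v vE v0].
  pose Mu' := Su *m M' *m Tu.
  have MuMu' : Mu *m Mu' = 1%:M.
    transitivity ((Su *m M *m Tu *m Su) *m M' *m Tu); first by rewrite /Mu' /Mu !mulmxA.
    rewrite (_ : Su *m M *m Tu *m Su = Su *m M); last by symmetry; exact: SuM.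
    by rewrite -(mulmxA Su) MM' mulmx1; exact: SuTu.
  have vE' : v = a *: (v *m map_mx toR Mu').
    by rewrite scalemxAl -vE -mulmxA -map_mxM MuMu' map_mx1 mulmx1.
  have a0 : a != 0 by apply: contraNneq v0 => a0; rewrite vE' a0 scale0r.
  have : nrm a^-1 < 1.
    apply: (@eigenvalue_decay _ _ Mc' (map_mx toR Su) (map_mx toR Tu) (map_mx toR Mu')) => //.
    - by rewrite -map_mxM SuTu map_mx1.
    - by rewrite -!map_mxM /Mu' -SuM'.
    apply/eigenvalueP; exists v => //.
    by rewrite {2}vE' scalerA mulVf// scale1r.
  have aa : nrm a * nrm a^-1 = 1 by rewrite -nrmM mulfV// nrm1.
  move=> h; rewrite ltNge; apply/negP => h1.
  by have := ler_wpM2r (nrm_ge0 a^-1) h1; rewrite aa mul1r leNgt h.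
have N1n : N1 = n1.
  rewrite N1E (seq.permP pE) count_cat.
  rewrite (_ : count _ (eigenvalues Mu) = 0%N) ?addn0.
    rewrite -[RHS](size_eigenvalues Ms); apply/eqP; rewrite -all_count.
    by apply/allP => a /ins; rewrite nrm_lt1.
  apply/eqP; rewrite -leqn0 leqNgt -has_count; apply/hasPn => a /outs.
  by rewrite nrm_gt1 => /lt_gtF ->.
have N2n : N2 = n2.
  rewrite N2E (seq.permP pE) count_cat.
  rewrite (_ : count _ (eigenvalues Ms) = 0%N) ?add0n.
    rewrite -[RHS](size_eigenvalues Mu); apply/eqP; rewrite -all_count.
    by apply/allP => a /outs; rewrite nrm_gt1.
  apply/eqP; rewrite -leqn0 leqNgt -has_count; apply/hasPn => a /ins.
  by rewrite nrm_lt1 => /lt_gtF ->.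
have toR_cvg (x : nat -> R) : (fun k => nrm (toC (x k))) @ \oo --> 0 -> x @ \oo --> 0.
  by under eq_fun do rewrite nrm_toC; move=> /norm_cvg0P.
rewrite N1n N2n; exists Ss, Ts, Su, Tu; split => //.
- by split => //; rewrite -TB TE mul_row_col.
- move=> i j; apply: toR_cvg; under eq_fun => k.
    rewrite (_ : toC _ = (map_mx toR Ss *m Mc ^+ k) i j); first over.
    by rewrite -rmorphXn/= -map_mxM [RHS]mxE.
  exact: decs.
- move=> i j; apply: toR_cvg; under eq_fun => k.
    rewrite (_ : toC _ = (map_mx toR Su *m Mc' ^+ k) i j); first over.
    by rewrite -rmorphXn/= -map_mxM [RHS]mxE.
  exact: decu.
Qed.

End Splitting.

(** * Quadratic Lyapunov functions of a contracting flow *)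

Section RealDerivatives.
Variable R : realType.
Implicit Types f df : R -> R.

Lemma is_derive_continuous f df :
  (forall x : R, is_derive x 1 f (df x)) -> continuous f.
Proof.
move=> fd x; apply: differentiable_continuous; apply/derivable1_diffP.
by have [] := fd x.
Qed.

Lemma is_derive_incr f df : (forall x : R, is_derive x 1 f (df x)) ->
  (forall x, 0 < df x) -> forall x y, x < y -> f x < f y.
Proof.
move=> fd df0 x y xy.
have [|c _ fE] := @MVT R f df x y xy (fun z _ => fd z).
  exact/continuous_subspaceT/(is_derive_continuous fd).
by rewrite -subr_gt0 fE mulr_gt0// subr_gt0.
Qed.

Lemma is_derive_mean f df : (forall x : R, is_derive x 1 f (df x)) ->
  forall x y, x < y -> exists2 c, x < c < y & f y - f x = df c * (y - x).
Proof.
move=> fd x y xy.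
have [|c cxy fE] := @MVT R f df x y xy (fun z _ => fd z).
  exact/continuous_subspaceT/(is_derive_continuous fd).
by exists c => //; move: cxy; rewrite in_itv.
Qed.

Definition mx_derive p q (M : R -> 'M[R]_(p, q)) (t : R) (D : 'M[R]_(p, q)) :=
  forall i j, is_derive t 1 (fun s => M s i j) (D i j).

Lemma mx_derive_cst p q (M : 'M[R]_(p, q)) t : mx_derive (fun=> M) t 0.
Proof. by move=> i j; rewrite mxE; exact: is_derive_cst. Qed.

Lemma mx_derive_tr p q (M : R -> 'M[R]_(p, q)) t D :
  mx_derive M t D -> mx_derive (fun s => (M s)^T) t D^T.
Proof.
by move=> MD i j; rewrite mxE; under eq_fun do rewrite mxE; exact: MD.
Qed.

Lemma mx_derive_mul p q r (M : R -> 'M[R]_(p, q)) (N : R -> 'M[R]_(q, r)) t D E :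
  mx_derive M t D -> mx_derive N t E ->
  mx_derive (fun s => M s *m N s) t (D *m N t + M t *m E).
Proof.
move=> MD NE i j.
have -> : (fun s => (M s *m N s) i j) =
    \sum_k ((fun s => M s i k) * (fun s => N s k j)).
  by apply/funext => s; rewrite mxE fct_sumE.
apply: (@is_derive_eq _ _ _ _ _ _ _
   (\sum_k (M t i k *: E k j + N t k j *: D i k))).
  by apply: is_derive_sum => k; exact: is_deriveM.
rewrite !mxE -big_split/=; apply: eq_bigr => k _.
by rewrite addrC [_ *: D i k]mulrC.
Qed.

Lemma mx_derive_comp p q (M : R -> 'M[R]_(p, q)) (u : R -> R) t a D :
  mx_derive M (u t) D -> is_derive t 1 u a ->
  mx_derive (fun s => M (u s)) t (a *: D).
Proof.
move=> MD ua i j; apply: (@is_derive_eq _ _ _ _ _ _ _ (D i j * a)).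
  exact: (@is_derive1_comp _ (fun s => M s i j) u).
by rewrite mxE mulrC.
Qed.

End RealDerivatives.

Lemma cvg0l (R : realType) (u : nat -> R) c : u @ \oo --> 0 -> (fun k => u k * c) @ \oo --> 0.
Proof. by move=> u0; rewrite -(mul0r c); exact: cvgMl. Qed.

Lemma cvg0r (R : realType) (u : nat -> R) c : u @ \oo --> 0 -> (fun k => c * u k) @ \oo --> 0.
Proof. by move=> u0; rewrite -(mulr0 c); exact: cvgMr. Qed.

Lemma cvg0M (R : realType) (u v : nat -> R) :
  u @ \oo --> 0 -> v @ \oo --> 0 -> (fun k => u k * v k) @ \oo --> 0.
Proof. by move=> u0 v0; rewrite -[X in _ --> X](mulr0 (0 : R)); exact: cvgM. Qed.

Section OneParameter.
Variables (R : realType) (m : nat) (B : R -> 'M[R]_m).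
Hypothesis B0 : B 0 = 1%:M.
Hypothesis BD : forall s t, B (s + t) = B s *m B t.
Hypothesis Bder : forall t i j, derivable (fun s => B s i j) t 1.
Hypothesis Bdec : forall i j, (fun k : nat => B k%:R i j) @ \oo --> (0 : R).

Implicit Types (y : 'cV[R]_m) (s t : R).

(** The infinitesimal generator of the one-parameter group. *)
Definition one_gen : 'M[R]_m := \matrix_(i, j) 'D_1 (fun s => B s i j) 0.
Local Notation g := one_gen.

(** Differentiate B s = B (s - t) B t at s = t. *)
Lemma one_param_derive t : mx_derive B t (g *m B t).
Proof.
have D0 : mx_derive B (0 + t - t) g.
  by move=> i j; rewrite add0r subrr mxE; exact: derivableP.
have Ds : mx_derive (fun s => B (s - t)) t g.
  rewrite -[g]scale1r; apply: (@mx_derive_comp _ _ _ B (fun s => s - t)).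
    by move: D0; rewrite add0r.
  rewrite -[X in is_derive _ _ _ X]subr0; exact: is_deriveB.
have := mx_derive_mul Ds (mx_derive_cst (B t) t).
rewrite mulmx0 addr0; congr mx_derive.
by apply/funext => s; rewrite -BD subrK.
Qed.

Lemma one_param_comm t : B t *m B (- t) = 1%:M.
Proof. by rewrite -BD subrr. Qed.

Lemma derive_form (X : 'M[R]_m) t :
  mx_derive (fun s => (B s)^T *m X *m B s) t
    ((B t)^T *m (X *m g + g^T *m X) *m B t).
Proof.
have := mx_derive_mul (mx_derive_mul (mx_derive_tr (one_param_derive t))
  (mx_derive_cst X t)) (one_param_derive t).
congr mx_derive; rewrite mulmx0 addr0 trmx_mul mulmxDr mulmxDl addrC.
by rewrite !mulmxA.
Qed.

Lemma form_cvg0 (X : 'M[R]_m) i j :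
  (fun k : nat => ((B k%:R)^T *m X *m B k%:R) i j) @ \oo --> (0 : R).
Proof.
under eq_fun do rewrite mxE;
apply: cvg_sumr0 => l; apply: cvg0M; last exact: Bdec.
under eq_fun do rewrite mxE;
apply: cvg_sumr0 => h; apply: cvg0l.
by under eq_fun do rewrite mxE; exact: Bdec.
Qed.

(* The Lyapunov operator is injective: a solution of the homogeneous equation is a form invariant under a contracting flow. *)
Lemma lyapunov_inj (X : 'M[R]_m) : X *m g + g^T *m X = 0 -> X = 0.
Proof.
move=> X0; apply/matrixP => i j; rewrite [RHS]mxE.
have cst t : ((B t)^T *m X *m B t) i j = X i j.
  rewrite -[in RHS](mulmx1 X) -[in RHS](mul1mx (X *m _)) -[X in X *m (_ *m _)]trmx1 -B0 mulmxA.
  apply: (@is_derive_0_is_cst _ (fun t => ((B t)^T *m X *m B t) i j)) => s.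
  by have := derive_form X s i j; rewrite X0 mulmx0 mul0mx mxE.
have := @form_cvg0 X i j; under eq_fun do rewrite cst.
by move=> /(cvg_unique _ (cvg_cst (X i j))); apply.
Qed.

(** An injective endomorphism of the finite-dimensional space of matrices is onto. The right-hand
    side -1 makes the form decrease along the contracting flow at the rate of the squared norm. *)
Lemma lyapunov_exists : exists Q : 'M[R]_m, Q *m g + g^T *m Q = - 1%:M.
Proof.
pose f : {linear 'M[R]_m -> 'M[R]_m} := mulmxr g \+ mulmx g^T.
have free : row_free (lin_mx f).
  rewrite -kermx_eq0; apply/eqP/row_matrixP => i; rewrite row0.
  set v := row i _.
  have : v *m lin_mx f = 0 by apply/sub_kermxP; exact: row_sub.
  rewrite -[v]vec_mxK mul_vec_lin => /(canRL mxvecK); rewrite linear0 /=.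
  by move=> /lyapunov_inj ->; rewrite linear0.
exists (vec_mx (mxvec (- 1%:M) *m invmx (lin_mx f))).
have -> (X : 'M[R]_m) : X *m g + g^T *m X = f X by [].
apply: (can_inj mxvecK); rewrite -mul_vec_lin vec_mxK mulmxKV//.
by rewrite -row_free_unit.
Qed.

Definition sqn (y : 'cV[R]_m) : R := \sum_i y i 0 ^+ 2.
Definition qform (Q : 'M[R]_m) (y : 'cV[R]_m) : R := (y^T *m Q *m y) 0 0.

Lemma sqn_gt0 y : y != 0 -> 0 < sqn y.
Proof.
move=> y0; rewrite lt_neqAle sumr_ge0 ?andbT; last by move=> i _; exact: sqr_ge0.
apply: contra y0; rewrite eq_sym psumr_eq0; last by move=> i _; exact: sqr_ge0.
move=> /allP h; apply/eqP/colP => i; rewrite mxE; apply/eqP.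
by have := h i (mem_index_enum _); rewrite /= sqrf_eq0.
Qed.

Lemma one_param_neq0 y t : y != 0 -> B t *m y != 0.
Proof.
apply: contraNneq => By0; rewrite -[y]mul1mx -(one_param_comm (- t)) opprK.
by rewrite -mulmxA By0 mulmx0.
Qed.

Variable Q : 'M[R]_m.
Hypothesis QE : Q *m g + g^T *m Q = - 1%:M.

Lemma qform_flow_derive y t :
  is_derive t 1 (fun s => qform Q (B (- s) *m y)) (sqn (B (- t) *m y)).
Proof.
have H := mx_derive_comp (derive_form Q (- t)) (is_deriveNid t 1).
have {H} := mx_derive_mul (mx_derive_mul (mx_derive_cst y^T t) H) (mx_derive_cst y t).
rewrite mulmx0 addr0 mul0mx add0r => /(_ 0 0).
have -> : (fun s => (y^T *m ((B (- s))^T *m Q *m B (- s)) *m y) 0 0) =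
   (fun s => qform Q (B (- s) *m y)).
  by apply/funext => s; rewrite /qform trmx_mul !mulmxA.
move=> /is_derive_eq; apply; rewrite QE.
rewrite mulmxN mulNmx scaleN1r opprK mulmx1.
rewrite !mulmxA -trmx_mul -mulmxA mxE; apply: eq_bigr => i _.
by rewrite [_^T _ _]mxE expr2.
Qed.

Lemma qform_flow_incr y s t : y != 0 -> s < t ->
  qform Q (B (- s) *m y) < qform Q (B (- t) *m y).
Proof.
move=> y0; apply: (is_derive_incr (qform_flow_derive y)) => x.
exact/sqn_gt0/one_param_neq0.
Qed.

Lemma qform_cvg0 y : (fun k : nat => qform Q (B k%:R *m y)) @ \oo --> (0 : R).
Proof.
have -> : (fun k : nat => qform Q (B k%:R *m y)) =
    (fun k : nat => \sum_i \sum_j y j 0 * ((B k%:R)^T *m Q *m B k%:R) j i * y i 0).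
  apply/funext => k; rewrite /qform trmx_mul -[X in X *m _]mulmxA mulmxA -[X in X *m y]mulmxA mxE.
  apply: eq_bigr => i _; rewrite mxE mulr_suml; apply: eq_bigr => j _.
  by rewrite mxE.
apply: cvg_sumr0 => i;
apply: cvg_sumr0 => j; apply: cvg0l.
by apply: cvg0r; exact: form_cvg0.
Qed.

(** The form decreases strictly along the forward flow and tends to 0; were it negative at time 1,
    it would stay below that value. *)
Lemma qform_gt0 y : y != 0 -> 0 < qform Q y.
Proof.
move=> y0; have h0 : qform Q (B 1 *m y) < qform Q y.
  have := @qform_flow_incr y (-1) 0 y0; rewrite opprK oppr0 B0 mul1mx; apply.
  by rewrite oppr_lt0.
apply: le_lt_trans h0; rewrite leNgt; apply/negP => neg.
have /cvgrPdist_lt/(_ (- qform Q (B 1 *m y))) := qform_cvg0 y.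
rewrite oppr_gt0 => /(_ neg)[K _ /(_ K.+2)/(_ _)/=].
rewrite ltnW// ?leqnSn// => /(_ isT).
have : qform Q (B K.+2%:R *m y) < qform Q (B 1 *m y).
  have := @qform_flow_incr y (- K.+2%:R) (-1) y0; rewrite !opprK; apply.
  by rewrite ltrN2 ltr1n.
move=> h1; rewrite sub0r normrN ltr0_norm; last exact: lt_trans neg.
by rewrite ltrN2 => /(lt_trans h1); rewrite ltxx.
Qed.

(** Bounds the derivative of the form along the backward flow, the squared norm, from below by the
    form itself, using |y i| |y j| <= sqn y. *)
Lemma qform_le_sqn : exists2 c : R, 0 < c & forall y, c * qform Q y <= sqn y.
Proof.
pose K : R := 1 + \sum_i \sum_j `|Q i j|.
have K0 : 0 < K by rewrite ltr_pwDl// sumr_ge0// => i _; exact: sumr_ge0.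
exists K^-1; first by rewrite invr_gt0.
move=> y; rewrite ler_pdivrMl//.
have yi i : y i 0 ^+ 2 <= sqn y.
  by rewrite /sqn (bigD1 i)//= lerDl sumr_ge0// => j _; exact: sqr_ge0.
have s0 : 0 <= sqn y by apply: sumr_ge0 => i _; exact: sqr_ge0.
have -> : qform Q y = \sum_i \sum_j y j 0 * Q j i * y i 0.
  rewrite /qform mxE; apply: eq_bigr => i _; rewrite mxE mulr_suml.
  by apply: eq_bigr => j _; rewrite mxE.
rewrite mulrDl mul1r mulr_suml ler_wpDl// exchange_big/=.
apply: ler_sum => i _; rewrite mulr_suml; apply: ler_sum => j _.
apply: (le_trans (ler_norm _)); rewrite !normrM mulrAC mulrC ler_wpM2l//.
rewrite -(@ler_pXn2r _ 2)// ?nnegrE ?mulr_ge0// exprMn !real_normK ?num_real//.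
by rewrite [sqn y ^+ 2]expr2 ler_pM ?sqr_ge0.
Qed.

Lemma qform_hit y : y != 0 -> exists t, qform Q (B (- t) *m y) = 1.
Proof.
move=> y0; pose f t := qform Q (B (- t) *m y).
have fc : continuous f by exact: (is_derive_continuous (qform_flow_derive y)).
have [a fa] : exists a, f a < 1.
  have /cvgrPdist_lt/(_ 1 ltr01)[K _ /(_ K (leqnn K))/=] := qform_cvg0 y.
  rewrite sub0r normrN => /ltr_normlW h.
  by exists (- K%:R); rewrite /f opprK.
have [c c0 cq] := qform_le_sqn.
have f0 t : 0 < f t by apply: qform_gt0; exact: one_param_neq0.
(* On [a, b] the derivative is at least c f(a), so a length of (c f(a))^-1 raises the form by at
   least 1; the entry a + 1 ensures a < b. *)
pose b := Num.max (a + 1) ((c * f a)^-1 + a).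
have ab : a < b by rewrite lt_max ltrDl ltr01.
have fb : 1 <= f b.
  have [z /andP[az zb] fE] := is_derive_mean (qform_flow_derive y) ab.
  rewrite -/(f b) -/(f a) in fE.
  have fz : f a <= f z by apply/ltW; exact: qform_flow_incr.
  have h1 : c * f a <= sqn (B (- z) *m y).
    by apply: le_trans (cq _); rewrite ler_pM2l.
  have h2 : (c * f a)^-1 <= b - a by rewrite lerBrDr le_max lexx orbT.
  have := ler_pM _ _ h1 h2; rewrite -fE mulfV ?gt_eqF ?mulr_gt0//.
  rewrite invr_ge0 ltW ?mulr_gt0// => /(_ isT isT); have := f0 a; lra.
have [|t _ ft] := @IVT _ f a b 1 (ltW ab) (continuous_subspaceT fc).
  by rewrite ge_min (ltW fa)/= le_max fb orbT.
by exists t.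
Qed.

End OneParameter.

(** * Calculus of iterated derivatives and implicit functions *)

Section Differentiability.
Variables (R : realType) (V : normedModType R).

Lemma differentiable_eps (W : normedModType R) (f : V -> W) x (L : {linear V -> W}) :
  continuous L ->
  (forall e : R, 0 < e -> \forall h \near (0 : V), `|f (h + x) - f x - L h| <= e * `|h|) ->
  differentiable f x.
Proof.
move=> Lc H.
have E : f \o shift x = cst (f x) + L +o_0 id.
  apply/eqaddoP => e e0; apply: filterS (H e e0) => h /=.
  by rewrite [(_ + _ : V -> W) h]/= opprD addrA.
have dE := diff_unique Lc E.
by apply/diff_locallyP; split; rewrite dE.
Qed.

Lemma differentiable_littleo (W : normedModType R) (f : V -> W) x : differentiable f x ->
  forall e : R, 0 < e -> \forall h \near (0 : V), `|f (h + x) - f x - 'd f x h| <= e * `|h|.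
Proof.
move=> /diff_locally/eqaddoP H e e0; apply: filterS (H e e0) => h /=.
by rewrite [(_ + _ : V -> W) h]/= opprD addrA.
Qed.

Lemma near_eq_differentiable (W : normedModType R) (f g : V -> W) x :
  (\forall y \near x, f y = g y) -> differentiable f x -> differentiable g x.
Proof.
move=> fg df; have fgx : f x = g x by exact: nbhs_singleton fg.
apply: (@differentiable_eps _ g x ('d f x)).
  by have /diff_locallyP[] := df.
move=> e e0; have := differentiable_littleo df e0; apply: filterS2; last first.
  have : \forall h \near (0 : V), f (h + x) = g (h + x).
    have sc : (fun h : V => h + x) @ (0 : V) --> x.
      rewrite -[X in _ --> X]add0r; apply: cvgD; [exact: cvg_id|exact: cvg_cst].
    exact: (sc _ fg).
  exact.
by move=> h /= fgh; rewrite fgh fgx.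
Qed.

End Differentiability.

(** The candidate differential of T is that of [phi], h |-> - a^-1 H (T x0, h + x0), with a the
    partial derivative of H in the solved variable. *)
Lemma implicit_differentiable (R : realType) (V : normedModType R) (H : R * V -> R) (T : V -> R) x0 :
  differentiable H (T x0, x0) -> {for x0, continuous T} ->
  (\forall x \near x0, H (T x, x) = H (T x0, x0)) ->
  'd H (T x0, x0) (1, 0) != 0 -> differentiable T x0.
Proof.
set t0 := T x0 => dH Tc HT a0; set a := 'd H (t0, x0) (1, 0) in a0 *.
have an0 : 0 < `|a| by rewrite normr_gt0.
have dE k h : 'd H (t0, x0) (k, h) = k * a + 'd H (t0, x0) (0, h).
  rewrite -[k * a]/(k *: a) -linearZ -linearD/=; congr ('d H (t0, x0) _).
  by congr pair; rewrite /= ?scaler0 ?add0r// addr0 -[_ *: _]/(k * 1) mulr1.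
pose phi (h : V) : R := (- a^-1) *: H (t0, h + x0).
have din : differentiable (fun h : V => (t0, h + x0)) 0.
  apply: differentiable_pair; first exact: differentiable_cst.
  by apply: differentiableD; [exact: ex_diff|exact: differentiable_cst].
have dinE h : 'd (fun h : V => (t0, h + x0)) 0 h = (0, h).
  rewrite diff_pair; [|exact: differentiable_cst|].
    rewrite /= diff_cst/= diffD; [|exact: ex_diff|exact: differentiable_cst].
    by rewrite diff_cst [X in (_, X)]/= addr0 diff_val.
  by apply: differentiableD; [exact: ex_diff|exact: differentiable_cst].
have dHin : differentiable (H \o (fun h : V => (t0, h + x0))) 0.
  by apply: differentiable_comp => //; rewrite add0r.
have dphi : differentiable phi 0 by exact: differentiableZ.
have phiE h : 'd phi 0 h = - a^-1 * 'd H (t0, x0) (0, h).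
  rewrite (_ : phi = (- a^-1) \*: (H \o (fun h : V => (t0, h + x0))))//.
  rewrite diffZ// [LHS]/= diff_comp//; last by rewrite add0r.
  by rewrite [X in _ *: X]/= dinE add0r.
have [phic _] := (diff_locallyP _ _).1 dphi.
apply: (@differentiable_eps R V _ T x0 ('d phi 0)) => // e e0.
have [M M0 HM] := linear_lipschitz phic.
have M2 : 0 < 2 * M + 2 by rewrite addr_gt0// mulr_gt0.
(* The bound 1/2 absorbs the term d |k| and yields |k| <= (2 M + 1) |h|; the other bound makes the
   final error d (2 M + 2) |h| at most e |h|. *)
pose d := Num.min (2^-1) (e / (2 * M + 2)).
have d0 : 0 < d by rewrite lt_min invr_gt0 ltr0n/= divr_gt0.
have d2 : d <= 2^-1 by rewrite ge_min lexx.
have de : d * (2 * M + 2) <= e by rewrite -ler_pdivlMr// ge_min lexx orbT.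
have sc : (fun h : V => h + x0) @ (0 : V) --> x0.
  by rewrite -[X in _ --> X]add0r; apply: cvgD; [exact: cvg_id|exact: cvg_cst].
have Tc' : (fun h : V => T (h + x0) - t0) @ (0 : V) --> (0 : R).
  rewrite -[X in _ --> X](subrr t0); apply: cvgB; last exact: cvg_cst.
  apply: (@cvg_comp _ _ _ (fun h : V => h + x0) T (nbhs 0) (nbhs x0)) => //; exact: sc.
have pc : (fun h : V => (T (h + x0) - t0, h)) @ (0 : V) --> ((0, 0) : R * V).
  exact: (cvg_pair Tc' (@cvg_id _ _)).
have Hp : \forall h \near (0 : V), `|H ((T (h + x0) - t0, h) + (t0, x0)) - H (t0, x0)
    - 'd H (t0, x0) (T (h + x0) - t0, h)| <= d * `|a| * `|(T (h + x0) - t0, h)|.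
  exact: (pc _ (differentiable_littleo dH (mulr_gt0 d0 an0))).
have HT0 : \forall h \near (0 : V), H (T (h + x0), h + x0) = H (t0, x0) := sc _ HT.
move: HT0 Hp; apply: filterS2 => h HTh.
set k := T (h + x0) - t0; set L := 'd phi 0 h.
have -> : H ((k, h) + (t0, x0)) = H (t0, x0) by rewrite -HTh; congr H; congr pair; rewrite /= subrK.
rewrite subrr sub0r normrN dE => Hk.
have kL : k - L = a^-1 * (k * a + 'd H (t0, x0) (0, h)).
  by rewrite /L phiE mulrDr mulrCA mulVf// mulr1 mulNr opprK.
have kl : `|k - L| <= d * (`|k| + `|h|).
  rewrite kL normrM normfV ler_pdivrMl// (le_trans Hk)// mulrAC mulrC ler_wpM2l//.
  rewrite ler_wpM2l ?(ltW d0)// prod_normE/= ge_max.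
  by rewrite lerDl lerDr !normr_ge0.
have := HM h; rewrite -/L => HL.
have k1 : `|k| <= `|L| + `|k - L|.
  by rewrite -[in X in X <= _](subrK L k) addrC (le_trans (ler_normD _ _)).
have hh := normr_ge0 h; have kk := normr_ge0 k.
have k2 : `|k| <= (2 * M + 1) * `|h|.
  have : d * (`|k| + `|h|) <= 2^-1 * (`|k| + `|h|) by rewrite ler_wpM2r// addr_ge0.
  move: k1 kl HL; set a1 := `|k|; set a2 := `|h|; set a3 := `|L|; set a4 := `|k - L|.
  set a5 := d * _; lra.
apply: (le_trans kl); apply: (@le_trans _ _ (d * (2 * M + 2) * `|h|)).
  rewrite -mulrA ler_wpM2l ?(ltW d0)//; move: k2; lra.
by rewrite ler_wpM2r.
Qed.

Lemma differentiable_sumr (R : realType) (V : normedModType R) (I : Type) (r : seq I)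
    (f : I -> V -> R) x :
  (forall i, differentiable (f i) x) -> differentiable (fun y => \sum_(i <- r) f i y) x.
Proof.
move=> df; elim: r => [|i r IH].
  by under eq_fun do rewrite big_nil; exact: differentiable_cst.
by under eq_fun do rewrite big_cons; exact: differentiableD.
Qed.

Section CkCalculus.
Variables (R : realType) (V : normedModType R).
Implicit Types (U : set V) (f g : V -> R) (x : V).

(** The derivatives in [Ck] are functions on the whole space, whereas the rules of calculus hold
    only on U; this allows replacing them by expressions that agree with them on U. *)
Lemma Ck_eq (W : normedModType R) k U (f g : V -> W) : open U ->
  (forall x, U x -> f x = g x) -> Ck k U f -> Ck k U g.
Proof.
move=> oU; elim: k f g => [|k IH] f g fg /=.
  move=> fc x Ux; have fgx : \forall y \near x, f y = g y.
    by apply: filterS (open_nbhs_nbhs (conj oU Ux)); exact: fg.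
  have fcx : f @ x --> f x := fc x Ux.
  change (g @ x --> g x); rewrite -(fg _ Ux); apply: cvg_trans fcx.
  by apply: near_eq_cvg; apply: filterS fgx => y ->.
have fgx x : U x -> \forall y \near x, f y = g y.
  by move=> Ux; apply: filterS (open_nbhs_nbhs (conj oU Ux)); exact: fg.
move=> [df Df]; split.
  by move=> x Ux; apply: near_eq_differentiable (df x Ux); exact: fgx.
move=> v; apply: IH (Df v) => x Ux.
by apply: near_eq_derive; exact: fgx.
Qed.

Lemma Ck_sub (W : normedModType R) k U U' (f : V -> W) :
  U' `<=` U -> Ck k U f -> Ck k U' f.
Proof.
move=> UU; elim: k f => [|k IH] f /=; first by move=> fc x /UU; exact: fc.
by move=> [df Df]; split => [x /UU|v]; [exact: df|exact: IH].
Qed.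

Lemma CkS (W : normedModType R) k U (f : V -> W) : Ck k.+1 U f -> Ck k U f.
Proof.
elim: k f => [|k IH] f /= [df Df].
  by move=> x Ux; exact/differentiable_continuous/df.
by split => // v; apply: IH; exact: Df.
Qed.

Lemma Ck_cst (W : normedModType R) k U (a : W) : Ck k U (fun=> a).
Proof.
elim: k a => [|k IH] a /=; first by move=> x _; exact: cst_continuous.
split => [x _|v]; first exact: differentiable_cst.
by under eq_fun do rewrite derive_cst; exact: IH.
Qed.

Lemma CkD (W : normedModType R) k U (f g : V -> W) : open U ->
  Ck k U f -> Ck k U g -> Ck k U (fun x => f x + g x).
Proof.
move=> oU; elim: k f g => [|k IH] f g /=.
  by move=> fc gc x Ux; apply: continuousD; [exact: fc|exact: gc].
move=> [df Df] [dg Dg]; split => [x Ux|v].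
  by apply: differentiableD; [exact: df|exact: dg].
apply: (@Ck_eq _ _ _ (fun x => 'D_v f x + 'D_v g x)) => //; last exact: IH.
by move=> x Ux; rewrite deriveD//; apply: diff_derivable; [exact: df|exact: dg].
Qed.

Lemma CkM k U f g : open U ->
  Ck k U f -> Ck k U g -> Ck k U (fun x => f x * g x).
Proof.
move=> oU; elim: k f g => [|k IH] f g.
  by move=> fc gc x Ux; apply: continuousM; [exact: fc|exact: gc].
move=> Cf Cg; have [df Df] := Cf; have [dg Dg] := Cg; split => [x Ux|v].
  by apply: differentiableM; [exact: df|exact: dg].
apply: (@Ck_eq _ _ _ (fun x => f x * 'D_v g x + g x * 'D_v f x)) => //.
  move=> x Ux; rewrite -[fun y => _]/(f * g) deriveM//; apply: diff_derivable.
    exact: df.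
  exact: dg.
by apply: CkD => //; apply: IH => //; (try exact: CkS); [exact: Dg|exact: Df].
Qed.

Lemma CkV k U f : open U -> (forall x, U x -> f x != 0) ->
  Ck k U f -> Ck k U (fun x => (f x)^-1).
Proof.
move=> oU f0; elim: k f f0 => [|k IH] f f0.
  by move=> fc x Ux; apply: continuousV; [exact: f0|exact: fc].
move=> Cf; have [df Df] := Cf; split => [x Ux|v].
  by apply: differentiableV; [exact: df|exact: f0].
apply: (@Ck_eq _ _ _ (fun x => (-1) * (((f x)^-1 * (f x)^-1) * 'D_v f x))) => //.
  move=> x Ux; rewrite deriveV ?f0//; last exact/diff_derivable/df.
  by rewrite -[RHS]/(_ * _) mulNr mul1r -expr2 exprVn mulNr.
apply: CkM => //; first exact: Ck_cst.
by apply: CkM => //; last exact: Df; apply: CkM => //; apply: IH => //; exact: CkS.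
Qed.

Lemma Ck_sum k U (I : Type) (r : seq I) (f : I -> V -> R) : open U ->
  (forall i, Ck k U (f i)) -> Ck k U (fun x => \sum_(i <- r) f i x).
Proof.
move=> oU Cf; elim: r => [|i r IH].
  by under eq_fun do rewrite big_nil; exact: Ck_cst.
by under eq_fun do rewrite big_cons; exact: CkD.
Qed.

Lemma derive_comp1 (c : R -> R) f x v : differentiable c (f x) ->
  differentiable f x -> 'D_v (fun y => c (f y)) x = 'D_1 c (f x) * 'D_v f x.
Proof.
move=> dc df; rewrite -[fun y => _]/(c \o f) deriveE; last exact: differentiable_comp.
rewrite diff_comp//= !deriveE//.
rewrite -[X in 'd c _ X = _](mulr1 ('d f x v)) -[_ * 1]/(_ *: 1) linearZ.
by rewrite mulrC.
Qed.

Lemma Ck_comp1 k U (U' : set R) (c : R -> R) f : open U -> open U' ->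
  (forall x, U x -> U' (f x)) -> Ck k U' c -> Ck k U f ->
  Ck k U (fun x => c (f x)).
Proof.
move=> oU oU' UU'; elim: k c f UU' => [|k IH] c f UU'.
  move=> cc fc x Ux; apply: (@continuous_comp _ _ _ f c); first exact: fc.
  exact/cc/UU'.
move=> Cc Cf; have [dc Dc] := Cc; have [df Df] := Cf; split => [x Ux|v].
  by apply: (@differentiable_comp _ _ _ _ f c); [exact: df|exact/dc/UU'].
apply: (@Ck_eq _ _ _ (fun x => 'D_1 c (f x) * 'D_v f x)) => //.
  by move=> x Ux; rewrite derive_comp1//; [exact/dc/UU'|exact: df].
apply: CkM => //; last exact: Df.
by apply: (IH _ _ UU' (Dc 1)); exact: CkS.
Qed.

Lemma Ck_linear (W : normedModType R) k U (f : {linear V -> W}) :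
  continuous f -> Ck k U f.
Proof.
move=> fc; case: k => [|k] /=; first by move=> x _; exact: fc.
split => [x _|v]; first exact: linear_differentiable.
rewrite (_ : (fun x => _) = (fun=> f v)); first exact: Ck_cst.
apply/funext => x; rewrite deriveE; last exact: linear_differentiable.
by rewrite diff_lin.
Qed.

Lemma derivable_entry m n (M : V -> 'M[R]_(m, n)) x : differentiable M x ->
  forall i j, differentiable (fun y => M y i j) x.
Proof.
move=> dM i j; apply: (@differentiable_comp _ _ _ _ M (fun N : 'M[R]_(m, n) => N i j)) => //.
exact: differentiable_coord.
Qed.

Lemma differentiable_mx m n (M : V -> 'M[R]_(m, n)) x :
  (forall i j, differentiable (fun y => M y i j) x) -> differentiable M x.
Proof.
move=> dM; rewrite (_ : M = \sum_(i < m) \sum_(j < n) (fun y => M y i j *: delta_mx i j)).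
  by apply: differentiable_sum => i; apply: differentiable_sum => j; exact: differentiableZl.
apply/funext => y; rewrite [LHS]matrix_sum_delta fct_sumE; apply: eq_bigr => i _.
by rewrite fct_sumE.
Qed.

Lemma Ck_entry m n k U (M : V -> 'M[R]_(m, n)) : open U ->
  Ck k U M -> forall i j, Ck k U (fun x => M x i j).
Proof.
move=> oU; elim: k M => [|k IH] M.
  move=> Mc i j x Ux; apply: (@continuous_comp _ _ _ M (fun N : 'M[R]_(m, n) => N i j)).
    exact: Mc.
  exact: coord_continuous.
move=> [dM DM] i j; split => [x Ux|v]; first by apply: derivable_entry; exact: dM.
apply: Ck_eq (IH _ (DM v) i j) => // x Ux.
by rewrite derive_mx ?mxE//; exact/diff_derivable/dM.
Qed.

Lemma Ck_mx m n k U (M : V -> 'M[R]_(m, n)) : open U ->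
  (forall i j, Ck k U (fun x => M x i j)) -> Ck k U M.
Proof.
move=> oU; elim: k M => [|k IH] M Mij.
  move=> x Ux; rewrite (_ : M = fun y => \sum_(i < m) \sum_(j < n) M y i j *: delta_mx i j); last first.
    by apply/funext => y; exact: matrix_sum_delta.
  apply: cvg_sumr => i; apply: cvg_sumr => j; apply: cvgZl.
  exact: Mij.
have dM x : U x -> differentiable M x.
  by move=> Ux; apply: differentiable_mx => i j; have [+ _] := Mij i j; exact.
split => // v; apply: (@Ck_eq _ _ _ (fun x => \matrix_(i, j) 'D_v (fun y => M y i j) x)) => //.
  by move=> x Ux; rewrite derive_mx//; exact/diff_derivable/dM.
apply: IH => i j; under eq_fun do rewrite mxE.
by have [_] := Mij i j; exact.
Qed.

Lemma Ck_pair (W1 W2 : normedModType R) k U (f : V -> W1) (g : V -> W2) : open U ->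
  Ck k U f -> Ck k U g -> Ck k U (fun x => (f x, g x)).
Proof.
move=> oU; elim: k f g => [|k IH] f g.
  by move=> fc gc x Ux; apply: cvg_pair; [exact: fc|exact: gc].
move=> [df Df] [dg Dg]; split => [x Ux|v].
  by apply: differentiable_pair; [exact: df|exact: dg].
apply: (@Ck_eq _ _ _ (fun x => ('D_v f x, 'D_v g x))) => //; last exact: (IH _ _ (Df v) (Dg v)).
move=> x Ux; have dfx := df x Ux; have dgx := dg x Ux.
rewrite [RHS]deriveE; last exact: differentiable_pair.
by rewrite diff_pair//= !deriveE.
Qed.

Variables (I : finType) (c : I -> R -> R) (w : I -> V -> R) (U : set V) (T : V -> R).
Hypotheses (oU : open U) (Cc : forall k i, Ck k setT (c i))
  (Cw : forall k i, Ck k U (w i)) (Tc : forall x, U x -> {for x, continuous T})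
  (TE : forall x, U x -> \sum_i c i (T x) * w i x = 1)
  (TD : forall x, U x -> \sum_i 'D_1 (c i) (T x) * w i x != 0).

Let fst_cont : continuous (fst : R * V -> R).
Proof. by move=> p; exact: cvg_fst. Qed.

Let snd_cont : continuous (snd : R * V -> V).
Proof. by move=> p; exact: cvg_snd. Qed.

(** The implicit equation is taken in separated form, a sum of products c i (T x) w i x. Its partial
    derivatives keep this form, and T is only ever composed with functions of one real variable. The
    equation of the hitting time takes this shape once the quadratic form is expanded in entries. *)
Lemma implicit_differentiable_sum x : U x -> differentiable T x.
Proof.
move=> Ux; pose H (p : R * V) := \sum_i c i p.1 * w i p.2.
have dc i s : differentiable (c i) s by have [+ _] := Cc 1 i; exact.
have dw i : differentiable (w i) x by have [+ _] := Cw 1 i; exact.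
have d1 i : differentiable (fun p : R * V => c i p.1) (T x, x).
  by apply: (@differentiable_comp _ _ _ _ fst (c i)) => //; exact: linear_differentiable.
have d2 i : differentiable (fun p : R * V => w i p.2) (T x, x).
  by apply: (@differentiable_comp _ _ _ _ snd (w i)) => //; exact: linear_differentiable.
have HE : H = \sum_i ((fun p : R * V => c i p.1) * (fun p => w i p.2)).
  by apply/funext => p; rewrite fct_sumE.
have dH : differentiable H (T x, x).
  by apply: differentiable_sumr => i; exact: differentiableM.
apply: (@implicit_differentiable _ _ H) => //; first exact: Tc.
  have := open_nbhs_nbhs (conj oU Ux); apply: filterS => y Uy.
  by rewrite /H/= !TE.
rewrite -deriveE//.
suff -> : 'D_(1, 0) H (T x, x) = \sum_i 'D_1 (c i) (T x) * w i x by exact: TD.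
rewrite HE.
have dp i : derivable (fun p : R * V => c i p.1) (T x, x) (1, 0).
  exact: diff_derivable.
have dq i : derivable (fun p : R * V => w i p.2) (T x, x) (1, 0).
  exact: diff_derivable.
have : is_derive (T x, x) (1, 0) (\sum_i ((fun p : R * V => c i p.1) * (fun p => w i p.2)))
   (\sum_i 'D_1 (c i) (T x) * w i x).
  elim/big_ind2 : _.
  - exact: is_derive_cst.
  - by move=> a b e f; exact: is_deriveD.
  move=> i _; apply: (@is_derive_eq _ _ _ _ _ _ _
     (c i (T x) *: 'D_(1, 0) (fun p : R * V => w i p.2) (T x, x) +
      w i x *: 'D_(1, 0) (fun p : R * V => c i p.1) (T x, x))).
    by apply: is_deriveM; exact: derivableP.
  rewrite !deriveE//.
  rewrite (@diff_comp _ _ _ _ (@snd R V) (w i)) ?(@diff_comp _ _ _ _ (@fst R V) (c i))//;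
    try (by apply: linear_differentiable).
  rewrite /= !diff_lin//= linear0 scaler0 add0r mulrC -deriveE//.
by move=> [].
Qed.

Lemma implicit_derive x v : U x -> 'D_v T x =
  - (\sum_i c i (T x) * 'D_v (w i) x) * (\sum_i 'D_1 (c i) (T x) * w i x)^-1.
Proof.
move=> Ux; apply/(canRL (mulfK (TD Ux)))/eqP; rewrite -addr_eq0; apply/eqP.
have dc i s : differentiable (c i) s by have [+ _] := Cc 1 i; exact.
have dw i : differentiable (w i) x by have [+ _] := Cw 1 i; exact.
have dT := implicit_differentiable_sum Ux.
have : 'D_v (fun y => \sum_i c i (T y) * w i y) x = 0.
  rewrite (@near_eq_derive _ _ _ _ (cst (1 : R))) ?derive_cst//.
  by apply: filterS (open_nbhs_nbhs (conj oU Ux)) => y; exact: TE.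
have -> : (fun y => \sum_i c i (T y) * w i y) =
    \sum_i ((fun y => c i (T y)) * w i).
  by apply/funext => p; rewrite fct_sumE.
have : is_derive x v (\sum_i ((fun y => c i (T y)) * w i))
   (\sum_i (c i (T x) * 'D_v (w i) x + w i x * ('D_1 (c i) (T x) * 'D_v T x))).
  elim/big_ind2 : _.
  - exact: is_derive_cst.
  - by move=> a b e f; exact: is_deriveD.
  move=> i _; rewrite -derive_comp1//.
  apply: is_deriveM; apply/derivableP/diff_derivable => //.
  exact: (@differentiable_comp _ _ _ _ T (c i)).
move=> [_ ->] E; rewrite -[RHS]E big_split/= [RHS]addrC mulr_sumr; congr (_ + _).
by apply: eq_bigr => i _; ring.
Qed.

(** Bootstrap: the formula for ['D_v T] contains T only inside compositions, so T of class k has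
    derivatives of class k. Continuity starts the induction. *)
Lemma implicit_Ck k : Ck k U T.
Proof.
elim: k => [|k IH]; first by move=> x Ux; exact: Tc.
split=> [x Ux|v]; first exact: implicit_differentiable_sum.
apply: (@Ck_eq _ _ _ (fun x => - (\sum_i c i (T x) * 'D_v (w i) x) *
   (\sum_i 'D_1 (c i) (T x) * w i x)^-1)) => //.
  by move=> x Ux; rewrite implicit_derive.
have D1 i : Ck k setT ('D_1 (c i)) by have [_] := Cc k.+1 i; exact.
have Dv i : Ck k U ('D_v (w i)) by have [_] := Cw k.+1 i; exact.
apply: CkM => //; last first.
  apply: CkV => //; apply: Ck_sum => // i; apply: CkM => //.
  by apply: (@Ck_comp1 k U setT ('D_1 (c i)) T) => //; exact: openT.
rewrite (_ : (fun x => - (\sum_i c i (T x) * 'D_v (w i) x)) = (fun x => (-1) * (\sum_i c i (T x) * 'D_v (w i) x))); last first.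
  by apply/funext => x; rewrite mulN1r.
apply: CkM => //; first exact: Ck_cst.
apply: Ck_sum => // i; apply: CkM => //.
by apply: (@Ck_comp1 k U setT (c i) T) => //; exact: openT.
Qed.

End CkCalculus.

(** * Smooth functions with complex values *)

Section SmoothAt.
Variables (R : realType) (V : normedModType R).
Implicit Types (f g : V -> R) (x : V).

(** Smoothness near a point spares tracking the domains of inverses and square roots; one
    neighbourhood serves all orders. *)
Definition smooth_at (W : normedModType R) (x : V) (f : V -> W) :=
  exists U : set V, [/\ open U, U x & smooth U f].

Lemma smooth_at_lift2 (W1 W2 W' : normedModType R)
    (Fo : (V -> W1) -> (V -> W2) -> (V -> W')) x (f : V -> W1) (g : V -> W2) :
  (forall k U, open U -> Ck k U f -> Ck k U g -> Ck k U (Fo f g)) ->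
  smooth_at x f -> smooth_at x g -> smooth_at x (Fo f g).
Proof.
move=> H [U [oU Ux Cf]] [U' [oU' U'x Cg]].
exists (U `&` U'); split => //; first exact: openI.
move=> k; apply: H; first exact: openI.
  by apply: Ck_sub (Cf k) => y [].
by apply: Ck_sub (Cg k) => y [].
Qed.

Lemma smooth_at_cst (W : normedModType R) x (a : W) : smooth_at x (fun=> a).
Proof. by exists setT; split => //; [exact: openT|move=> k; exact: Ck_cst]. Qed.

Lemma smooth_atD (W : normedModType R) x (f g : V -> W) :
  smooth_at x f -> smooth_at x g -> smooth_at x (fun y => f y + g y).
Proof.
move=> fx gx; apply: (@smooth_at_lift2 _ _ _ (fun a b y => a y + b y) x f g _ fx gx) => k U.
exact: CkD.
Qed.

Lemma smooth_atM x f g : smooth_at x f -> smooth_at x g ->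
  smooth_at x (fun y => f y * g y).
Proof.
move=> fx gx; apply: (@smooth_at_lift2 _ _ _ (fun (a b : V -> R) y => a y * b y) x f g _ fx gx) => k U.
exact: CkM.
Qed.

Lemma smooth_atN x f : smooth_at x f -> smooth_at x (fun y => - f y).
Proof.
move=> fx; rewrite (_ : (fun y => - f y) = (fun y => (-1) * f y)).
  by apply: smooth_atM => //; exact: smooth_at_cst.
by apply/funext => y; rewrite mulN1r.
Qed.

Lemma smooth_at_pair (W1 W2 : normedModType R) x (f : V -> W1) (g : V -> W2) :
  smooth_at x f -> smooth_at x g -> smooth_at x (fun y => (f y, g y)).
Proof.
move=> fx gx; apply: (@smooth_at_lift2 _ _ _ (fun a b y => (a y, b y)) x f g _ fx gx) => k U.
exact: Ck_pair.
Qed.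

Lemma smooth_at_sum (I : Type) (r : seq I) (f : I -> V -> R) x :
  (forall i, smooth_at x (f i)) -> smooth_at x (fun y => \sum_(i <- r) f i y).
Proof.
move=> Cf; elim: r => [|i r IH].
  by under eq_fun do rewrite big_nil; exact: smooth_at_cst.
by under eq_fun do rewrite big_cons; exact: smooth_atD.
Qed.

Lemma smooth_at_continuous (W : normedModType R) x (f : V -> W) :
  smooth_at x f -> f @ x --> f x.
Proof. by move=> [U [oU Ux Cf]]; exact: (Cf 0%N x Ux). Qed.

Lemma smooth_at_open (W : normedModType R) x (f : V -> W) (D : set W) :
  open D -> D (f x) -> smooth_at x f ->
  exists U, [/\ open U, U x, smooth U f & forall y, U y -> D (f y)].
Proof.
move=> oD Dfx [U [oU Ux Cf]].
have nD : \forall y \near x, D (f y) by apply: (Cf 0%N x Ux); exact: open_nbhs_nbhs.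
exists (U `&` interior [set y | D (f y)]); split.
- by apply: openI => //; exact: open_interior.
- by [].
- by move=> k; apply: Ck_sub (Cf k) => y [].
- by move=> y [_ /interior_subset].
Qed.

Lemma open_neq0 : open [set a : R | a != 0].
Proof.
rewrite (_ : [set a | _] = ~` [set 0]); last by apply/predeqP => x; split => /= /eqP.
exact/closed_openC/accessible_closed_set1/hausdorff_accessible/norm_hausdorff.
Qed.

Lemma smooth_at_comp1 (D : set R) (c : R -> R) x f : open D -> D (f x) ->
  smooth D c -> smooth_at x f -> smooth_at x (fun y => c (f y)).
Proof.
move=> oD Dfx Cc /(smooth_at_open oD Dfx)[U [oU Ux Cf UD]].
by exists U; split => // k; exact: (@Ck_comp1 _ _ k U D).
Qed.

Lemma smooth_atV x f : f x != 0 -> smooth_at x f -> smooth_at x (fun y => (f y)^-1).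
Proof.
move=> fx0 fx; have [|U [oU Ux Cf U0]] := smooth_at_open _ (fx0 : [set a : R | a != 0] (f x)) fx.
  exact: open_neq0.
by exists U; split => // k; exact: CkV.
Qed.

Lemma smooth_at_mx m n (M : V -> 'M[R]_(m, n)) x :
  (forall i j, smooth_at x (fun y => M y i j)) -> smooth_at x M.
Proof.
move=> Mx; have /choice[U HU] : forall ij : 'I_m * 'I_n, exists U : set V,
    [/\ open U, U x & smooth U (fun y => M y ij.1 ij.2)].
  by move=> [i j]; have [U HU] := Mx i j; exists U.
pose U0 := interior [set y | forall ij, U ij y].
exists U0; split; first exact: open_interior.
  apply: (filter_forall (F := nbhs x)) => ij; have [oU Ux _] := HU ij.
  exact: open_nbhs_nbhs.
move=> k; apply: Ck_mx => [|i j]; first exact: open_interior.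
have [_ _ CU] := HU (i, j).
by apply: Ck_sub (CU k) => y /interior_subset/(_ (i, j)); apply.
Qed.

Lemma smooth_at_entry m n (M : V -> 'M[R]_(m, n)) x i j :
  smooth_at x M -> smooth_at x (fun y => M y i j).
Proof. by move=> [U [oU Ux CM]]; exists U; split => // k; exact: Ck_entry. Qed.

Lemma smooth_at_linear (W : normedModType R) x (f : {linear V -> W}) :
  continuous f -> smooth_at x f.
Proof. by move=> fc; exists setT; split => //; [exact: openT|move=> k; exact: Ck_linear]. Qed.

End SmoothAt.

Lemma Ck_local (R : realType) (V W : normedModType R) k (U : set V) (f : V -> W) :
  (forall x, U x -> smooth_at x f) -> Ck k U f.
Proof.
elim: k f => [|k IH] f sf /=.
  by move=> x Ux; have [U' [_ U'x Cf]] := sf x Ux; exact: (Cf 0%N x U'x).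
split => [x Ux|v]; first by have [U' [_ U'x Cf]] := sf x Ux; exact: (proj1 (Cf 1%N)).
apply: IH => x Ux; have [U' [oU' U'x Cf]] := sf x Ux; exists U'; split => // j.
by have [_] := Cf j.+1; exact.
Qed.

Section Sqrt.
Variable R : realType.

(* sqrt is the implicit solution of t ^ 2 / s = 1 *)
Lemma smooth_sqrt : smooth [set s : R | 0 < s] (@Num.sqrt R).
Proof.
have oP : open [set s : R | 0 < s] by exact: open_gt.
have Cid k (U : set R) : Ck k U (fun t : R => t).
  by apply: (@Ck_linear R R R k U idfun) => y; exact: cvg_id.
have CX k : Ck k [set: R] (fun t : R => t * t).
  by apply: CkM => //; exact: openT.
move=> k; apply: (@implicit_Ck R R 'I_1 (fun _ t => t * t) (fun _ s => s^-1)) => //.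
- move=> j _; apply: CkV => //; first by move=> s /= s0; rewrite gt_eqF.
- by move=> s _; exact: sqrt_continuous.
- move=> s /= s0; rewrite big_ord1 -expr2 sqr_sqrtr ?(ltW s0)//.
  by rewrite mulfV// gt_eqF.
- move=> s /= s0; rewrite big_ord1 mulf_neq0//; last first.
    by rewrite invr_eq0 gt_eqF.
  rewrite -[fun t => t * t]/((id : R -> R) * id) deriveM; [|exact: derivable_id|exact: derivable_id].
  rewrite derive_id -[_ *: _]/(_ * _) mulr1 -mulr2n mulrn_eq0/= gt_eqF//.
  by rewrite sqrtr_gt0.
Qed.

End Sqrt.

Section ComplexSmooth.
Variables (R : realType) (V : normedModType R).
Local Notation C := (Cx R).
Local Notation Re := (@complex.Re R).
Local Notation Im := (@complex.Im R).
Implicit Types (f g : V -> C) (x : V).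

Lemma ReM (z w : C) : Re (z * w) = Re z * Re w - Im z * Im w.
Proof. by case: z => a b; case: w. Qed.
Lemma ImM (z w : C) : Im (z * w) = Re z * Im w + Im z * Re w.
Proof. by case: z => a b; case: w. Qed.
Lemma ReD (z w : C) : Re (z + w) = Re z + Re w.
Proof. by case: z => a b; case: w. Qed.
Lemma ImD (z w : C) : Im (z + w) = Im z + Im w.
Proof. by case: z => a b; case: w. Qed.
Lemma ReV (z : C) : Re z^-1 = Re z * (Re z ^+ 2 + Im z ^+ 2)^-1.
Proof. by case: z. Qed.
Lemma ImV (z : C) : Im z^-1 = - (Im z * (Re z ^+ 2 + Im z ^+ 2)^-1).
Proof. by case: z. Qed.
Lemma complexP (z w : C) : Re z = Re w -> Im z = Im w -> z = w.
Proof. by case: z => a b; case: w => c d /= -> ->. Qed.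

Lemma sqrRI_gt0 (z : C) : z != 0 -> 0 < Re z ^+ 2 + Im z ^+ 2.
Proof.
move=> z0; rewrite lt_neqAle addr_ge0 ?sqr_ge0// andbT.
apply: contra z0; rewrite eq_sym paddr_eq0 ?sqr_ge0// !sqrf_eq0 => /andP[/eqP a /eqP b].
by apply/eqP; apply: complexP.
Qed.

(** [Ck] asks for a normed module over R, while [Cx R] is a normed module over itself, so real
    smoothness is imposed on the real and imaginary parts. *)
Definition csmooth_at x f :=
  smooth_at x (fun y => Re (f y)) /\ smooth_at x (fun y => Im (f y)).

Lemma csmooth_at_cst x (a : C) : csmooth_at x (fun=> a).
Proof. by split; exact: smooth_at_cst. Qed.

Lemma csmooth_atD x f g : csmooth_at x f -> csmooth_at x g ->
  csmooth_at x (fun y => f y + g y).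
Proof.
move=> [f1 f2] [g1 g2]; split.
  by under eq_fun do rewrite ReD; exact: smooth_atD.
by under eq_fun do rewrite ImD; exact: smooth_atD.
Qed.

Lemma csmooth_atM x f g : csmooth_at x f -> csmooth_at x g ->
  csmooth_at x (fun y => f y * g y).
Proof.
move=> [f1 f2] [g1 g2]; split.
  under eq_fun do rewrite ReM.
  by apply: smooth_atD; [exact: smooth_atM|apply: smooth_atN; exact: smooth_atM].
by under eq_fun do rewrite ImM; apply: smooth_atD; exact: smooth_atM.
Qed.

Lemma csmooth_atV x f : f x != 0 -> csmooth_at x f -> csmooth_at x (fun y => (f y)^-1).
Proof.
move=> fx0 [f1 f2].
have sq : smooth_at x (fun y => (Re (f y) ^+ 2 + Im (f y) ^+ 2)^-1).
  apply: smooth_atV; first by rewrite gt_eqF// sqrRI_gt0.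
  by apply: smooth_atD; under eq_fun do rewrite expr2; exact: smooth_atM.
split.
  by under eq_fun do rewrite ReV; exact: smooth_atM.
by under eq_fun do rewrite ImV; apply: smooth_atN; exact: smooth_atM.
Qed.

Lemma csmooth_at_sum (I : Type) (r : seq I) (f : I -> V -> C) x :
  (forall i, csmooth_at x (f i)) -> csmooth_at x (fun y => \sum_(i <- r) f i y).
Proof.
move=> Cf; elim: r => [|i r IH].
  by under eq_fun do rewrite big_nil; exact: csmooth_at_cst.
by under eq_fun do rewrite big_cons; exact: csmooth_atD.
Qed.

Lemma csmooth_at_toC x (f : V -> R) : smooth_at x f -> csmooth_at x (fun y => toC (f y)).
Proof. by move=> fx; split => //; exact: smooth_at_cst. Qed.

Lemma csmooth_at_near0 x f : csmooth_at x f -> f x != 0 -> \forall y \near x, f y != 0.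
Proof.
move=> [f1 f2] fx0.
have c1 := smooth_at_continuous f1; have c2 := smooth_at_continuous f2.
have nz (h : V -> R) : h @ x --> h x -> h x != 0 -> \forall y \near x, h y != 0.
  move=> hc hx; have : nbhs (h x) [set a : R | a != 0].
    by apply: open_nbhs_nbhs; split => //; exact: open_neq0.
  exact: hc.
have [r0|r0] := eqVneq (Re (f x)) 0.
  have [i0|i0] := eqVneq (Im (f x)) 0.
    by move: fx0; rewrite (_ : f x = 0) ?eqxx//; exact: complexP.
  by apply: filterS (nz _ c2 i0) => y; apply: contra => /eqP ->.
by apply: filterS (nz _ c1 r0) => y; apply: contra => /eqP ->.
Qed.

Definition mxsmooth_at m n x (M : V -> 'M[C]_(m, n)) :=
  forall i j, csmooth_at x (fun y => M y i j).

Lemma mxsmooth_at_cst m n x (M : 'M[C]_(m, n)) : mxsmooth_at x (fun=> M).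
Proof. by move=> i j; exact: csmooth_at_cst. Qed.

Lemma mxsmooth_at_mul m n p x (M : V -> 'M[C]_(m, n)) (M' : V -> 'M[C]_(n, p)) :
  mxsmooth_at x M -> mxsmooth_at x M' -> mxsmooth_at x (fun y => M y *m M' y).
Proof.
move=> Mx M'x i j; under eq_fun do rewrite mxE.
by apply: csmooth_at_sum => k; exact: csmooth_atM.
Qed.

Lemma mxsmooth_at_col m1 m2 n x (M : V -> 'M[C]_(m1, n)) (M' : V -> 'M[C]_(m2, n)) :
  mxsmooth_at x M -> mxsmooth_at x M' -> mxsmooth_at x (fun y => col_mx (M y) (M' y)).
Proof.
move=> Mx M'x i j; case: (splitP i) => k ik.
  have -> : i = lshift m2 k by exact/val_inj.
  by under eq_fun do rewrite col_mxEu; exact: Mx.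
have -> : i = rshift m1 k by exact/val_inj.
by under eq_fun do rewrite col_mxEd; exact: M'x.
Qed.

Lemma mxsmooth_at_row m n1 n2 x (M : V -> 'M[C]_(m, n1)) (M' : V -> 'M[C]_(m, n2)) :
  mxsmooth_at x M -> mxsmooth_at x M' -> mxsmooth_at x (fun y => row_mx (M y) (M' y)).
Proof.
move=> Mx M'x i j; case: (splitP j) => k jk.
  have -> : j = lshift n2 k by exact/val_inj.
  by under eq_fun do rewrite row_mxEl; exact: Mx.
have -> : j = rshift n1 k by exact/val_inj.
by under eq_fun do rewrite row_mxEr; exact: M'x.
Qed.

End ComplexSmooth.

Lemma smooth_at_fst (R : realType) (E F : normedModType R) (p : E * F) :
  smooth_at p (fst : E * F -> E).
Proof. by apply: smooth_at_linear => q; exact: cvg_fst. Qed.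

Lemma smooth_at_snd (R : realType) (E F : normedModType R) (p : E * F) :
  smooth_at p (snd : E * F -> F).
Proof. by apply: smooth_at_linear => q; exact: cvg_snd. Qed.

Lemma smooth_at_id (R : realType) (E : normedModType R) (p : E) : smooth_at p (fun x : E => x).
Proof. by apply: (@smooth_at_linear _ _ _ p idfun) => q; exact: cvg_id. Qed.

Section AffineCharts.
Variable R : realType.
Local Notation C := (Cx R).

Lemma affine_coordZ m n (k : 'I_(m * n)) (M : 'M[C]_(m, n)) (c : C) : c != 0 ->
  affine_coord k (c *: M) = affine_coord k M.
Proof.
move=> c0; rewrite /affine_coord; congr (realify (col' k _)).
by rewrite linearZ/= mxE scalerA invfM mulrAC mulVf// mul1r.
Qed.

(** The inverse chart: homogeneous coordinates normalised to 1 in position k. *)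
Definition affine_mx m n (k : 'I_(m * n)) (u : 'rV[R]_((m * n).-1 + (m * n).-1)) : 'M[C]_(m, n) :=
  vec_mx (\row_l if unlift k l is Some l'
    then (complex.Complex (u 0 (lshift _ l')) (u 0 (rshift _ l')) : C) else 1).

Lemma affine_coordK m n (k : 'I_(m * n)) (M : 'M[C]_(m, n)) : mxvec M 0 k != 0 ->
  affine_mx k (affine_coord k M) = (mxvec M 0 k)^-1 *: M.
Proof.
move=> Mk0; rewrite (_ : _ *: M = vec_mx ((mxvec M 0 k)^-1 *: mxvec M)); last by rewrite linearZ/= mxvecK.
congr vec_mx.
apply/rowP => l; rewrite !mxE; case: unliftP => [l'|] ->; last by rewrite mulVf.
by rewrite row_mxEl row_mxEr !mxE; case: (_ * _).
Qed.

Lemma affine_mx_smooth (V : normedModType R) m n (k : 'I_(m * n)) x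
    (h : V -> 'rV[R]_((m * n).-1 + (m * n).-1)) :
  smooth_at x h -> mxsmooth_at x (fun y => affine_mx k (h y)).
Proof.
move=> hx i j; rewrite /csmooth_at; under eq_fun do rewrite !mxE.
under [X in _ /\ smooth_at _ X]eq_fun do rewrite !mxE.
case: unliftP => [l'|] _; last by split; exact: smooth_at_cst.
by split; exact: smooth_at_entry.
Qed.

Lemma affine_coord_smooth (V : normedModType R) m n (k : 'I_(m * n)) x (M : V -> 'M[C]_(m, n)) :
  mxsmooth_at x M -> mxvec (M x) 0 k != 0 ->
  smooth_at x (fun y => affine_coord k (M y)).
Proof.
move=> Mx k0; have Mv l : csmooth_at x (fun y => mxvec (M y) 0 l).
  by case/mxvec_indexP: l => i j; under eq_fun do rewrite mxvecE; exact: Mx.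
have Mc l : csmooth_at x (fun y => (mxvec (M y) 0 k)^-1 * mxvec (M y) 0 l).
  by apply: csmooth_atM => //; exact: csmooth_atV.
apply: smooth_at_mx => i j; rewrite /affine_coord /realify.
case: (splitP j) => l jl.
  have -> : j = lshift _ l by exact/val_inj.
  under eq_fun do rewrite row_mxEl mxE [X in complex.Re X]mxE [X in complex.Re X]mxE.
  by rewrite ord1; have [] := Mc (lift k l).
have -> : j = rshift _ l by exact/val_inj.
under eq_fun do rewrite row_mxEr mxE [X in complex.Im X]mxE [X in complex.Im X]mxE.
by rewrite ord1; have [] := Mc (lift k l).
Qed.

Lemma exists_chart m n (M : 'M[C]_(m, n)) : M != 0 -> exists k, mxvec M 0 k != 0.
Proof.
move=> M0; apply/existsP; apply: contraNT M0; rewrite negb_exists => /forallP H.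
apply/eqP; rewrite -[M]mxvecK (_ : mxvec M = 0) ?linear0//.
by apply/rowP => l; rewrite [RHS]mxE; apply/eqP; have := H l; rewrite negbK.
Qed.

Lemma smooth_onI (E F : normedModType R) (T U : Type) (a : atlas E T) (b : atlas F U)
    (S : set T) (f : T -> U) :
  (forall x, S x -> exists2 c, a c & exists2 d, b d &
    [/\ chart_dom c x, chart_dom d (f x) & exists2 g : E -> F, smooth_at (c x) g &
      \forall u \near c x, forall y, S y -> chart_dom c y -> c y = u ->
         chart_dom d (f y) /\ g (c y) = d (f y)]) ->
  smooth_on a b S f.
Proof.
move=> H x Sx; have [c ac [d bd [cx dx [g [W [oW Wx sg]] gn]]]] := H x Sx.
exists c => //; exists d => //; split => //.
exists (W `&` interior [set u | forall y, S y -> chart_dom c y -> c y = u ->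
         chart_dom d (f y) /\ g (c y) = d (f y)]), g; split.
- by apply: openI => //; exact: open_interior.
- by [].
- by move=> k; apply: Ck_sub (sg k) => y [].
- by move=> y Sy cy [_ /interior_subset]; apply.
Qed.

End AffineCharts.

(** * Homogeneous coordinates adapted to the group *)

Section MatrixCvg.
Variables (K : numFieldType) (T : Type) (F : set_system T).
Hypothesis FF : Filter F.

Lemma cvg_mx m n (f : T -> 'M[K]_(m, n)) (l : 'M[K]_(m, n)) :
  (forall i j, (fun x => f x i j) @ F --> l i j) -> f @ F --> l.
Proof.
move=> fl; rewrite [l]matrix_sum_delta.
rewrite (_ : f = fun y => \sum_(i < m) \sum_(j < n) f y i j *: delta_mx i j); last first.
  by apply/funext => y; exact: matrix_sum_delta.
by apply: cvg_sumr => i; apply: cvg_sumr => j; apply: cvgZl; exact: fl.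
Qed.

Lemma cvg_entry m n (f : T -> 'M[K]_(m, n)) (l : 'M[K]_(m, n)) i j :
  f @ F --> l -> (fun x => f x i j) @ F --> l i j.
Proof.
move=> fl; apply: (@cvg_comp _ _ _ f (fun M : 'M[K]_(m, n) => M i j) _ (nbhs l)) => //.
exact: coord_continuous.
Qed.

Lemma cvg_mulmx m n p (f : T -> 'M[K]_(m, n)) (g : T -> 'M[K]_(n, p))
    (l : 'M[K]_(m, n)) (l' : 'M[K]_(n, p)) :
  f @ F --> l -> g @ F --> l' -> (fun x => f x *m g x) @ F --> l *m l'.
Proof.
move=> fl gl; apply: cvg_mx => i j; under eq_fun do rewrite mxE; rewrite mxE.
by apply: cvg_sumr => k; apply: cvgM; exact: cvg_entry.
Qed.

Lemma cvg_col_mx m1 m2 n (f : T -> 'M[K]_(m1, n)) (g : T -> 'M[K]_(m2, n))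
    (l : 'M[K]_(m1, n)) (l' : 'M[K]_(m2, n)) :
  f @ F --> l -> g @ F --> l' -> (fun x => col_mx (f x) (g x)) @ F --> col_mx l l'.
Proof.
move=> fl gl; apply: cvg_mx => i j; case: (splitP i) => k ik.
  have -> : i = lshift m2 k by exact/val_inj.
  by under eq_fun do rewrite col_mxEu; rewrite col_mxEu; exact: cvg_entry.
have -> : i = rshift m1 k by exact/val_inj.
by under eq_fun do rewrite col_mxEd; rewrite col_mxEd; exact: cvg_entry.
Qed.

End MatrixCvg.

Section ComplexCvg.
Variable R : realType.
Local Notation C := (Cx R).

Lemma norm_ReIm_le (z : C) : `|complex.Re z| <= nrm z /\ `|complex.Im z| <= nrm z.
Proof.
rewrite /nrm normc_def/=; case: z => a b /=; rewrite -!sqrtr_sqr !ler_wsqrtr//.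
  by rewrite lerDr sqr_ge0.
by rewrite lerDl sqr_ge0.
Qed.

Lemma Re_sum (I : Type) (r : seq I) (f : I -> C) :
  complex.Re (\sum_(i <- r) f i) = \sum_(i <- r) complex.Re (f i).
Proof. by elim: r => [|i r IH]; rewrite ?big_nil// !big_cons ReD IH. Qed.

Lemma Im_sum (I : Type) (r : seq I) (f : I -> C) :
  complex.Im (\sum_(i <- r) f i) = \sum_(i <- r) complex.Im (f i).
Proof. by elim: r => [|i r IH]; rewrite ?big_nil// !big_cons ImD IH. Qed.

Lemma Re_continuous : continuous (@complex.Re R : C -> R).
Proof.
move=> z; apply/(@cvgrPdist_lt _ _ _ (nbhs z) (nbhs_filter z)) => e e0.
have e0' : 0 < toC e by rewrite -[0]/(toC (0 : R)) ltC_toC.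
have /(@cvgrPdist_lt _ _ _ (nbhs z) (nbhs_filter z))/(_ _ e0') := @cvg_id _ (nbhs z).
apply: filterS => w /=; rewrite normC_nrm ltC_toC; apply: le_lt_trans.
rewrite (_ : complex.Re z - _ = complex.Re (z - w)); first by have [] := norm_ReIm_le (z - w).
by case: z; case: w.
Qed.

Lemma Im_continuous : continuous (@complex.Im R : C -> R).
Proof.
move=> z; apply/(@cvgrPdist_lt _ _ _ (nbhs z) (nbhs_filter z)) => e e0.
have e0' : 0 < toC e by rewrite -[0]/(toC (0 : R)) ltC_toC.
have /(@cvgrPdist_lt _ _ _ (nbhs z) (nbhs_filter z))/(_ _ e0') := @cvg_id _ (nbhs z).
apply: filterS => w /=; rewrite normC_nrm ltC_toC; apply: le_lt_trans.
rewrite (_ : complex.Im z - _ = complex.Im (z - w)); first by have [] := norm_ReIm_le (z - w).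
by case: z; case: w.
Qed.

Lemma toC_continuous : continuous (@toC R).
Proof.
move=> x; apply/cvgrPdist_lt => e e0.
have eE : e = toC (complex.Re e).
  by case: e e0 => a b; rewrite ltcE/= => /andP[/eqP -> _].
have r0 : 0 < complex.Re e by rewrite -ltC_toC -eE.
have /cvgrPdist_lt/(_ _ r0) := @cvg_id _ (nbhs x).
apply: filterS => y /=; rewrite -[toC x - toC y]/(toC x - toC y) /toC -rmorphB/=.
by rewrite normC_nrm nrm_toC eE ltC_toC.
Qed.

Lemma cvg_toC (T : Type) (F : set_system T) (FF : Filter F) (f : T -> R) (l : R) :
  f @ F --> l -> (fun x => toC (f x)) @ F --> toC l.
Proof. by move=> fl; apply: cvg_comp fl _; exact: toC_continuous. Qed.

Lemma cvg_map_toC (T : Type) (F : set_system T) (FF : Filter F) m n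
    (f : T -> 'M[R]_(m, n)) (l : 'M[R]_(m, n)) :
  f @ F --> l -> (fun x => map_mx (@toC R) (f x)) @ F --> map_mx (@toC R) l.
Proof.
move=> fl; apply: cvg_mx => i j; under eq_fun do rewrite mxE; rewrite mxE.
by apply: cvg_toC; exact: cvg_entry.
Qed.

Lemma cvg_initial (S : choiceType) (X : topologicalType) (h : S -> X) (T : Type)
    (F : set_system T) (FF : Filter F) (u : T -> S) (s : S) :
  (fun x => h (u x)) @ F --> h s -> u @ F --> (s : initial_topology h).
Proof.
move=> hu B; rewrite nbhsE => -[W [oW Ws] WB]; case: oW => D oD DW.
have : nbhs (h s) D by apply: open_nbhs_nbhs; split => //; move: Ws; rewrite -DW.
move=> /hu H; have {}H : F (fun x => D (h (u x))) := H.
change (F (u @^-1` B)); apply: (filterS _ H) => x Dx; apply: WB; rewrite -DW; exact: Dx.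
Qed.

Lemma cvg_toproj n (T : Type) (F : set_system T) (FF : Filter F) (v : T -> nzvec R n) (l : nzvec R n) :
  (fun x => nzvec_val (v x)) @ F --> nzvec_val l -> (fun x => toproj (v x)) @ F --> toproj l.
Proof.
move=> vl; apply: (@cvg_comp _ _ _ v (@toproj R n) _ (nbhs l)); last exact: pi_continuous.
exact: (@cvg_initial _ _ (@nzvec_val R n)).
Qed.

Lemma open_projsp n (O : set (projsp R n)) (D : set 'cV[C]_n) : open D ->
  (forall v : nzvec R n, O (toproj v) <-> D v) -> open O.
Proof.
move=> oD OD; rewrite -[open O]/(open (@toproj R n @^-1` O)).
rewrite (_ : _ @^-1` _ = @nzvec_val R n @^-1` D).
  by apply: open_comp => // v _; exact: initial_continuous.
by apply/predeqP => v; exact: OD.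
Qed.

End ComplexCvg.

Local Notation sdm := sdprod_mul.

Section Homogeneous.
Variables (R : realType) (N : nat) (A : R -> GL N R) (P : GL (N + 1) (Cx R)).
Hypothesis repA : is_representation A.
Hypothesis A_inj : injective A.
Local Notation C := (Cx R).
Local Notation Re := (@complex.Re R).
Local Notation Im := (@complex.Im R).
Implicit Types (x y : 'cV[R]_N * R) (w : 'cV[C]_(N + 1)).

Lemma repD s t : GLmx (A (s + t)) = A s *m A t.
Proof. by rewrite repA. Qed.

Lemma rep0 : GLmx (A 0) = 1%:M.
Proof.
have : (A 0 = A 0 * A 0)%g by rewrite -repA addr0.
by move=> /(congr1 (fun g => g * (A 0)^-1)%g); rewrite mulgV mulgK => <-.
Qed.

Lemma repN t : A t *m A (- t) = 1%:M. Proof. by rewrite -repD subrr rep0. Qed.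
Lemma repNl t : A (- t) *m A t = 1%:M. Proof. by rewrite -repD addNr rep0. Qed.

Definition sdinv x : 'cV[R]_N * R := (- (A (- x.2) *m x.1), - x.2).

Lemma sdmulV x : sdm A x (sdinv x) = (0, 0).
Proof. by rewrite /sdprod_mul/= mulmxN mulmxA repN mul1mx !subrr. Qed.
Lemma sdVmul x : sdm A (sdinv x) x = (0, 0).
Proof. by rewrite /sdprod_mul/= addNr addNr. Qed.
Lemma sdmul1 x : sdm A (0, 0) x = x.
Proof. by case: x => b t; rewrite /sdprod_mul/= rep0 mul1mx !add0r. Qed.
Lemma sd1mul x : sdm A x (0, 0) = x.
Proof. by case: x => b t; rewrite /sdprod_mul/= mulmx0 !addr0. Qed.
Lemma sdmulA x y z : sdm A x (sdm A y z) = sdm A (sdm A x y) z.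
Proof. by rewrite /sdprod_mul/= repD mulmxDr !mulmxA !addrA. Qed.

Definition emb x : PGL R (N + 1) := toPGL (P * rho A x * P^-1)%g.

Lemma emb_mul x y : emb (sdm A x y) = (emb x * emb y)%g.
Proof.
rewrite /emb -[RHS](toPGLM (P * rho A x * P^-1)%g) rhoM//; congr toPGL.
by rewrite !mulgA mulgKV.
Qed.

Lemma emb1 : emb (0, 0) = 1%g.
Proof.
have : (emb (0, 0) = emb (0, 0) * emb (0, 0))%g by rewrite -emb_mul sdmul1.
by move=> /(congr1 (fun g => g * (emb (0, 0))^-1)%g); rewrite mulgV mulgK => <-.
Qed.

Lemma embV x : emb (sdinv x) = (emb x)^-1%g.
Proof.
apply: (mulgI (emb x)); rewrite mulgV -emb_mul sdmulV.
exact: emb1.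
Qed.

Lemma emb_inj : injective emb.
Proof.
move=> x y; rewrite /emb => /eqP/toPGLP[c c0].
move=> /(congr1 (fun M => (invmx P *m M *m P : 'M[C]_(N + 1)))).
rewrite /= -scalemxAr -scalemxAl !mulmxA mulVmx ?GLmx_unit// !mul1mx.
rewrite -!mulmxA mulVmx ?GLmx_unit// !mulmx1 /rho/= /rho_mx !map_block_mx scale_block_mx.
move=> /eq_block_mx[EA Eb _ E1].
(* The corner entry 1 of [rho] removes the freedom of scaling in PGL; faithfulness of A then gives
   equal times. *)
have c1 : c = 1.
  have := congr1 (fun M : 'M[C]_1 => M 0 0) E1; rewrite !mxE/= mulr1 => <-.
  by rewrite /toC.
move: EA Eb; rewrite c1 !scale1r => /(@map_mx_inj _ _ (@real_complex R)) EA.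
move=> /(@map_mx_inj _ _ (@real_complex R)) Eb.
case: x y EA Eb {E1} => b t [b' t'] /= EA ->; congr pair.
by apply: A_inj; apply: val_inj.
Qed.

Definition htop w : 'cV[C]_N := locked (usubmx (invmx P *m w)).
Definition hbot w : C := dsubmx (invmx P *m w) 0 0.

Lemma hcoordE w : w = P *m col_mx (htop w) (const_mx (hbot w)).
Proof.
rewrite -[LHS](mulKVmx (GLmx_unit P)); congr (_ *m _).
rewrite /htop -lock -[LHS]vsubmxK; congr col_mx; apply/matrixP => i j.
by rewrite [RHS]mxE !ord1.
Qed.

Lemma htop_i w i : htop w i 0 = (invmx P *m w) (lshift 1 i) 0.
Proof. by rewrite /htop -lock mxE. Qed.
Lemma hbot_i w : hbot w = (invmx P *m w) (rshift N 0) 0.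
Proof. by rewrite /hbot mxE. Qed.

Lemma htopE p (q : 'M[C]_1) : htop (P *m col_mx p q) = p.
Proof. by rewrite /htop -lock mulKmx ?GLmx_unit// col_mxKu. Qed.
Lemma hbotE (p : 'cV[C]_N) q : hbot (P *m col_mx p q) = q 0 0.
Proof. by rewrite /hbot mulKmx ?GLmx_unit// col_mxKd. Qed.

Lemma htopZ c w : htop (c *: w) = c *: htop w.
Proof. by rewrite /htop -!lock -scalemxAr linearZ. Qed.
Lemma hbotZ c w : hbot (c *: w) = c * hbot w.
Proof. by rewrite /hbot -scalemxAr linearZ mxE. Qed.

(* The real vector Im (q^* p) of homogeneous coordinates (p : q): it is transformed by A, it vanishes exactly on Lambda, and it is |q|^2 times the imaginary part of the affine coordinate p / q. *)
Definition mom w : 'cV[R]_N :=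
  \col_i (Re (hbot w) * Im (htop w i 0) - Im (hbot w) * Re (htop w i 0)).

Lemma momZ (c : C) w : mom (c *: w) = (Re c ^+ 2 + Im c ^+ 2) *: mom w.
Proof.
apply/colP => i; rewrite !mxE htopZ hbotZ !mxE !ReM !ImM; ring.
Qed.

Lemma map_rho_mx x : map_mx (@toC R) (rho_mx A x) =
  block_mx (map_mx (@toC R) (A x.2)) (map_mx (@toC R) x.1) 0 1%:M.
Proof.
rewrite (_ : @toC R = @real_complex R)// /rho_mx map_block_mx map_mx0 map_mx1.
by [].
Qed.

(** A real translation b adds q b to p, and the imaginary part of |q|^2 b is 0; the real matrix A t
    commutes with taking imaginary parts. *)
Lemma mom_rho x w : mom (P *m rho A x *m invmx P *m w) = A x.2 *m mom w.
Proof.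
rewrite [in LHS](hcoordE w) -!mulmxA mulKmx ?GLmx_unit//=.
rewrite map_rho_mx mul_block_col mul0mx add0r mul1mx.
apply/colP => i; rewrite [in LHS]mxE htopE hbotE [const_mx _ _ _]mxE.
rewrite [(_ + _ : matrix _ _ _) _ _]mxE ReD ImD.
have bE : (map_mx (@toC R) x.1 *m (const_mx (hbot w) : 'M[C]_1)) i 0 = toC (x.1 i 0) * hbot w.
  by rewrite mxE big_ord1 !mxE.
rewrite bE ReM ImM /= !mul0r subr0 addr0.
have AE : (map_mx (@toC R) (A x.2) *m htop w) i 0 = \sum_j toC (A x.2 i j) * htop w j 0.
  by rewrite mxE; apply: eq_bigr => j _; rewrite mxE.
have ReS : Re (\sum_j toC (A x.2 i j) * htop w j 0) = \sum_j A x.2 i j * Re (htop w j 0).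
  rewrite Re_sum; apply: eq_bigr => j _.
  by rewrite ReM /= mul0r subr0.
have ImS : Im (\sum_j toC (A x.2 i j) * htop w j 0) = \sum_j A x.2 i j * Im (htop w j 0).
  rewrite Im_sum; apply: eq_bigr => j _.
  by rewrite ImM /= mul0r addr0.
rewrite AE ReS ImS [RHS]mxE; under [RHS]eq_bigr do rewrite mxE mulrBr.
rewrite sumrB.
have -> : \sum_j A x.2 i j * (Re (hbot w) * Im (htop w j 0)) = Re (hbot w) * \sum_j A x.2 i j * Im (htop w j 0).
  by rewrite mulr_sumr; apply: eq_bigr => j _; ring.
have -> : \sum_j A x.2 i j * (Im (hbot w) * Re (htop w j 0)) = Im (hbot w) * \sum_j A x.2 i j * Re (htop w j 0).
  by rewrite mulr_sumr; apply: eq_bigr => j _; ring.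
ring.
Qed.

Lemma mom_continuous : continuous (mom : 'cV[C]_(N + 1) -> 'cV[R]_N).
Proof.
move=> w.
have hc : (fun w => invmx P *m w) @ w --> invmx P *m w.
  by apply: (cvg_mulmx (nbhs_filter w)); [exact: cvg_cst|exact: cvg_id].
have tc i : (fun w => htop w i 0) @ w --> htop w i 0.
  under eq_fun do rewrite htop_i; rewrite htop_i.
  exact: (@cvg_entry C _ (nbhs w) (N + 1)%N 1%N (fun v => invmx P *m v) (invmx P *m w) (lshift 1 i) 0 hc).
have bc : hbot @ w --> hbot w.
  rewrite (_ : hbot = fun w => (invmx P *m w) (rshift N 0) 0); last by apply/funext => v; exact: hbot_i.
  exact: (@cvg_entry C _ (nbhs w) (N + 1)%N 1%N (fun v => invmx P *m v) (invmx P *m w) (rshift N 0) 0 hc).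
have Rc (f : 'cV[C]_(N + 1) -> C) : f @ w --> f w -> (fun w => Re (f w)) @ w --> Re (f w).
  by move=> fw; apply: (cvg_comp _ _ fw); exact: Re_continuous.
have Ic (f : 'cV[C]_(N + 1) -> C) : f @ w --> f w -> (fun w => Im (f w)) @ w --> Im (f w).
  by move=> fw; apply: (cvg_comp _ _ fw); exact: Im_continuous.
apply: (cvg_mx (nbhs_filter w)) => i j; under eq_fun do rewrite mxE; rewrite mxE.
exact: (cvgB (cvgM (Rc _ bc) (Ic _ (tc i))) (cvgM (Ic _ bc) (Rc _ (tc i)))).
Qed.

Lemma pt_subproof (p : 'cV[C]_N) (q : C) : (q != 0) || (p != 0) ->
  P *m col_mx p (const_mx q : 'M[C]_1) != 0.
Proof.
apply: contraL => /eqP w0; rewrite negb_or !negbK.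
have := htopE p (const_mx q); have := hbotE p (const_mx q); rewrite mxE w0.
have -> : (0 : 'cV[C]_(N + 1)) = 0 *: (0 : 'cV[C]_(N + 1)) by rewrite scale0r.
by rewrite hbotZ htopZ scale0r mul0r => <- <-; rewrite !eqxx.
Qed.

Lemma pt_proof (p : 'cV[C]_N) : P *m col_mx p (const_mx 1 : 'M[C]_1) != 0.
Proof. by apply: pt_subproof; rewrite oner_eq0. Qed.

Definition pt (p : 'cV[C]_N) : projsp R (N + 1) := toproj (MkNz (pt_proof p)).

Lemma act_emb x (v : nzvec R (N + 1)) : exists2 v' : nzvec R (N + 1), act (emb x) (toproj v) = toproj v' &
  nzvec_val v' = P *m rho A x *m invmx P *m v.
Proof. by exists (GLact (P * rho A x * P^-1)%g v); [exact: actE|]. Qed.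

Lemma act_mul (g h : PGL R (N + 1)) z : act (g * h)%g z = act g (act h z).
Proof.
rewrite -(toPGL_repr g) -(toPGL_repr h) -[(_ * _)%g]toPGLM -(toproj_repr z) !actE.
by congr toproj; apply: val_inj; rewrite /= mulmxA.
Qed.

Lemma toproj_eq (v w : nzvec R (N + 1)) (c : C) : c != 0 ->
  nzvec_val w = c *: nzvec_val v -> toproj v = toproj w.
Proof. by move=> c0 E; apply/eqP/toprojP; exists c. Qed.

Lemma act_pt x p : act (emb x) (pt p) =
  pt (map_mx (@toC R) (A x.2) *m p + map_mx (@toC R) x.1).
Proof.
have [v' -> vE] := act_emb x (MkNz (pt_proof p)).
apply: (@toproj_eq _ _ 1); first exact: oner_neq0.
rewrite scale1r vE /= -!mulmxA mulKmx ?GLmx_unit//; congr (_ *m _).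
rewrite map_rho_mx mul_block_col mul0mx add0r mul1mx.
congr (col_mx (_ + _) _); apply/colP => i.
by rewrite [RHS]mxE big_ord1 !mxE mulr1.
Qed.

Lemma pt_inj : injective pt.
Proof.
move=> p p' /eqP/toprojP[c c0 /= E].
have := congr1 hbot E; rewrite hbotZ !hbotE !mxE mulr1 => c1.
by have := congr1 htop E; rewrite htopZ !htopE -c1 scale1r.
Qed.

Lemma mom_pt (p : 'cV[C]_N) : mom (P *m col_mx p (const_mx 1)) = map_mx Im p.
Proof.
by apply/colP => i; rewrite !mxE htopE hbotE mxE /= mul1r mul0r subr0.
Qed.

Lemma toproj_pt (v : nzvec R (N + 1)) : hbot v != 0 ->
  toproj v = pt ((hbot v)^-1 *: htop v).
Proof.
move=> b0; apply: (@toproj_eq _ _ (hbot v)^-1); first by rewrite invr_eq0.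
rewrite [RHS](_ : _ = (hbot v)^-1 *: (P *m col_mx (htop v) (const_mx (hbot v)))); last by rewrite -hcoordE.
rewrite scalemxAr scale_col_mx; congr (_ *m col_mx _ _).
by apply/matrixP => i j; rewrite !mxE mulVf.
Qed.

(** Computed from the chosen representative, hence meaningful only up to a positive factor; the
    vanishing of S [momz] z is intrinsic. *)
Definition momz (z : projsp R (N + 1)) := mom (repr z).

Lemma momz_toproj v : exists2 c : R, 0 < c & momz (toproj v) = c *: mom v.
Proof.
have [c c0 cE] : exists2 c : C, c != 0 & nzvec_val (repr (toproj v)) = c *: nzvec_val v.
  by apply/toprojP; rewrite toproj_repr.
by exists (Re c ^+ 2 + Im c ^+ 2); [exact: sqrRI_gt0|rewrite /momz cE momZ].
Qed.

Lemma momz_act x z : exists2 c : R, 0 < c & momz (act (emb x) z) = c *: (A x.2 *m momz z).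
Proof.
have [v' vE v'E] := act_emb x (repr z); rewrite toproj_repr in vE.
have [c c0 cE] := momz_toproj v'; exists c => //.
by rewrite vE cE v'E mom_rho.
Qed.

Lemma momz_pt p : exists2 c : R, 0 < c & momz (pt p) = c *: map_mx Im p.
Proof.
have [c c0 cE] := momz_toproj (MkNz (pt_proof p)).
by exists c => //; rewrite /pt cE /= mom_pt.
Qed.

Lemma momz_neq0_pt z : momz z != 0 -> exists p, z = pt p.
Proof.
move=> z0; rewrite -(toproj_repr z); have [b0|b0] := eqVneq (hbot (repr z)) 0.
  move: z0; rewrite /momz (_ : mom _ = 0) ?eqxx//.
  by apply/colP => i; rewrite !mxE b0 /= !mul0r subrr.
by exists ((hbot (repr z))^-1 *: htop (repr z)); exact: toproj_pt.
Qed.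

(** On the hyperplane at infinity, q = 0, the added term q b vanishes. *)
Lemma emb_translation_fix l (z : projsp R (N + 1)) : hbot (repr z) = 0 -> act (emb (l, 0)) z = z.
Proof.
move=> b0; have [v vE v'E] := act_emb (l, 0) (repr z).
rewrite -{1}(toproj_repr z) vE -[RHS]toproj_repr; apply/esym/(@toproj_eq _ _ 1).
  exact: oner_neq0.
rewrite scale1r v'E [RHS](hcoordE) {1}[nzvec_val _](hcoordE (repr z)).
rewrite -!mulmxA mulKmx ?GLmx_unit//; congr (_ *m _).
rewrite [X in X *m _ = _]/= map_rho_mx mul_block_col mul0mx add0r mul1mx b0 rep0//.
have -> : const_mx 0 = 0 :> 'M[C]_1 by apply/matrixP => i j; rewrite !mxE.
by rewrite mulmx0 addr0 [map_mx _ _](map_mx1 (@real_complex R)) mul1mx.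
Qed.

Lemma momz_eq0 z : momz z = 0 -> hbot (repr z) = 0 \/ exists x : 'cV[R]_N, z = pt (map_mx (@toC R) x).
Proof.
move=> z0; have [b0|b0] := eqVneq (hbot (repr z)) 0; [by left|right].
have := toproj_pt b0; rewrite toproj_repr => zE.
pose p := (hbot (repr z))^-1 *: htop (repr z); rewrite -/p in zE.
exists (map_mx Re p); rewrite zE; congr pt.
have [c c0] := momz_pt p; rewrite -zE z0 => /esym/eqP; rewrite scaler_eq0 gt_eqF//=.
move=> /eqP/colP p0; apply/colP => i; rewrite !mxE; have := p0 i; rewrite !mxE.
by case: (_ * _) => ? ? /= ->.
Qed.

Lemma momz_real (x : 'cV[R]_N) : momz (pt (map_mx (@toC R) x)) = 0.
Proof.
have [c _ ->] := momz_pt (map_mx (@toC R) x); rewrite (_ : map_mx _ _ = 0) ?scaler0//.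
by apply/colP => i; rewrite !mxE.
Qed.

Definition Omega m (S : 'M[R]_(m, N)) : set (projsp R (N + 1)) :=
  [set z | S *m momz z != 0].

Lemma OmegaE m (S : 'M[R]_(m, N)) v : Omega S (toproj v) <-> S *m mom v != 0.
Proof.
have [c c0 cE] := momz_toproj v; rewrite /Omega/= cE -scalemxAr scaler_eq0.
by rewrite gt_eqF.
Qed.

Lemma open_Omega m (S : 'M[R]_(m, N)) : open (Omega S).
Proof.
apply: (@open_projsp _ _ _ [set w | S *m mom w != 0]); last by move=> v; exact: OmegaE.
rewrite (_ : [set w | _] = \bigcup_i (fun w => (S *m mom w) i 0) @^-1` [set a : R | a != 0]).
  apply: bigcup_open => i _; apply: open_comp; last exact: open_neq0.
  move=> w _; apply: (@cvg_entry _ _ (nbhs w)); apply: cvg_mulmx; first exact: cvg_cst.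
  exact: mom_continuous.
apply/predeqP => w; split => /=.
  move=> /eqP w0; apply: contrapT => H; apply: w0; apply/colP => i; rewrite [RHS]mxE.
  by apply/eqP; apply: contrapT => /negP h; apply: H; exists i.
by move=> [i _ /=]; apply: contraNneq => ->; rewrite mxE.
Qed.

Lemma Omega_invariant m (S : 'M[R]_(m, N)) (As : R -> 'M[R]_m) :
  (forall t, S *m A t = As t *m S) -> is_invariant (range emb) (Omega S).
Proof.
move=> SA g z [x _ <-] Oz; have [c c0] := momz_act x z.
rewrite /Omega/= => ->; rewrite -scalemxAr scaler_eq0 gt_eqF//= mulmxA.
apply: contra Oz => /eqP E.
have -> : S *m momz z = As (- x.2) *m (S *m A x.2 *m momz z).
  by rewrite !mulmxA -SA -(mulmxA S) repNl mulmx1.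
by rewrite E mulmx0.
Qed.

End Homogeneous.

(** * The product structure of the domains Omega *)

Section ReprLemmas.
Variables (R : realType) (n : nat).
Local Notation C := (Cx R).

Lemma repr_toproj (v : nzvec R n) :
  exists2 c : C, c != 0 & nzvec_val (repr (toproj v)) = c *: nzvec_val v.
Proof. by apply/toprojP; rewrite toproj_repr. Qed.

Lemma repr_act (g : PGL R n) (v : nzvec R n) : exists2 c : C, c != 0 &
  nzvec_val (repr (act g (toproj v))) = c *: (GLmx (repr g) *m nzvec_val v).
Proof.
rewrite -{1}(toPGL_repr g) actE; have [c c0 cE] := repr_toproj (GLact (repr g) v).
by exists c.
Qed.

Lemma mxvecZE p r (c : C) (M : 'M[C]_(p, r)) i : mxvec (c *: M) 0 i = c * mxvec M 0 i.
Proof. by rewrite linearZ/= mxE. Qed.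

End ReprLemmas.

Section ProductStructure.
Variables (R : realType) (N : nat) (A : R -> GL N R) (P : GL (N + 1) (Cx R)).
Hypotheses (repA : is_representation A) (A_inj : injective A)
  (A_smooth : smooth setT (fun t : R => GLmx (A t))).
Variables (m k : nat) (S1 : 'M[R]_(m, N)) (T1 : 'M[R]_(N, m))
  (S2 : 'M[R]_(k, N)) (T2 : 'M[R]_(N, k)) (eps : R).
Hypotheses (S1T1 : S1 *m T1 = 1%:M) (S1T2 : S1 *m T2 = 0) (S2T1 : S2 *m T1 = 0)
  (S2T2 : S2 *m T2 = 1%:M) (TS : T1 *m S1 + T2 *m S2 = 1%:M)
  (S1A : forall t, S1 *m A t = S1 *m A t *m T1 *m S1) (eps2 : eps * eps = 1)
  (dec : forall i j, (fun l : nat => (S1 *m A (eps * l%:R)) i j) @ \oo --> (0 : R)).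
Local Notation C := (Cx R).
Local Notation Re := (@complex.Re R).
Local Notation Im := (@complex.Im R).

Lemma smooth_rep_entry (V : normedModType R) x (u : V -> R) i j :
  smooth_at x u -> smooth_at x (fun y => GLmx (A (u y)) i j).
Proof.
apply: (@smooth_at_comp1 _ _ setT (fun t => GLmx (A t) i j)) => //; first exact: openT.
move=> l; apply: (@Ck_entry _ _ _ _ l setT (fun t => GLmx (A t))); [exact: openT|exact: A_smooth].
Qed.

(** The sign [eps] is the direction of time in which the subspace cut out by S1 contracts; [flow] is
    thus a contracting one-parameter group for both the stable and the unstable subspace. *)
Definition flow (s : R) : 'M[R]_m := locked (S1 *m A (eps * s) *m T1).

Lemma flow_def s : flow s = S1 *m A (eps * s) *m T1.
Proof. by rewrite /flow -lock. Qed.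

Lemma flowE s : S1 *m A (eps * s) = flow s *m S1.
Proof. by rewrite flow_def -S1A. Qed.

Lemma flow_time t : S1 *m A t = flow (eps * t) *m S1.
Proof. by rewrite -flowE mulrA eps2 mul1r. Qed.

Lemma flow0 : flow 0 = 1%:M.
Proof. by rewrite flow_def mulr0 rep0// mulmx1. Qed.

Lemma flowD s t : flow (s + t) = flow s *m flow t.
Proof.
rewrite flow_def mulrDr repD// mulmxA flowE -[_ *m S1 *m _]mulmxA flowE.
by rewrite -!mulmxA S1T1 mulmx1.
Qed.

Lemma smooth_flow_entry (V : normedModType R) x (u : V -> R) i j :
  smooth_at x u -> smooth_at x (fun y => flow (u y) i j).
Proof.
move=> ux; under eq_fun do rewrite flow_def mxE.
apply: smooth_at_sum => a; apply: smooth_atM; last exact: smooth_at_cst.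
under eq_fun do rewrite mxE; apply: smooth_at_sum => b.
apply: smooth_atM; first exact: smooth_at_cst.
by apply: smooth_rep_entry; apply: smooth_atM => //; exact: smooth_at_cst.
Qed.

Lemma smooth_at_derivable (f : R -> R) t : smooth_at t f -> derivable f t 1.
Proof.
move=> [U [oU Ut Cf]]; apply: diff_derivable.
by have [+ _] := Cf 1%N; exact.
Qed.

Lemma flow_derivable t i j : derivable (fun s => flow s i j) t 1.
Proof. by apply: smooth_at_derivable; apply: smooth_flow_entry; exact: smooth_at_id. Qed.

Lemma flow_dec i j : (fun l : nat => flow l%:R i j) @ \oo --> (0 : R).
Proof.
under eq_fun do rewrite flow_def mxE; apply: cvg_sumr0 => a.
by apply: cvg0l; exact: dec.
Qed.

Definition lyap : 'M[R]_m := sval (cid (lyapunov_exists flow0 flowD flow_derivable flow_dec)).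
Lemma lyapP : lyap *m one_gen flow + (one_gen flow)^T *m lyap = - 1%:M.
Proof. exact: svalP (cid (lyapunov_exists flow0 flowD flow_derivable flow_dec)). Qed.

Local Notation q := (qform lyap).

Lemma q_gt0 y : y != 0 -> 0 < q y.
Proof. exact: (qform_gt0 flow0 flowD flow_derivable flow_dec lyapP). Qed.

Lemma qZ c y : q (c *: y) = c ^+ 2 * q y.
Proof.
by rewrite /qform -scalemxAr [(_ *: _)^T]linearZ/= -!scalemxAl scalerA mxE expr2.
Qed.

(** The hitting time of the level q = 1. For y = 0 there is none and the default 0 is returned; the
    lemmas on [tau] assume a nonzero vector. *)
Definition tau (y : 'cV[R]_m) : R := xget 0 [set t | q (flow (- t) *m y) = 1].

Lemma tauP y : y != 0 -> q (flow (- tau y) *m y) = 1.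
Proof.
move=> y0; rewrite /tau; case: xgetP => [t -> //|].
by have [t tE] := qform_hit flow0 flowD flow_derivable flow_dec lyapP y0 => /(_ t).
Qed.

Lemma q_flow_incr y s t : y != 0 -> s < t ->
  q (flow (- s) *m y) < q (flow (- t) *m y).
Proof. exact: (qform_flow_incr flow0 flowD flow_derivable lyapP). Qed.

Lemma tau_unique y t : y != 0 -> q (flow (- t) *m y) = 1 -> tau y = t.
Proof.
move=> y0 tE; have h := tauP y0.
case: (ltgtP (tau y) t) => // lt; have := q_flow_incr y0 lt; by rewrite tE h ltxx.
Qed.

(** Separates the matrix, which will carry the time, from the vector, as the implicit function lemma
    requires. *)
Lemma qE (M : 'M[R]_m) y : q (M *m y) =
  \sum_(ij : 'I_m * 'I_m) (M^T *m lyap *m M) ij.1 ij.2 * (y ij.1 0 * y ij.2 0).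
Proof.
rewrite -(pair_bigA _ (fun i j => (M^T *m lyap *m M) i j * (y i 0 * y j 0)))/=.
rewrite /qform trmx_mul -[X in X *m _]mulmxA mulmxA -[X in X *m y]mulmxA mxE exchange_big/=.
apply: eq_bigr => j _; rewrite mxE mulr_suml; apply: eq_bigr => i _.
by rewrite mxE mulrCA mulrA.
Qed.

Lemma tau_smooth (V : normedModType R) x (y : V -> 'cV[R]_m) :
  smooth_at x y -> y x != 0 -> smooth_at x (fun z => tau (y z)).
Proof.
move=> yx y0.
have oD : open [set v : 'cV[R]_m | v != 0].
  rewrite (_ : [set v | _] = ~` [set 0]); last by apply/predeqP => v; split => /= /eqP.
  exact/closed_openC/accessible_closed_set1/hausdorff_accessible/norm_hausdorff.
have [U [oU Ux Cy UD]] := smooth_at_open oD (y0 : [set v : 'cV[R]_m | v != 0] (y x)) yx.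
have Cyij l i : Ck l U (fun z => y z i 0) by exact: (Ck_entry oU (Cy l)).
pose c (ij : 'I_m * 'I_m) (t : R) := ((flow (- t))^T *m lyap *m flow (- t)) ij.1 ij.2.
pose w (ij : 'I_m * 'I_m) (z : V) := y z ij.1 0 * y z ij.2 0.
have qcw t z : q (flow (- t) *m y z) = \sum_ij c ij t * w ij z by rewrite qE.
have Cw l ij : Ck l U (w ij) by apply: CkM.
have sc t ij : smooth_at t (c ij).
  have sN : smooth_at t (fun s : R => - s) by apply: smooth_atN; exact: smooth_at_id.
  rewrite /c; under eq_fun do rewrite mxE; apply: smooth_at_sum => a.
  apply: smooth_atM; last exact: smooth_flow_entry.
  under eq_fun do rewrite mxE; apply: smooth_at_sum => b.
  apply: smooth_atM; last exact: smooth_at_cst.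
  by under eq_fun do rewrite mxE; exact: smooth_flow_entry.
have Cc l ij : Ck l setT (c ij) by apply: Ck_local => t _; exact: sc.
exists U; split => // l.
apply: (@implicit_Ck R V _ c w) => //.
- move=> z Uz; apply/(@cvgrPdist_lt _ _ _ (nbhs z) (nbhs_filter z)) => e e0.
  have wc ij : w ij @ z --> w ij z by exact: (Cw 0%N ij z Uz).
  have qc t : (fun z' => q (flow (- t) *m y z')) @ z --> q (flow (- t) *m y z).
    under eq_fun do rewrite qcw; rewrite qcw; apply: cvg_sumr => ij.
    by apply: cvgMr; exact: wc.
  have yz0 := UD z Uz; have h := tauP yz0.
  (* Continuity of the hitting time: q is below 1 at time tau - e and above 1 at time tau + e; both
     persist for nearby z', and strict monotonicity traps the hitting time in between. *)
  have l1 : q (flow (- (tau (y z) - e)) *m y z) < 1.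
    by rewrite -[X in _ < X]h; apply: q_flow_incr => //; rewrite ltrBlDr ltrDl.
  have l2 : 1 < q (flow (- (tau (y z) + e)) *m y z).
    by rewrite -[X in X < _]h; apply: q_flow_incr => //; rewrite ltrDl.
  have n1 : \forall z' \near z, q (flow (- (tau (y z) - e)) *m y z') < 1.
    exact: (qc (tau (y z) - e) [set a : R | a < 1] (open_nbhs_nbhs (conj (@open_lt _ 1) l1))).
  have n2 : \forall z' \near z, 1 < q (flow (- (tau (y z) + e)) *m y z').
    exact: (qc (tau (y z) + e) [set a : R | 1 < a] (open_nbhs_nbhs (conj (@open_gt _ 1) l2))).
  have n3 : \forall z' \near z, U z' by apply: open_nbhs_nbhs.
  apply: filterS3 n1 n2 n3 => z' h1 h2 Uz'.
  have h' := tauP (UD z' Uz').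
  have m1 : tau (y z) - e < tau (y z').
    rewrite ltNge le_eqVlt; apply/negP => /orP[/eqP E|lt].
      by move: h1; rewrite -E h' ltxx.
    by have := q_flow_incr (UD z' Uz') lt; rewrite h' => /(lt_trans h1); rewrite ltxx.
  have m2 : tau (y z') < tau (y z) + e.
    rewrite ltNge le_eqVlt; apply/negP => /orP[/eqP E|lt].
      by move: h2; rewrite E h' ltxx.
    by have := q_flow_incr (UD z' Uz') lt; rewrite h' => /(lt_trans h2); rewrite ltxx.
  by rewrite ltr_norml; apply/andP; split; lra.
- by move=> z Uz; rewrite -qcw tauP// UD.
(* Nondegeneracy: the time derivative of the equation is the squared norm of a nonzero vector. *)
- move=> z Uz; have dq := qform_flow_derive flowD flow_derivable lyapP (y z) (tau (y z)).
  have s0 : 0 < sqn (flow (- tau (y z)) *m y z).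
    by apply/sqn_gt0/(one_param_neq0 flow0 flowD)/UD.
  suff -> : \sum_i 'D_1 (c i) (tau (y z)) * w i z = sqn (flow (- tau (y z)) *m y z).
    by rewrite gt_eqF.
  have [_ <-] := dq; under [in RHS]eq_fun do rewrite qcw.
  rewrite (_ : (fun t => _) = \sum_ij (fun t => c ij t * w ij z)); last first.
    by apply/funext => t; rewrite fct_sumE.
  have dc ij : derivable (c ij) (tau (y z)) 1 by exact: smooth_at_derivable.
  have : is_derive (tau (y z)) 1 (\sum_ij (fun t => c ij t * w ij z))
     (\sum_i 'D_1 (c i) (tau (y z)) * w i z).
    elim/big_ind2 : _.
    - exact: is_derive_cst.
    - by move=> a b e f; exact: is_deriveD.
    move=> ij _; apply: (@is_derive_eq _ _ _ _ _ _ _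
       (c ij (tau (y z)) *: 0 + w ij z *: 'D_1 (c ij) (tau (y z)))).
      by apply: is_deriveM; exact: derivableP.
    by rewrite scaler0 add0r mulrC.
  by move=> [].
Qed.

Definition imC (r : R) : C := complex.Complex 0 r.

(** The factor X of the product uses the Euclidean sphere, the cross-section the level q = 1: the
    first block is rescaled radially from one to the other, the second block is the free component
    in the complementary subspace. *)
Definition vec_of (x : 'rV[R]_(m + k)) : 'cV[R]_N :=
  T1 *m ((Num.sqrt (q (lsubmx x)^T))^-1 *: (lsubmx x)^T) + T2 *m (rsubmx x)^T.

Definition cross : set 'rV[R]_(m + k) := [set x | sphere R m (lsubmx x)].

Definition prod_map (gx : PGL R (N + 1) * 'rV[R]_(m + k)) : projsp R (N + 1) :=
  act gx.1 (pt P (map_mx imC (vec_of gx.2))).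

(** Time and position of the orbit of y on the cross-section; the factor [eps] converts the time of
    [flow] into the time of A. *)
Definition crossing (y : 'cV[R]_N) : R * 'rV[R]_(m + k) :=
  locked (let t := eps * tau (S1 *m y) in let y' := A (- t) *m y in
  (t, row_mx ((Num.sqrt (sqn (S1 *m y')))^-1 *: (S1 *m y')^T) (S2 *m y')^T)).

Lemma crossing1E y : (crossing y).1 = eps * tau (S1 *m y).
Proof. by rewrite /crossing -lock. Qed.

Lemma crossing2E y : (crossing y).2 = let y' := A (- (crossing y).1) *m y in
  row_mx ((Num.sqrt (sqn (S1 *m y')))^-1 *: (S1 *m y')^T) (S2 *m y')^T.
Proof. by rewrite crossing1E /crossing -lock. Qed.

Definition aff (w : 'cV[C]_(N + 1)) : 'cV[C]_N := (hbot P w)^-1 *: htop P w.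

Definition prod_inv (z : projsp R (N + 1)) : PGL R (N + 1) * 'rV[R]_(m + k) :=
  locked (let p := aff (repr z) in let d := crossing (map_mx Im p) in
  (emb A P (map_mx Re p, d.1), d.2)).

Lemma prod_invE z : prod_inv z =
  (emb A P (map_mx Re (aff (repr z)), (crossing (map_mx Im (aff (repr z)))).1),
   (crossing (map_mx Im (aff (repr z)))).2).
Proof. by rewrite /prod_inv -lock. Qed.

Lemma affZ c w : c != 0 -> aff (c *: w) = aff w.
Proof.
by move=> c0; rewrite /aff hbotZ htopZ scalerA invfM mulrAC mulVf// mul1r.
Qed.

Lemma aff_pt p : aff (repr (pt P p)) = p.
Proof.
have [c c0 cE] := repr_toproj (MkNz (pt_proof P p)).
by rewrite cE affZ// /aff /= htopE hbotE mxE invr1 scale1r.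
Qed.

Lemma Omega_pt p : Omega P S1 (pt P p) <-> S1 *m map_mx Im p != 0.
Proof.
have [c c0 cE] := momz_pt P p; rewrite /Omega/= cE -scalemxAr scaler_eq0.
by rewrite gt_eqF.
Qed.

Lemma cross_lsub x : cross x -> (lsubmx x)^T != 0.
Proof.
move=> xX; apply: contraPneq xX => x0; rewrite /cross/= /sphere/= big1 => [/eqP|i _].
  by rewrite eq_sym oner_eq0.
by rewrite -[lsubmx x]trmxK x0 mxE mxE expr0n.
Qed.

Lemma S1_vec_of x : S1 *m vec_of x = (Num.sqrt (q (lsubmx x)^T))^-1 *: (lsubmx x)^T.
Proof. by rewrite /vec_of mulmxDr !mulmxA S1T1 S1T2 mul1mx mul0mx addr0. Qed.

Lemma S2_vec_of x : S2 *m vec_of x = (rsubmx x)^T.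
Proof. by rewrite /vec_of mulmxDr !mulmxA S2T1 S2T2 mul1mx mul0mx add0r. Qed.

Lemma map_imC_mul n1 n2 (M : 'M[R]_(n1, n2)) (v : 'cV[R]_n2) :
  map_mx (@toC R) M *m map_mx imC v = map_mx imC (M *m v).
Proof.
apply/colP => i; rewrite !mxE; apply: complexP; rewrite ?Re_sum ?Im_sum/=.
  by rewrite big1// => j _; rewrite !mxE ReM /= mulr0 mul0r subr0.
by apply: eq_bigr => j _; rewrite !mxE ImM /= mul0r addr0.
Qed.

Lemma imC_toC_Im (b y : 'cV[R]_N) :
  map_mx Im (map_mx imC y + map_mx (@toC R) b) = y /\
  map_mx Re (map_mx imC y + map_mx (@toC R) b) = b.
Proof. by split; apply/colP => i; rewrite !mxE/= ?addr0 ?add0r. Qed.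

Lemma imC_toC_eta (p : 'cV[C]_N) :
  p = map_mx imC (map_mx Im p) + map_mx (@toC R) (map_mx Re p).
Proof. by apply/colP => i; rewrite !mxE; apply: complexP; rewrite /= ?addr0 ?add0r. Qed.

Lemma prod_map_pt b s x : prod_map (emb A P (b, s), x) =
  pt P (map_mx imC (A s *m vec_of x) + map_mx (@toC R) b).
Proof. by rewrite /prod_map/= act_pt map_imC_mul. Qed.

(** With [crossingK], this makes (s, x) |-> A s (vec_of x) a bijection onto the vectors y with S1 y
    nonzero; it rests on the uniqueness of the hitting time. *)
Lemma crossing_flow s x : cross x -> S1 *m (A s *m vec_of x) != 0 /\
  crossing (A s *m vec_of x) = (s, x).
Proof.
move=> xX; have x0 := cross_lsub xX.
have q0 := q_gt0 x0; have s0 : 0 < Num.sqrt (q (lsubmx x)^T) by rewrite sqrtr_gt0.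
have v0 : S1 *m vec_of x != 0.
  by rewrite S1_vec_of scaler_eq0 invr_eq0 gt_eqF//.
have w0 : S1 *m (A s *m vec_of x) != 0.
  by rewrite mulmxA flow_time -mulmxA; apply: (one_param_neq0 flow0 flowD).
split => //.
have tE : tau (S1 *m (A s *m vec_of x)) = eps * s.
  apply: tau_unique => //.
  have -> : S1 *m (A s *m vec_of x) = flow (eps * s) *m (S1 *m vec_of x).
    by rewrite (mulmxA S1) flow_time -(mulmxA (flow _)).
  rewrite mulmxA -flowD addNr flow0 mul1mx.
  by rewrite S1_vec_of qZ exprVn sqr_sqrtr ?(ltW q0)// mulVf// gt_eqF.
rewrite [crossing _]surjective_pairing crossing2E crossing1E tE mulrA eps2 mul1r mulmxA repNl// mul1mx.
rewrite /= S2_vec_of trmxK; congr pair; rewrite -[RHS]hsubmxK; congr row_mx.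
have sq1 : sqn (lsubmx x)^T = 1.
  by move: xX; rewrite /cross/= /sphere/= => <-; apply: eq_bigr => i _; rewrite mxE.
have sqZ c (y : 'cV[R]_m) : sqn (c *: y) = c ^+ 2 * sqn y.
  by rewrite /sqn mulr_sumr; apply: eq_bigr => i _; rewrite mxE exprMn.
rewrite S1_vec_of sqZ sq1 mulr1 sqrtr_sqr ger0_norm ?invr_ge0 ?(ltW s0)// invrK.
by rewrite [X in _ *: X]linearZ/= scalerA trmxK mulfV ?gt_eqF// scale1r.
Qed.

Lemma crossingK y : S1 *m y != 0 -> cross (crossing y).2 /\
  A (crossing y).1 *m vec_of (crossing y).2 = y.
Proof.
move=> y0; rewrite crossing2E crossing1E; set t := eps * _; set y' := A (- t) *m y; rewrite /=.
have qy' : q (S1 *m y') = 1.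
  by rewrite /y' mulmxA flow_time -mulmxA mulrN mulrA eps2 mul1r tauP.
have y'0 : S1 *m y' != 0.
  apply/eqP => E; move: qy'; rewrite E /qform mulmx0 mxE => /eqP.
  by rewrite eq_sym oner_eq0.
have s0 := sqn_gt0 y'0; set c := Num.sqrt _.
have c0 : 0 < c by rewrite sqrtr_gt0.
have xl : (lsubmx (row_mx (c^-1 *: (S1 *m y')^T) (S2 *m y')^T))^T = c^-1 *: (S1 *m y').
  by rewrite row_mxKl linearZ/= trmxK.
split.
  rewrite /cross/= /sphere/= row_mxKl.
  under eq_bigr do rewrite mxE exprMn [_^T _ _]mxE.
  by rewrite -mulr_sumr exprVn sqr_sqrtr ?(ltW s0)// mulVf// gt_eqF.
rewrite /vec_of xl row_mxKr trmxK qZ qy' mulr1 exprVn sqrtrV ?sqr_ge0// sqrtr_sqr.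
rewrite invrK ger0_norm ?(ltW c0)// scalerA mulfV ?gt_eqF// scale1r !mulmxA -!mulmxDl TS mul1mx.
by rewrite /y' mulmxA repN// mul1mx.
Qed.

Lemma prod_mapK g x : range (emb A P) g -> cross x ->
  Omega P S1 (prod_map (g, x)) /\ prod_inv (prod_map (g, x)) = (g, x).
Proof.
move=> [[b s] _ <-] xX; rewrite prod_map_pt; have [w0 cE] := crossing_flow s xX.
have [ImE ReE] := imC_toC_Im b (A s *m vec_of x).
split; first by apply/Omega_pt; rewrite ImE.
by rewrite prod_invE aff_pt ImE ReE cE.
Qed.

Lemma prod_invK z : Omega P S1 z -> (range (emb A P) `*` cross) (prod_inv z) /\
  prod_map (prod_inv z) = z.
Proof.
move=> Oz; have z0 : momz P z != 0 by apply: contraNneq Oz => ->; rewrite mulmx0.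
have [p zE] := momz_neq0_pt z0; move: Oz; rewrite zE => /Omega_pt p0.
rewrite prod_invE aff_pt; have [cX cE] := crossingK p0; split.
  by split => //=; exists (map_mx Re p, (crossing (map_mx Im p)).1).
by rewrite prod_map_pt cE -imC_toC_eta.
Qed.

Lemma mxsmooth_htop (V : normedModType R) x (w : V -> 'cV[C]_(N + 1)) :
  mxsmooth_at x w -> mxsmooth_at x (fun y => htop P (w y)).
Proof.
move=> wx i j; rewrite ord1; under eq_fun do rewrite htop_i.
by apply: mxsmooth_at_mul => //; exact: mxsmooth_at_cst.
Qed.

Lemma csmooth_hbot (V : normedModType R) x (w : V -> 'cV[C]_(N + 1)) :
  mxsmooth_at x w -> csmooth_at x (fun y => hbot P (w y)).
Proof.
move=> wx; rewrite (_ : (fun y => _) = fun y => (invmx P *m w y) (rshift N 0) 0); last first.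
  by apply/funext => y; rewrite hbot_i.
by apply: mxsmooth_at_mul => //; exact: mxsmooth_at_cst.
Qed.

Lemma smooth_mulmx (V : normedModType R) x n1 n2 n3 (M : V -> 'M[R]_(n1, n2)) (L : V -> 'M[R]_(n2, n3)) :
  smooth_at x M -> smooth_at x L -> smooth_at x (fun y => M y *m L y).
Proof.
move=> Mx Lx; apply: smooth_at_mx => i j; under eq_fun do rewrite mxE.
by apply: smooth_at_sum => l; apply: smooth_atM; exact: smooth_at_entry.
Qed.

Lemma smooth_scale (V : normedModType R) x n1 n2 (c : V -> R) (M : V -> 'M[R]_(n1, n2)) :
  smooth_at x c -> smooth_at x M -> smooth_at x (fun y => c y *: M y).
Proof.
move=> cx Mx; apply: smooth_at_mx => i j; under eq_fun do rewrite mxE.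
by apply: smooth_atM => //; exact: smooth_at_entry.
Qed.

Lemma smooth_tr (V : normedModType R) x n1 n2 (M : V -> 'M[R]_(n1, n2)) :
  smooth_at x M -> smooth_at x (fun y => (M y)^T).
Proof.
move=> Mx; apply: smooth_at_mx => i j; under eq_fun do rewrite mxE.
exact: smooth_at_entry.
Qed.

Lemma smooth_row (V : normedModType R) x n1 n2 n3 (M : V -> 'M[R]_(n1, n2)) (L : V -> 'M[R]_(n1, n3)) :
  smooth_at x M -> smooth_at x L -> smooth_at x (fun y => row_mx (M y) (L y)).
Proof.
move=> Mx Lx; apply: smooth_at_mx => i j; case: (splitP j) => l jl.
  have -> : j = lshift n3 l by exact/val_inj.
  by under eq_fun do rewrite row_mxEl; exact: smooth_at_entry.
have -> : j = rshift n2 l by exact/val_inj.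
by under eq_fun do rewrite row_mxEr; exact: smooth_at_entry.
Qed.

Lemma smooth_sqrtV (V : normedModType R) x (f : V -> R) : 0 < f x ->
  smooth_at x f -> smooth_at x (fun y => (Num.sqrt (f y))^-1).
Proof.
move=> f0 fx; apply: smooth_atV; first by rewrite gt_eqF// sqrtr_gt0.
exact: (@smooth_at_comp1 R V [set s : R | 0 < s] (@Num.sqrt R) x f (@open_gt _ 0) f0 (@smooth_sqrt R) fx).
Qed.

Lemma smooth_vec_of (V : normedModType R) x (u : V -> 'rV[R]_(m + k)) : cross (u x) ->
  smooth_at x u -> smooth_at x (fun y => vec_of (u y)).
Proof.
move=> uX ux.
have lx : smooth_at x (fun y => (lsubmx (u y))^T).
  apply: smooth_tr; apply: smooth_at_mx => i j; under eq_fun do rewrite mxE.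
  exact: smooth_at_entry.
have rx : smooth_at x (fun y => (rsubmx (u y))^T).
  apply: smooth_tr; apply: smooth_at_mx => i j; under eq_fun do rewrite mxE.
  exact: smooth_at_entry.
rewrite /vec_of; apply: smooth_atD; apply: smooth_mulmx => //; try exact: smooth_at_cst.
apply: smooth_scale => //; apply: smooth_sqrtV; first exact/q_gt0/cross_lsub.
rewrite /qform; apply: smooth_at_entry; apply: smooth_mulmx => //; apply: smooth_mulmx.
  exact: smooth_tr.
exact: smooth_at_cst.
Qed.

Lemma smooth_rep (V : normedModType R) x (u : V -> R) :
  smooth_at x u -> smooth_at x (fun y => GLmx (A (u y))).
Proof. by move=> ux; apply: smooth_at_mx => i j; exact: smooth_rep_entry. Qed.

Lemma smooth_crossing1 (V : normedModType R) x (y : V -> 'cV[R]_N) : S1 *m y x != 0 ->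
  smooth_at x y -> smooth_at x (fun z => (crossing (y z)).1).
Proof.
move=> y0 yx; under eq_fun do rewrite crossing1E; apply: smooth_atM; first exact: smooth_at_cst.
by apply: tau_smooth => //; apply: smooth_mulmx => //; exact: smooth_at_cst.
Qed.

Lemma smooth_crossing2 (V : normedModType R) x (y : V -> 'cV[R]_N) : S1 *m y x != 0 ->
  smooth_at x y -> smooth_at x (fun z => (crossing (y z)).2).
Proof.
move=> y0 yx; have t1 := smooth_crossing1 y0 yx.
have y's : smooth_at x (fun z => A (- (crossing (y z)).1) *m y z).
  by apply: smooth_mulmx => //; apply: smooth_rep; exact: smooth_atN.
have s1 : smooth_at x (fun z => S1 *m (A (- (crossing (y z)).1) *m y z)).
  by apply: smooth_mulmx => //; exact: smooth_at_cst.
under eq_fun do rewrite crossing2E.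
apply: smooth_row; last by apply: smooth_tr; apply: smooth_mulmx => //; exact: smooth_at_cst.
apply: smooth_scale; last exact: smooth_tr.
apply: smooth_sqrtV.
  by apply: sqn_gt0; rewrite mulmxA flow_time -mulmxA; apply: (one_param_neq0 flow0 flowD).
rewrite /sqn; apply: smooth_at_sum => i; under eq_fun do rewrite expr2.
by apply: smooth_atM; exact: smooth_at_entry.
Qed.

Lemma mxsmooth_map (V : normedModType R) x n1 n2 (M : V -> 'M[R]_(n1, n2)) (h : R -> C) :
  (forall f : V -> R, smooth_at x f -> csmooth_at x (fun y => h (f y))) ->
  smooth_at x M -> mxsmooth_at x (fun y => map_mx h (M y)).
Proof.
move=> hs Mx i j; under eq_fun do rewrite mxE.
by apply: hs; exact: smooth_at_entry.
Qed.

Lemma prod_map_smooth : smooth_on (prod_atlas (PGL_atlas R (N + 1)) (vect_atlas 'rV[R]_(m + k)))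
  (projsp_atlas R (N + 1)) (range (emb A P) `*` cross) prod_map.
Proof.
apply: smooth_onI => -[g x] [/= Gg xX].
pose vx (x : 'rV[R]_(m + k)) := P *m col_mx (map_mx imC (vec_of x)) (const_mx 1 : 'M[C]_1).
have reprE g' x' : exists2 c : C, c != 0 &
    nzvec_val (repr (prod_map (g', x'))) = c *: (GLmx (repr g') *m vx x').
  exact: repr_act.
have [i ix] := exists_chart (nzvecP (repr (prod_map (g, x)))).
have [j jg] : exists j, mxvec (GLmx (repr g)) 0 j != 0.
  apply: exists_chart; apply: contraTneq ix => g0.
  by have [c _ ->] := reprE g x; rewrite g0 mul0mx scaler0 linear0 mxE eqxx.
exists (Chart ([set g : PGL R (N + 1) | mxvec (repr g) 0 j != 0] `*` setT)
   (fun p => (affine_coord j (repr p.1), p.2))).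
  exists (Chart [set g : PGL R (N + 1) | mxvec (repr g) 0 j != 0]
          (fun g => affine_coord j (repr g))); first by exists j.
  by exists (@Chart R 'rV[R]_(m + k) 'rV[R]_(m + k) setT id).
exists (Chart [set z : projsp R (N + 1) | mxvec (repr z) 0 i != 0]
          (fun z => affine_coord i (repr z))); first by exists i.
split => //=.
(* Representatives in PGL and in projective space are known only up to scalars. W is a smooth lift
   of the map to homogeneous coordinates, and the target chart forgets the scalar. *)
pose W (u : 'rV[R]_(((N + 1) * (N + 1)).-1 + ((N + 1) * (N + 1)).-1) * 'rV[R]_(m + k)) :=
  affine_mx j u.1 *m vx u.2.
pose u0 := (affine_coord j (GLmx (repr g)), x).
have Wg g' x' : mxvec (GLmx (repr g')) 0 j != 0 -> exists2 c : C, c != 0 &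
    nzvec_val (repr (prod_map (g', x'))) = c *: W (affine_coord j (repr g'), x').
  move=> jg'; have [c c0 ->] := reprE g' x'; rewrite /W/= affine_coordK// -scalemxAl.
  exists (c * mxvec (GLmx (repr g')) 0 j); first exact: mulf_neq0.
  by rewrite scalerA mulfK.
have Ws : mxsmooth_at u0 W.
  apply: mxsmooth_at_mul; first by apply: affine_mx_smooth; exact: smooth_at_fst.
  apply: mxsmooth_at_mul; first exact: mxsmooth_at_cst.
  apply: mxsmooth_at_col; last exact: mxsmooth_at_cst.
  apply: mxsmooth_map; last by apply: smooth_vec_of => //; exact: smooth_at_snd.
  by move=> f fs; split => //; exact: smooth_at_cst.
have W0 : mxvec (W u0) 0 i != 0.
  have [c c0 cE] := Wg g x jg; move: ix; rewrite cE linearZ/= mxE.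
  by rewrite mulf_eq0 negb_or => /andP[].
exists (fun u => affine_coord i (W u)); first exact: (affine_coord_smooth Ws W0).
have Wi : csmooth_at u0 (fun u => mxvec (W u) 0 i).
  case/mxvec_indexP: i {ix W0} => a b; rewrite (_ : (fun u => _) = (fun u => W u a b)).
    exact: Ws.
  by apply/funext => u; rewrite mxvecE.
have := csmooth_at_near0 Wi W0; apply: filterS => u Wu0 [g' x'] [/= Gg' xX'] [/= jg' _] uE.
have [c c0 cE] := Wg g' x' jg'; subst u; rewrite cE; split.
  by rewrite mxvecZE mulf_neq0.
by rewrite affine_coordZ.
Qed.

Lemma prod_inv_smooth : smooth_on (projsp_atlas R (N + 1))
  (prod_atlas (PGL_atlas R (N + 1)) (vect_atlas 'rV[R]_(m + k))) (Omega P S1) prod_inv.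
Proof.
apply: smooth_onI => z Oz.
have [i iz] := exists_chart (nzvecP (repr z)).
(* The group component is computed through the matrices M b t, smooth in b and t; the chosen
   representative of its class is a multiple of them. *)
pose M (b : 'cV[R]_N) t : 'M[C]_(N + 1) :=
  GLmx P *m col_mx (row_mx (map_mx (@toC R) (A t)) (map_mx (@toC R) b)) (row_mx 0 1%:M) *m invmx P.
have ME b t : GLmx (P * rho A (b, t) * P^-1)%g = M b t.
  by rewrite /= map_rho_mx.
have reprE b t : exists2 c : C, c != 0 & GLmx (repr (emb A P (b, t))) = c *: M b t.
  by have := repr_toPGL (P * rho A (b, t) * P^-1)%g; rewrite ME.
pose pz := aff (repr z).
have [j jg] : exists j, mxvec (GLmx (repr (prod_inv z).1)) 0 j != 0.
  apply: exists_chart; apply: contra_neq (oner_neq0 C) => g0.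
  have := mulmxV (GLmx_unit (repr (prod_inv z).1)); rewrite g0 mul0mx.
  by move=> /matrixP/(_ (rshift N 0) (rshift N 0)); rewrite !mxE eqxx => E; exact: esym E.
exists (Chart [set z : projsp R (N + 1) | mxvec (repr z) 0 i != 0]
          (fun z => affine_coord i (repr z))); first by exists i.
exists (Chart ([set g : PGL R (N + 1) | mxvec (repr g) 0 j != 0] `*` setT)
   (fun p => (affine_coord j (repr p.1), p.2))).
  exists (Chart [set g : PGL R (N + 1) | mxvec (repr g) 0 j != 0]
          (fun g => affine_coord j (repr g))); first by exists j.
  by exists (@Chart R 'rV[R]_(m + k) 'rV[R]_(m + k) setT id).
split => //=.
pose af (u : 'rV[R]_(((N + 1) * 1).-1 + ((N + 1) * 1).-1)) := aff (affine_mx i u).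
have afE (z' : projsp R (N + 1)) : mxvec (nzvec_val (repr z')) 0 i != 0 ->
    af (affine_coord i (repr z')) = aff (repr z').
  by move=> i0; rewrite /af affine_coordK// affZ// invr_eq0.
set u0 := affine_coord i (nzvec_val (repr z)).
have hb z' : Omega P S1 z' -> hbot P (repr z') != 0.
  apply: contraPneq => b0; apply/negP; rewrite negbK /momz (_ : mom _ _ = 0) ?mulmx0//.
  by apply/colP => l; rewrite !mxE b0 /= !mul0r subrr.
have afs : mxsmooth_at u0 af.
  have ws : mxsmooth_at u0 (affine_mx i) by apply: affine_mx_smooth; exact: smooth_at_id.
  have hb0 : hbot P (affine_mx i u0) != 0.
    by rewrite affine_coordK// hbotZ mulf_neq0// ?invr_eq0//; exact: hb.
  move=> a b; rewrite /af /aff; under eq_fun do rewrite mxE.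
    apply: csmooth_atM; last exact: mxsmooth_htop.
  by apply: csmooth_atV => //; exact: csmooth_hbot.
have Res : smooth_at u0 (fun u => map_mx Re (af u)).
  by apply: smooth_at_mx => a b; under eq_fun do rewrite mxE; have [] := afs a b.
have Ims : smooth_at u0 (fun u => map_mx Im (af u)).
  by apply: smooth_at_mx => a b; under eq_fun do rewrite mxE; have [] := afs a b.
have Im0 : S1 *m map_mx Im (af u0) != 0.
  rewrite afE//; move: (Oz); rewrite -{1}(toproj_repr z) (toproj_pt (hb z Oz)).
  by move=> /Omega_pt.
pose t u := (crossing (map_mx Im (af u))).1.
have ts : smooth_at u0 t by exact: smooth_crossing1.
have xs := smooth_crossing2 Im0 Ims.
have Ms : mxsmooth_at u0 (fun u => M (map_mx Re (af u)) (t u)).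
  apply: mxsmooth_at_mul; last exact: mxsmooth_at_cst.
  apply: mxsmooth_at_mul; first exact: mxsmooth_at_cst.
  apply: mxsmooth_at_col; last exact: mxsmooth_at_cst.
  apply: mxsmooth_at_row; apply: mxsmooth_map => //; try by move=> f; exact: csmooth_at_toC.
  exact: smooth_rep.
have M0 : mxvec (M (map_mx Re (af u0)) (t u0)) 0 j != 0.
  move: jg; rewrite prod_invE -afE//; have [c c0 ->] := reprE (map_mx Re (af u0)) (t u0).
  by rewrite mxvecZE mulf_eq0 negb_or => /andP[].
exists (fun u => (affine_coord j (M (map_mx Re (af u)) (t u)), (crossing (map_mx Im (af u))).2)).
  apply: smooth_at_pair => //.
  exact: (@affine_coord_smooth _ _ _ _ j u0 (fun u => M (map_mx Re (af u)) (t u))).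
have Mj : csmooth_at u0 (fun u => mxvec (M (map_mx Re (af u)) (t u)) 0 j).
  case/mxvec_indexP: j {jg M0} => a b; rewrite (_ : (fun u => _) = (fun u => M (map_mx Re (af u)) (t u) a b)).
    exact: Ms.
  by apply/funext => u; rewrite mxvecE.
have := csmooth_at_near0 Mj M0; apply: filterS => u Mu0 z' Oz' iz' uE.
have [c c0 cE] := reprE (map_mx Re (af u)) (t u).
have zE : prod_inv z' = (emb A P (map_mx Re (af u), t u), (crossing (map_mx Im (af u))).2).
  have ze := afE z' iz'; rewrite uE in ze.
  by rewrite prod_invE -ze.
have jE : mxvec (GLmx (repr (emb A P (map_mx Re (af u), t u)))) 0 j != 0.
  by rewrite cE mxvecZE mulf_neq0.
have cjE : affine_coord j (M (map_mx Re (af u)) (t u)) =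
    affine_coord j (GLmx (repr (emb A P (map_mx Re (af u), t u)))).
  by rewrite cE affine_coordZ.
rewrite zE uE; split; first by split; [exact: jE|].
exact: (congr1 (fun a => (a, (crossing (map_mx Im (af u))).2)) cjE).
Qed.

Lemma cross_diffeo : exists f, diffeo (vect_atlas 'rV[R]_(m + k))
  (prod_atlas (vect_atlas 'rV[R]_m) (vect_atlas 'rV[R]_k)) cross (sphere R m `*` setT) f.
Proof.
exists (fun x => (lsubmx x, rsubmx x)), (fun p => row_mx p.1 p.2); split.
- by move=> x xX; rewrite hsubmxK; split.
- by move=> [a b] [/= aS _]; rewrite row_mxKl row_mxKr /cross/= row_mxKl.
- apply: smooth_onI => x xX.
  exists (@Chart R 'rV[R]_(m + k) 'rV[R]_(m + k) setT id) => //.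
  exists (Chart (setT `*` setT) (fun x : 'rV[R]_m * 'rV[R]_k => (x.1, x.2))).
    exists (@Chart R 'rV[R]_m 'rV[R]_m setT id) => //.
    by exists (@Chart R 'rV[R]_k 'rV[R]_k setT id).
  split => //=; exists (fun x => (lsubmx x, rsubmx x)); last by near=> u.
  apply: smooth_at_pair; apply: smooth_at_mx => i j; under eq_fun do rewrite mxE;
    by apply: smooth_at_entry; exact: smooth_at_id.
apply: smooth_onI => x xX.
exists (Chart (setT `*` setT) (fun x : 'rV[R]_m * 'rV[R]_k => (x.1, x.2))).
  exists (@Chart R 'rV[R]_m 'rV[R]_m setT id) => //.
  by exists (@Chart R 'rV[R]_k 'rV[R]_k setT id).
exists (@Chart R 'rV[R]_(m + k) 'rV[R]_(m + k) setT id) => //.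
split => //=; exists (fun x => row_mx x.1 x.2); last by near=> u.
by apply: smooth_row; [exact: smooth_at_fst|exact: smooth_at_snd].
Unshelve. all: by end_near. Qed.

Lemma product_action_Omega : product_action (range (emb A P)) m (Omega P S1).
Proof.
exists (m + k)%N, k, cross; split; first exact: cross_diffeo.
exists prod_map; split; last first.
  by move=> h g x _ _ _; rewrite /prod_map/= act_mul.
exists prod_inv; split.
- by move=> [g x] [/= Gg xX]; exact: prod_mapK.
- by move=> z Oz; exact: prod_invK.
- exact: prod_map_smooth.
- exact: prod_inv_smooth.
Qed.

End ProductStructure.

(** * Topology of PGL(n) and proper actions *)

Section PGLTopology.
Variables (R : realType) (n : nat) (V W : 'M[Cx R]_n).
Local Notation C := (Cx R).
Hypotheses (Vu : V \in unitmx) (Wu : W \in unitmx).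

Lemma conjC_continuous : continuous (fun z : C => z^*).
Proof.
move=> z; apply/(@cvgrPdist_lt _ _ _ (nbhs z) (nbhs_filter z)) => e e0.
have /(@cvgrPdist_lt _ _ _ (nbhs z) (nbhs_filter z))/(_ _ e0) := @cvg_id _ (nbhs z).
by apply: filterS => w /=; rewrite -rmorphB/= norm_conjC.
Qed.

(** V and W are the identity when PGL is shown to be Hausdorff, and P^-1 and P in the study of
    proper actions, where they turn elements of G back into matrices [rho_mx]. *)
Definition conjugated (M : 'M[C]_n) := V *m M *m W.

Definition gl_ratio (a b : 'I_n * 'I_n) (M : 'M[C]_n) : C :=
  conjugated M a.1 a.2 * (conjugated M b.1 b.2)^* /
  (\sum_i \sum_j conjugated M i j * (conjugated M i j)^*).

(* These functions are well defined and continuous on PGL(n) and separate its points. *)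
Definition pgl_ratio a b (h : PGL R n) : C := gl_ratio a b (repr h).

Lemma conjugated_norm_gt0 (g : 'M[C]_n) : g != 0 ->
  0 < \sum_i \sum_j conjugated g i j * (conjugated g i j)^*.
Proof.
move=> g0; have [i [j ij0]] : exists i j, conjugated g i j != 0.
  apply: contrapT => H; case/eqP: g0.
  rewrite -[g](mulKmx Vu) -[X in _ *m X](mulmxK Wu) -/(conjugated g).
  rewrite (_ : conjugated g = 0) ?mul0mx ?mulmx0//.
  apply/matrixP => i j; rewrite [RHS]mxE; apply/eqP; apply: contrapT => /negP h.
  by apply: H; exists i, j.
have nn a b : 0 <= conjugated g a b * (conjugated g a b)^* by rewrite -normCK exprn_ge0.
rewrite (bigD1 i)//= ltr_wpDr//; first by apply: sumr_ge0 => a _; apply: sumr_ge0.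
rewrite (bigD1 j)//= ltr_wpDr//; first exact: sumr_ge0.
by rewrite -normCK exprn_gt0// normr_gt0.
Qed.

Lemma GL_neq0 (i : 'I_n) (g : GL n C) : GLmx g != 0.
Proof.
apply: contraTneq (GLmx_unit g) => ->.
by rewrite -row_free_unit /row_free mxrank0; case: (n) i => [[]|].
Qed.

Lemma gl_ratioZ a b c M : c != 0 -> gl_ratio a b (c *: M) = gl_ratio a b M.
Proof.
move=> c0; have cE i j : conjugated (c *: M) i j = c * conjugated M i j.
  by rewrite /conjugated -scalemxAr -scalemxAl mxE.
have c2 : c * c^* != 0 by rewrite mulf_neq0// conjC_eq0.
rewrite /gl_ratio !cE rmorphM/=.
under eq_bigr => i _ do under eq_bigr => j _ do rewrite cE rmorphM mulrACA.
under eq_bigr => i _ do rewrite -mulr_sumr.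
by rewrite -mulr_sumr mulrACA -mulf_div divff// mul1r.
Qed.

Lemma pgl_ratioE a b g : pgl_ratio a b (toPGL g) = gl_ratio a b g.
Proof. by have [c c0 E] := repr_toPGL g; rewrite /pgl_ratio E gl_ratioZ. Qed.

Lemma pgl_ratio_continuous a b : continuous (pgl_ratio a b).
Proof.
have i : 'I_n by exact: a.1.
suff H : continuous (fun g : GL n C => gl_ratio a b g).
  have E : pgl_ratio a b \o @toPGL R n = (fun g : GL n C => gl_ratio a b g).
    by apply/funext => g; exact: pgl_ratioE.
  by apply: (quotient_continuous (pgl_ratio a b)).2; move: H; rewrite -E.
move=> g.
have gc : (fun g : GL n C => conjugated g) @ g --> conjugated g.
  apply: (cvg_mulmx (nbhs_filter g)); last exact: cvg_cst.
  apply: (cvg_mulmx (nbhs_filter g)); first exact: cvg_cst.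
  exact: (@initial_continuous _ _ (@GLmx n C)).
have ec k l : (fun g : GL n C => conjugated g k l) @ g --> conjugated g k l.
  exact: (@cvg_entry C _ (nbhs g) n n (fun g : GL n C => conjugated g) _ k l gc).
have cc k l : (fun g : GL n C => (conjugated g k l)^*) @ g --> (conjugated g k l)^*.
  by apply: (cvg_comp _ _ (ec k l)); exact: conjC_continuous.
have sc : (fun g : GL n C => \sum_k \sum_l conjugated g k l * (conjugated g k l)^*) @ g -->
    \sum_k \sum_l conjugated g k l * (conjugated g k l)^*.
  apply: (@cvg_sumr C C^o _ _ _ (nbhs g)) => k; apply: (@cvg_sumr C C^o _ _ _ (nbhs g)) => l.
  exact: (cvgM (ec k l) (cc k l)).
have s0 : \sum_k \sum_l conjugated g k l * (conjugated g k l)^* != 0.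
  by rewrite gt_eqF// conjugated_norm_gt0// (GL_neq0 i).
exact: (cvgM (cvgM (ec _ _) (cc _ _)) (cvgV s0 sc)).
Qed.

(** With the second factor frozen at a nonzero entry (k, l) of X, the products form a nonzero
    multiple of X on one side and of Y on the other. *)
Lemma proportional_of_products (X Y : 'M[C]_n) (x y : C) : x != 0 -> y != 0 -> X != 0 ->
  (forall a b a' b', X a b * (X a' b')^* / x = Y a b * (Y a' b')^* / y) ->
  exists2 c : C, c != 0 & Y = c *: X.
Proof.
move=> x0 y0 X0 E; have [k [l kl0]] : exists k l, X k l != 0.
  apply: contrapT => H; case/eqP: X0; apply/matrixP => a b; rewrite [RHS]mxE.
  by apply/eqP; apply: contrapT => /negP h; apply: H; exists a, b.
have kl0' : Y k l != 0.
  apply: contraNneq kl0 => z; have /eqP := E k l k l; rewrite z !mul0r.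
  by rewrite mulf_eq0 invr_eq0 (negbTE x0) orbF -normCK expf_eq0/= normr_eq0.
have dY0 : (Y k l)^* / y != 0 by rewrite mulf_neq0// ?invr_eq0 ?conjC_eq0.
have dX0 : (X k l)^* / x != 0 by rewrite mulf_neq0// ?invr_eq0 ?conjC_eq0.
exists ((X k l)^* / x / ((Y k l)^* / y)).
  by rewrite mulf_neq0// invr_eq0.
apply/matrixP => a b; rewrite [RHS]mxE; apply: (mulIf dY0).
by rewrite [RHS]mulrAC divfK// mulrA -E [RHS]mulrC mulrA.
Qed.

Lemma PGL_hausdorff : hausdorff_space (PGL R n).
Proof.
move=> p q pq.
have E a b : pgl_ratio a b p = pgl_ratio a b q.
  apply: (@norm_hausdorff C C) => B D Bp Dq.
  have [z [Bz Dz]] := pq _ _ (pgl_ratio_continuous Bp) (pgl_ratio_continuous Dq).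
  by exists (pgl_ratio a b z).
rewrite -(toPGL_repr p) -(toPGL_repr q); apply/eqP/toPGLP.
case: (pickP (fun _ : 'I_n => true)) => [i _|e0]; last first.
  exists 1; rewrite ?oner_eq0//; apply/matrixP => i.
  by have := e0 i.
have n0 (h : PGL R n) := conjugated_norm_gt0 (GL_neq0 i (repr h)).
have [|||c c0 cE] := @proportional_of_products (conjugated (repr p)) (conjugated (repr q)) _ _ _ _ _
   (fun a b a' b' => E (a, b) (a', b')).
- by rewrite gt_eqF//; exact: n0.
- by rewrite gt_eqF//; exact: n0.
- apply: contra_ltN (n0 p) => /eqP ->.
  by rewrite big1// => a _; rewrite big1// => b _; rewrite mxE mul0r.
exists c => //.
have := congr1 (fun M => invmx V *m M *m invmx W) cE.
rewrite -scalemxAr -scalemxAl /conjugated -!(mulmxA V) !(mulKmx Vu) !(mulmxK Wu).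
by [].
Qed.

End PGLTopology.

Section ProperActions.
Variables (R : realType) (N : nat) (A : R -> GL N R) (P : GL (N + 1) (Cx R)).
Hypothesis repA : is_representation A.
Hypothesis A_inj : injective A.
Local Notation C := (Cx R).
Local Notation Re := (@complex.Re R).
Local Notation Im := (@complex.Im R).
Implicit Types (x y : 'cV[R]_N * R).

Let last : 'I_(N + 1) := rshift N 0.
Let iP : invmx (GLmx P) \in unitmx. Proof. by rewrite unitmx_inv GLmx_unit. Qed.
Let rat i j : PGL R (N + 1) -> C := pgl_ratio (invmx P) P (i, j) (last, last).

Lemma conj_emb x :
  conjugated (invmx P) P (P * rho A x * P^-1)%g = map_mx (@toC R) (rho_mx A x).
Proof.
by rewrite /conjugated /= -!mulmxA mulVmx ?GLmx_unit// mulmx1 mulKmx ?GLmx_unit.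
Qed.

Lemma rho_last x : map_mx (@toC R) (rho_mx A x) last last = 1.
Proof. by rewrite [LHS]mxE /rho_mx block_mxEdr mxE eqxx. Qed.

Lemma ratio_emb i j x : rat i j (emb A P x) =
  toC (rho_mx A x i j) * rat last last (emb A P x).
Proof.
rewrite /rat /emb !pgl_ratioE /gl_ratio conj_emb [(i, j).1]/= [(i, j).2]/= [(last, last).1]/= [(last, last).2]/=.
by rewrite !rho_last conjC1 !mulr1 mul1r [X in X / _]mxE.
Qed.

Lemma rat_neq0 x : rat last last (emb A P x) != 0.
Proof.
rewrite /rat /emb pgl_ratioE /gl_ratio [(last, last).1]/= [(last, last).2]/=.
rewrite {1 2}conj_emb rho_last conjC1 mulr1 mul1r invr_eq0 gt_eqF//.
by apply: conjugated_norm_gt0; [exact: iP|exact: GLmx_unit|exact: (GL_neq0 last)].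
Qed.

(** The corner entry of [rho_mx] is 1, so every entry is the quotient of two ratios that are
    continuous on PGL. This is how convergence in G controls translations and linear parts. *)
Lemma emb_cvg_rho (T : Type) (F : set_system T) (FF : Filter F) (u : T -> 'cV[R]_N * R) y :
  (fun k => emb A P (u k)) @ F --> emb A P y ->
  (fun k => rho_mx A (u k)) @ F --> rho_mx A y.
Proof.
move=> ue; apply: cvg_mx => i j.
have rc a b : (fun k => rat a b (emb A P (u k))) @ F --> rat a b (emb A P y).
  by apply: (cvg_comp _ _ ue); apply: pgl_ratio_continuous; [exact: iP|exact: GLmx_unit].
have E x : rho_mx A x i j = Re (rat i j (emb A P x) / rat last last (emb A P x)).
  by rewrite ratio_emb mulfK// rat_neq0.
under eq_fun do rewrite E; rewrite E.
have : (fun k => rat i j (emb A P (u k)) / rat last last (emb A P (u k))) @ F -->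
    rat i j (emb A P y) / rat last last (emb A P y).
  by apply: cvgM; [exact: rc|apply: cvgV; [exact: rat_neq0|exact: rc]].
by move=> H; apply: (cvg_comp _ _ H); exact: Re_continuous.
Qed.

Lemma emb_cvg_fst (T : Type) (F : set_system T) (FF : Filter F) (u : T -> 'cV[R]_N * R) y :
  (fun k => emb A P (u k)) @ F --> emb A P y -> (fun k => (u k).1) @ F --> y.1.
Proof.
move=> /emb_cvg_rho H; apply: cvg_mx => i j.
have E x : x.1 i j = rho_mx A x (lshift 1 i) (rshift N j) by rewrite block_mxEur.
by under eq_fun do rewrite E; rewrite E; apply: cvg_entry; exact: H.
Qed.

Lemma emb_cvg_A (T : Type) (F : set_system T) (FF : Filter F) (u : T -> 'cV[R]_N * R) y :
  (fun k => emb A P (u k)) @ F --> emb A P y ->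
  (fun k => GLmx (A (u k).2)) @ F --> GLmx (A y.2).
Proof.
move=> /emb_cvg_rho H; apply: cvg_mx => i j.
have E x : A x.2 i j = rho_mx A x (lshift 1 i) (lshift 1 j) by rewrite block_mxEul.
by under eq_fun do rewrite E; rewrite E; apply: cvg_entry; exact: H.
Qed.

Variables (m k : nat) (S1 : 'M[R]_(m, N)) (T1 : 'M[R]_(N, m)) (S2 : 'M[R]_(k, N)) (T2 : 'M[R]_(N, k)).
Hypothesis TS : T1 *m S1 + T2 *m S2 = 1%:M.
Hypothesis S1A : forall t, S1 *m A t = S1 *m A t *m T1 *m S1.
Hypothesis S2A : forall t, S2 *m A t = S2 *m A t *m T2 *m S2.
Hypothesis dec1 : forall i j, (fun l : nat => (S1 *m A l%:R) i j) @ \oo --> (0 : R).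
Hypothesis dec2 : forall i j, (fun l : nat => (S2 *m A (- l%:R)) i j) @ \oo --> (0 : R).
Hypothesis N_gt0 : (0 < N)%N.

Lemma mx_cvg_unique p q (u : nat -> 'M[R]_(p, q)) (l l' : 'M[R]_(p, q)) :
  u @ \oo --> l -> u @ \oo --> l' -> l = l'.
Proof.
exact: (@cvg_unique _ (@norm_hausdorff R _)).
Qed.

(** If A (u l) tends to the invertible A s, then X A (u l) -> 0 forces X A s = 0, and Y = Y A (- u
    l) A (u l) tends to 0. *)
Lemma flow_not_cvg p q (X : 'M[R]_(p, N)) (Y : 'M[R]_(q, N)) (u : nat -> R) s :
  (fun l => X *m A (u l)) @ \oo --> (0 : 'M[R]_(p, N)) ->
  (fun l => Y *m A (- u l)) @ \oo --> (0 : 'M[R]_(q, N)) ->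
  (fun l => GLmx (A (u l))) @ \oo --> GLmx (A s) -> X = 0 /\ Y = 0.
Proof.
move=> u1 u2 us; split.
  rewrite -[X]mulmx1 -(repN repA s) mulmxA; set B := X *m A s.
  rewrite (_ : B = 0) ?mul0mx//; apply: mx_cvg_unique u1.
  by apply: cvg_mulmx => //; exact: cvg_cst.
rewrite -(mul0mx _ (GLmx (A s))); apply: (@mx_cvg_unique _ _ (fun=> Y)); first exact: cvg_cst.
have -> : (fun=> Y) = fun l => Y *m A (- u l) *m A (u l).
  by apply/funext => l; rewrite -mulmxA repNl// mulmx1.
exact: cvg_mulmx.
Qed.

Lemma splitting_neq0 : S1 = 0 -> S2 = 0 -> False.
Proof.
move=> S10 S20; have := TS; rewrite S10 S20 !mulmx0 addr0.
move=> /matrixP/(_ (Ordinal N_gt0) (Ordinal N_gt0)).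
by rewrite !mxE eqxx => /esym/eqP; rewrite oner_eq0.
Qed.

Lemma incr_ge (phi : nat -> nat) : {homo phi : i j / (i < j)%N} -> forall i, (i <= phi i)%N.
Proof. by move=> H; elim=> // i IH; exact: leq_ltn_trans (H _ _ (ltnSn i)). Qed.

Lemma cvg_subseq (T : topologicalType) (u : nat -> T) (l : T) (phi : nat -> nat) c :
  {homo phi : i j / (i < j)%N} -> u @ \oo --> l -> (fun i => u (phi i + c)%N) @ \oo --> l.
Proof.
move=> H ul B /ul [n _ nB]; exists n => // i ni; apply: nB => /=.
by rewrite (leq_trans ni)// (leq_trans (incr_ge H i))// leq_addr.
Qed.

(** Diverging times exclude convergence whatever the translations are. The shift c serves sequences
    whose first terms have been dropped. *)
Lemma emb_not_cvg (b : nat -> 'cV[R]_N) (phi : nat -> nat) c y :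
  {homo phi : i j / (i < j)%N} ->
  ~ (fun i => emb A P (b i, (phi i + c)%:R)) @ \oo --> emb A P y /\
  ~ (fun i => emb A P (b i, - (phi i + c)%:R)) @ \oo --> emb A P y.
Proof.
move=> Hphi; pose u := fun i => (phi i + c)%:R : R.
have d1 : (fun i => S1 *m A (u i)) @ \oo --> (0 : 'M[R]_(m, N)).
  by apply: (@cvg_subseq _ (fun i => S1 *m A i%:R) _ _ c Hphi); apply: cvg_mx => i j; rewrite mxE; exact: dec1.
have d2 : (fun i => S2 *m A (- u i)) @ \oo --> (0 : 'M[R]_(k, N)).
  apply: (@cvg_subseq _ (fun i => S2 *m A (- i%:R)) _ _ c Hphi); apply: cvg_mx => i j.
  by rewrite mxE; exact: dec2.
split=> /emb_cvg_A /= H.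
  by have [] := flow_not_cvg d1 d2 H; exact: splitting_neq0.
have d3 : (fun i => S1 *m A (- - u i)) @ \oo --> (0 : 'M[R]_(m, N)).
  by under eq_fun do rewrite opprK.
by have [? ?] := flow_not_cvg d2 d3 H; exact: splitting_neq0.
Qed.

Section Region.
Variable O : set (projsp R (N + 1)).
Hypotheses (openO : open O) (invO : is_invariant (range (emb A P)) O).
Hypothesis propO : proper_action (range (emb A P)) O.

Lemma proper_real_point z : O z -> momz P z != 0.
Proof.
move=> Oz; apply/negP => /eqP z0.
have [b0|[x zE]] := momz_eq0 z0.
  (* A point at infinity is fixed by all translations. Along a convergent subsequence the integers
     phi l would converge, although they grow by at least 1 at each step. *)
  pose g l : PGL R (N + 1) := emb A P (l%:R *: const_mx 1, 0).
  have gz l : act (g l) z = z by exact: emb_translation_fix.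
  have [phi [h [Hphi [y _ <-] gh]]] : exists (phi : nat -> nat) (h : PGL R (N + 1)),
      [/\ {homo phi : i j / (i < j)%N}, range (emb A P) h & (g \o phi) @ \oo --> h].
    apply: (propO (g := g) (z := fun=> z) (a := z) (b := z)) => //.
    - exact: cvg_cst.
    - by under eq_fun do rewrite gz; exact: cvg_cst.
  have i : 'I_N by exact: Ordinal N_gt0.
  have /cvgrPdist_lt : (fun l => (phi l)%:R : R) @ \oo --> y.1 i 0.
    pose u l : 'cV[R]_N * R := ((phi l)%:R *: const_mx 1, 0).
    have guh : (fun l => emb A P (u l)) @ \oo --> emb A P y by exact: gh.
    have -> : (fun l => (phi l)%:R : R) = fun l => (u l).1 i 0.
      by apply/funext => l; rewrite /u/= !mxE mulr1.
    exact: (@cvg_entry R _ _ _ _ _ _ i 0 (emb_cvg_fst _ guh)).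
  have h2 : 0 < 2^-1 :> R by rewrite invr_gt0 ltr0n.
  move=> /(_ _ h2) [n _ nB].
  have B1 := nB n (leqnn n); have B2 := nB n.+1 (leqnSn n); rewrite /= in B1 B2.
  have : 1 <= (phi n.+1)%:R - (phi n)%:R :> R.
    by rewrite lerBrDr nat1r ler_nat Hphi.
  by move: B1 B2; rewrite !ltr_norml => /andP[? ?] /andP[? ?]; lra.
(* The translation part x - A l x is the one for which the element of time l fixes the real point
   x. *)
pose g (l : nat) : PGL R (N + 1) := emb A P (x - A l%:R *m x, l%:R).
have gz l : act (g l) z = z.
  rewrite zE /g act_pt/=; congr pt; rewrite -!map_mxM -!map_mxD.
  by rewrite addrC subrK.
have [phi [h [Hphi [y _ <-] gh]]] : exists (phi : nat -> nat) (h : PGL R (N + 1)),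
    [/\ {homo phi : i j / (i < j)%N}, range (emb A P) h & (g \o phi) @ \oo --> h].
  apply: (propO (g := g) (z := fun=> z) (a := z) (b := z)) => //.
  - exact: cvg_cst.
  - by under eq_fun do rewrite gz; exact: cvg_cst.
have [+ _] := @emb_not_cvg (fun i => x - A (phi i)%:R *m x) phi 0 y Hphi; apply.
by under eq_fun do rewrite addn0.
Qed.

Let I : C := (0 +i* 1)%C.
Let cplx (a b : 'cV[R]_N) : 'cV[C]_N := map_mx (@toC R) a + I *: map_mx (@toC R) b.

Let cplxE (p : 'cV[C]_N) : p = cplx (map_mx Re p) (map_mx Im p).
Proof.
apply/colP => i; rewrite !mxE; case: (p i 0) => a b; apply: complexP => /=; ring.
Qed.

Let act_cplx t b c a : act (emb A P (a, t)) (pt P (cplx b c)) = pt P (cplx (A t *m b + a) (A t *m c)).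
Proof.
have mD (u v : 'cV[R]_N) : map_mx (@toC R) (u + v) = map_mx (@toC R) u + map_mx (@toC R) v.
  by apply/matrixP => i j; rewrite !mxE /toC rmorphD.
by rewrite act_pt; congr pt; rewrite /cplx mulmxDr -scalemxAr -!map_mxM/= mD [RHS]addrAC.
Qed.

Let cvg_pt_cplx (u : nat -> 'cV[R]_N) a b : u @ \oo --> b ->
  (fun l => pt P (cplx a (u l))) @ \oo --> pt P (cplx a b).
Proof.
move=> ub; apply: cvg_toproj; apply: cvg_mulmx; first exact: cvg_cst.
apply: cvg_col_mx; last exact: cvg_cst.
apply: cvgD; first exact: cvg_cst.
by apply: cvgZr; exact: cvg_map_toC.
Qed.

Let stable_cvg0 p q (X : 'M[R]_(p, N)) (X' : 'M[R]_(N, p)) (Y : 'M[R]_(q, N)) (Y' : 'M[R]_(N, q))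
    (eps : R) (v : 'cV[R]_N) :
  X' *m X + Y' *m Y = 1%:M -> (forall t, Y *m A t = Y *m A t *m Y' *m Y) ->
  (forall i j, (fun l : nat => (X *m A (eps * l%:R)) i j) @ \oo --> (0 : R)) ->
  Y *m v = 0 -> (fun l : nat => A (eps * l%:R) *m v) @ \oo --> (0 : 'cV[R]_N).
Proof.
move=> XY YA dX Yv.
have -> : (fun l : nat => A (eps * l%:R) *m v) = fun l => X' *m (X *m A (eps * l%:R)) *m v.
  apply/funext => l; rewrite -[LHS]mul1mx -XY mulmxDl -!mulmxA [X in _ + _ *m X]mulmxA YA.
  by rewrite -(mulmxA _ Y) Yv !mulmx0 addr0.
rewrite -(mul0mx _ v) -(mulmx0 _ X').
apply: cvg_mulmx; last exact: cvg_cst.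
apply: cvg_mulmx; first exact: cvg_cst.
by apply: cvg_mx => i j; rewrite mxE; exact: dX.
Qed.

Lemma proper_dichotomy : O `<=` Omega P S1 \/ O `<=` Omega P S2.
Proof.
apply: contrapT => /not_orP[/existsNP[z /not_implyP[Oz z1]] /existsNP[z' /not_implyP[Oz' z2]]].
have {z1} z1 : S1 *m momz P z = 0 by apply/eqP; apply: contrapT => /negP.
have {z2} z2 : S2 *m momz P z' = 0 by apply/eqP; apply: contrapT => /negP.
have [p zp] := momz_neq0_pt (proper_real_point Oz).
have [p' zp'] := momz_neq0_pt (proper_real_point Oz').
have mom0 a (S : 'M[R]_(a, N)) q : S *m momz P (pt P q) = 0 -> S *m map_mx Im q = 0.
  have [c c0 ->] := momz_pt P q; rewrite -scalemxAr => /eqP.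
  by rewrite scaler_eq0 gt_eqF//= => /eqP.
rewrite zp in z1; rewrite zp' in z2.
move: z1 z2 => /mom0 z1 /mom0 z2.
set x := map_mx Re p; set x' := map_mx Re p'.
set y := map_mx Im p in z1; set y' := map_mx Im p' in z2.
have {zp} zE : z = pt P (cplx x y) by rewrite zp (cplxE p).
have {zp'} zE' : z' = pt P (cplx x' y') by rewrite zp' (cplxE p').
have TS' : T2 *m S2 + T1 *m S1 = 1%:M by rewrite addrC.
have c1 : (fun l : nat => A l%:R *m y') @ \oo --> (0 : 'cV[R]_N).
  rewrite (_ : (fun l => _) = fun l => A (1 * l%:R) *m y'); last by apply/funext => l; rewrite mul1r.
  by apply: stable_cvg0 TS S2A _ z2 => i j; under eq_fun do rewrite mul1r; exact: dec1.
have c2 : (fun l : nat => A (- l%:R) *m y) @ \oo --> (0 : 'cV[R]_N).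
  rewrite (_ : (fun l => _) = fun l => A (- 1 * l%:R) *m y); last by apply/funext => l; rewrite mulN1r.
  by apply: stable_cvg0 TS' S1A _ z1 => i j; under eq_fun do rewrite mulN1r; exact: dec2.
pose zs l := pt P (cplx x (y + A l%:R *m y')).
(* The translation part carries the real part x exactly to x', so only the imaginary parts have to
   converge. *)
pose g (l : nat) := emb A P (x' - A (- l%:R) *m x, - l%:R).
have zc : zs @ \oo --> z.
  rewrite zE; apply: cvg_pt_cplx; rewrite -[X in _ --> X]addr0.
  by apply: cvgD => //; exact: cvg_cst.
have gzE l : act (g l) (zs l) = pt P (cplx x' (A (- l%:R) *m y + y')).
  rewrite /g /zs act_cplx addrC subrK; congr (pt _ (cplx _ _)).
  by rewrite mulmxDr mulmxA repNl// mul1mx.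
have gc : (fun l => act (g l) (zs l)) @ \oo --> z'.
  rewrite zE'; under eq_fun do rewrite gzE.
  apply: cvg_pt_cplx; rewrite -[X in _ --> X]add0r.
  by apply: cvgD => //; exact: cvg_cst.
(* Only the tail of [zs] is known to lie in O, hence the shift by K. *)
have [K _ OK] : \forall l \near \oo, O (zs l).
  by apply: zc; exact: open_nbhs_nbhs.
have sh (T : topologicalType) (u : nat -> T) (a : T) : u @ \oo --> a -> (fun i => u (i + K)%N) @ \oo --> a.
  by move=> ua; apply: (@cvg_subseq _ u a id K).
have H0 l : range (emb A P) (g (l + K)%N) by exists (x' - A (- (l + K)%:R) *m x, - (l + K)%:R).
have H1 l : O (zs (l + K)%N) by apply: OK => /=; rewrite leq_addl.
have [phi [h [Hphi [w _ <-] gh]]] : exists (phi : nat -> nat) (h : PGL R (N + 1)),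
    [/\ {homo phi : i j / (i < j)%N}, range (emb A P) h & ((fun i => g (i + K)%N) \o phi) @ \oo --> h].
  exact: (propO H0 H1 Oz Oz' (sh _ _ _ zc) (sh _ (fun l => act (g l) (zs l)) _ gc)).
have [_ ] := @emb_not_cvg (fun i => x' - A (- (phi i + K)%:R) *m x) phi K w Hphi; apply.
exact: gh.
Qed.

End Region.

End ProperActions.

(** * Dyadic cells and translation-invariant measures *)

Local Notation Brl T := (g_sigma_algebraType (@open T)).

Section Borel.
Variables (T U : ptopologicalType).

Lemma open_borel (B : set (Brl T)) : @open T B -> measurable B.
Proof. by move=> oB; exact: sub_sigma_algebra. Qed.

Lemma closed_borel (B : set (Brl T)) : @closed T B -> measurable B.
Proof. by move=> cB; rewrite -[B]setCK; apply: measurableC; apply: open_borel; exact: closed_openC. Qed.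

Lemma continuous_borel (f : T -> U) (B : set (Brl U)) : continuous f ->
  measurable B -> measurable (f @^-1` B : set (Brl T)).
Proof.
move=> cf; pose M : set (set U) := [set C | measurable (f @^-1` C : set (Brl T))].
suff : <<s @open U >> `<=` M by apply.
apply: smallest_sub; last by move=> C oC; apply: open_borel; apply: open_comp => // x _; exact: cf.
split; first by rewrite /M/= preimage_set0; exact: measurable0.
- by move=> C MC; rewrite /M/= setTD preimage_setC; exact: measurableC.
- by move=> F MF; rewrite /M/= preimage_bigcup; exact: bigcupT_measurable.
Qed.

End Borel.

Lemma measure_bigcupT d (T : measurableType d) (R : realType) (mu : {measure set T -> \bar R})
    (F : nat -> set T) : (forall n, measurable (F n)) -> trivIset setT F ->
  mu (\bigcup_n F n) = (\sum_(0 <= n <oo) mu (F n))%E.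
Proof.
move=> mF tF; rewrite measure_bigcup//; apply: eq_eseriesl => n.
by rewrite in_setT.
Qed.

Lemma measure_finite_union d (T : measurableType d) (R : realType) (mu : {measure set T -> \bar R})
    (I : finType) (F : I -> set T) c : (forall i, measurable (F i)) ->
  (forall i, mu (F i) = c) -> trivIset setT F ->
  mu (\bigcup_(i in [set: I]) F i) = (#|I|%:R%:E * c)%E.
Proof.
move=> mF Fc tF; rewrite measure_fin_bigcup//.
rewrite (eq_fsbigr (fun=> c)); last by move=> i _; exact: Fc.
rewrite (@fsbigE _ _ _ _ _ (index_enum I))//; first last.
- by move=> i _; rewrite mem_index_enum.
- exact: index_enum_uniq.
rewrite mule_natl; under eq_bigl do rewrite in_setT.
rewrite big_const_seq count_predT -[index_enum I]enumT -cardE; move: #|I| => n.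
by elim: n => [|n IH]; [rewrite mule0n|rewrite iterS IH; exact/esym/muleS].
exact: finite_finset.
Qed.

(* Each point of B is moved into D by some j in H, and the pieces of B so obtained have disjoint images. *)
Lemma packing d (T : measurableType d) (R : realType) (mu : {measure set T -> \bar R})
    (J : Type) (H : set J) (a b : J -> T -> T) (B D : set T) :
  countable H -> (forall j, cancel (a j) (b j)) -> (forall j, cancel (b j) (a j)) ->
  (forall j (M : set T), measurable M -> measurable (a j @^-1` M)) ->
  (forall j (M : set T), measurable M -> measurable (b j @^-1` M)) ->
  (forall j (M : set T), H j -> measurable M -> mu (b j @^-1` M) = mu M) ->
  measurable B -> measurable D ->
  (forall x, B x -> exists2 j, H j & D (a j x)) ->
  (forall j j' x x', H j -> H j' -> B x -> B x' -> a j x = a j' x' -> j = j') ->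
  (mu B <= mu D)%E.
Proof.
move=> /countable_injP[f finj] ab ba am bm amu mB mD BD Bfree.
have F_eq n : (exists j, H j /\ f j = n) \/ ~ (exists j, H j /\ f j = n) by exact: EM.
pose F n := [set x | B x /\ exists j, [/\ H j, f j = n & D (a j x)]].
pose G n := [set y | D y /\ exists j, [/\ H j, f j = n & B (b j y)]].
have FGE n : [/\ measurable (F n), measurable (G n) & mu (F n) = mu (G n)].
  have [[j [Hj fj]]|no] := F_eq n; last first.
    have -> : F n = set0 by apply/seteqP; split => // x [_ [j [? ? _]]]; apply: no; exists j.
    have -> : G n = set0 by apply/seteqP; split => // x [_ [j [? ? _]]]; apply: no; exists j.
    by split => //; exact: measurable0.
  have uniq j' : H j' -> f j' = n -> j' = j.
    by move=> Hj' fj'; apply: finj; rewrite ?inE// fj fj'.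
  have FE : F n = B `&` a j @^-1` D.
    apply/seteqP; split=> x [Bx]; first by move=> [j' [Hj' fj' Dj]]; rewrite -(uniq j').
    by move=> Dx; split => //; exists j.
  have GE : G n = b j @^-1` F n.
    rewrite FE; apply/seteqP; split=> y; first by move=> [Dy [j' [Hj' fj' Bj]]]; rewrite -(uniq j')//; split => //=; rewrite ba.
    by move=> [By /=]; rewrite ba => Dy; split => //; exists j.
  have mF : measurable (F n) by rewrite FE; apply: measurableI => //; exact: am.
  by split => //; rewrite GE; [exact: bm|rewrite amu].
have tG : trivIset setT G.
  move=> n n' _ _ [y [[Dy [j [Hj fj Bj]]] [_ [j' [Hj' fj' Bj']]]]].
  rewrite -fj -fj'; congr f; apply: (Bfree j j' (b j y) (b j' y)) => //.
  by rewrite !ba.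
apply: (@le_trans _ _ (\sum_(0 <= n <oo) mu (F n))%E).
  apply: measure_sigma_subadditive => //; first by move=> n; have [] := FGE n.
  by move=> x Bx; have [j Hj Dj] := BD _ Bx; exists (f j) => //; split => //; exists j.
rewrite (@eq_eseriesr _ _ (fun n => mu (G n))); last by move=> n _; have [] := FGE n.
rewrite -measure_bigcupT//; last by move=> n; have [] := FGE n.
apply: le_measure; rewrite ?inE//.
  by apply: bigcup_measurable => n _; have [] := FGE n.
by move=> y [n _ []].
Qed.

Section Cells.
Variables (R : realType) (N : nat).
Local Notation V := 'cV[R]_N.
Implicit Types (x y u : V) (k : nat) (z : 'cV[int]_N).

(** Half-open dyadic cubes of side 2^-k: a countable family, any two members of which are disjoint
    or nested, that generates the Borel sets. *)
Definition cell_index k x : 'cV[int]_N := \col_i Num.floor (2 ^+ k * x i 0).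
Definition cell k z : set V := [set x | cell_index k x = z].

Let pow_gt0 k : 0 < 2 ^+ k :> R. Proof. by rewrite exprn_gt0. Qed.

Lemma cellP k z x :
  cell k z x <-> forall i, (z i 0)%:~R <= 2 ^+ k * x i 0 < (z i 0 + 1)%:~R.
Proof.
split=> [<- i|H]; first by rewrite mxE -floor_eq.
by apply/colP => i; rewrite mxE; apply/eqP; rewrite floor_eq.
Qed.

Lemma cell_measurable k z : measurable (cell k z : set (Brl V)).
Proof.
have -> : cell k z = \bigcap_(i in [set: 'I_N]) [set x : V | (z i 0)%:~R <= 2 ^+ k * x i 0 < (z i 0 + 1)%:~R].
  by apply/seteqP; split => x; rewrite cellP => H i; [move=> _|]; exact: H.
apply: (@fin_bigcap_measurable _ (Brl V)); first exact: finite_finset.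
move=> i _; have ci : continuous (fun x : V => 2 ^+ k * x i 0).
  by move=> x; apply: (@cvgMl_tmp _ _ (nbhs x)); exact: coord_continuous.
rewrite (_ : [set x | _] = (fun x : V => 2 ^+ k * x i 0) @^-1` [set r | (z i 0)%:~R <= r] `&`
    (fun x : V => 2 ^+ k * x i 0) @^-1` [set r | r < (z i 0 + 1)%:~R]); last first.
  by apply/seteqP; split => x /=; [move=> /andP|move=> [-> ->]].
apply: (@measurableI _ (Brl V)).
  apply: closed_borel; apply: closed_comp; first by move=> x _; exact: ci.
  exact: closed_ge.
by apply: open_borel; apply: open_comp; [move=> x _; exact: ci|exact: open_lt].
Qed.

Lemma same_cell_dist k x y i : cell_index k x = cell_index k y ->
  `|x i 0 - y i 0| < (2 ^+ k)^-1.
Proof.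
move=> xy; have /cellP/(_ i) /andP[x1 x2] : cell k (cell_index k y) x by [].
have /cellP/(_ i) /andP[y1 y2] : cell k (cell_index k y) y by [].
rewrite -(ltr_pM2l (pow_gt0 k)) divff ?gt_eqF// -[X in X * `|_|]gtr0_norm// -normrM.
rewrite mulrBr ltr_norml; move: x1 x2 y1 y2; rewrite intrD.
set a := 2 ^+ k * x i 0; set b := 2 ^+ k * y i 0; set c := _%:~R; move=> *.
by apply/andP; split; lra.
Qed.

Lemma exists_pow2 (e : R) : 0 < e -> exists k, (2 ^+ k)^-1 < e.
Proof.
move=> e0; have h2 : `|2^-1 : R| < 1 by rewrite ger0_norm ?invr_ge0// invf_lt1 ?ltr1n.
have /cvgrPdist_lt/(_ _ e0)[n _ /(_ n (leqnn n)) /=] := cvg_expr h2.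
by rewrite sub0r normrN ger0_norm ?exprn_ge0 ?invr_ge0// exprVn; exists n.
Qed.

Lemma open_cell (U : set V) x : open U -> U x ->
  exists k, cell k (cell_index k x) `<=` U.
Proof.
move=> oU Ux; have /nbhs_ballP[e /= e0 eU] : nbhs x U by exact: open_nbhs_nbhs.
have [k ke] := exists_pow2 e0.
exists k => y yx; apply: eU; split => // i j; rewrite !ord1.
by apply: lt_trans ke; exact: same_cell_dist.
Qed.

Lemma cell_index_le k l x y : (k <= l)%N -> cell_index l x = cell_index l y ->
  cell_index k x = cell_index k y.
Proof.
move=> kl E; have H x' y' i : cell_index l x' = cell_index l y' ->
    Num.floor (2 ^+ k * x' i 0) <= Num.floor (2 ^+ k * y' i 0).
  move=> /colP/(_ i); rewrite !mxE => {}E; rewrite floor_ge_int.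
  set c := Num.floor _; have lk : 2 ^+ l = 2 ^+ (l - k) * 2 ^+ k :> R by rewrite -exprD subnK.
  have : c%:~R <= 2 ^+ k * x' i 0 by rewrite -floor_ge_int.
  rewrite -(ler_pM2l (pow_gt0 (l - k))) mulrA -lk -[2 ^+ (l - k) in X in X -> _]/(2 ^+ (l - k)).
  have -> : 2 ^+ (l - k) * c%:~R = (2 ^+ (l - k) * c)%:~R :> R by rewrite intrM rmorphXn.
  move=> cx; have : 2 ^+ (l - k) * c <= Num.floor (2 ^+ l * y' i 0) by rewrite -E floor_ge_int.
  by rewrite floor_ge_int lk intrM rmorphXn/= -mulrA ler_pM2l.
by apply/colP => i; rewrite !mxE; apply/eqP; rewrite eq_le !H.
Qed.

Section Haar.
Variable nu : {measure set (Brl V) -> \bar R}.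
Hypothesis nu_inv : forall u (B : set (Brl V)), measurable B -> nu ((fun x => x + u) @^-1` B) = nu B.
Hypothesis nu_fin : (nu (cell 0 0) < +oo)%E.

Lemma cell_translate k z z' :
  (fun x => x + (2 ^+ k)^-1 *: map_mx intr (z' - z)) @^-1` cell k z' = cell k z.
Proof.
apply/seteqP; split => x /cellP H; apply/cellP => i; have := H i; rewrite !mxE mulrDr mulrA divff ?gt_eqF// mul1r;
  rewrite !intrD rmorphN/= => /andP[? ?]; apply/andP; split; lra.
Qed.

Lemma nu_cell k z z' : nu (cell k z) = nu (cell k z').
Proof. by rewrite -(cell_translate k z z') nu_inv//; exact: cell_measurable. Qed.

Lemma nu_cellS k : nu (cell k 0) = ((2 ^ N)%:R%:E * nu (cell k.+1 0))%E.
Proof.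
pose w (e : {ffun 'I_N -> bool}) : 'cV[int]_N := \col_i (e i)%:R.
have E : cell k 0 = \bigcup_(e in [set: {ffun 'I_N -> bool}]) cell k.+1 (w e).
  apply/seteqP; split => x.
    move=> /cellP H; exists [ffun i => (1 <= 2 ^+ k.+1 * x i 0)] => //; apply/cellP => i.
    have := H i; rewrite !mxE ffunE exprS; set a := 2 ^+ k * x i 0; rewrite -mulrA -/a.
    by case: (lerP 1 (2 * a)) => /= h; rewrite ?add0r => /andP[h1 h2]; apply/andP; split; lra.
  move=> [e _ /cellP H]; apply/cellP => i; have := H i; rewrite !mxE exprS -mulrA.
  by case: (e i) => /=; rewrite ?add0r => /andP[h1 h2]; apply/andP; split; lra.
rewrite E (@measure_finite_union _ _ _ nu _ _ (nu (cell k.+1 0))).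
- by rewrite card_ffun card_bool card_ord.
- by move=> e; exact: cell_measurable.
- by move=> e; exact: nu_cell.
- move=> e e' _ _ [x [xe xe']]; apply/ffunP => i.
  by have := congr1 (fun z : 'cV[int]_N => z i 0) (etrans (esym xe) xe'); rewrite !mxE; case: (e i); case: (e' i).
Qed.

Lemma nu_cellX k : nu (cell 0 0) = (((2 ^ N) ^ k)%N%:R%:E * nu (cell k 0))%E.
Proof.
elim: k => [|k ->]; first by rewrite expn0 mul1e.
by rewrite nu_cellS muleA -EFinM -natrM -expnSr.
Qed.

End Haar.

Lemma setI_cell k l z z' : (k <= l)%N ->
  cell k z `&` cell l z' = set0 \/ cell k z `&` cell l z' = cell l z'.
Proof.
move=> kl; have [E|/set0P[x [xk xl]]] := eqVneq (cell k z `&` cell l z') set0; first by left.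
right; apply/seteqP; split => y; first by case.
move=> yl; split => //; rewrite /cell/= -xk; apply: cell_index_le kl _.
by rewrite yl.
Qed.

Definition cells : set (set V) := [set B | B = set0 \/ exists k z, B = cell k z].

(** A point of an open set lies in a cell contained in that set, and cells are countable in
    number. *)
Lemma borel_cells : @measurable _ (Brl V) = <<s cells >>.
Proof.
apply/seteqP; split; apply: smallest_sub; try exact: smallest_sigma_algebra.
  move=> U oU.
  have -> : U = \bigcup_(k in [set: nat]) \bigcup_(z in [set z | cell k z `<=` U]) cell k z.
    apply/seteqP; split => x; last by move=> [k _ [z zU]]; exact: zU.
    by move=> /(open_cell oU)[k kU]; exists k => //; exists (cell_index k x).
  apply: sigma_algebra_bigcup => k.
  have -> : \bigcup_(z in [set z | cell k z `<=` U]) cell k z = \bigcup_n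
      (if unpickle n is Some z then [set x | cell k z x /\ cell k z `<=` U] else set0).
    apply/seteqP; split => x; first by move=> [z zU xz]; exists (pickle z) => //; rewrite pickleK.
    by move=> [n _]; case: unpickle => //= z [xz zU]; exists z.
  apply: sigma_algebra_bigcup => n; apply: sub_sigma_algebra.
  case: unpickle => [z|]; last by left.
  have [zU|zU] := EM (cell k z `<=` U); last by left; apply/seteqP; split => // x [].
  by right; exists k, z; apply/seteqP; split => // x [].
move=> B [->|[k [z ->]]]; first exact: (@measurable0 _ (Brl V)).
exact: cell_measurable.
Qed.

(** Invariance and subdivision into 2^N equal cells determine a measure on all cells from the unit
    cell, and cells form a pi-system. Cross-multiplication avoids a division by the measure of the
    unit cell. *)
Lemma haar_unique (nu nu' : {measure set (Brl V) -> \bar R}) :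
  (forall u (B : set (Brl V)), measurable B -> nu ((fun x => x + u) @^-1` B) = nu B) ->
  (forall u (B : set (Brl V)), measurable B -> nu' ((fun x => x + u) @^-1` B) = nu' B) ->
  (nu (cell 0 0) < +oo)%E -> (nu' (cell 0 0) < +oo)%E ->
  forall B : set (Brl V), measurable B ->
  (nu' (cell 0 0) * nu B = nu (cell 0 0) * nu' B)%E.
Proof.
move=> inv inv' fin fin' B mB.
have r0 (m : {measure set (Brl V) -> \bar R}) : 0 <= fine (m (cell 0 0)) by apply: fine_ge0.
pose c m := NngNum (r0 m).
have cE (m : {measure set (Brl V) -> \bar R}) : (m (cell 0 0) < +oo)%E -> (c m)%:num%:E = m (cell 0 0).
  by move=> mf; rewrite /= fineK// ge0_fin_numE.
have on_cell k z : (nu' (cell 0 0) * nu (cell k z) = nu (cell 0 0) * nu' (cell k z))%E.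
  rewrite (nu_cell inv k z 0) (nu_cell inv' k z 0) (nu_cellX inv k) (nu_cellX inv' k).
  by rewrite muleAC.
rewrite -(cE nu fin) -(cE nu' fin').
apply: (@measure_unique _ R (Brl V) cells (fun i => if unpickle i is Some z then cell 0 z else set0)
  _ _ _ _ (mscale (c nu') nu) (mscale (c nu) nu')).
- exact: borel_cells.
- move=> C C' [->|[k [z ->]]]; first by left; rewrite set0I.
  move=> [->|[l [z' ->]]]; first by left; rewrite setI0.
  have [kl|/ltnW kl] := leqP k l.
    by have [->|->] := setI_cell z z' kl; [left|right; exists l, z'].
  by rewrite setIC; have [->|->] := setI_cell z' z kl; [left|right; exists k, z].
- by move=> i; case: unpickle => [z|]; [right; exists 0%N, z|left].
- apply/seteqP; split => // x _; exists (pickle (cell_index 0 x)) => //.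
  by rewrite pickleK.
- move=> C [->|[k [z ->]]]; first by rewrite !measure0.
  rewrite -[LHS]/((c nu')%:num%:E * nu (cell k z))%E -[RHS]/((c nu)%:num%:E * nu' (cell k z))%E.
  by rewrite !cE//; exact: on_cell.
- move=> i; case: unpickle => [z|]; last by rewrite measure0.
  rewrite -[X in (X < _)%E]/((c nu')%:num%:E * nu (cell 0 z))%E.
  by rewrite cE// (nu_cell inv 0 z 0) lte_mul_pinfty// ge0_fin_numE.
- exact: mB.
Qed.

End Cells.

(** * Lebesgue null sets *)

Section LebesgueNull.
Variables (R : realType) (d : nat).
Hypothesis d_gt0 : (0 < d)%N.
Implicit Types (Y Z : set 'rV[R]_d) (a b : 'rV[R]_d).

Lemma lebesgue_null_sub Y Z : Y `<=` Z -> lebesgue_null Z -> lebesgue_null Y.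
Proof.
by move=> YZ H e /H[a [b [Zab s]]]; exists a, b; split => //; exact: subset_trans Zab.
Qed.

Lemma box_volume_ge0 a b : 0 <= box_volume a b.
Proof. by apply: prodr_ge0 => i _; rewrite le_max lexx. Qed.

(** An empty box that pads finite coverings to sequences. In dimension 0 the empty product would
    give it volume 1. *)
Lemma box_volume_empty : box_volume (const_mx 1) (const_mx 0 : 'rV[R]_d) = 0.
Proof.
rewrite /box_volume (bigD1 (Ordinal d_gt0))//= !mxE sub0r.
by rewrite max_l ?mul0r// oppr_le0.
Qed.

Lemma null_bigcup (Z : nat -> set 'rV[R]_d) :
  (forall n, lebesgue_null (Z n)) -> lebesgue_null (\bigcup_n Z n).
Proof.
move=> Zn e e0.
have en n : 0 < e / (2 ^ n.+1)%:R by rewrite divr_gt0// ltr0n expn_gt0.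
have /choice[ab abP] : forall n, exists ab : (nat -> 'rV[R]_d) * (nat -> 'rV[R]_d),
    Z n `<=` \bigcup_k box (ab.1 k) (ab.2 k) /\
    (\sum_(0 <= k <oo) (box_volume (ab.1 k) (ab.2 k))%:E <= (e / (2 ^ n.+1)%:R)%:E)%E.
  by move=> n; have [a [b H]] := Zn n _ (en n); exists (a, b).
have /card_set_bijP[f fbij] : ([set: nat] #= [set: nat * nat])%card by rewrite card_eq_sym; exact: card_nat2.
exists (fun m => (ab (f m).1).1 (f m).2), (fun m => (ab (f m).1).2 (f m).2); split.
  move=> y [n _ /(abP n).1[k _ yk]]; have [_ _ fsurj] := fbij.
  by have [m _ fm] := fsurj (n, k) I; exists m => //; rewrite fm.
pose v (p : nat * nat) : \bar R := (box_volume ((ab p.1).1 p.2) ((ab p.1).2 p.2))%:E.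
have v0 p : (0 <= v p)%E by rewrite lee_fin box_volume_ge0.
rewrite (_ : (\sum_(0 <= k <oo) _)%E = (\sum_(0 <= n <oo) \sum_(0 <= k <oo) v (n, k))%E).
  apply: le_trans (_ : (\sum_(0 <= n <oo) (e / (2 ^ n.+1)%:R)%:E <= _)%E).
    by apply: lee_nneseries => // [n _ _|n _]; [exact: nneseries_ge0|exact: (abP n).2].
  by apply: epsilon_trick0; exact: ltW.
have sT (a : nat -> \bar R) : (forall n, (0 <= a n)%E) ->
    (\sum_(0 <= n <oo) a n = \esum_(n in [set: nat]) a n)%E.
  by move=> a0; rewrite nneseries_esum//; congr esum; apply/seteqP.
rewrite sT; last by move=> m; exact: (v0 (f m)).
rewrite sT; last by move=> n; exact: nneseries_ge0.
transitivity (\esum_(p in [set: nat * nat]) v p)%E.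
  by rewrite (@reindex_esum _ _ _ [set: nat] [set: nat * nat] f v fbij).
rewrite [RHS](eq_esum (b := fun n => \esum_(k in [set: nat]) v (n, k))%E); last first.
  by move=> n _; rewrite sT.
rewrite (@esum_esum R nat nat setT (fun=> setT) (fun n k => v (n, k)))//.
symmetry; have -> : [set: nat] `*`` (fun=> [set: nat]) = [set: nat * nat] by apply/seteqP.
by apply: eq_esum => // -[].
Qed.

End LebesgueNull.

(** * From null sets of an invariant measure to coverings by boxes *)

Section Tiny.
Variables (R : realType) (N : nat).
Local Notation V := 'cV[R]_N.
Hypothesis N_gt0 : (0 < N)%N.

(* Jordan content zero, measured with dyadic cells. *)
Definition tiny (K : set V) := forall e : R, 0 < e -> exists k (s : seq 'cV[int]_N),
  (forall x, K x -> cell_index k x \in s) /\ (size s)%:R <= e * ((2 ^ N) ^ k)%:R.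

Lemma finite_cells (K : set V) (M k : nat) : (forall x, K x -> forall i, `|x i 0| <= M%:R) ->
  finite_set [set cell_index k x | x in K].
Proof.
clear N_gt0; move=> KM; pose B := (2 ^ k * M).+1.
pose f (g : {ffun 'I_N -> 'I_(2 * B + 1)}) : 'cV[int]_N := \col_i ((g i : nat)%:Z - B%:Z).
apply: (@sub_finite_set _ _ [set f g | g in [set: {ffun 'I_N -> 'I_(2 * B + 1)}]]); last first.
  by apply: finite_image; exact: finite_finset.
move=> z [x Kx <-]; pose h i := Num.floor (2 ^+ k * x i 0).
have hb i : (- B%:Z <= h i) && (h i <= B%:Z).
  have := KM _ Kx i; rewrite ler_norml => /andP[x1 x2].
  have BE : B%:R = 2 ^+ k * M%:R + 1 :> R by rewrite /B -natr1 natrM natrX.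
  have p0 : 0 < 2 ^+ k :> R by rewrite exprn_gt0.
  rewrite /h floor_ge_int; apply/andP; split.
    rewrite rmorphN/= -[B%:Z%:~R]/(B%:R) BE.
    have : 2 ^+ k * - M%:R <= 2 ^+ k * x i 0 by rewrite ler_pM2l.
    by rewrite mulrN; lra.
  rewrite -(ler_int R); apply: le_trans (floor_le _) _; rewrite -[B%:Z%:~R]/(B%:R) BE.
  have : 2 ^+ k * x i 0 <= 2 ^+ k * M%:R by rewrite ler_pM2l.
  by lra.
have hB i : (absz (h i + B%:Z)%R < 2 * B + 1)%N by have := hb i; lia.
exists [ffun i => Ordinal (hB i)] => //; apply/colP => i; rewrite !mxE ffunE /=.
by have := hb i; rewrite -/(h i); lia.
Qed.

(** The unions F k of the level k cells that meet K decrease to K because K is closed, so their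
    measures tend to 0. Boundedness makes the number of cells finite, and that number is the measure
    of F k divided by the measure of one cell. *)
Lemma compact_null_tiny (nu : {measure set (Brl V) -> \bar R}) (K : set V) (M : nat) :
  (forall u (B : set (Brl V)), measurable B -> nu ((fun x => x + u) @^-1` B) = nu B) ->
  (nu (cell 0 0) < +oo)%E -> (0 < nu (cell 0 0))%E ->
  closed K -> (forall x, K x -> forall i, `|x i 0| <= M%:R) -> nu K = 0 -> tiny K.
Proof.
move=> inv fin pos cK KM K0 e e0.
have /choice[s sP] : forall k, exists s : seq 'cV[int]_N, uniq s /\
    forall z, z \in s <-> exists2 x, K x & cell_index k x = z.
  move=> k; have /finite_seqP[s sE] := finite_cells k KM.
  exists (undup s); split; first exact: undup_uniq.
  move=> z; rewrite mem_undup.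
  have : [set cell_index k x | x in K] z = [set` s] z by rewrite sE.
  by move=> E; split; [move=> zs; change ([set cell_index k x | x in K] z); rewrite E|
    move=> zK; change ([set` s] z); rewrite -E].
pose F k : set (Brl V) := \bigcup_(i in [set: 'I_(size (s k))]) cell k (nth 0 (s k) i).
have FP k x : F k x <-> exists2 y, K y & cell_index k y = cell_index k x.
  split=> [[i _ xi]|/(sP k).2 xs].
    have /(sP k).2[y Ky yi] : nth 0 (s k) i \in s k by rewrite mem_nth.
    by exists y => //; rewrite yi.
  have xi : (index (cell_index k x) (s k) < size (s k))%N by rewrite index_mem.
  by exists (Ordinal xi) => //; rewrite /cell/= nth_index.
have cfin k : nu (cell k 0) \is a fin_num.
  rewrite ge0_fin_numE//; apply: contraPT fin; rewrite -leNgt => h.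
  rewrite (nu_cellX inv k).
  have p0 : (0 < ((2 ^ N) ^ k)%N%:R%:E :> \bar R)%E by rewrite lte_fin ltr0n expn_gt0 expn_gt0.
  by move: h; rewrite leye_eq => /eqP ->; rewrite (gt0_muley p0) ltxx.
have FE k : nu (F k) = ((size (s k))%:R%:E * nu (cell k 0))%E.
  rewrite (@measure_finite_union _ _ _ nu _ _ (nu (cell k 0))) ?card_ord//.
  - by move=> i; exact: cell_measurable.
  - by move=> i; exact: nu_cell.
  - move=> i j _ _ [x [xi xj]]; apply: val_inj; apply/eqP; rewrite -(nth_uniq 0 (ltn_ord i) (ltn_ord j) (sP k).1).
    by rewrite -xi -xj.
have FK : \bigcap_k F k = K.
  apply/seteqP; split => x; last by move=> Kx k _; apply/FP; exists x.
  move=> H; apply: contrapT => nKx.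
  have [k kK] := open_cell (closed_openC cK) nKx.
  have /FP[y Ky yx] := H k I.
  by apply: (kK y) Ky.
have Fm k : measurable (F k).
  by apply: fin_bigcup_measurable => [|i _]; [exact: finite_finset|exact: cell_measurable].
have Fdec : {homo F : n m / (n <= m)%N >-> (m <= n)%O}.
  move=> k l kl; apply/subsetPset => x /FP[y Ky yx]; apply/FP; exists y => //.
  exact: cell_index_le kl yx.
have F0 : (nu (F 0%N) < +oo)%E by rewrite FE lte_mul_pinfty// -ge0_fin_numE.
have := nonincreasing_cvg_mu F0 Fm (_ : measurable (\bigcap_k F k)) Fdec.
have -> : nu (\bigcap_k F k) = 0 by rewrite FK.
move=> /(_ (bigcapT_measurable Fm)) Fcvg.
have ec : (0 < (e%:E * nu (cell 0 0)))%E by rewrite mule_gt0.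
have : \forall k \near \oo, (nu (F k) < e%:E * nu (cell 0 0))%E.
  have nb : nbhs (0 : \bar R) [set y | (y < e%:E * nu (cell 0 0))%E].
    by apply: open_nbhs_nbhs; split; [exact: open_ereal_lt_ereal|exact: ec].
  exact: (Fcvg _ nb).
move=> [k _ /(_ k (leqnn k)) /=]; rewrite FE (nu_cellX inv k).
have c0 : 0 < fine (nu (cell k 0)).
  move: pos; rewrite (nu_cellX inv k) -(fineK (cfin k)) -EFinM lte_fin.
  by rewrite pmulr_rgt0// ltr0n expn_gt0 expn_gt0.
rewrite -(fineK (cfin k)) -!EFinM lte_fin mulrA ltr_pM2r// => H.
exists k, (s k); split; last exact: ltW.
by move=> x Kx; apply/(sP k).2; exists x.
Qed.

(** The part of Y sent by g into one cell of side 2^-k fits into a cube of half-side C 2^-k around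
    any of its points. The resulting factor (2 C)^N is paid for in advance in the choice of e. *)
Lemma tiny_null d (Y : set 'rV[R]_d) (g : 'rV[R]_d -> V) (K : set V) (C : R) :
  d = N -> 0 < C -> tiny K -> (forall y, Y y -> K (g y)) ->
  (forall y y' e, Y y -> Y y' -> (forall i, `|g y i 0 - g y' i 0| <= e) ->
     forall j, `|y 0 j - y' 0 j| <= C * e) ->
  lebesgue_null Y.
Proof.
move=> dN C0 tK YK lip e e0.
have C2 : 0 < (C + C) ^+ N by rewrite exprn_gt0// addr_gt0.
have [k [s [Ks ss]]] := tK (e / (C + C) ^+ N) (divr_gt0 e0 C2).
pose del : R := (2 ^+ k)^-1.
have /choice[y0 y0P] : forall n, exists ab : 'rV[R]_d * 'rV[R]_d,
    (forall y, Y y -> cell_index k (g y) = nth 0 s n -> (n < size s)%N -> box ab.1 ab.2 y) /\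
    (box_volume ab.1 ab.2 <= if (n < size s)%N then (C * del + C * del) ^+ N else 0).
  move=> n; have dl0 : 0 <= C * del + C * del by rewrite addr_ge0// mulr_ge0 ?invr_ge0 ?exprn_ge0// ltW.
  have d0 : (0 < d)%N by rewrite dN.
  case: ifPn => ns; last first.
    exists (const_mx 1, const_mx 0); split; last by rewrite box_volume_empty.
    by [].
  have [[y1 [Yy1 y1n]]|H] := EM (exists y, Y y /\ cell_index k (g y) = nth 0 s n); last first.
    exists (const_mx 1, const_mx 0); split; first by move=> y Yy yn; case: H; exists y.
    by rewrite box_volume_empty// exprn_ge0.
  exists (y1 - const_mx (C * del), y1 + const_mx (C * del)); split => [y Yy yn _ i|].
    have := lip y y1 del Yy Yy1 _ i; rewrite !mxE ler_norml.
    move=> H; have /H/andP[? ?] : forall i, `|g y i 0 - g y1 i 0| <= del.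
      by move=> j; apply/ltW/same_cell_dist; rewrite yn.
    by apply/andP; split; lra.
  rewrite /box_volume (eq_bigr (fun=> C * del + C * del)).
    by rewrite prodr_const card_ord dN.
  by move=> i _; rewrite !mxE opprD opprK addrACA subrr add0r max_r.
exists (fun n => (y0 n).1), (fun n => (y0 n).2); split.
  move=> y Yy; have ys := Ks _ (YK _ Yy).
  exists (index (cell_index k (g y)) s) => //; apply: (y0P _).1 => //.
    by rewrite nth_index.
  by rewrite index_mem.
apply: lime_le; first by apply: is_cvg_nneseries => n _ _; rewrite lee_fin box_volume_ge0.
apply: nearW => n; rewrite sumEFin lee_fin.
apply: (@le_trans _ _ (\sum_(0 <= i < n) if (i < size s)%N then (C * del + C * del) ^+ N else 0)).
  by apply: ler_sum => i _; exact: (y0P i).2.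
set c := (_ + _) ^+ N; have c0 : 0 <= c.
  by rewrite exprn_ge0// addr_ge0// mulr_ge0 ?invr_ge0 ?exprn_ge0// ltW.
have -> : \sum_(0 <= i < n) (if (i < size s)%N then c else 0) = (minn n (size s))%:R * c.
  elim: n => [|n IH]; first by rewrite big_geq// min0n mul0r.
  rewrite big_nat_recr//= IH; case: ltnP => ns.
    by rewrite (minn_idPl ns) -natr1 mulrDl mul1r.
  by rewrite (minn_idPr (leqW ns)) addr0.
apply: (@le_trans _ _ ((size s)%:R * c)).
  by rewrite ler_wpM2r// ler_nat geq_minr.
apply: le_trans (ler_wpM2r c0 ss) _.
have -> : c = (C + C) ^+ N * ((2 ^ N) ^ k)%:R^-1.
  by rewrite /c -mulrDl exprMn /del exprVn -exprM mulnC exprM natrX natrX.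
rewrite mulrACA divfK ?gt_eqF// divff ?mulr1//.
Qed.

End Tiny.

(** * Lattices of the semidirect product *)

(* This makes R^N x R, a product of pointed spaces, a pointed topological space. *)
HB.saturate prod.

Section LatticeData.
Variables (R : realType) (N : nat) (A : R -> GL N R).
Local Notation V := 'cV[R]_N.
Local Notation X := ('cV[R]_N * R)%type.

(* D is a fundamental domain of finite measure for the left action of H on the semidirect product, and m is a left Haar measure. *)
Record lattice_data (m : {measure set (Brl X) -> \bar R}) (D H : set X) : Prop := {
  ld_inv : forall x (B : set (Brl X)), measurable B -> m (sdprod_mul A x @^-1` B) = m B;
  ld_compact : forall K : set X, compact K -> (m K < +oo)%E;
  ld_pos : (0 < m setT)%E;
  ld_D : measurable (D : set (Brl X));
  ld_fin : (m D < +oo)%E;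
  ld_fd : forall x, exists! g, H g /\ D (sdprod_mul A g x);
  ld_1 : H (0, 0);
  ld_mul : forall x y, H x -> H y -> H (sdprod_mul A x y);
  ld_inverse : forall x, H x -> H (sdinv A x);
  ld_disc : exists2 U : set X, open U /\ U (0, 0) & forall g, H g -> U g -> g = (0, 0)
}.

End LatticeData.

Section Boxes.
Variables (R : realType) (N : nat).
Local Notation V := 'cV[R]_N.
Local Notation X := ('cV[R]_N * R)%type.

Lemma cube_compact (M : R) : compact [set x : V | forall i, `|x i 0| <= M].
Proof.
have -> : [set x : V | forall i, `|x i 0| <= M] =
    [set v^T | v in [set v : 'rV[R]_N | forall i, [set r | r \in `[- M, M]] (v ord0 i)]].
  apply/seteqP; split => [x xM|x [v vM <-] i].
    exists x^T; last by rewrite trmxK.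
    by move=> i /=; rewrite mxE in_itv/= -ler_norml.
  by rewrite mxE ler_norml; have := vM i; rewrite /= in_itv.
apply: continuous_compact.
  apply: continuous_subspaceT => v; apply: (cvg_mx (nbhs_filter v)) => i j.
  by under eq_fun do rewrite mxE; rewrite mxE; exact: coord_continuous.
apply: (@rV_compact R N (fun=> [set r | r \in `[- M, M]])) => i.
exact: segment_compact.
Qed.

Lemma box_compact (M : R) : compact [set x : X | (forall i, `|x.1 i 0| <= M) /\ `|x.2| <= M].
Proof.
have := compact_setX (@cube_compact M) (@segment_compact R (- M) M).
rewrite (_ : _ `*` _ = [set x : X | (forall i, `|x.1 i 0| <= M) /\ `|x.2| <= M])//.
apply/seteqP; split => -[x t] /= [xM tM]; split => //; first by rewrite ler_norml; move: tM; rewrite in_itv.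
by rewrite in_itv/= -ler_norml.
Qed.

Lemma open_sigma_compact (U : set X) : open U ->
  exists2 K : nat -> set X, forall n, compact (K n) & U = \bigcup_n K n.
Proof.
move=> oU.
pose C n := [set x : X | forall y, ball x n.+1%:R^-1 y -> U y].
exists (fun n => [set x : X | (forall i, `|x.1 i 0| <= n%:R) /\ `|x.2| <= n%:R] `&` C n).
  move=> n; apply: compact_closedI; first exact: box_compact.
  rewrite -openC (_ : ~` _ = \bigcup_(y in ~` U) ball y n.+1%:R^-1).
    by apply: bigcup_open => y _; apply: ball_open; rewrite invr_gt0 ltr0n.
  apply/seteqP; split => x.
    by move=> /existsNP[y /not_implyP[xy nUy]]; exists y => //; exact: ball_sym.
  by move=> [y nUy yx] Cx; apply: nUy; apply: Cx; exact: ball_sym.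
apply/seteqP; split => x; last first.
  by move=> [n _ [_ Cx]]; apply: Cx; apply: ballxx; rewrite invr_gt0 ltr0n.
move=> Ux; have /nbhs_ballP[e /= e0 eU] : nbhs x U by exact: open_nbhs_nbhs.
pose M := \sum_i `|x.1 i 0| + `|x.2| + e^-1.
have M0 : 0 <= M by rewrite !addr_ge0// ?sumr_ge0// invr_ge0 ltW.
have [n Mn] : exists n : nat, M < n%:R.
  exists (Num.truncn M).+1; exact: truncnS_gt.
have s0 : 0 <= \sum_i `|x.1 i 0| by rewrite sumr_ge0.
have e1 : 0 < e^-1 by rewrite invr_gt0.
exists n => //; split; first split.
- move=> i; apply: le_trans (ltW Mn); rewrite /M (bigD1 i)//= -!addrA lerDl.
  by rewrite !addr_ge0// ?sumr_ge0// ltW.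
- by apply: le_trans (ltW Mn); rewrite /M; have := normr_ge0 x.2; lra.
- move=> y xy; apply: eU; apply: le_ball xy.
  rewrite invf_ple ?posrE// ?ltr0n//; apply: le_trans (_ : n%:R <= _); last by rewrite ler_nat.
  by apply: le_trans (ltW Mn); rewrite /M; have := normr_ge0 x.2; lra.
Qed.

End Boxes.

Section Bridge.
Variables (R : realType) (N : nat) (A : R -> GL N R) (P : GL (N + 1) (Cx R)).
Hypothesis repA : is_representation A.
Hypothesis A_inj : injective A.
Hypothesis A_cont : continuous (fun t => GLmx (A t) : 'M[R]_N).
Local Notation V := 'cV[R]_N.
Local Notation X := ('cV[R]_N * R)%type.
Local Notation e := (emb A P).

Lemma cvg_toPGL n (T : Type) (F : set_system T) (FF : Filter F) (g : T -> GL n (Cx R)) (l : GL n (Cx R)) :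
  (fun x => GLmx (g x)) @ F --> GLmx l -> (fun x => toPGL (g x)) @ F --> toPGL l.
Proof.
move=> gl; apply: (@cvg_comp _ _ _ g (@toPGL R n) _ (nbhs l)); last exact: pi_continuous.
exact: (@cvg_initial _ _ (@GLmx n (Cx R))).
Qed.

Lemma emb_continuous : continuous (e : X -> PGL R (N + 1)).
Proof.
move=> x; apply: cvg_toPGL.
apply: (cvg_mulmx (nbhs_filter x)); last exact: cvg_cst.
apply: (cvg_mulmx (nbhs_filter x)); first exact: cvg_cst.
apply: cvg_map_toC; apply: (cvg_mx (nbhs_filter x)) => i j.
have Ac k l : (fun y : X => A y.2 k l) @ x --> A x.2 k l.
  apply: (@cvg_entry R _ (nbhs x) _ _ (fun y : X => GLmx (A y.2)) (GLmx (A x.2)) k l).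
  apply: (@cvg_comp _ _ _ (fun y : X => y.2) (fun t => GLmx (A t)) (nbhs x) (nbhs x.2)).
    exact: cvg_snd.
  exact: A_cont.
have bc k l : (fun y : X => y.1 k l) @ x --> x.1 k l.
  apply: (@cvg_entry R _ (nbhs x) _ _ (fun y : X => y.1) x.1 k l).
  exact: cvg_fst.
case: (splitP i) => k ik; [rewrite (_ : i = lshift 1 k); last exact/val_inj|
  rewrite (_ : i = rshift N k); last exact/val_inj];
case: (splitP j) => l jl; [rewrite (_ : j = lshift 1 l); last exact/val_inj|
  rewrite (_ : j = rshift N l); last exact/val_inj| rewrite (_ : j = lshift 1 l); last exact/val_inj|
  rewrite (_ : j = rshift N l); last exact/val_inj].
- by under eq_fun do rewrite /rho_mx block_mxEul; rewrite /rho_mx block_mxEul; exact: Ac.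
- by under eq_fun do rewrite /rho_mx block_mxEur; rewrite /rho_mx block_mxEur; exact: bc.
- by under eq_fun do rewrite /rho_mx block_mxEdl; rewrite /rho_mx block_mxEdl; exact: cvg_cst.
- by under eq_fun do rewrite /rho_mx block_mxEdr; rewrite /rho_mx block_mxEdr; exact: cvg_cst.
Qed.

Lemma emb_compact (K : set X) : compact K -> compact (e @` K).
Proof.
move=> cK; apply: continuous_compact => //; apply: continuous_subspaceT.
exact: emb_continuous.
Qed.

(** An open set is a countable union of compact sets, whose images are compact, hence closed in the
    Hausdorff space PGL; complements are handled by injectivity. *)
Lemma emb_borel (B : set (Brl X)) : measurable B -> measurable (e @` B : set (borelPGL R (N + 1))).
Proof.
have mo (U : set X) : open U -> measurable (e @` U : set (borelPGL R (N + 1))).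
  move=> /open_sigma_compact[K cK ->]; rewrite image_bigcup.
  apply: bigcupT_measurable => n; apply: closed_borel.
  apply: compact_closed; first by apply: (@PGL_hausdorff _ _ 1%:M 1%:M); exact: unitmx1.
  exact: emb_compact.
pose M : set (set X) := [set C | measurable (e @` C : set (borelPGL R (N + 1)))].
suff : <<s @open X >> `<=` M by apply.
apply: smallest_sub; last by move=> U; exact: mo.
split; first by rewrite /M/= image_set0; exact: measurable0.
- move=> C MC; rewrite /M/= setTD.
  have -> : e @` (~` C) = e @` setT `\` e @` C.
    apply/seteqP; split => y.
      by move=> [x nCx <-]; split; [exists x|move=> [x' Cx' /(emb_inj A_inj) xx]; apply: nCx; rewrite -xx].
    by move=> [[x _ <-] H]; exists x => // Cx; apply: H; exists x.
  by apply: measurableD => //; apply: mo; exact: openT.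
- by move=> F MF; rewrite /M/= image_bigcup; exact: bigcupT_measurable.
Qed.

Section Pullback.
Variable mu : {measure set (borelPGL R (N + 1)) -> \bar R}.

Definition emb_measure (B : set (Brl X)) := mu (e @` B).

Let emb_measure0 : emb_measure set0 = 0%E.
Proof. by rewrite /emb_measure image_set0 measure0. Qed.
Let emb_measure_ge0 B : (0 <= emb_measure B)%E.
Proof. exact: measure_ge0. Qed.
Let emb_measure_sigma : semi_sigma_additive emb_measure.
Proof.
move=> F mF tF mU; rewrite /emb_measure image_bigcup.
apply: measure_semi_sigma_additive.
- by move=> n; exact: emb_borel.
- move=> i j _ _ [y [[x Fx <-] [x' Fx' /(emb_inj A_inj) xx]]].
  by apply: (tF i j) => //; exists x; split => //; rewrite -xx.
- by apply: bigcupT_measurable => n; exact: emb_borel.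
Qed.
HB.instance Definition _ := isMeasure.Build _ _ _ emb_measure
  emb_measure0 emb_measure_ge0 emb_measure_sigma.

End Pullback.

Lemma sdprod_mul_continuous x : continuous (sdprod_mul A x : X -> X).
Proof.
move=> y.
have c1 : (fun z : X => x.1 + A x.2 *m z.1) @ y --> x.1 + A x.2 *m y.1.
  apply: (@cvgD R V _ (nbhs y)); first exact: cvg_cst.
  apply: (cvg_mulmx (nbhs_filter y)); first exact: cvg_cst.
  exact: cvg_fst.
have c2 : (fun z : X => x.2 + z.2) @ y --> x.2 + y.2.
  apply: (@cvgD R R^o _ (nbhs y)); first exact: cvg_cst.
  exact: cvg_snd.
exact: (cvg_pair c1 c2).
Qed.

(** Transports measure, fundamental domain and discreteness to R^N x R, where the sets needed for
    packing can be written down explicitly. *)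
Lemma lattice_dataP (Gam : set (PGL R (N + 1))) : is_lattice (range e) Gam ->
  exists m D, lattice_data A m D (e @^-1` Gam).
Proof.
move=> [[G1 GM GV] GamG Giso [mu [D [[mu_inv mu_fin mu_pos] mD DG fd Dfin]]]].
pose m : {measure set (Brl X) -> \bar R} := emb_measure mu.
exists m, (e @^-1` D).
have DE : e @` (e @^-1` D) = D.
  apply/seteqP; split => [y [x Dx <-]//|y Dy]; have [x _ xy] := DG _ Dy.
  by exists x => //; rewrite /= xy.
split.
- move=> x B mB; rewrite /m/= /emb_measure -(mu_inv _ (e x)).
  + congr (mu _); apply/seteqP; split => [y [_ [z /= Bz <-] <-]|y [z Bz <-]].
      by exists (sdprod_mul A x z) => //; rewrite emb_mul.
    exists (e (sdprod_mul A (sdinv A x) z)); last by rewrite emb_mul// embV// mulKVg.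
    by exists (sdprod_mul A (sdinv A x) z) => //=; rewrite sdmulA// sdmulV// sdmul1.
  + by apply: emb_borel; apply: (continuous_borel (@sdprod_mul_continuous x) mB).
  + by move=> y [z _ <-]; exists z.
  + by exists x.
- move=> K cK; apply: mu_fin; first exact: emb_compact.
  by move=> y [z _ <-]; exists z.
- by [].
- exact: (continuous_borel emb_continuous mD).
- by rewrite /m/= /emb_measure DE.
- move=> x; have [g [[Gg Dg] gu]] : exists! gam, Gam gam /\ D (gam * e x)%g by apply: fd; exists x.
  have [y _ yg] := GamG _ Gg; exists y; split.
    by split; rewrite /= ?emb_mul// yg.
  move=> y' [/= Gy' Dy']; apply: (@emb_inj _ _ A P A_inj); rewrite yg; apply: gu; split => //.
  by rewrite -emb_mul.
- by rewrite /= emb1.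
- by move=> x y /= Gx Gy; rewrite emb_mul//; exact: GM.
- by move=> x /= Gx; rewrite embV//; exact: GV.
- have [_ [W W1 WE]] := Giso _ G1.
  exists (interior (e @^-1` W)).
    split; first exact: open_interior.
    by apply: emb_continuous; rewrite emb1.
  move=> g /= Gg /interior_subset /= Wg; apply: (@emb_inj _ _ A P A_inj); rewrite emb1//.
  by have : [set 1%g] (e g) by rewrite -WE.
Qed.

End Bridge.

(** With c > 0 the first n sets would already have measure n c, beyond any finite M. This closes the
    packing arguments. *)
Lemma disjoint_bounded d (T : measurableType d) (R : realType) (mu : {measure set T -> \bar R})
    (F : nat -> set T) (c M : \bar R) : (forall n, measurable (F n)) -> trivIset setT F ->
  (forall n, (c <= mu (F n))%E) -> (mu (\bigcup_n F n) <= M)%E -> (M < +oo)%E -> (c <= 0)%E.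
Proof.
move=> mF tF cF UM Mfin; rewrite leNgt; apply/negP => c0.
have H n : (n%:R%:E * c <= M)%E.
  apply: le_trans UM; rewrite measure_bigcupT//.
  apply: le_trans (_ : (\sum_(0 <= i < n) mu (F i) <= _)%E); last first.
    by apply: nneseries_lim_ge.
  elim: n => [|n IH]; first by rewrite mul0e big_geq.
  by rewrite big_nat_recr//= -natr1 EFinD ge0_muleDl ?lee_fin// mul1e leeD.
have M0 : (0 <= M)%E by have := H 0%N; rewrite mul0e.
move: H c0 Mfin M0; case: c cF => [c| |] cF //; last first.
  by move=> H _ Mfin _; have := H 1%N; rewrite mul1e leye_eq => /eqP ME; rewrite ME ltxx in Mfin.
case: M UM => // M _ H; rewrite lte_fin => c0 _; rewrite lee_fin => M0.
have := H (Num.truncn (M / c)).+1; rewrite -EFinM lee_fin leNgt => /negP; apply.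
by rewrite -ltr_pdivrMr// truncnS_gt.
Qed.

Lemma countable_union_null d (T : measurableType d) (R : realType) (mu : {measure set T -> \bar R})
    (I : countType) (F : I -> set T) : (forall i, measurable (F i)) ->
  (forall i, mu (F i) = 0%E) -> mu (\bigcup_(i in [set: I]) F i) = 0%E.
Proof.
move=> mF F0; pose G n := if unpickle n is Some i then F i else set0.
have mG n : measurable (G n) by rewrite /G; case: unpickle.
have FG : \bigcup_(i in [set: I]) F i = \bigcup_n G n.
  apply/seteqP; split => x [i _ xi]; first by exists (pickle i) => //; rewrite /G pickleK.
  by move: xi; rewrite /G; case: unpickle => // j xj; exists j.
apply/eqP; rewrite eq_le measure_ge0 andbT FG.
apply: le_trans (generalized_Boole_inequality mu mG _) _; first exact: bigcupT_measurable.
rewrite eseries0// => n _ _; rewrite /G; case: unpickle => [i|]; [exact: F0|exact: measure0].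
Qed.

Lemma unitmx_of_ker (F : fieldType) n (M : 'M[F]_n) :
  (forall v : 'cV[F]_n, M *m v = 0 -> v = 0) -> M \in unitmx.
Proof.
move=> H; rewrite -unitmx_tr -row_free_unit -kermx_eq0; apply/eqP/row_matrixP => i.
rewrite row0; apply: trmx_inj; rewrite trmx0; apply: H; apply: trmx_inj.
by rewrite trmx_mul trmxK trmx0 -row_mul mulmx_ker row0.
Qed.

Section Slab.
Variables (R : realType) (N : nat).
Local Notation V := 'cV[R]_N.
Local Notation X := ('cV[R]_N * R)%type.
Variables (m : {measure set (Brl X) -> \bar R}) (a b : R).

Definition slab (B : set V) : set X := [set x | B x.1 /\ a <= x.2 < b].

Lemma slab_borel (B : set (Brl V)) : measurable B -> measurable (slab B : set (Brl X)).
Proof.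
move=> mB; have -> : slab B = (fst @^-1` B) `&` ((snd @^-1` [set r | a <= r]) `&` (snd @^-1` [set r | r < b])).
  by apply/seteqP; split => x; [move=> [Bx /andP[]]|move=> [Bx [/= h1 h2]]; split => //; rewrite h1 h2].
have c1 : continuous (fst : X -> V) by move=> x; exact: cvg_fst.
have c2 : continuous (snd : X -> R) by move=> x; exact: cvg_snd.
apply: (@measurableI _ (Brl X)); first exact: (continuous_borel c1 mB).
apply: (@measurableI _ (Brl X)).
  by apply: closed_borel; apply: closed_comp; [move=> x _; exact: c2|exact: closed_ge].
by apply: open_borel; apply: open_comp; [move=> x _; exact: c2|exact: open_lt].
Qed.

(** For a left Haar measure m this is translation-invariant on R^N, since left multiplication by (u,
    0) moves the first factor by u and keeps the time. *)
Definition slab_measure (B : set (Brl V)) := m (slab B).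

Let slab_measure0 : slab_measure set0 = 0%E.
Proof. by rewrite /slab_measure (_ : slab _ = set0) ?measure0//; apply/seteqP; split => x []. Qed.
Let slab_measure_ge0 B : (0 <= slab_measure B)%E.
Proof. exact: measure_ge0. Qed.
Let slab_measure_sigma : semi_sigma_additive slab_measure.
Proof.
move=> F mF tF mU; have sE : slab (\bigcup_n F n) = \bigcup_n slab (F n).
  apply/seteqP; split => x; first by move=> [[n _ Fx] h]; exists n.
  by move=> [n _ [Fx h]]; split => //; exists n.
rewrite /slab_measure sE; apply: measure_semi_sigma_additive.
- by move=> n; exact: slab_borel.
- by move=> i j _ _ [x [[Fx _] [Fx' _]]]; apply: (tF i j) => //; exists x.1.
- by apply: bigcupT_measurable => n; exact: slab_borel.
Qed.
HB.instance Definition _ := isMeasure.Build _ _ _ slab_measure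
  slab_measure0 slab_measure_ge0 slab_measure_sigma.

End Slab.

(** * Translations and times of a lattice *)

Section LatticeStructure.
Variables (R : realType) (N : nat) (A : R -> GL N R).
Hypothesis repA : is_representation A.
Hypothesis A_cont : continuous (fun t => GLmx (A t) : 'M[R]_N).
Hypothesis A_fix : forall t (v : 'cV[R]_N), t != 0 -> A t *m v = v -> v = 0.
Local Notation V := 'cV[R]_N.
Local Notation X := ('cV[R]_N * R)%type.
Local Notation mul := (sdprod_mul A).
Variables (m : {measure set (Brl X) -> \bar R}) (D H : set X).
Hypothesis ld : lattice_data A m D H.

Let box k (x y : X) := cell_index k y.1 = cell_index k x.1 /\
  cell_index k (const_mx y.2 : 'cV_1) = cell_index k (const_mx x.2 : 'cV_1).

Lemma open_box (U : set X) x : open U -> U x -> exists k, box k x `<=` U.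
Proof.
move=> oU Ux; have /nbhs_ballP[e /= e0 eU] : nbhs x U by exact: open_nbhs_nbhs.
have [k ke] := exists_pow2 e0.
exists k => y [yx1 yx2]; apply: eU; split.
  split => // i j; rewrite !ord1; apply: lt_trans ke; exact: same_cell_dist (esym yx1).
apply: lt_trans ke; have := same_cell_dist 0 (esym yx2).
by rewrite !mxE.
Qed.

Lemma lattice_uniq g g' x : mul (mul (sdinv A g') g) x = x -> g = g'.
Proof.
move=> E; have E1 : mul (sdinv A g') g = (0, 0).
  by rewrite -[LHS](sd1mul A) -(sdmulV repA x) (sdmulA repA) E.
by rewrite -[LHS](sdmul1 repA) -(sdmulV repA g') -(sdmulA repA) E1 sd1mul.
Qed.

(** Each g is labelled by a dyadic box around it contained in g U, where U isolates the identity;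
    equal labels force equal elements. *)
Lemma lattice_countable : countable H.
Proof.
have [U [oU U1] UH] := ld_disc ld.
have /choice[k kP] : forall g : X, exists k, box k g `<=` [set y | U (mul (sdinv A g) y)].
  move=> g; apply: open_box; last by rewrite /= sdVmul.
  apply: open_comp => // x _; exact: sdprod_mul_continuous.
apply/countable_injP.
exists (fun g => pickle (k g, cell_index (k g) g.1, cell_index (k g) (const_mx g.2 : 'cV_1))).
move=> g g'; rewrite !inE => Hg Hg' /(pcan_inj pickleK)[kE c1 c2].
have : U (mul (sdinv A g) g').
  by apply: kP; split; [rewrite /= c1 kE|rewrite /= c2 kE].
move=> /(UH _ (ld_mul ld (ld_inverse ld Hg) Hg')) E.
by apply/esym/(@lattice_uniq g' g (0, 0)); rewrite E sdmul1.
Qed.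

(** A set without two points in the same H-orbit is cut into countably many pieces that H moves
    disjointly into D. *)
Lemma lattice_packing (B : set (Brl X)) : measurable B ->
  (forall g x x', H g -> B x -> B x' -> mul g x = x' -> g = (0, 0)) -> (m B <= m D)%E.
Proof.
move=> mB Bfree.
have mm g (C : set (Brl X)) : measurable C -> measurable (mul g @^-1` C : set (Brl X)).
  by move=> mC; apply: (continuous_borel (@sdprod_mul_continuous _ _ A g) mC).
apply: (@packing _ (Brl X) R m X H mul (fun g => mul (sdinv A g)) B D) => //.
- exact: lattice_countable.
- by move=> g x; rewrite sdmulA// sdVmul// sdmul1.
- by move=> g x; rewrite sdmulA// sdmulV// sdmul1.
- by move=> g; exact: mm.
- by move=> g C Hg mC; rewrite (ld_inv ld).
- exact: (ld_D ld).
- by move=> x _; have [g [[Hg Dg] _]] := ld_fd ld x; exists g.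
- move=> g g' x x' Hg Hg' Bx Bx' E; apply/(@lattice_uniq g g' (0, 0)).
  rewrite (Bfree (mul (sdinv A g') g) x x') ?sdmul1//.
    by apply: (ld_mul ld) => //; exact: (ld_inverse ld).
  by rewrite -sdmulA// E sdmulA// sdVmul// sdmul1.
Qed.

Lemma lattice_discrete : exists2 d : R, 0 < d &
  forall g, H g -> (forall i, `|g.1 i 0| < d) -> `|g.2| < d -> g = (0, 0).
Proof.
have [U [oU U1] UH] := ld_disc ld.
have /nbhs_ballP[d /= d0 dU] : nbhs ((0, 0) : X) U by exact: open_nbhs_nbhs.
exists d => // g Hg g1 g2; apply: UH => //; apply: dU; split; last by rewrite /ball/= sub0r normrN.
by split => // i j; rewrite !ord1 mxE /ball/= sub0r normrN.
Qed.

Lemma small_flow (v : V) (d : R) : 0 < d ->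
  exists2 e : R, 0 < e & forall s, `|s| < e -> forall i, `|(A s *m v - v) i 0| < d.
Proof.
move=> d0; have c : (fun s => A s *m v) @ (0 : R) --> v.
  rewrite -[X in _ --> X]mul1mx -(rep0 repA).
  by apply: (cvg_mulmx (nbhs_filter (0 : R))); [exact: A_cont|exact: cvg_cst].
have /nbhs_ballP[e /= e0 eP] := c _ (nbhsx_ballx v _ d0).
exists e => // s se i; have [_ /(_ i 0)] : ball v d (A s *m v).
  by apply: eP; rewrite /ball/= sub0r normrN.
by rewrite /ball/= distrC !mxE.
Qed.

(** Conjugation by g acts on the translations of H through the linear part of g. *)
Lemma lattice_conj g l : H g -> H (l, 0) -> H (A g.2 *m l, 0).
Proof.
move=> Hg Hl; have := ld_mul ld (ld_mul ld Hg Hl) (ld_inverse ld Hg).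
rewrite /sdprod_mul/= addr0 mulmxN mulmxA repN// mul1mx subrr.
by rewrite [g.1 + _]addrC addrK.
Qed.

Lemma lattice_sub l l' : H (l, 0) -> H (l', 0) -> H (l - l', 0).
Proof.
move=> Hl Hl'; have := ld_mul ld Hl (ld_inverse ld Hl').
by rewrite /sdprod_mul/sdinv/= rep0// oppr0 rep0// !mul1mx addr0.
Qed.

Lemma fixed_point (g : X) : g.2 != 0 -> exists p, A g.2 *m p + g.1 = p.
Proof.
move=> g0; have u : 1%:M - GLmx (A g.2) \in unitmx.
  apply: unitmx_of_ker => v; rewrite mulmxBl mul1mx => /eqP; rewrite subr_eq0 => /eqP E.
  by apply: (A_fix g0); rewrite -E.
exists (invmx (1%:M - GLmx (A g.2)) *m g.1).
set p := invmx _ *m _; have : (1%:M - GLmx (A g.2)) *m p = g.1 by rewrite /p mulKVmx.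
by rewrite mulmxBl mul1mx => <-; rewrite addrC subrK.
Qed.

(** If H contains a translation l <> 0, an element of small time moves l by less than the isolation
    radius, hence fixes it, which for nonzero time is excluded. If H has no nonzero translation, all
    commutators with g0 are trivial, so every element fixes the fixed point p of g0; its translation
    part is then small when its time is small, and discreteness applies. *)
Lemma times_discrete : exists2 e : R, 0 < e & forall g, H g -> `|g.2| < e -> g.2 = 0.
Proof.
have [d d0 dH] := lattice_discrete.
have [[g0 [Hg0 t0]]|all0] := EM (exists g, H g /\ g.2 != 0); last first.
  exists 1 => // g Hg _; apply/eqP; apply: contrapT => /negP g0; apply: all0.
  by exists g.
have [[l [Hl l0]]|L0] := EM (exists l : V, H (l, 0) /\ l != 0).
  have [e e0 eP] := small_flow l d0.
  exists e => // g Hg ge; apply/eqP; apply: contraNT l0 => g20; apply/eqP; apply: (A_fix g20).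
  have Hc := lattice_sub (lattice_conj Hg Hl) Hl.
  have : (A g.2 *m l - l, 0) = (0, 0) :> X.
    by apply: dH Hc _ _; [exact: eP|rewrite normr0].
  by move=> [/eqP]; rewrite subr_eq0 => /eqP.
have [p pE] := fixed_point t0.
have [e e0 eP] := small_flow p d0.
exists (Num.min e d); first by rewrite lt_min e0 d0.
move=> g Hg; rewrite lt_min => /andP[ge gd].
have gE : g.1 = p - A g.2 *m p.
  pose b := A g.2 *m p + g.1 - p.
  (* This is the commutator of g0 and g; b is the displacement of p under g. *)
  have Hc : H (A g0.2 *m b - b, 0).
    have := ld_mul ld (ld_mul ld Hg0 Hg) (ld_mul ld (ld_inverse ld Hg0) (ld_inverse ld Hg)).
    rewrite /sdprod_mul/sdinv/= (_ : g0.2 + g.2 + _ = 0); last by ring.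
    have -> : g0.1 = p - A g0.2 *m p by rewrite -[X in X - _]pE addrC addKr.
    rewrite !(mulmxDr, mulmxN, mulmxA) -!(repD repA).
    have e1 : g0.2 + g.2 - g0.2 = g.2 by rewrite addrC addKr.
    rewrite e1 (addrC g.2 g0.2) (subrr g.2) (rep0 repA) mul1mx /b.
    move: (A g0.2 *m p) (A g0.2 *m g.1) (A g.2 *m p) (A (g0.2 + g.2) *m p) => u1 u2 u3 u4.
    rewrite (_ : p - u1 + u2 + _ = u4 + u2 - u1 - (u3 + g.1 - p))//.
    by apply/colP => i; rewrite !mxE; ring.
  have : A g0.2 *m b = b.
    apply/eqP; rewrite -subr_eq0; apply/eqP; apply: contrapT => /eqP nz.
    by apply: L0; exists (A g0.2 *m b - b).
  move=> /(A_fix t0)/eqP; rewrite subr_eq0 => /eqP E.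
  by rewrite -[X in X - _ *m _]E addrC addKr.
have : g = (0, 0).
  apply: dH => // i; rewrite gE -normrN; have := eP _ ge i.
  by rewrite !mxE opprB.
by move=> ->.
Qed.

Local Notation nu a b := (slab_measure m a b).

Lemma slab_shift a b s (B : set (Brl V)) : measurable B ->
  nu (a - s) (b - s) ((fun x => A s *m x) @^-1` B) = nu a b B.
Proof.
move=> mB; rewrite /slab_measure -[RHS](ld_inv ld (0, s)); last exact: slab_borel.
congr (m _); apply/seteqP; split => x; rewrite /slab/= add0r => -[Bx /andP[h1 h2]];
  split => //; apply/andP; split; lra.
Qed.

Lemma slab_translate a b u (B : set (Brl V)) : measurable B ->
  nu a b ((fun x => x + u) @^-1` B) = nu a b B.
Proof.
move=> mB; rewrite /slab_measure -[RHS](ld_inv ld (u, 0)); last exact: slab_borel.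
congr (m _); apply/seteqP; split => x; rewrite /slab/= rep0// mul1mx add0r;
  by rewrite addrC.
Qed.

Lemma slab_cell_fin a b : (nu a b (cell 0 0) < +oo)%E.
Proof.
pose M := 1 + `|a| + `|b|.
have M1 : 1 <= M by rewrite /M -addrA lerDl addr_ge0.
apply: le_lt_trans (ld_compact ld (box_compact (N := N) (M := M))).
apply: le_measure; rewrite ?inE.
- exact: (slab_borel a b (@cell_measurable R N 0 0)).
- exact: (closed_borel (compact_closed (@norm_hausdorff R X) (@box_compact R N M))).
- move=> x [/cellP x1 /andP[x2 x3]]; split.
    move=> i; have := x1 i; rewrite mxE expr0 mul1r ler_norml => /andP[h1 h2].
    by apply/andP; split; lra.
  rewrite /M ler_norml; have := ler_norm a; have := ler_norm (- a); have := ler_norm b; have := ler_norm (- b).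
  by rewrite !normrN => *; apply/andP; split; lra.
Qed.

(** If the unit cell were null for one slab, so would be all its translates, hence R^N; shifting
    times would make all slabs of the same height null, hence the whole group. *)
Lemma slab_cell_pos a h : 0 < h -> (0 < nu a (a + h) (cell 0 0))%E.
Proof.
move=> h0; rewrite lt_neqAle measure_ge0 andbT eq_sym; apply/negP => /eqP z.
have z0 s (B : set (Brl V)) : measurable B -> nu s (s + h) B = 0.
  move=> mB.
  have zc c : nu a (a + h) (cell 0 c) = 0 by rewrite -z; apply: nu_cell => u C; exact: slab_translate.
  have zT : nu a (a + h) setT = 0.
    have -> : [set: V] = \bigcup_(c in [set: 'cV[int]_N]) cell 0 c.
      by apply/seteqP; split => // x _; exists (cell_index 0 x).
    by apply: (@countable_union_null _ (Brl V)) => // c; exact: cell_measurable.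
  rewrite -(slab_shift s (s + h) (s - a) mB).
  have e1 : s - (s - a) = a by ring.
  have e2 : s + h - (s - a) = a + h by ring.
  rewrite e1 e2.
  apply/eqP; rewrite eq_le measure_ge0 andbT -zT.
  apply: le_measure; rewrite ?inE//.
  apply: continuous_borel mB => x; apply: (cvg_mulmx (nbhs_filter x)); [exact: cvg_cst|exact: cvg_id].
have := ld_pos ld; have -> : [set: X] = \bigcup_(i in [set: int]) slab (i%:~R * h) (i%:~R * h + h) setT.
  apply/seteqP; split => // x _; exists (Num.floor (x.2 / h)) => //; split => //.
  have := floor_le (x.2 / h); have := floorD1_gt (x.2 / h).
  rewrite ltr_pdivrMr// ler_pdivlMr// intrD mulrDl mul1r => -> ->.
  by [].
rewrite (@countable_union_null _ (Brl X) _ m); first by rewrite ltxx.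
- by move=> i; apply: slab_borel.
- by move=> i; exact: z0.
Qed.

Lemma flow_continuous s : continuous (fun x : V => A s *m x).
Proof. by move=> x; apply: (cvg_mulmx (nbhs_filter x)); [exact: cvg_cst|exact: cvg_id]. Qed.

(** By left invariance under (0, s), pulling back by A s replaces the slab [0, 1) by [s, s + 1).
    Both slabs give translation-invariant measures, which uniqueness makes proportional. *)
Lemma flow_scaling : exists c : R -> R, [/\ forall s, 0 < c s,
  forall s (B : set (Brl V)), measurable B -> nu 0 1 ((fun x => A s *m x) @^-1` B) = ((c s)%:E * nu 0 1 B)%E
  & forall s s', c (s + s') = c s * c s'].
Proof.
pose q s := fine (nu s (s + 1) (cell 0 0)).
have qE s : nu s (s + 1) (cell 0 0) = (q s)%:E.
  by rewrite fineK// ge0_fin_numE//; exact: slab_cell_fin.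
have q0 s : 0 < q s by rewrite -lte_fin -qE; exact: slab_cell_pos.
have cE s (B : set (Brl V)) : measurable B ->
    nu 0 1 ((fun x => A s *m x) @^-1` B) = ((q s / q 0)%:E * nu 0 1 B)%E.
  move=> mB; have -> : nu 0 1 ((fun x => A s *m x) @^-1` B) = nu s (s + 1) B.
    by rewrite -(slab_shift s (s + 1) s mB) subrr addrAC subrr add0r.
  have E : (nu s (s + 1) (cell 0 0) * nu 0 1 B = nu 0 1 (cell 0 0) * nu s (s + 1) B)%E.
    apply: haar_unique mB; [move=> u C; exact: slab_translate|move=> u C; exact: slab_translate| |];
      exact: slab_cell_fin.
  have q0E : nu 0 1 (cell 0 0) = (q 0)%:E by rewrite -qE add0r.
  rewrite qE q0E in E.
  by rewrite mulrC EFinM -muleA E muleA -EFinM mulVf ?gt_eqF// mul1e.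
exists (fun s => q s / q 0); split=> [s|s B|s s']; first by rewrite divr_gt0.
  exact: cE.
have mQ := @cell_measurable R N 0 0.
have mQs : measurable ((fun x => A s *m x) @^-1` (cell 0 0) : set (Brl V)).
  exact: (continuous_borel (@flow_continuous s) mQ).
have : nu 0 1 ((fun x => A (s + s') *m x) @^-1` cell 0 0) =
    nu 0 1 ((fun x => A s' *m x) @^-1` ((fun x => A s *m x) @^-1` cell 0 0)).
  by congr (nu 0 1 _); apply/seteqP; split => x; rewrite /= repD// mulmxA.
rewrite (cE _ _ mQ) (cE _ _ mQs) (cE _ _ mQ).
have -> : nu 0 1 (cell 0 0) = (q 0)%:E by rewrite -qE add0r.
rewrite -!EFinM => -[]; rewrite divfK ?gt_eqF// => ->.
by rewrite divfK ?gt_eqF// [RHS]mulrC mulrA.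
Qed.

Lemma slab_cellk_pos a h k : 0 < h -> (0 < nu a (a + h) (cell k 0))%E.
Proof.
move=> h0; rewrite lt_neqAle measure_ge0 andbT eq_sym; apply/negP => /eqP z.
have E := @nu_cellX _ _ (nu a (a + h)) (fun u C => @slab_translate a (a + h) u C) k.
have := slab_cell_pos a h0; rewrite E.
by rewrite -[X in (_ * X)%E]/(nu a (a + h) (cell k 0)) z mule0 ltxx.
Qed.

Lemma cell0_dist k (d : R) (x y : V) i : (2 ^+ k)^-1 < d -> cell k 0 x -> cell k 0 y -> `|x i 0 - y i 0| < d.
Proof. by move=> kd xQ yQ; apply: lt_trans kd; apply: same_cell_dist; rewrite xQ yQ. Qed.

(** If all times in H were 0, the slabs [t n, t n + 1) over one small cell, with t n = n or t n = -
    n, would be disjoint and their union would meet every H-orbit at most once. The sign [sg] is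
    chosen so that the scaling factor is at least 1, which keeps the measures bounded below. *)
Lemma exists_time : exists2 g, H g & g.2 != 0.
Proof.
apply: contrapT => no.
have all0 g : H g -> g.2 = 0.
  by move=> Hg; apply/eqP; apply: contrapT => /negP g2; apply: no; exists g.
have [d d0 dH] := lattice_discrete; have [k kd] := exists_pow2 d0.
have [c [c0 cE cM]] := flow_scaling.
have c00 : c 0 = 1 by apply: (mulfI (lt0r_neq0 (c0 0))); rewrite -cM addr0 mulr1.
have [sg [sg1 cs]] : exists sg : int, `|sg| = 1 /\ 1 <= c sg%:~R.
  have [h|h] := lerP 1 (c 1); first by exists 1.
  exists (- 1); split => //; rewrite rmorphN/=; have : c 1 * c (- 1) = 1 by rewrite -cM subrr.
  by move=> E; rewrite leNgt; apply/negP => h'; have := c0 1; have := c0 (- 1); nra.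
have csn n : 1 <= c (n%:R * sg%:~R).
  elim: n => [|n IH]; first by rewrite mul0r c00.
  by rewrite -natr1 mulrDl mul1r cM; have := c0 (n%:R * sg%:~R); nra.
pose t n : R := n%:R * sg%:~R.
pose F n := slab (t n) (t n + 1) (cell k (0 : 'cV[int]_N)).
have mQ := @cell_measurable R N k 0.
have Fm n : measurable (F n : set (Brl X)) by exact: slab_borel.
suff : (nu 0 (0 + 1) (cell k 0) <= 0)%E by rewrite leNgt slab_cellk_pos.
apply: (@disjoint_bounded _ (Brl X) _ m F _ (m D)) => //; last exact: (ld_fin ld).
- move=> i j _ _ [x [[_ xi] [_ xj]]].
  have E z : t z = (z%:Z * sg)%:~R by rewrite intrM.
  move: xi xj; rewrite !E -!(intrD _ _ 1) => /andP[i1 i2] /andP[j1 j2].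
  have h1 := le_lt_trans i1 j2; have h2 := le_lt_trans j1 i2.
  rewrite !ltr_int in h1 h2; have : i%:Z * sg = j%:Z * sg by lia.
  have : sg = 1 \/ sg = -1 by lia.
  by move=> [->|->]; lia.
- move=> n; have -> : m (F n) = nu 0 1 ((fun x => A (t n) *m x) @^-1` cell k 0).
    rewrite -[LHS]/(nu (t n) (t n + 1) (cell k 0)) -(slab_shift (t n) (t n + 1) (t n) mQ).
    by rewrite subrr addrAC subrr add0r.
  by rewrite cE// add0r -[X in (X <= _)%E]mul1e lee_wpmul2r// lee_fin csn.
- apply: lattice_packing; first exact: bigcupT_measurable.
  move=> g x x' Hg [n _ [xQ _]] [n' _ [x'Q _]] E.
  apply: dH => //; last by rewrite all0// normr0.
  move=> i; have := congr1 (fun p => p.1) E; rewrite /sdprod_mul/= all0// rep0// mul1mx => E1.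
  have := cell0_dist i kd x'Q xQ; rewrite -E1 mxE.
  by rewrite addrK.
Qed.

(** If lam <> 0 killed all translations of H, the translates of a small cell by n e, where lam e =
    1, could not be identified by H, since lam separates them. Times are confined to [0, h) so that
    two points of the slab are related only by pure translations. *)
Lemma lattice_spans (lam : 'rV[R]_N) : (forall l, H (l, 0) -> lam *m l = 0) -> lam = 0.
Proof.
move=> lamL; apply/eqP; apply: contrapT => /negP lam0.
have [i0 li0] : exists i, lam 0 i != 0.
  apply: contrapT => no; case/negP: lam0; apply/eqP/rowP => i; rewrite mxE; apply/eqP.
  by apply: contrapT => /negP h; apply: no; exists i.
have [e lame] : exists e : V, (lam *m e) 0 0 = 1.
  exists ((lam 0 i0)^-1 *: delta_mx i0 0); rewrite -scalemxAr mxE mxE (bigD1 i0)//= big1 => [|j ji]; last by rewrite mxE (negbTE ji) mulr0.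
  by rewrite mxE !eqxx mulr1 addr0 mulVf.
have [d d0 dH] := lattice_discrete; have [h h0 hH] := times_discrete.
pose M := 1 + \sum_i `|lam 0 i|.
have M0 : 0 < M by rewrite /M ltr_pwDl// sumr_ge0.
(* A side below d prevents nonzero translations of H from relating two points of the cell; a side
   below M^-1 makes lam vary by less than 1 on it. *)
have [k] : exists k, (2 ^+ k)^-1 < Num.min d M^-1 by apply: exists_pow2; rewrite lt_min d0 invr_gt0.
rewrite lt_min => /andP[kd kM].
have lamQ (x y : V) : cell k 0 x -> cell k 0 y -> `|(lam *m (x - y)) 0 0| < 1.
  move=> xQ yQ; rewrite mxE; apply: le_lt_trans (ler_norm_sum _ _ _) _.
  apply: (@le_lt_trans _ _ (\sum_i `|lam 0 i| * M^-1)).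
    apply: ler_sum => i _; rewrite normrM ler_wpM2l// !mxE; apply: ltW.
    exact: cell0_dist kM xQ yQ.
  by rewrite -mulr_suml ltr_pdivrMr// mul1r /M ltrDr.
pose F n := slab 0 h ((fun x : V => x - n%:R *: e) @^-1` cell k (0 : 'cV[int]_N)).
have mQ := @cell_measurable R N k 0.
have mQn n : measurable ((fun x : V => x - n%:R *: e) @^-1` cell k (0 : 'cV[int]_N) : set (Brl V)).
  apply: continuous_borel mQ => x; apply: (@cvgB R V _ (nbhs x)); [exact: cvg_id|exact: cvg_cst].
have Fm n : measurable (F n : set (Brl X)) by exact: slab_borel.
have same n n' (x x' : V) : cell k 0 (x - n%:R *: e) -> cell k 0 (x' - n'%:R *: e) ->
    lam *m x = lam *m x' -> n = n'.
  move=> xn xn' xx; have := lamQ _ _ xn xn'.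
  have -> : (lam *m (x - n%:R *: e - (x' - n'%:R *: e))) 0 0 = n'%:R - n%:R.
    rewrite !mulmxBr xx -!scalemxAr.
    move: (lam *m e) lame (lam *m x') => le lee w; rewrite !mxE lee; ring.
  rewrite (_ : n'%:R - n%:R = (n'%:Z - n%:Z)%:~R :> R); last by rewrite intrD rmorphN.
  by rewrite -intr_norm -[1]/(1%:~R) ltr_int; lia.
suff : (nu 0 (0 + h) (cell k 0) <= 0)%E by rewrite leNgt slab_cellk_pos.
apply: (@disjoint_bounded _ (Brl X) _ m F _ (m D)) => //; last exact: (ld_fin ld).
- by move=> i j _ _ [x [[xi _] [xj _]]]; exact: same xi xj _.
- move=> n; have -> : m (F n) = nu 0 h ((fun x : V => x + - (n%:R *: e)) @^-1` cell k 0) by [].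
  by rewrite slab_translate// add0r.
- apply: lattice_packing; first exact: bigcupT_measurable.
  move=> g x x' Hg [n _ [xQ /andP[x1 x2]]] [n' _ [x'Q /andP[x1' x2']]] E.
  have g2 : g.2 = 0.
    apply: hH => //; have := congr1 (fun p => p.2) E; rewrite /sdprod_mul/= => E2.
    by rewrite ltr_norml; apply/andP; split; lra.
  have := congr1 (fun p => p.1) E; rewrite /sdprod_mul/= g2 rep0// mul1mx => E1.
  have Hl : H (g.1, 0) by rewrite -g2 -surjective_pairing.
  have nn' : n = n'.
    apply: (same n n' x.1 x'.1 xQ x'Q).
    by rewrite -E1 mulmxDr (lamL _ Hl) add0r.
  apply: dH => //; last by rewrite g2 normr0.
  move=> i; have := cell0_dist i kd x'Q xQ; rewrite -nn' -E1 !mxE.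
  by rewrite opprB addrA subrK addrK.
Qed.

End LatticeStructure.

(** * Discrete subgroups of R^N *)

(** Cramer's rule for the identity matrix. *)
Lemma det_replace_col (F : comNzRingType) n (i : 'I_n) (y : 'cV[F]_n) :
  \det (\matrix_(k, j) if j == i then y k 0 else (k == j)%:R) = y i 0.
Proof.
set E := \matrix_(k, j) _.
have cE k : cofactor E k i = cofactor 1%:M k i.
  congr (_ * \det _); apply/matrixP => a b; rewrite !mxE.
  by rewrite eq_sym (negbTE (neq_lift _ _)).
rewrite (expand_det_col E i); under eq_bigr => k _ do rewrite cE mxE eqxx.
have adj1 : \adj (1%:M : 'M[F]_n) = 1%:M by rewrite -[LHS]mul1mx mul_mx_adj det1.
transitivity ((\adj (1%:M : 'M[F]_n) *m y) i 0); last by rewrite adj1 mul1mx.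
by rewrite mxE; apply: eq_bigr => k _; rewrite mxE mulrC.
Qed.

Section ZBasis.
Variables (R : realType) (N : nat).
Local Notation V := 'cV[R]_N.
Variables (L : set V) (d : R).
Hypothesis L0 : L 0.
Hypothesis L_sub : forall l l', L l -> L l' -> L (l - l').
Hypothesis d_gt0 : 0 < d.
Hypothesis L_disc : forall l, L l -> (forall i, `|l i 0| < d) -> l = 0.
Hypothesis L_span : forall lam : 'rV[R]_N, (forall l, L l -> lam *m l = 0) -> lam = 0.
Local Notation toR := (map_mx (intr : int -> R)).

Lemma subgroupD l l' : L l -> L l' -> L (l + l').
Proof. by move=> Ll Ll'; rewrite -[l']opprK; apply: L_sub => //; rewrite -sub0r; exact: L_sub. Qed.

Lemma subgroupZ (z : int) l : L l -> L (z%:~R *: l).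
Proof.
move=> Ll; have H n : L (n%:R *: l).
  by elim: n => [|n IH]; rewrite ?scale0r// -natr1 scalerDl scale1r; exact: subgroupD.
case: z => n; first exact: H.
by rewrite NegzE rmorphN/= scaleNr -sub0r; apply: L_sub => //; exact: H.
Qed.

Lemma subgroup_comb (S : 'M[R]_N) (z : 'cV[int]_N) : (forall j, L (col j S)) -> L (S *m toR z).
Proof.
move=> LS; have -> : S *m toR z = \sum_j (z j 0)%:~R *: col j S.
  apply/colP => i; rewrite mxE summxE; apply: eq_bigr => j _.
  by rewrite !mxE mulrC.
elim/big_rec: _ => // j x _ Lx.
by apply: subgroupD => //; exact: subgroupZ.
Qed.

(** While fewer than N vectors are chosen, some v <> 0 is orthogonal to them all; by the spanning
    hypothesis some l in L is not orthogonal to v and can be added. *)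
Lemma exists_frame : exists2 S : 'M[R]_N, S \in unitmx & forall j, L (col j S).
Proof.
suff : exists2 B : 'M[R]_N, row_free B & forall i, L (row i B)^T.
  move=> [B Bf BL]; exists B^T; first by rewrite unitmx_tr -row_free_unit.
  by move=> j; rewrite -tr_row.
have H r : (r <= N)%N -> exists2 B : 'M[R]_(r, N), row_free B & forall i, L (row i B)^T.
  elim: r => [|r IH] rN.
    exists 0; last by case.
    by rewrite /row_free mxrank0.
  have [B Bf BL] := IH (ltnW rN).
  have [v v0 Bv] : exists2 v : V, v != 0 & B *m v = 0.
    have : cokermx B != 0.
      by rewrite -mxrank_eq0 mxrank_coker (eqP Bf) -lt0n subn_gt0.
    move=> cB; apply: contrapT => no; case/eqP: cB; apply/matrixP => i j; rewrite [RHS]mxE.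
    have [cj|cj] := eqVneq (col j (cokermx B)) 0.
      by have := congr1 (fun w : V => w i 0) cj; rewrite !mxE.
    by case: no; exists (col j (cokermx B)) => //; rewrite colE mulmxA mulmx_coker mul0mx.
  have [l Ll vl] : exists2 l, L l & v^T *m l != 0.
    apply: contrapT => no; case/eqP: v0; apply: trmx_inj; rewrite trmx0; apply: L_span => l Ll.
    by apply/eqP; apply: contrapT => /negP h; apply: no; exists l.
  rewrite -addn1; exists (col_mx B l^T).
    rewrite -kermx_eq0; apply/eqP/row_matrixP => i; rewrite row0.
    set u := row i _; have : u *m col_mx B l^T = 0 by rewrite -row_mul mulmx_ker row0.
    rewrite -[u]hsubmxK mul_row_col => E.
    have u2 : rsubmx u = 0.
      have := congr1 (fun w => w *m v) E; rewrite /= mulmxDl mul0mx -mulmxA Bv mulmx0 add0r.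
      rewrite -mulmxA; have -> : l^T *m v = (v^T *m l)^T by rewrite trmx_mul trmxK.
      rewrite [rsubmx u]mx11_scalar mul_scalar_mx => /eqP; rewrite scaler_eq0 (_ : (_^T == 0) = false).
        by rewrite orbF => /eqP ->; rewrite raddf0.
      by apply/negbTE; apply: contra vl => /eqP h; rewrite -[X in X == _]trmxK h trmx0.
    move: E; rewrite u2 mul0mx addr0 => /eqP; rewrite mulmx_free_eq0// => /eqP ->.
    exact: row_mx0.
  move=> i; case: (splitP i) => j ij.
    have -> : i = lshift 1 j by exact/val_inj.
    by rewrite rowKu.
  have -> : i = rshift r j by exact/val_inj.
  by rewrite rowKd row_id trmxK.
exact: H.
Qed.

Let frac (x : R) := x - (Num.floor x)%:~R.
Let frac_itv x : 0 <= frac x < 1.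
Proof.
have := floor_le x; have := floorD1_gt x; rewrite /frac intrD => h1 h2.
by apply/andP; split; lra.
Qed.

(** Pigeonhole: among F + 1 multiples of x, two have fractional parts in the same cube of side 1 /
    K. Their difference gives an element of L too short to be nonzero, so some k' - k <= F clears
    the denominators of x, and F! does so for every l at once. *)
Lemma common_denominator (S : 'M[R]_N) : S \in unitmx -> (forall j, L (col j S)) ->
  exists2 q : nat, (0 < q)%N & forall l, L l -> exists z : 'cV[int]_N, q%:R *: (invmx S *m l) = toR z.
Proof.
move=> Su LS.
pose c := 1 + \sum_i \sum_j `|S i j|.
have c0 : 0 < c by rewrite /c ltr_pwDl// sumr_ge0// => i _; apply: sumr_ge0.
(* Chosen so that S sends vectors with entries at most 1 / K to vectors with entries below the
   isolation radius d. *)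
pose K := (Num.truncn (c / d)).+1.
have Kc : c / K%:R < d by rewrite ltr_pdivrMr ?ltr0n// mulrC -ltr_pdivrMr// truncnS_gt.
pose F := #|{ffun 'I_N -> 'I_K}|.
exists F`!; first exact: fact_gt0.
move=> l Ll; have [x xE] : exists x, x = invmx S *m l by exists (invmx S *m l).
pose h (k : nat) i := Num.floor (K%:R * frac (k%:R * x i 0)).
have hK k i : (absz (h k i) < K)%N /\ 0 <= h k i.
  have /andP[f0 f1] := frac_itv (k%:R * x i 0).
  have h0 : 0 <= h k i by rewrite /h floor_ge0 mulr_ge0.
  have : h k i < K%:Z.
    by rewrite /h floor_lt_int -[K%:Z%:~R]/(K%:R) -[X in _ < X]mulr1 ltr_pM2l ?ltr0n.
  by split => //; lia.
pose f (k : 'I_F.+1) : {ffun 'I_N -> 'I_K} := [ffun i => Ordinal (hK k i).1].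
have [k [k' [kk' fk]]] : exists k k' : 'I_F.+1, (k < k')%N /\ f k = f k'.
  apply: contrapT => no; have : injective f.
    move=> k k' fkk'; apply/val_inj/eqP; rewrite eqn_leq; apply/andP; split; rewrite leqNgt;
      apply/negP => lt; apply: no; [exists k', k|exists k, k']; by split.
  by move=> /leq_card; rewrite card_ord -/F ltnn.
have fr i : frac (k%:R * x i 0) = frac (k'%:R * x i 0).
  pose w := S *m (\col_i (frac (k'%:R * x i 0) - frac (k%:R * x i 0))).
  have wE : w = (k' - k)%N%:R *: l - S *m toR (\col_i (Num.floor (k'%:R * x i 0) - Num.floor (k%:R * x i 0))).
    have -> : (k' - k)%N%:R *: l = S *m ((k' - k)%N%:R *: x).
      by rewrite -scalemxAr xE mulKVmx.
    rewrite -mulmxBr; congr (_ *m _).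
    by apply/colP => j; rewrite !mxE natrB ?(ltnW kk')// intrB /frac; ring.
  have Lw : L w.
    by rewrite wE; apply: L_sub; [exact: (@subgroupZ (k' - k)%N)|exact: subgroup_comb].
  have w0 : w = 0.
    apply: L_disc => // a; apply: le_lt_trans Kc; rewrite mxE.
    apply: le_trans (ler_norm_sum _ _ _) _.
    apply: (@le_trans _ _ (\sum_j `|S a j| * K%:R^-1)).
      apply: ler_sum => j _; rewrite normrM ler_wpM2l// mxE.
      have /(congr1 val)/= := congr1 (fun g : {ffun _} => g j) fk; rewrite !ffunE/= => hh.
      have {}hh : h k j = h k' j by have := (hK k j).2; have := (hK k' j).2; lia.
      have K0 : 0 < K%:R :> R by rewrite ltr0n.
      rewrite -[X in _ <= X]mul1r ler_pdivlMr// -[X in _ * X]gtr0_norm// -normrM mulrBl ler_norml.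
      have := floor_le (K%:R * frac (k%:R * x j 0)); have := floorD1_gt (K%:R * frac (k%:R * x j 0)).
      have := floor_le (K%:R * frac (k'%:R * x j 0)); have := floorD1_gt (K%:R * frac (k'%:R * x j 0)).
      rewrite -/(h k j) -/(h k' j) hh intrD => *; apply/andP; split; lra.
    rewrite -mulr_suml ler_wpM2r ?invr_ge0//.
    rewrite /c; apply: le_trans (_ : \sum_i \sum_j `|S i j| <= _); last by rewrite lerDr.
    rewrite [leRHS](bigD1 a)//= lerDl; apply: sumr_ge0 => b _; exact: sumr_ge0.
  have := congr1 (fun v : V => (invmx S *m v) i 0) w0; rewrite /w mulKmx// mulmx0 !mxE.
  by move=> /eqP; rewrite subr_eq0 => /eqP ->.
have [z zE] : exists z : 'cV[int]_N, (k' - k)%N%:R *: x = toR z.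
  exists (\col_i (Num.floor (k'%:R * x i 0) - Num.floor (k%:R * x i 0))).
  apply/colP => i; rewrite !mxE natrB ?(ltnW kk')// intrB; have := fr i; rewrite /frac.
  by rewrite mulrBl; lra.
have dv : (k' - k %| F`!)%N.
  apply: dvdn_fact; rewrite subn_gt0 kk'/=.
  by have := ltn_ord k'; lia.
exists ((F`! %/ (k' - k))%N%:Z *: z).
rewrite -xE -(divnK dv) natrM -scalerA zE; apply/colP => i.
by rewrite !mxE intrM (divnK dv).
Qed.

(** A frame in L of least |determinant| is a basis. The minimum exists because the common
    denominator q makes the rescaled determinants integers; a coordinate with nonzero fractional
    part would allow exchanging a column and multiplying the determinant by a number strictly
    between 0 and 1. *)
Lemma Z_basis : exists2 S : 'M[R]_N, S \in unitmx &
  forall l, L l <-> exists z : 'cV[int]_N, l = S *m toR z.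
Proof.
have [S0 S0u S0L] := exists_frame.
have [q q0 qL] := common_denominator S0u S0L.
pose D (S : 'M[R]_N) := \det (q%:R *: (invmx S0 *m S)).
have DM (S E : 'M[R]_N) : D (S *m E) = D S * \det E.
  by rewrite /D mulmxA scalemxAl det_mulmx.
have D0 S : (D S != 0) = (S \in unitmx).
  rewrite /D detZ det_mulmx !mulf_eq0 expf_eq0 !negb_or pnatr_eq0.
  rewrite (gtn_eqF q0) andbF/= -!unitfE -!unitmxE unitmx_inv S0u/=.
  by [].
have DN S : (forall j, L (col j S)) -> exists n : nat, `|D S| = n%:R.
  move=> SL; have /choice[z zP] : forall j, exists z : 'cV[int]_N, q%:R *: (invmx S0 *m col j S) = toR z.
    by move=> j; exact: qL.
  exists (absz (\det (\matrix_(i, j) z j i 0))).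
  have -> : D S = (\det (\matrix_(i, j) z j i 0))%:~R.
    rewrite -det_map_mx; congr (\det _); apply/matrixP => i j.
    have := congr1 (fun v : V => v i 0) (zP j).
    move=> E; transitivity ((q%:R *: (invmx S0 *m col j S)) i 0).
      by rewrite !mxE; congr (_ * _); apply: eq_bigr => k _; rewrite [in RHS]mxE.
    by rewrite E !mxE.
  by rewrite -intr_norm -abszE.
pose P n := `[< exists S, [/\ S \in unitmx, forall j, L (col j S) & `|D S| = n%:R] >].
have exP : exists n, P n.
  by have [n nE] := DN _ S0L; exists n; apply/asboolP; exists S0.
case: (ex_minnP exP) => n /asboolP[S [Su SL Sn]] nmin.
exists S => // l; split; last by move=> [z ->]; exact: subgroup_comb.
move=> Ll; have [x xE] : exists x, x = invmx S *m l by exists (invmx S *m l).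
suff xZ i : frac (x i 0) = 0.
  exists (\col_i Num.floor (x i 0)); rewrite -[LHS](mulKVmx Su) -xE; congr (_ *m _).
  apply/colP => i; rewrite !mxE; have := xZ i; rewrite /frac => /eqP.
  by rewrite subr_eq0 => /eqP.
apply/eqP; apply: contrapT => /negP fx0.
have /andP[f0 f1] := frac_itv (x i 0).
pose y := x - (Num.floor (x i 0))%:~R *: delta_mx i 0.
have yi : y i 0 = frac (x i 0) by rewrite !mxE !eqxx mulr1.
pose E : 'M[R]_N := \matrix_(k, j) if j == i then y k 0 else (k == j)%:R.
have dE : \det E = frac (x i 0) by rewrite det_replace_col yi.
have cE j : col j E = if j == i then y else delta_mx j 0.
  apply/colP => k; rewrite [LHS]mxE [LHS]mxE; case: eqP => // _.
  by rewrite mxE eqxx andbT.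
have S'L j : L (col j (S *m E)).
  rewrite colE -mulmxA -colE cE; case: eqP => _; last by rewrite -colE.
  rewrite /y mulmxBr xE mulKVmx// -scalemxAr -colE.
  by apply: L_sub => //; exact: subgroupZ.
have [n' n'E] := DN _ S'L.
have S'u : S *m E \in unitmx by rewrite unitmx_mul Su unitmxE dE unitfE.
have : (n <= n')%N by apply: nmin; apply/asboolP; exists (S *m E).
rewrite -(ler_nat R) -n'E DM dE normrM Sn (ger0_norm f0) leNgt; case/negP.
have : 0 < n%:R :> R by rewrite -Sn normr_gt0 D0.
by move=> n0; rewrite -[X in _ < X]mulr1 ltr_pM2l.
Qed.

End ZBasis.

Lemma lattice_automorphism (R : realType) N (S B B' : 'M[R]_N) : S \in unitmx ->
  B *m B' = 1%:M ->
  (forall z : 'cV[int]_N, exists w : 'cV[int]_N, B *m (S *m map_mx intr z) = S *m map_mx intr w) ->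
  (forall z : 'cV[int]_N, exists w : 'cV[int]_N, B' *m (S *m map_mx intr z) = S *m map_mx intr w) ->
  exists M M' : 'M[int]_N, [/\ B *m S = S *m map_mx intr M, M *m M' = 1%:M, M' *m M = 1%:M & `|\det B| = 1].
Proof.
move=> Su BB' BL BL'.
have mk (C : 'M[R]_N) : (forall z : 'cV[int]_N, exists w : 'cV[int]_N, C *m (S *m map_mx intr z) = S *m map_mx intr w) ->
    exists M : 'M[int]_N, C *m S = S *m map_mx intr M.
  move=> CL; have /choice[w wP] := fun j : 'I_N => CL (delta_mx j 0).
  exists (\matrix_(i, j) w j i 0).
  apply/matrixP => i j; have := wP j; rewrite (map_delta_mx (intr : {rmorphism int -> R})) mulmxA -colE.
  move=> /colP/(_ i); rewrite [X in X = _ -> _]mxE => ->; rewrite [LHS]mxE [RHS]mxE.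
  by apply: eq_bigr => k _; rewrite [in LHS]mxE [X in _ = _ * X]mxE [X in _ = _ * _ X]mxE.
have [M ME] := mk B BL; have [M' ME'] := mk B' BL'.
have MM : M *m M' = 1%:M.
  have E : map_mx (intr : int -> R) (M *m M') = 1%:M.
    transitivity (map_mx (intr : int -> R) M *m map_mx (intr : int -> R) M'); first exact: map_mxM.
    rewrite -[LHS](mulKmx Su) (mulmxA S) -ME -(mulmxA B) -ME' (mulmxA B) BB' mul1mx.
    by rewrite mulVmx.
  apply/matrixP => i j; apply: (@intr_inj R).
  transitivity (map_mx (intr : int -> R) (M *m M') i j); first by rewrite [RHS]mxE.
  by rewrite E !mxE; case: (i == j).
exists M, M'; split => //; first exact: mulmx1C.
have : \det M * \det M' = 1 by rewrite -det_mulmx MM det1.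
move=> /eqP; rewrite mulrC => dM.
have -> : \det B = (\det M)%:~R.
  apply: (mulIf (_ : \det S != 0)); first by rewrite -unitfE -unitmxE.
  by rewrite -det_mulmx ME det_mulmx mulrC det_map_mx.
rewrite -intr_norm; have := dM; move: (\det M) (\det M') => a b /eqP ab.
have : (absz b * absz a)%N = 1%N by rewrite -abszM ab.
by move=> /eqP; rewrite muln_eq1 => /andP[_ /eqP a1]; rewrite -abszE a1.
Qed.

(** * Invariant closed sets of a hyperbolic automorphism *)

Section FundamentalDomains.
Variables (R : realType) (N : nat).
Local Notation V := 'cV[R]_N.
Local Notation toR := (map_mx (intr : int -> R)).
Variable nu : {measure set (Brl V) -> \bar R}.
Hypothesis nu_inv : forall u (B : set (Brl V)), measurable B -> nu ((fun x => x + u) @^-1` B) = nu B.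
Hypothesis nu_fin : (nu (cell 0 0) < +oo)%E.
Hypothesis nu_pos : (0 < nu (cell 0 0))%E.
Variable S : 'M[R]_N.
Hypothesis Su : S \in unitmx.
Implicit Types (x u : V) (z : 'cV[int]_N) (W : set V).

Lemma shift_borel u (B : set (Brl V)) : measurable B -> measurable ((fun x => x + u) @^-1` B : set (Brl V)).
Proof.
move=> mB; apply: continuous_borel mB => x.
by apply: (@cvgD R V _ (nbhs x)); [exact: cvg_id|exact: cvg_cst].
Qed.

Lemma mulmx_borel (C : 'M[R]_N) (B : set (Brl V)) : measurable B ->
  measurable ((fun x => C *m x) @^-1` B : set (Brl V)).
Proof.
move=> mB; apply: continuous_borel mB => x.
by apply: (cvg_mulmx (nbhs_filter x)); [exact: cvg_cst|exact: cvg_id].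
Qed.

Lemma bounded_fin (K : set (Brl V)) (M : nat) : measurable K ->
  (forall x, K x -> forall i, `|x i 0| <= M%:R) -> (nu K < +oo)%E.
Proof.
move=> mK KM; have /finite_seqP[s sE] := finite_cells 0 KM.
pose F (i : 'I_(size (undup s))) := cell 0 (nth 0 (undup s) i) : set (Brl V).
have FE := @measure_finite_union _ (Brl V) R nu _ F (nu (cell 0 0)).
apply: le_lt_trans (_ : nu (\bigcup_(i in [set: 'I_(size (undup s))]) F i) < +oo)%E.
  apply: le_measure; rewrite ?inE//.
    by apply: fin_bigcup_measurable => [|i _]; [exact: finite_finset|exact: cell_measurable].
  move=> x Kx; have xs : cell_index 0 x \in undup s.
    have : [set` s] (cell_index 0 x) by rewrite -sE; exists x.
    by rewrite mem_undup.
  by exists (Ordinal (etrans (index_mem _ _) xs)) => //; rewrite /F /cell/= nth_index.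
rewrite FE.
- by rewrite lte_mul_pinfty// ge0_fin_numE.
- by move=> i; exact: cell_measurable.
- by move=> i; exact: nu_cell.
- move=> i j _ _ [x [xi xj]]; apply: val_inj; apply/eqP.
  rewrite -(nth_uniq 0 (ltn_ord i) (ltn_ord j) (undup_uniq s)).
  by rewrite -xi -xj.
Qed.

Definition fundamental W := [/\ measurable (W : set (Brl V)),
  forall x z, W x -> W (x + S *m toR z) -> z = 0 &
  forall x, exists z, W (x + S *m toR z)].

Definition periodic (F : set V) := forall x z, F x -> F (x + S *m toR z).

Lemma toRD z z' : toR (z + z') = toR z + toR z'.
Proof. by apply/colP => i; rewrite !mxE intrD. Qed.
Lemma toRN z : toR (- z) = - toR z.
Proof. by apply/colP => i; rewrite !mxE rmorphN. Qed.

(** Lattice translations move the pieces of one domain into the other, and the periodic set F is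
    carried along. *)
Lemma fundamental_le (F W W' : set V) : measurable (F : set (Brl V)) -> periodic F ->
  fundamental W -> fundamental W' -> (nu (F `&` W) <= nu (F `&` W'))%E.
Proof.
move=> mF pF [mW Wf _] [mW' _ Wc'].
apply: (@packing _ (Brl V) R nu 'cV[int]_N setT (fun z x => x + S *m toR z) (fun z x => x - S *m toR z)).
- exact: countableP.
- by move=> z x; rewrite addrK.
- by move=> z x; rewrite subrK.
- by move=> z B; exact: shift_borel.
- by move=> z B; exact: shift_borel.
- by move=> z B _; exact: nu_inv.
- exact: (@measurableI _ (Brl V)).
- exact: (@measurableI _ (Brl V)).
- by move=> x [Fx _]; have [z Wz] := Wc' x; exists z => //; split => //; exact: pF.
- move=> z z' x x' _ _ [_ Wx] [_ Wx'] E.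
  have : W (x' + S *m toR (z' - z)).
    by rewrite toRD toRN mulmxBr addrA -E addrK.
  by move=> /(Wf _ _ Wx')/eqP; rewrite subr_eq0 => /eqP.
Qed.

Lemma fundamental_eq (F W W' : set V) : measurable (F : set (Brl V)) -> periodic F ->
  fundamental W -> fundamental W' -> nu (F `&` W) = nu (F `&` W').
Proof. by move=> mF pF fW fW'; apply/eqP; rewrite eq_le !fundamental_le. Qed.

Lemma fundamental_shift W u : fundamental W -> fundamental ((fun x => x + u) @^-1` W).
Proof.
move=> [mW Wf Wc]; split; first exact: shift_borel.
- by move=> x z /= Wx; rewrite addrAC; exact: Wf.
- by move=> x; have [z Wz] := Wc (x + u); exists z; rewrite /= addrAC.
Qed.

Definition unit_domain : set V := [set x | cell 0 0 (invmx S *m x)].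

Lemma unit_domain_fundamental : fundamental unit_domain.
Proof.
split; first by apply: mulmx_borel; exact: cell_measurable.
- move=> x z; rewrite /unit_domain/= mulmxDr mulKmx// => /cellP h /cellP h'.
  apply/colP => i; have := h i; have := h' i; rewrite !mxE !expr0 !mul1r add0r.
  move=> /andP[a1 a2] /andP[b1 b2].
  have c1 : - 1 < z i 0 by rewrite -(ltr_int R) rmorphN/=; lra.
  have c2 : z i 0 < 1 by rewrite -(ltr_int R); lra.
  by lia.
- move=> x; exists (- cell_index 0 (invmx S *m x)).
  rewrite /unit_domain/= mulmxDr mulKmx//; apply/cellP => i.
  rewrite !mxE !expr0 !mul1r add0r rmorphN/=; set y := \sum_j _.
  by have := floor_le y; have := floorD1_gt y; rewrite intrD => h1 h2; apply/andP; split; lra.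
Qed.

Lemma unit_domain_fin : (nu unit_domain < +oo)%E.
Proof.
pose c := \sum_i \sum_j `|S i j|.
apply: (@bounded_fin _ (Num.truncn c).+1).
  by have [] := unit_domain_fundamental.
move=> x xW i; apply: ltW; apply: le_lt_trans (truncnS_gt c).
rewrite -[x](mulKVmx Su) mxE; apply: le_trans (ler_norm_sum _ _ _) _.
apply: (@le_trans _ _ (\sum_j `|S i j|)).
  apply: ler_sum => j _; rewrite normrM -[leRHS]mulr1 ler_wpM2l//.
  have /cellP/(_ j) := xW; rewrite mxE expr0 mul1r add0r => /andP[h1 h2].
  by rewrite ger0_norm; [exact: ltW|exact: h1].
rewrite /c [leRHS](bigD1 i)//= lerDl; apply: sumr_ge0 => b _; exact: sumr_ge0.
Qed.

Lemma periodic_null (F W : set V) : measurable (F : set (Brl V)) -> periodic F ->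
  fundamental W -> nu (F `&` W) = 0%E -> nu F = 0%E.
Proof.
move=> mF pF fW F0; have [mW Wf Wc] := fW.
have -> : F = \bigcup_(z in [set: 'cV[int]_N]) (F `&` (fun x => x + S *m toR z) @^-1` W).
  apply/seteqP; split => x; last by move=> [z _ []].
  by move=> Fx; have [z Wz] := Wc x; exists z.
apply: (@countable_union_null _ (Brl V)) => z.
  by apply: (@measurableI _ (Brl V)) => //; exact: shift_borel.
rewrite -F0; apply: fundamental_eq => //.
exact: fundamental_shift.
Qed.

Lemma fundamental_pos W : fundamental W -> (0 < nu W)%E.
Proof.
move=> fW; rewrite lt_neqAle measure_ge0 andbT eq_sym; apply/eqP => W0.
have : nu setT = 0%E.
  by apply: (@periodic_null setT W) => //; rewrite setTI.
move=> T0; have := nu_pos; rewrite ltNge => /negP; apply; rewrite -T0.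
by apply: le_measure; rewrite ?inE//; exact: cell_measurable.
Qed.

Section Hyperbolic.
Variables (B B' : 'M[R]_N) (M M' : 'M[int]_N) (chi : R).
Hypothesis BB' : B *m B' = 1%:M.
Hypothesis BM : B *m S = S *m toR M.
Hypothesis MM' : M *m M' = 1%:M.
Hypothesis M'M : M' *m M = 1%:M.
Hypothesis nuB : forall C : set (Brl V), measurable C ->
  nu ((fun x => B *m x) @^-1` C) = (chi%:E * nu C)%E.
Hypothesis splitV : forall u : V, exists u1 u2 : V, [/\ u = u1 + u2,
  forall i, (fun n => iter n (mulmx B) u1 i 0) @ \oo --> (0 : R) &
  forall i, (fun n => iter n (mulmx B') u2 i 0) @ \oo --> (0 : R)].
Variable E : set V.
Hypotheses (closedE : closed E) (periodicE : periodic E).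
Hypothesis BE : forall x, E (B *m x) <-> E x.

Let moved u : set V := [set x | E (x - u) /\ ~ E x].

Let moved_borel u : measurable (moved u : set (Brl V)).
Proof.
apply: (@measurableI _ (Brl V)); first by apply: shift_borel; exact: closed_borel.
by apply: measurableC; exact: closed_borel.
Qed.

Let moved_periodic u : periodic (moved u).
Proof.
move=> x z [Ex nEx]; split; first by rewrite addrAC; exact: periodicE.
move=> Exz; apply: nEx; rewrite -[x](addrK (S *m toR z)) -mulmxN -toRN.
exact: periodicE.
Qed.

Let W := unit_domain.
Let fW : fundamental W. Proof. exact: unit_domain_fundamental. Qed.
(** The measure per period of E + u outside E. It is invariant under B and subadditive in u, and it
    cannot stay constant and nonzero along a sequence tending to 0; splitting u into a part
    contracted by B and a part contracted by B' then gives a u = 0. *)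
Let a u := nu (moved u `&` W).

Let fundamental_preim : fundamental ((fun x => B *m x) @^-1` W).
Proof.
have [mW Wf Wc] := fW.
have BSz z : B *m (S *m toR z) = S *m toR (M *m z).
  by rewrite mulmxA BM -mulmxA; congr (_ *m _); rewrite [RHS]map_mxM.
split; first exact: mulmx_borel.
- move=> x z /= Wx; rewrite mulmxDr BSz => /(Wf _ _ Wx) Mz.
  by rewrite -[z]mul1mx -M'M -mulmxA Mz mulmx0.
- move=> x; have [z Wz] := Wc (B *m x); exists (M' *m z).
  by rewrite /= mulmxDr BSz mulmxA MM' mul1mx.
Qed.

(** The preimage of a fundamental domain under the lattice automorphism B is again one, hence of the
    same measure, which is finite and positive. *)
Let chi1 : chi = 1.
Proof.
have [mW _ _] := fW.
have := nuB mW; rewrite -[X in nu X = _]setTI (fundamental_eq _ _ fundamental_preim fW)// setTI.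
have := fundamental_pos fW; have := unit_domain_fin; rewrite -/W.
case: (nu W) => [w| |]//; rewrite !lte_fin => _ w0 [] /eqP.
by rewrite -[X in X == _]mul1r eq_sym (inj_eq (mulIf (lt0r_neq0 w0))) => /eqP.
Qed.

Let moved_flow u : a (B *m u) = a u.
Proof.
have [mW _ _] := fW.
rewrite /a -[LHS]mul1e -{1}chi1 -nuB; last exact: (@measurableI _ (Brl V)).
rewrite preimage_setI (_ : _ @^-1` moved (B *m u) = moved u).
  exact: (fundamental_eq _ _ fundamental_preim fW).
apply/seteqP; split => x; rewrite /moved/= -mulmxBr => -[h1 h2]; split; try exact/BE;
  by move=> Ex; apply: h2; exact/BE.
Qed.

(** A point of E + u + u' outside E lies in [moved u'] if it is in E + u', and otherwise in the
    translate of [moved u] by u'. Translating the fundamental domain does not change the measure per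
    period. *)
Let moved_sub u u' : (a (u + u') <= a u + a u')%E.
Proof.
have [mW _ _] := fW.
pose G := (fun x => x - u') @^-1` moved u.
have mG : measurable (G : set (Brl V)) by exact: shift_borel.
have pG : periodic G.
  by move=> x z Gx; rewrite /G/= addrAC; exact: moved_periodic.
have GE : nu (G `&` W) = a u.
  rewrite (fundamental_eq mG pG fW (fundamental_shift (- u') fW)) /a.
  by rewrite -(nu_inv (- u') (@measurableI _ (Brl V) _ _ (moved_borel u) mW)).
rewrite -GE [leRHS]addeC; apply: le_trans (measureU2 _ _ _); rewrite ?inE//.
- apply: le_measure; rewrite ?inE.
  + exact: (@measurableI _ (Brl V)).
  + by apply: (@measurableU _ (Brl V)); exact: (@measurableI _ (Brl V)).
  + move=> x [[Ex nEx] Wx]; have [Ex'|Ex'] := EM (E (x - u')); [left|right] => //.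
    by split => //; split => //=; rewrite -addrA -opprD (addrC u').
- exact: (@measurableI _ (Brl V)).
- exact: (@measurableI _ (Brl V)).
Qed.

(** A point x in infinitely many of the sets [moved (u k)] would be a limit of points x - u k of E,
    hence in E. So the tail unions decrease to the empty set inside a domain of finite measure. *)
Let moved_cvg0 (u : nat -> V) : (forall i, (fun n => u n i 0) @ \oo --> (0 : R)) ->
  (forall n, a (u n) = a (u 0%N)) -> a (u 0%N) = 0%E.
Proof.
have [mW _ _] := fW.
move=> u0 au; pose G n : set (Brl V) := \bigcup_(k in [set k | (n <= k)%N]) (moved (u k) `&` W).
have mm k : measurable (moved (u k) `&` W : set (Brl V)) by exact: (@measurableI _ (Brl V)).
have mG n : measurable (G n) by apply: bigcup_measurable => k _; exact: mm.
have Gdec : {homo G : n m / (n <= m)%N >-> (m <= n)%O}.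
  move=> n n' nn'; apply/subsetPset => x [k /= kn xk]; exists k => //=.
  exact: leq_trans kn.
have G0 : (nu (G 0%N) < +oo)%E.
  apply: le_lt_trans unit_domain_fin; apply: le_measure; rewrite ?inE//.
  by move=> x [k _ []].
have GI : \bigcap_n G n = set0.
  apply/seteqP; split => // x H; have [k0 _ [[_ nEx] _]] := H 0%N I.
  have xc : (fun k => x - u k) @ \oo --> x.
    rewrite -[X in _ --> X]subr0; apply: cvgB; first exact: cvg_cst.
    by apply: (cvg_mx _) => i j; rewrite ord1 mxE.
  have nb : nbhs x (~` E) by apply: open_nbhs_nbhs; split; [exact: closed_openC|].
  have [n _ nP] := xc _ nb.
  by have [k nk [[Ek _] _]] := H n I; exact: (nP k nk).
have := nonincreasing_cvg_mu G0 mG (bigcapT_measurable mG) Gdec.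
rewrite GI measure0 => Gc.
apply/eqP; rewrite eq_le measure_ge0 andbT.
apply: (cvge_to_ge Gc).
apply: nearW => n /=; rewrite -(au n); apply: le_measure; rewrite ?inE//.
by move=> x xn; exists n => /=.
Qed.

Let moved0 u : a u = 0%E.
Proof.
have [v [w [-> vB wB]]] := splitV u.
have fB' x : a (B' *m x) = a x by rewrite -moved_flow mulmxA BB' mul1mx.
have v0 : a v = 0%E.
  apply: (moved_cvg0 (u := fun n => iter n (mulmx B) v)) => // n.
  by elim: n => //= n <-; rewrite moved_flow.
have w0 : a w = 0%E.
  apply: (moved_cvg0 (u := fun n => iter n (mulmx B') w)) => // n.
  by elim: n => //= n <-; rewrite fB'.
apply/eqP; rewrite eq_le measure_ge0 andbT.
by apply: le_trans (moved_sub v w) _; rewrite v0 w0 adde0.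
Qed.

(* Mautner's phenomenon: translates of E agree with E up to null sets, so E cannot miss an open set. *)
Lemma invariant_closed_null : E <> setT -> nu E = 0%E.
Proof.
have [mW _ _] := fW.
move=> ET; have [y nEy] : exists y, ~ E y.
  apply: contrapT => H; apply: ET; apply/seteqP; split => // x _.
  by apply: contrapT => h; apply: H; exists x.
have [k kE] := open_cell (closed_openC closedE) nEy; set z0 := cell_index k y in kE.
have -> : E = \bigcup_(z in [set: 'cV[int]_N]) (E `&` cell k z).
  by apply/seteqP; split => x; [move=> Ex; exists (cell_index k x)|move=> [z _ []]].
have mE z : measurable (E `&` cell k z : set (Brl V)).
  by apply: (@measurableI _ (Brl V)); [exact: closed_borel|exact: cell_measurable].
apply: (@countable_union_null _ (Brl V)) => // z.
(* This vector carries the cell z onto the cell z0, which misses E; so E in the cell z is carried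
   into [moved u]. *)
pose u := (2 ^+ k)^-1 *: map_mx intr (z0 - z) : V.
have F0 : nu (moved u) = 0%E by exact: (periodic_null (moved_borel u) (@moved_periodic u) fW (moved0 u)).
apply/eqP; rewrite eq_le measure_ge0 andbT -F0 -(nu_inv u (moved_borel u)).
apply: le_measure; rewrite ?inE//; first exact: shift_borel.
move=> x [Ex xz]; split; first by rewrite addrK.
by apply: kE; have : cell k z x by []; rewrite -(@cell_translate R N k z z0).
Qed.

End Hyperbolic.
End FundamentalDomains.

(** * Determinant and isotropy *)

Section Determinant.
Variable R : realType.

Lemma cvg_prodr (T : Type) (F : set_system T) (FF : Filter F) (I : Type) (r : seq I) (f : I -> T -> R) (l : I -> R) :
  (forall i, f i @ F --> l i) -> (fun x => \prod_(i <- r) f i x) @ F --> \prod_(i <- r) l i.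
Proof.
move=> fl; elim: r => [|i r IH].
  by under eq_fun do rewrite big_nil; rewrite big_nil; exact: cvg_cst.
under eq_fun do rewrite big_cons; rewrite big_cons.
by apply: cvgM => //; exact: fl.
Qed.

Lemma cvg_det (T : Type) (F : set_system T) (FF : Filter F) n (M : T -> 'M[R]_n) (L : 'M[R]_n) :
  M @ F --> L -> (fun x => \det (M x)) @ F --> \det L.
Proof.
move=> ML; apply: (@cvg_sumr R R^o _ _ _ F) => s.
apply: (@cvgMl_tmp R T F); apply: cvg_prodr => i.
exact: (@cvg_entry R T F n n M L i (s i) ML).
Qed.

(** Bernoulli's inequality: x^n >= 1 + n (x - 1). *)
Lemma bounded_hom_le1 (x M : R) : 0 <= x -> (forall n, x ^+ n <= M) -> x <= 1.
Proof.
move=> x0 xM; rewrite leNgt; apply/negP => x1.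
have H n : 1 + n%:R * (x - 1) <= x ^+ n.
  elim: n => [|n IH]; first by rewrite mul0r addr0 expr0.
  rewrite exprS -natr1; have : x * (1 + n%:R * (x - 1)) <= x * x ^+ n by rewrite ler_pM2l// (lt_trans _ x1).
  have : 0 <= n%:R * (x - 1) ^+ 2 by rewrite mulr_ge0// sqr_ge0.
  by rewrite expr2; nra.
have d0 : 0 < x - 1 by rewrite subr_gt0.
have := truncnS_gt (M / (x - 1)); set n := (Num.truncn _).+1.
rewrite ltr_pdivrMr// => Mn.
by have := H n; have := xM n; lra.
Qed.

(** f has period t0, so it is bounded by its maximum over one period; bounded powers of f t and of f
    (- t) force both to be at most 1. *)
Lemma hom_periodic_one (f : R -> R) (t0 : R) : continuous f -> (forall s t, f (s + t) = f s * f t) ->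
  (forall t, 0 < f t) -> t0 != 0 -> f t0 = 1 -> forall t, f t = 1.
Proof.
move=> fc fM f0 t00 ft0.
have fz : f 0 = 1 by apply: (mulfI (lt0r_neq0 (f0 0))); rewrite -fM addr0 mulr1.
have fN t : f (- t) = (f t)^-1.
  by apply: (mulfI (lt0r_neq0 (f0 t))); rewrite -fM subrr fz divff// lt0r_neq0.
wlog t0_gt0 : t0 t00 ft0 / 0 < t0.
  move=> H; have [lt|gt|e] := ltgtP 0 t0; [exact: H ft0 lt| |by rewrite e eqxx in t00].
  by apply: (H (- t0)); rewrite ?oppr_eq0 ?oppr_gt0// fN ft0 invr1.
have fn n : f (n%:R * t0) = 1.
  by elim: n => [|n IH]; rewrite ?mul0r// -natr1 mulrDl mul1r fM IH ft0 mulr1.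
have fz' (n : int) : f (n%:~R * t0) = 1.
  case: n => n; first exact: fn.
  by rewrite NegzE rmorphN/= mulNr fN fn invr1.
have [c _ cM] : exists2 c, c \in `[0, t0]%R & forall t, t \in `[0, t0]%R -> f t <= f c.
  by apply: EVT_max; [exact: ltW|exact: continuous_subspaceT].
have bnd t : f t <= f c.
  have -> : f t = f (t - (Num.floor (t / t0))%:~R * t0).
    by rewrite -mulNr -rmorphN/= fM fz' mulr1.
  apply: cM; rewrite in_itv/=; have := floor_le (t / t0); have := floorD1_gt (t / t0).
  rewrite ltr_pdivrMr// ler_pdivlMr// intrD mulrDl mul1r => h1 h2.
  by apply/andP; split; lra.
have fX t n : f t ^+ n = f (n%:R * t).
  by elim: n => [|n IH]; rewrite ?mul0r ?fz ?expr0// exprS IH -natr1 mulrDl mul1r fM mulrC.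
have le1 t : f t <= 1.
  by apply: (@bounded_hom_le1 _ (f c)); [exact: ltW|move=> n; rewrite fX; exact: bnd].
move=> t; apply/eqP; rewrite eq_le le1/=.
by have := le1 (- t); rewrite fN invf_le1.
Qed.

End Determinant.

Lemma infinite_of_injection (T : choiceType) (Y : set T) (f : nat -> T) : injective f ->
  (forall n, Y (f n)) -> infinite_set Y.
Proof.
move=> finj fY /finite_seqP[s sE].
have : (size [seq f i | i <- iota 0 (size s).+1] <= size s)%N.
  apply: uniq_leq_size; first by rewrite map_inj_uniq// iota_uniq.
  move=> x /mapP[i _ ->]; have : [set` s] (f i) by rewrite -sE.
  by [].
by rewrite size_map size_iota ltnn.
Qed.

Lemma closure_seq (T : topologicalType) (Y : set T) (u : nat -> T) (l : T) :
  u @ \oo --> l -> (forall n, Y (u n)) -> closure Y l.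
Proof.
move=> ul uY B /ul [n _ nB]; exists (u n); split; first exact: uY.
exact: (nB n (leqnn n)).
Qed.

Section LatticeDynamics.
Variables (R : realType) (N : nat) (A : R -> GL N R) (P : GL (N + 1) (Cx R)).
Local Notation V := 'cV[R]_N.
Local Notation X := ('cV[R]_N * R)%type.
Local Notation C := (Cx R).
Local Notation mul := (sdprod_mul A).
Local Notation toR := (map_mx (intr : int -> R)).
Local Notation e := (emb A P).
Hypothesis N_gt0 : (0 < N)%N.
Hypothesis repA : is_representation A.
Hypothesis A_inj : injective A.
Hypothesis A_cont : continuous (fun t => GLmx (A t) : 'M[R]_N).
Hypothesis A_fix : forall t (v : V), t != 0 -> A t *m v = v -> v = 0.
Variables (m : {measure set (Brl X) -> \bar R}) (D H : set X).
Hypothesis ld : lattice_data A m D H.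

Lemma det_rep_gt0 t : 0 < \det (A t).
Proof.
have -> : t = t / 2 + t / 2 by rewrite -splitr.
rewrite repD// det_mulmx -expr2 exprn_even_gt0//=.
by rewrite -unitfE -unitmxE GLmx_unit.
Qed.

Lemma lattice_frame : exists (S : 'M[R]_N) (g0 : X) (M M' : 'M[int]_N),
  [/\ S \in unitmx /\ (forall l, H (l, 0) <-> exists z : 'cV[int]_N, l = S *m toR z),
      H g0 /\ g0.2 != 0,
      A g0.2 *m S = S *m toR M, M *m M' = 1%:M /\ M' *m M = 1%:M & forall t, \det (A t) = 1].
Proof.
have [g0 Hg0 t0] := exists_time repA ld.
have [d d0 dH] := lattice_discrete ld.
have dL l : H (l, 0) -> (forall i, `|l i 0| < d) -> l = 0.
  by move=> Hl ld'; have [] : (l, 0 : R) = (0, 0) by apply: dH => //=; rewrite normr0.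
have [S Su SL] := @Z_basis R N [set l | H (l, 0)] d (ld_1 ld)
  (fun l l' Hl Hl' => lattice_sub repA ld Hl Hl') d0 dL
  (fun lam Hlam => lattice_spans repA A_cont A_fix ld Hlam).
have BL (g : X) (z : 'cV[int]_N) : H g -> exists w : 'cV[int]_N, A g.2 *m (S *m toR z) = S *m toR w.
  move=> Hg; apply/SL; apply: (lattice_conj repA ld Hg).
  by apply/SL; exists z.
have [M [M' [ME MM' M'M detB]]] := lattice_automorphism Su (repN repA g0.2) (fun z => BL g0 z Hg0)
  (fun z => BL (sdinv A g0) z (ld_inverse ld Hg0)).
exists S, g0, M, M'; split => // t.
(* g0 preserves a lattice, so det A is 1 at the nonzero time of g0; as a continuous homomorphism it
   is then 1 at all times. *)
apply: (@hom_periodic_one R (fun t => \det (A t)) g0.2) => //.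
- by move=> s; apply: cvg_det; exact: A_cont.
- by move=> s u; rewrite repD// det_mulmx.
- exact: det_rep_gt0.
- by rewrite -detB ger0_norm// ltW// det_rep_gt0.
Qed.

(** Excludes that one of the two subspaces is 0, since A would then contract everything in one
    direction of time. N > 0 gives det 0 = 0. *)
Lemma contracting_det (eps : R) : (forall t, \det (A t) = 1) ->
  (forall i j, (fun l : nat => (A (eps * l%:R)) i j) @ \oo --> (0 : R)) -> False.
Proof.
move=> det1 dec; have c0 : (fun l : nat => GLmx (A (eps * l%:R))) @ \oo --> (0 : 'M[R]_N).
  by apply: cvg_mx => i j; rewrite mxE; exact: dec.
have : (fun l : nat => \det (A (eps * l%:R))) @ \oo --> \det (0 : 'M[R]_N) by exact: cvg_det.
under eq_fun do rewrite det1.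
have -> : \det (0 : 'M[R]_N) = 0 by case: (N) N_gt0 => // n' _; exact: det0.
move=> /(@cvg_unique _ (@Rhausdorff R) _ _ _ _ (cvg_cst (1 : R)))/eqP.
by rewrite oner_eq0.
Qed.

Variable Gam : set (PGL R (N + 1)).
Hypothesis HE : forall x, H x <-> Gam (e x).

Lemma isotropy_translations (z : projsp R (N + 1)) : hbot P (repr z) = 0 -> infinite_isotropy Gam z.
Proof.
move=> z0; have [S [g0 [M [M' [[Su SL] _ _ _ _]]]]] := lattice_frame.
pose i0 := Ordinal N_gt0.
apply: (@infinite_of_injection _ _ (fun k : nat => e (S *m toR (k%:Z *: delta_mx i0 0), 0))).
  move=> k k' /(@emb_inj _ _ A P A_inj)/(congr1 fst)/= E.
  have := congr1 (fun v => (invmx S *m v) i0 0) E; rewrite /= !mulKmx// !mxE !eqxx !mulr1.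
  by move=> /intr_inj[].
move=> k; split; first by apply/HE/SL; exists (k%:Z *: delta_mx i0 0).
exact: emb_translation_fix.
Qed.

Definition sdpow (h : X) k := iter k (mul h) (0, 0).

Lemma sdpow_time h k : (sdpow h k).2 = k%:R * h.2.
Proof. by elim: k => [|k IH]; rewrite ?mul0r//= IH -natr1 mulrDl mul1r addrC. Qed.

Lemma sdpow_lattice h k : H h -> H (sdpow h k).
Proof. by move=> Hh; elim: k => [|k IH]; [exact: (ld_1 ld)|exact: (ld_mul ld)]. Qed.

Lemma sdpow_fix h k (y : V) : A h.2 *m y + h.1 = y -> A (sdpow h k).2 *m y + (sdpow h k).1 = y.
Proof.
move=> hy; elim: k => [|k IH]; first by rewrite /= rep0// mul1mx addr0.
rewrite /= repD// -mulmxA [h.1 + _]addrC addrA -mulmxDr.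
by rewrite IH.
Qed.

Lemma isotropy_infinite (y : V) h : H h -> h.2 != 0 -> A h.2 *m y + h.1 = y ->
  infinite_isotropy Gam (pt P (map_mx (@toC R) y)).
Proof.
move=> Hh h2 hy; apply: (@infinite_of_injection _ _ (fun k => e (sdpow h k))).
  move=> k k' /(@emb_inj _ _ A P A_inj)/(congr1 snd)/=; rewrite !sdpow_time.
  by move=> /(mulIf h2)/eqP; rewrite eqr_nat => /eqP.
move=> k; split; first by apply/HE; exact: sdpow_lattice.
by rewrite act_pt; congr pt; rewrite -map_mxM -map_mxD sdpow_fix.
Qed.

(* Torsion points of R^N / L are periodic: an automorphism permutes the finite set (1/q) L / L. *)
Lemma torsion_fixed (S : 'M[R]_N) (g0 : X) (M M' : 'M[int]_N) (p0 : V) (q : nat) (z : 'cV[int]_N) :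
  (forall l, H (l, 0) <-> exists z : 'cV[int]_N, l = S *m toR z) -> H g0 -> g0.2 != 0 ->
  A g0.2 *m S = S *m toR M -> M' *m M = 1%:M -> A g0.2 *m p0 + g0.1 = p0 -> (0 < q)%N ->
  exists h, [/\ H h, h.2 != 0 & A h.2 *m (p0 + q%:R^-1 *: (S *m toR z)) + h.1 = p0 + q%:R^-1 *: (S *m toR z)].
Proof.
move=> SL Hg0 g02 AS M'M fp q0.
pose F i : 'cV[int]_N := iter i (mulmx M) z.
pose r i : {ffun 'I_N -> 'I_q.-1.+1} := [ffun j => inord `|(F i j 0%R %% q%:Z)%Z|%N].
have [i [n [n0 rE]]] : exists i n, (0 < n)%N /\ r (i + n)%N = r i.
  apply: contrapT => no.
  have rinj : injective r.
    move=> i k; wlog ik : i k / (i <= k)%N.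
      by move=> W; have [/W//|/ltnW/W h e] := leqP i k; rewrite -h.
    move=> rik; apply/eqP; apply: contrapT => /negP ne; apply: no; exists i, (k - i)%N.
    by rewrite subn_gt0 ltn_neqAle ne ik subnKC.
  have := @infinite_of_injection _ [set: {ffun 'I_N -> 'I_q.-1.+1}] r rinj (fun=> I).
  by apply; exact: finite_finset.
have [w wE] : exists w : 'cV[int]_N, F (i + n)%N - F i = q%:Z *: w.
  exists (\col_j ((F (i + n)%N j 0%R - F i j 0%R)%R %/ q%:Z)%Z); apply/colP => j.
  rewrite [RHS]mxE [X in _ = _ * X]mxE [LHS]mxE [X in _ + X]mxE mulrC divzK//.
  rewrite -eqz_mod_dvd; have := congr1 val (congr1 (fun f : {ffun 'I_N -> 'I_q.-1.+1} => f j) rE); rewrite /= !ffunE.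
  have qz : q%:Z != 0 by rewrite eqz_nat -lt0n.
  have lt k : (`|(F k j 0%R %% q%:Z)%Z| < q.-1.+1)%N.
    by rewrite prednK// -ltz_nat gez0_abs ?modz_ge0// ltz_pmod.
  rewrite !inordK// => /(congr1 Posz); rewrite !gez0_abs ?modz_ge0// => ->.
  by [].
have M'F k u : iter k (mulmx M') (iter k (mulmx M) u) = u.
  by elim: k u => // k IH u; rewrite iterSr /= mulmxA M'M mul1mx IH.
have M'D k u v : iter k (mulmx M') (u - v) = iter k (mulmx M') u - iter k (mulmx M') v.
  by elim: k => //= k ->; rewrite mulmxBr.
have M'Z k u c : iter k (mulmx M') (c *: u) = c *: iter k (mulmx M') u.
  by elim: k => //= k ->; rewrite scalemxAr.
(* The inverse M' removes the preperiod i: z itself returns to its class modulo q after n steps. *)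
have {}wE : F n = z + q%:Z *: iter i (mulmx M') w.
  by rewrite -M'Z -wE M'D /F iterD !M'F addrC subrK.
set w' := iter i _ w in wE.
have AF k : A (sdpow g0 k).2 *m (S *m toR z) = S *m toR (F k).
  rewrite sdpow_time; elim: k => [|k IH]; first by rewrite mul0r rep0// mul1mx.
  by rewrite -natr1 mulrDl mul1r addrC repD// -mulmxA IH mulmxA AS -mulmxA /= map_mxM.
(* The n-th power of g0 moves the torsion point by the lattice vector S w', which the translation
   takes back. *)
exists (mul (- (S *m toR w'), 0) (sdpow g0 n)); split.
- apply: (ld_mul ld); last exact: sdpow_lattice.
  apply/SL; exists (- w'); rewrite -mulmxN; congr (_ *m _).
  by apply/colP => j; rewrite !mxE rmorphN.
- by rewrite /= add0r sdpow_time mulf_neq0// pnatr_eq0 -lt0n.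
rewrite /sdprod_mul/= add0r rep0// mul1mx mulmxDr -scalemxAr AF wE.
have -> : toR (z + q%:Z *: w') = toR z + q%:R *: toR w'.
  by apply/colP => j; rewrite !mxE rmorphD rmorphM.
rewrite mulmxDr -scalemxAr scalerDr scalerA mulVf ?scale1r ?pnatr_eq0 -?lt0n//.
rewrite -[RHS](congr1 (fun y => y + _) (sdpow_fix n fp)).
by rewrite -!addrA; congr (_ + _); rewrite addNKr addrC.
Qed.

End LatticeDynamics.

Lemma cvg_floor_scale (R : realType) (y : R) :
  (fun n : nat => n.+1%:R^-1 * (Num.floor (n.+1%:R * y))%:~R) @ \oo --> y.
Proof.
apply/cvgrPdist_le => eps eps0.
have /cvgrPdist_le/(_ _ eps0) := @cvg_harmonic R.
apply: filterS => n; rewrite /= sub0r normrN ger0_norm ?invr_ge0// => ne.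
apply: le_trans ne; have n0 : 0 < n.+1%:R :> R by rewrite ltr0n.
rewrite -[y in `|y - _|](mulKf (lt0r_neq0 n0)) -mulrBr normrM ger0_norm ?invr_ge0//.
rewrite ler_piMr ?invr_ge0// ger0_norm ?subr_ge0 ?floor_le//.
by rewrite lerBlDl ltW// -[1]/(1%:~R) -intrD floorD1_gt.
Qed.

Section Isotropy.
Variables (R : realType) (N : nat) (A : R -> GL N R) (P : GL (N + 1) (Cx R)).
Local Notation V := 'cV[R]_N.
Local Notation X := ('cV[R]_N * R)%type.
Local Notation C := (Cx R).
Local Notation mul := (sdprod_mul A).
Local Notation toR := (map_mx (intr : int -> R)).
Local Notation e := (emb A P).
Local Notation ptR y := (pt P (map_mx (@toC R) y)).
Hypothesis N_gt0 : (0 < N)%N.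
Hypothesis repA : is_representation A.
Hypothesis A_inj : injective A.
Hypothesis A_cont : continuous (fun t => GLmx (A t) : 'M[R]_N).
Hypothesis A_fix : forall t (v : V), t != 0 -> A t *m v = v -> v = 0.
Variables (m : {measure set (Brl X) -> \bar R}) (D H : set X).
Hypothesis ld : lattice_data A m D H.
Variable Gam : set (PGL R (N + 1)).
Hypothesis HE : forall x, H x <-> Gam (e x).

Lemma cvg_ptR (T : Type) (F : set_system T) (FF : Filter F) (u : T -> V) (x : V) :
  u @ F --> x -> (fun n => ptR (u n)) @ F --> ptR x.
Proof.
move=> ux; apply: (@cvg_toproj R _ T F FF) => /=.
apply: (@cvg_mulmx _ T F) => //; first exact: cvg_cst.
apply: (@cvg_mx C T F) => i j.
case: (fintype.splitP i) => k ik.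
  have -> : i = lshift 1 k by apply: val_inj.
  under eq_fun do rewrite col_mxEu; rewrite col_mxEu.
  apply: (@cvg_entry C T F); exact: cvg_map_toC.
have -> : i = rshift N k by apply: val_inj.
by under eq_fun do rewrite col_mxEd; rewrite col_mxEd; exact: cvg_cst.
Qed.

Lemma isotropy_dense : dense_in [set z | momz P z = 0]
  ([set z | momz P z = 0] `&` infinite_isotropy Gam).
Proof.
move=> z z0; have [b0|[x ->]] := momz_eq0 z0.
  apply: subset_closure; split => //; split => //.
  exact: (isotropy_translations N_gt0 repA A_inj A_cont A_fix ld HE b0).
have [S [g0 [M [M' [[Su SL] [Hg0 g02] AS [MM' M'M] _]]]]] := lattice_frame repA A_cont A_fix ld.
have [p0 fp] := fixed_point A_fix g02.
have [u uE] : exists u, u = invmx S *m (x - p0) by exists (invmx S *m (x - p0)).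
(* Rounding (n + 1) u down gives torsion points p0 + S w / (n + 1) that converge to x = p0 + S u. *)
pose w n : 'cV[int]_N := \col_i Num.floor (n.+1%:R * u i 0).
apply: (@closure_seq _ _ (fun n => ptR (p0 + n.+1%:R^-1 *: (S *m toR (w n))))).
  apply: cvg_ptR; rewrite -[x in _ --> x](subrKC p0).
  apply: cvgD; first exact: cvg_cst.
  rewrite -[x - p0](mulKVmx Su) -uE.
  under eq_fun do rewrite scalemxAr.
  apply: cvg_mulmx; first exact: cvg_cst.
  apply: cvg_mx => i j; rewrite (ord1 j); under eq_fun do rewrite !mxE.
  exact: cvg_floor_scale.
move=> n; have [h [Hh h2 hy]] := torsion_fixed repA ld (w n) SL Hg0 g02 AS M'M fp (ltn0Sn n).
have z1 := momz_real P (p0 + n.+1%:R^-1 *: (S *m toR (w n))).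
split => //; split => //.
exact: (isotropy_infinite repA A_inj ld HE Hh h2 hy).
Qed.

End Isotropy.

(** * Null sets in affine charts *)

Section NullTransport.
Variables (R : realType) (N : nat).
Local Notation V := 'cV[R]_N.
Hypothesis N_gt0 : (0 < N)%N.
Variable nu : {measure set (Brl V) -> \bar R}.
Hypothesis nu_inv : forall u (B : set (Brl V)), measurable B -> nu ((fun x => x + u) @^-1` B) = nu B.
Hypothesis nu_fin : (nu (cell 0 0) < +oo)%E.
Hypothesis nu_pos : (0 < nu (cell 0 0))%E.

Lemma closed_bounded (F : set V) (r : nat) : closed F -> closed (F `&` [set y : V | forall i, `|y i 0| <= r%:R]).
Proof.
move=> cF; apply: closedI => //.
rewrite (_ : [set y | _] = \bigcap_i [set y : V | `|y i 0| <= r%:R]); last first.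
  by apply/seteqP; split => y /= H; [move=> i _; exact: H|move=> i; exact: (H i I)].
apply: closed_bigI => i _.
rewrite (_ : [set y | _] = (fun y : V => `|y i 0|) @^-1` [set s | s <= r%:R])//.
apply: (closed_comp _ (@closed_le R _)) => y _; apply: (@cvg_norm R R V (nbhs y)).
by apply: (@cvg_entry R V (nbhs y)); exact: cvg_id.
Qed.

(** Y is cut into the pieces where phi y, y and g y are bounded by r. On such a piece g has a
    Lipschitz inverse, with a constant that may depend on r, and its image lies in a bounded closed
    null set, which has Jordan content zero. *)
Lemma transport_null (F : set V) d (Y : set 'rV[R]_d) (g : 'rV[R]_d -> V) (phi : 'rV[R]_d -> R) :
  d = N -> closed F -> nu F = 0%E -> (forall y, Y y -> F (g y)) ->
  (forall r : nat, exists2 C, 0 < C & forall y y' e, Y y -> Y y' -> `|phi y| <= r%:R ->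
     (forall j, `|y' 0 j| <= r%:R) -> (forall i, `|g y i 0 - g y' i 0| <= e) ->
     forall j, `|y 0 j - y' 0 j| <= C * e) ->
  lebesgue_null Y.
Proof.
move=> dN cF F0 YF lip.
pose Yr (r : nat) := [set y | [/\ Y y, `|phi y| <= r%:R, forall j, `|y 0 j| <= r%:R & forall i, `|g y i 0| <= r%:R]].
apply: (@lebesgue_null_sub _ _ _ (\bigcup_r Yr r)).
  move=> y Yy; pose M := `|phi y| + \sum_j `|y 0 j| + \sum_i `|g y i 0|.
  have s1 : 0 <= \sum_j `|y 0 j| by apply: sumr_ge0.
  have s2 : 0 <= \sum_i `|g y i 0| by apply: sumr_ge0.
  exists (Num.truncn M).+1 => //; have := truncnS_gt M; set r := _%:R => Mr; split => //.
  - by apply: le_trans (ltW Mr); rewrite /M -addrA lerDl addr_ge0.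
  - move=> j; apply: le_trans (ltW Mr); rewrite /M addrAC (bigD1 j)//= addrCA lerDl.
    by rewrite !addr_ge0// sumr_ge0.
  - move=> i; apply: le_trans (ltW Mr); rewrite /M (bigD1 i)//= addrCA lerDl.
    by rewrite !addr_ge0// sumr_ge0.
apply: (@null_bigcup R d Yr) => r.
have [C C0 Clip] := lip r.
pose K := F `&` [set y : V | forall i, `|y i 0| <= r%:R].
have cK : closed K by exact: closed_bounded.
apply: (@tiny_null R N N_gt0 d (Yr r) g K C dN C0).
- apply: (@compact_null_tiny R N nu K r nu_inv nu_fin nu_pos cK); first by move=> x [].
  apply/eqP; rewrite eq_le measure_ge0 andbT -F0; apply: le_measure; rewrite ?inE; try exact: closed_borel.
  by move=> x [].
- by move=> y [Yy _ _ gy]; split; [exact: YF|].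
- by move=> y y' e [Yy py _ _] [Yy' _ yy' _]; exact: Clip.
Qed.

(** Lines in the direction u meet F at most once, so the translates of a bounded piece of F by u /
    (n + 1) are disjoint, of equal measure, and contained in a bounded set. *)
Lemma transversal_null (F : set V) (u : V) : closed F ->
  (forall s t x, F (x + s *: u) -> F (x + t *: u) -> s = t) -> nu F = 0%E.
Proof.
move=> cF Fu.
rewrite (_ : F = \bigcup_(r in [set: nat]) (F `&` [set y : V | forall i, `|y i 0| <= r%:R])); last first.
  apply/seteqP; split => x; last by move=> [r _ []].
  move=> Fx; exists (Num.truncn (\sum_i `|x i 0|)).+1 => //; split => // i; apply: ltW.
  apply: le_lt_trans (truncnS_gt _); rewrite (bigD1 i)//= lerDl sumr_ge0//.
apply: (@countable_union_null _ (Brl V)) => [r|r]; first by apply: closed_borel; exact: closed_bounded.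
set K := _ `&` _; have cK : closed K by exact: closed_bounded.
pose G n : set (Brl V) := (fun x => x + n.+1%:R^-1 *: u) @^-1` K.
have mG n : measurable (G n) by apply: shift_borel; exact: closed_borel.
pose M := (Num.truncn (r%:R + \sum_i `|u i 0|)).+1.
have GM : (nu (\bigcup_n G n) < +oo)%E.
  apply: (bounded_fin (M := M) nu_inv nu_fin); first exact: bigcupT_measurable.
  move=> x [n _ [_ xr]] i; apply: ltW; apply: le_lt_trans (truncnS_gt _).
  have := xr i; rewrite !mxE => xi.
  rewrite -[x i 0](addrK (n.+1%:R^-1 * u i 0)); apply: le_trans (ler_normB _ _) _.
  apply: lerD => //; rewrite (bigD1 i)//= normrM; apply: le_trans (_ : `|u i 0| <= _).
    rewrite ler_piMl// ger0_norm ?invr_ge0// invf_le1 ?ltr0n// ler1n//.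
  by rewrite lerDl sumr_ge0.
apply/eqP; rewrite eq_le measure_ge0 andbT.
apply: (disjoint_bounded (F := G) (M := nu (\bigcup_n G n)) mG) => //.
- apply/trivIsetP => i j _ _ ij; apply/seteqP; split => // x [[Fi _] [Fj _]].
  have /eqP := Fu _ _ _ Fi Fj.
  by rewrite (inj_eq invr_inj) eqr_nat eqSS (negbTE ij).
- by move=> n; rewrite /G nu_inv//; exact: closed_borel.
Qed.

Definition real_vec (j : 'I_(N + 1)) (x : 'rV[R]_(N + 1).-1) : 'cV[R]_(N + 1) :=
  \col_i (if unlift j i is Some l then x 0 l else 1).

Lemma affine_vecE j x : affine_vec j x = map_mx (@toC R) (real_vec j x).
Proof. by apply/colP => i; rewrite !mxE. Qed.

Lemma real_vec_lift j x l : real_vec j x (lift j l) 0 = x 0 l.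
Proof. by rewrite mxE liftK. Qed.

Lemma real_vec_eq j x : real_vec j x j 0 = 1.
Proof. by rewrite mxE unlift_none. Qed.

(** Charts have (N + 1).-1 coordinates, a number not convertible to N; hence the casts below. *)
Lemma dimE : N = (N + 1).-1. Proof. by rewrite addn1. Qed.

(** If c is supported at j, the hyperplane misses the chart, where coordinate j is 1. Otherwise a
    coordinate direction in which c does not vanish is transversal to it. *)
Lemma hyperplane_null (j : 'I_(N + 1)) (c : 'rV[R]_(N + 1)) : c != 0 ->
  lebesgue_null [set x | c *m real_vec j x = 0].
Proof.
move=> c0; pose f (y : V) := \row_l y (cast_ord (esym dimE) l) 0.
pose g (x : 'rV[R]_(N + 1).-1) : V := \col_i x 0 (cast_ord dimE i).
have fg x : f (g x) = x by apply/rowP => l; rewrite !mxE; congr (x _ _); exact: val_inj.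
have [[l cl]|no] := EM (exists l, c 0 (lift j l) != 0); last first.
  have cj : c 0 j != 0.
    apply: contra_neq c0 => cj; apply/rowP => i; rewrite [RHS]mxE.
    case: (unliftP j i) => [l ->|->//]; apply/eqP; apply: contrapT => /negP h.
    by apply: no; exists l.
  apply: (@lebesgue_null_sub _ _ _ set0).
    move=> x /= /matrixP/(_ 0 0); rewrite !mxE (bigD1 j)//= real_vec_eq big1 ?addr0 ?mulr1.
      by move=> cj0; rewrite cj0 eqxx in cj.
    move=> i ij; case: (unliftP j i) => [l ->|E]; last by rewrite E eqxx in ij.
    suff -> : c 0 (lift j l) = 0 by rewrite mul0r.
    by apply/eqP; apply: contrapT => /negP h; apply: no; exists l.
  by apply: (@transport_null set0 _ set0 g (fun=> 0) (esym dimE) closed0 (measure0 nu)) => // r; exists 1.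
pose F := [set y : V | c *m real_vec j (f y) = 0].
have cF : closed F.
  rewrite (_ : F = (fun y : V => (c *m real_vec j (f y)) 0 0) @^-1` [set s | s = 0]); last first.
    by apply/seteqP; split => y; rewrite /F/= => H; [rewrite H mxE|apply/matrixP => a b; rewrite !ord1 H mxE].
  apply: (closed_comp _ (@closed_eq R 0)) => y _; apply: (@cvg_entry R V (nbhs y)).
  apply: (@cvg_mulmx R V (nbhs y)); first exact: cvg_cst.
  apply: (@cvg_mx R V (nbhs y)) => i k; under eq_fun do rewrite mxE; rewrite mxE.
  case: unlift => [l'|]; last exact: cvg_cst.
  under eq_fun do rewrite mxE; rewrite mxE.
  by apply: (@cvg_entry R V (nbhs y)); exact: cvg_id.
pose u : V := delta_mx (cast_ord (esym dimE) l) 0.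
have F0 : nu F = 0%E.
  apply: (transversal_null (u := u) cF) => s t x.
  have rE s' : real_vec j (f (x + s' *: u)) = real_vec j (f x) + s' *: delta_mx (lift j l) 0.
    apply/colP => i; rewrite !mxE; case: (unliftP j i) => [l' ->|->]; last first.
      by rewrite (negbTE (neq_lift _ _)) mulr0 addr0.
    by rewrite !mxE (inj_eq lift_inj) !eqxx !andbT (inj_eq (@cast_ord_inj _ _ _)).
  rewrite /F/= !rE !mulmxDr => h1 h2; have := congr1 (fun M : 'M[R]_1 => M 0 0) (etrans h1 (esym h2)).
  move=> /= /(congr1 (fun z : R => z - (c *m real_vec j (f x)) 0 0)).
  have cE s' : (c *m (s' *: delta_mx (lift j l) 0)) 0 0 = s' * c 0 (lift j l).
    rewrite mxE (bigD1 (lift j l))//= big1 => [|i il]; last by rewrite !mxE (negbTE il) !mulr0.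
    by rewrite !mxE !eqxx mulr1 addr0 mulrC.
  have E (a b : 'M[R]_1) : (a + b) 0 0 - a 0 0 = b 0 0 by rewrite mxE addrC addKr.
  by rewrite !E !cE => /(mulIf cl).
apply: (@transport_null F _ _ g (fun=> 0) (esym dimE) cF F0).
  by move=> y; rewrite /F/= fg.
move=> r; exists 1 => // y y' e _ _ _ _ ge k; rewrite mul1r.
have := ge (cast_ord (esym dimE) k); rewrite !mxE.
by rewrite (_ : cast_ord dimE _ = k)//; exact: val_inj.
Qed.

(** x is recovered from its affine coordinate g x by a projective map. Bounds on q x and on x' make
    this recovery Lipschitz, which is the estimate that [transport_null] asks for, with phi = q. *)
Lemma affine_chart_null (Q : 'M[R]_(N + 1)) (j : 'I_(N + 1)) (F : set V) : Q \in unitmx ->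
  closed F -> nu F = 0%E ->
  lebesgue_null [set x | let w := Q *m real_vec j x in
    dsubmx w 0 0 != 0 /\ F ((dsubmx w 0 0)^-1 *: usubmx w)].
Proof.
move=> Qu cF F0; pose q x := dsubmx (Q *m real_vec j x) 0 0.
pose g x := (q x)^-1 *: usubmx (Q *m real_vec j x).
apply: (@transport_null F _ _ g q (esym dimE) cF F0); first by move=> x [].
move=> r; pose W := invmx Q.
pose c := 1 + \sum_i \sum_k `|W i k|.
have c0 : 0 < c by rewrite ltr_pwDl// sumr_ge0// => i _; apply: sumr_ge0.
have r1 : 0 < 1 + r%:R :> R by rewrite ltr_pwDl.
exists ((1 + r%:R) * (c * (1 + (1 + r%:R)))).
  by rewrite !mulr_gt0// addr_gt0.
move=> x x' e [qx _] [qx' _] qr xr ge l.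
have e0 : 0 <= e by apply: le_trans (ge (Ordinal N_gt0)).
have vE y : q y != 0 -> real_vec j y = q y *: (W *m col_mx (g y) (const_mx 1)).
  move=> qy; rewrite scalemxAr scale_col_mx /g scalerA divff// scale1r.
  rewrite -[LHS](mulKmx Qu) -/W; congr (_ *m _); rewrite -[LHS]vsubmxK; congr col_mx.
  by apply/matrixP => a b; rewrite !ord1 [RHS]mxE [const_mx _ _ _]mxE mulr1.
pose dl := W *m col_mx (g x - g x') (const_mx 0).
have dlE i : `|dl i 0| <= c * e.
  rewrite mxE; apply: le_trans (ler_norm_sum _ _ _) _.
  apply: le_trans (_ : (\sum_k `|W i k|) * e <= _).
    rewrite mulr_suml; apply: ler_sum => k _; rewrite normrM ler_wpM2l//.
    case: (fintype.splitP k) => k' kk'.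
      have -> : k = lshift 1 k' by apply: val_inj.
      by rewrite col_mxEu !mxE; have := ge k'; rewrite !mxE.
    have -> : k = rshift N k' by apply: val_inj.
    by rewrite col_mxEd mxE normr0.
  rewrite ler_wpM2r// /c [in leRHS](bigD1 i)//= addrCA lerDl addr_ge0// sumr_ge0// => i' _.
  exact: sumr_ge0.
have dvE : real_vec j x - real_vec j x' = q x *: dl + ((q x - q x') / q x') *: real_vec j x'.
  rewrite [X in _ = _ + _ *: X]vE// scalerA divfK// {1}vE// {1}vE// /dl.
  have -> : col_mx (g x - g x') (const_mx 0) = col_mx (g x) (const_mx 1) - col_mx (g x') (const_mx 1) :> 'cV[R]_(N + 1).
    by rewrite opp_col_mx add_col_mx; congr col_mx; apply/matrixP => a b; rewrite !mxE subrr.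
  by rewrite mulmxBr scalerBr scalerBl addrA subrK.
(* Entry j of both vectors is 1, so their difference vanishes there; this determines the scalar and
   removes the denominator q x'. *)
have kE : (q x - q x') / q x' = - (q x * dl j 0).
  have := congr1 (fun v : 'cV[R]_(N + 1) => v j 0) dvE.
  rewrite ![in X in X -> _]mxE !unlift_none subrr mulr1 => /esym/eqP.
  by rewrite addrC addr_eq0 => /eqP ->; rewrite mxE.
have := congr1 (fun v : 'cV[R]_(N + 1) => v (lift j l) 0) dvE.
have E (a b : 'cV[R]_(N + 1)) i : (a + b) i 0 = a i 0 + b i 0 by rewrite mxE.
have EZ s (a : 'cV[R]_(N + 1)) i : (s *: a) i 0 = s * a i 0 by rewrite mxE.
have EN (a : 'cV[R]_(N + 1)) i : (- a) i 0 = - a i 0 by rewrite mxE.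
rewrite E EN E !EZ !real_vec_lift => ->; rewrite kE mulNr -mulrA -mulrBr normrM -mulrA.
have qr' : `|q x| <= 1 + r%:R by apply: le_trans qr _; rewrite lerDr.
apply: ler_pM => //; apply: le_trans (ler_normB _ _) _.
rewrite normrM mulrAC mulrDr mulr1; apply: lerD; first exact: dlE.
apply: ler_pM => //.
by apply: le_trans (xr l) _; rewrite lerDr.
Qed.

End NullTransport.

(** * Dense orbits and real points *)

Section RealKernel.
Variable R : realType.
Local Notation C := (Cx R).
Local Notation toCm := (map_mx (@toC R)).

(** Take the real or the imaginary part of a row of D, whichever is nonzero. *)
Lemma real_kernel_row p n (D : 'M[C]_(p, n)) : D != 0 ->
  exists2 c : 'rV[R]_n, c != 0 & forall v : 'cV[R]_n, D *m toCm v = 0 -> c *m v = 0.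
Proof.
move=> D0; have [i [k Dik]] : exists i k, D i k != 0.
  apply: contrapT => H; case/eqP: D0; apply/matrixP => i k; rewrite [RHS]mxE.
  by apply/eqP; apply: contrapT => /negP h; apply: H; exists i, k.
have [ReE ImE] : (forall v : 'cV[R]_n, complex.Re ((D *m toCm v) i 0) = \sum_j complex.Re (D i j) * v j 0) /\
    (forall v : 'cV[R]_n, complex.Im ((D *m toCm v) i 0) = \sum_j complex.Im (D i j) * v j 0).
  split=> v; rewrite mxE ?Re_sum ?Im_sum; apply: eq_bigr => j _; rewrite mxE.
    by case: (D i j) => a b /=; ring.
  by case: (D i j) => a b /=; ring.
have [re0|re0] := eqVneq (complex.Re (D i k)) 0; last first.
  exists (\row_j complex.Re (D i j)).
    by apply: contraNneq re0 => /rowP/(_ k); rewrite !mxE => ->.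
  move=> v Dv; apply/matrixP => a b; rewrite !ord1 mxE [RHS]mxE.
  by under eq_bigr do rewrite mxE; rewrite -ReE Dv mxE.
have im0 : complex.Im (D i k) != 0.
  by apply: contraNneq Dik => im0; apply/eqP; move: re0 im0; case: (D i k) => a b /= -> ->.
exists (\row_j complex.Im (D i j)).
  by apply: contraNneq im0 => /rowP/(_ k); rewrite !mxE => ->.
move=> v Dv; apply/matrixP => a b; rewrite !ord1 mxE [RHS]mxE.
by under eq_bigr do rewrite mxE; rewrite -ImE Dv mxE.
Qed.

Lemma conj_toCm n (v : 'cV[R]_n) : map_mx Num.conj (toCm v) = toCm v.
Proof. by apply/colP => i; rewrite !mxE; apply: complexP => //=; rewrite oppr0. Qed.

(* A real structure on C^n pulled back by Pi is either proportional to the standard one, or meets it in finitely many proper subspaces, the eigenspaces of Pi^-1 conj(Pi). *)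
Lemma real_or_hyperplanes n (Pi : 'M[C]_n) : Pi \in unitmx ->
  (exists (mu : C) (Q : 'M[R]_n), mu != 0 /\ Pi = mu *: toCm Q) \/
  exists s : seq 'rV[R]_n, (forall c, c \in s -> c != 0) /\
    forall (v : 'cV[R]_n) (theta : C), v != 0 ->
      map_mx Num.conj (Pi *m toCm v) = theta *: (Pi *m toCm v) -> exists2 c, c \in s & c *m v = 0.
Proof.
move=> Piu; pose K := invmx Pi *m map_mx Num.conj Pi.
have [[th0 KE]|Kns] := EM (exists th, K = th%:M); [left|right].
  have cE : map_mx Num.conj Pi = th0 *: Pi.
    by rewrite -[LHS](mulKVmx Piu) -/K KE mul_mx_scalar.
  have [[i [k Pik]]|no] := EM (exists i k, Pi i k != 0); last first.
    exists 1, 0; split; first exact: oner_neq0.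
    rewrite scale1r; apply/matrixP => i k; rewrite !mxE; apply/eqP; apply: contrapT => /negP h.
    by apply: no; exists i, k.
  have ce a b : (Pi a b)^* = th0 * Pi a b by have := congr1 (fun M : 'M[C]_n => M a b) cE; rewrite !mxE.
  have th00 : th0 != 0 by apply: contraNneq Pik => z; rewrite -conjC_eq0 ce z mul0r.
  exists (Pi i k), (\matrix_(a, b) complex.Re (Pi a b / Pi i k)); split => //.
  apply/matrixP => a b; rewrite [RHS]mxE [X in _ * X]mxE [X in toC X]mxE.
  have rE (w : C) : w^* = w -> toC (complex.Re w) = w.
    by move=> wE; apply: (@RRe_real R); rewrite (CrealE (w : C)) wE.
  rewrite rE; first by rewrite mulrC divfK.
  by rewrite rmorphM fmorphV /= !ce invfM mulrACA divff// mul1r.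
(* K is not scalar, so K - th is nonzero for every th and some nonzero real form kills the real
   vectors of the eigenspace; only the finitely many eigenvalues th matter. *)
have /choice[c cP] : forall th : C, exists c : 'rV[R]_n, c != 0 /\
    forall v : 'cV[R]_n, (K - th%:M) *m toCm v = 0 -> c *m v = 0.
  move=> th; have [|c c0 cv] := @real_kernel_row _ _ (K - th%:M); last by exists c.
  by rewrite subr_eq0; apply/eqP => E; apply: Kns; exists th.
have [r rE] := closed_field_poly_normal (char_poly K^T).
exists [seq c th | th <- r]; split; first by move=> _ /mapP[th _ ->]; exact: (cP th).1.
move=> v th v0 E; exists (c th); last first.
  apply: (cP th).2; rewrite mulmxBl mul_scalar_mx; apply/eqP; rewrite subr_eq0; apply/eqP.
  rewrite -mulmxA -[in LHS](conj_toCm v) -map_mxM E -scalemxAr mulKmx//.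
apply/map_f; have : eigenvalue K^T th.
  apply/eigenvalueP; exists (toCm v)^T.
    rewrite -trmx_mul -linearZ/=; congr trmx.
    by rewrite -mulmxA -[in LHS](conj_toCm v) -map_mxM E -scalemxAr mulKmx.
  apply: contraNneq v0 => /(congr1 trmx); rewrite trmxK trmx0 => /colP H; apply/eqP/colP => i.
  by have := H i; rewrite !mxE => /eqP; rewrite fmorph_eq0 => /eqP.
rewrite eigenvalue_root_char rE rootZ ?root_prod_XsubC//.
by rewrite lead_coef_eq0 monic_neq0// char_poly_monic.
Qed.

Lemma hyperbolic_decay N (B B' : 'M[R]_N) : B *m B' = 1%:M ->
  (forall a : C, eigenvalue (toCm B) a -> `|a| != 1) ->
  forall u : 'cV[R]_N, exists u1 u2 : 'cV[R]_N, [/\ u = u1 + u2,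
    forall i, (fun n => iter n (mulmx B) u1 i 0) @ \oo --> (0 : R) &
    forall i, (fun n => iter n (mulmx B') u2 i 0) @ \oo --> (0 : R)].
Proof.
case: N B B' => [|n] B B' BB' Beig u.
  by exists 0, 0; split=> [|[]//|[]//]; apply/colP => -[].
have [Ss [Ts [Su [Tu [[ST1 ST2 ST3 ST4 TS] comm d1 d2]]]]] := hyperbolic_splitting BB' Beig erefl erefl.
have B'B := mulmx1C BB'.
have iterE (M : 'M[R]_n.+1) k (w : 'cV[R]_n.+1) : iter k (mulmx M) w = M ^+ k *m w.
  by elim: k => [|k IH]; rewrite ?expr0 ?mul1mx// exprS /= IH mulmxA.
have cB k : comm_mx B (B ^+ k) by exact: commrX.
have cB' k : comm_mx B (B' ^+ k) by apply: commrX; rewrite /GRing.comm /= -[B * B']/(B *m B') BB' -B'B.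
have decay p (S : 'M[R]_(p, n.+1)) (T : 'M[R]_(n.+1, p)) (M : 'M[R]_n.+1) :
    (forall k, M ^+ k *m T = T *m S *m M ^+ k *m T) ->
    (forall i j, (fun k : nat => (S *m M ^+ k) i j) @ \oo --> (0 : R)) ->
    forall i, (fun k => iter k (mulmx M) (T *m (S *m u)) i 0) @ \oo --> (0 : R).
  move=> ME dM i; have : (fun k : nat => T *m (S *m M ^+ k *m (T *m (S *m u)))) @ \oo --> T *m ((0 : 'M[R]_(p, n.+1)) *m (T *m (S *m u))).
    apply: cvg_mulmx; first exact: cvg_cst.
    apply: cvg_mulmx; last exact: cvg_cst.
    by apply: cvg_mx => a b; rewrite [X in _ --> X]mxE; exact: dM.
  move=> /(@cvg_entry R _ _ _ _ _ _ i 0); rewrite mul0mx mulmx0 mxE.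
  by under [in X in _ -> X]eq_fun do rewrite iterE [_ *m (T *m _)]mulmxA ME -!mulmxA; under eq_fun do rewrite -!mulmxA.
exists (Ts *m (Ss *m u)), (Tu *m (Su *m u)); split.
- by rewrite !mulmxA -mulmxDl TS mul1mx.
- apply: decay d1 => k; have [_ Suk] := comm _ (cB k).
  have z : Su *m B ^+ k *m Ts = 0 by rewrite Suk -mulmxA ST3 mulmx0.
  rewrite -[X in X *m Ts = _]mul1mx -TS !mulmxDl -(mulmxA Tu) -(mulmxA Tu) z mulmx0 addr0.
  by [].
- apply: decay d2 => k; have [Ssk _] := comm _ (cB' k).
  have z : Ss *m B' ^+ k *m Tu = 0 by rewrite Ssk -mulmxA ST2 mulmx0.
  rewrite -[X in X *m Tu = _]mul1mx -TS !mulmxDl -(mulmxA Ts) -(mulmxA Ts) z mulmx0 add0r.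
  by [].
Qed.

End RealKernel.

Section DenseOrbits.
Variables (R : realType) (N : nat) (A : R -> GL N R).
Local Notation V := 'cV[R]_N.
Local Notation X := ('cV[R]_N * R)%type.
Hypothesis repA : is_representation A.
Hypothesis A_cont : continuous (fun t => GLmx (A t) : 'M[R]_N).
Hypothesis A_eig : forall (t : R) (a : Cx R), t != 0 -> eigenvalue (map_mx (@toC R) (A t)) a -> `|a| != 1.
Hypothesis A_fix : forall t (v : V), t != 0 -> A t *m v = v -> v = 0.
Variables (m : {measure set (Brl X) -> \bar R}) (D H : set X).
Hypothesis ld : lattice_data A m D H.
Local Notation nu := (slab_measure m 0 1).

Lemma slab_inv u (B : set (Brl V)) : measurable B -> nu ((fun x => x + u) @^-1` B) = nu B.
Proof. exact: (slab_translate repA ld). Qed.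
Lemma slab_fin : (nu (cell 0 0) < +oo)%E. Proof. exact: (slab_cell_fin ld). Qed.
Lemma slab_pos : (0 < nu (cell 0 0))%E.
Proof. by have := slab_cell_pos repA ld 0 (@ltr01 R); rewrite add0r. Qed.

Lemma lattice_invariant_null (E : set V) : closed E ->
  (forall h x, H h -> E x -> E (A h.2 *m x + h.1)) -> E <> setT -> nu E = 0%E.
Proof.
move=> cE HE ET.
have [S [g0 [M [M' [[Su SL] [Hg0 g02] AS [MM' M'M] _]]]]] := lattice_frame repA A_cont A_fix ld.
have [p0 fp] := fixed_point A_fix g02.
have [c [_ cE' _]] := flow_scaling repA ld.
(* Moving the fixed point p0 of g0 to the origin makes g0 linear, so that the result on lattice
   automorphisms applies. *)
pose E' := (fun x => x + p0) @^-1` E.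
have cE2 : closed E'.
  apply: (closed_comp _ cE) => x _; apply: (@cvgD R V _ (nbhs x)); [exact: cvg_id|exact: cvg_cst].
have <- : nu E' = nu E by apply: slab_inv; exact: closed_borel.
have BE x : A g0.2 *m x + p0 = A g0.2 *m (x + p0) + g0.1.
  by rewrite mulmxDr -addrA fp.
apply: (invariant_closed_null slab_inv slab_fin slab_pos Su (repN repA g0.2) AS MM' M'M (cE' g0.2)
  (hyperbolic_decay (repN repA g0.2) (fun a => @A_eig g0.2 a g02)) cE2).
- move=> x z; rewrite /E'/= => Ex; have := HE (S *m map_mx intr z, 0) _ _ Ex.
  by rewrite /= rep0// mul1mx addrAC; apply; apply/SL; exists z.
- move=> x; rewrite /E'/= BE; split; last exact: HE.
  move=> /(HE _ _ (ld_inverse ld Hg0)) /=.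
  by rewrite mulmxDr addrK mulmxA repNl// mul1mx.
- move=> E'T; apply: ET; apply/seteqP; split => // x _.
  have : E' (x - p0) by rewrite E'T.
  by rewrite /E'/= subrK.
Qed.

Definition dense_orbit (x : V) := forall U : set V, open U -> U !=set0 ->
  exists2 h, H h & U (A h.2 *m x + h.1).

(** Countably many invariant sets that together contain every point whose orbit is not dense; the
    interior of the cell makes them closed. *)
Definition avoiding k z := [set x | forall h, H h -> ~ (cell k z)^° (A h.2 *m x + h.1)].

Lemma avoiding_closed k z : closed (avoiding k z).
Proof.
rewrite (_ : avoiding k z = \bigcap_(h in H) (fun x => A h.2 *m x + h.1) @^-1` (~` (cell k z)^°)).
  apply: closed_bigI => h _; apply: closed_comp; last by apply: open_closedC; exact: open_interior.
  move=> x _; apply: (@cvgD R V _ (nbhs x)); last exact: cvg_cst.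
  exact: flow_continuous.
by apply/seteqP; split => x Hx h Hh; exact: Hx.
Qed.

Lemma avoiding_invariant k z h x : H h -> avoiding k z x -> avoiding k z (A h.2 *m x + h.1).
Proof.
move=> Hh Ex g Hg; have E : A g.2 *m (A h.2 *m x + h.1) + g.1 =
    A (sdprod_mul A g h).2 *m x + (sdprod_mul A g h).1.
  by rewrite [(_, _).1]/= [(_, _).2]/= repD// mulmxDr -mulmxA -addrA [_ + g.1]addrC.
by rewrite E; exact: (Ex _ (ld_mul ld Hg Hh)).
Qed.

Lemma avoiding_null k z : nu (avoiding k z) = 0%E.
Proof.
apply: (lattice_invariant_null (@avoiding_closed k z) (@avoiding_invariant k z)) => E.
(* The centre of the cell lies in its interior, so it does not avoid the cell and the invariant set
   is proper. *)
pose c : V := \col_i ((2 ^+ k)^-1 * ((z i 0)%:~R + 2^-1)).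
have k0 : 0 < 2 ^+ k :> R by rewrite exprn_gt0.
have : avoiding k z c by rewrite E.
move=> /(_ (0, 0) (ld_1 ld)); apply; rewrite rep0// mul1mx addr0.
apply/nbhs_ballP; exists ((2 ^+ k)^-1 * 2^-1) => /=; first by rewrite mulr_gt0 ?invr_gt0.
move=> y [_ yc]; apply/cellP => i; have := yc i 0; rewrite mxE /ball/=.
rewrite -[y i 0](mulKf (lt0r_neq0 k0)) -mulrBr normrM ger0_norm ?invr_ge0 ?(ltW k0)//.
rewrite ltr_pM2l ?invr_gt0// ltr_norml mulrA divff ?lt0r_neq0// mul1r intrD.
by move=> /andP[h1 h2]; apply/andP; split; lra.
Qed.

Lemma not_dense_avoiding x : ~ dense_orbit x -> exists k z, avoiding k z x.
Proof.
move=> nd; apply: contrapT => no; apply: nd => U oU [y Uy].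
have [k kU] := open_cell oU Uy; apply: contrapT => nU; apply: no.
exists k, (cell_index k y) => h Hh /interior_subset hx; apply: nU; exists h => //.
exact: kU.
Qed.

End DenseOrbits.

(** * Orbits of real points in projective space *)

Section RealPoints.
Variables (R : realType) (N : nat) (A : R -> GL N R) (P : GL (N + 1) (Cx R)).
Local Notation V := 'cV[R]_N.
Local Notation X := ('cV[R]_N * R)%type.
Local Notation C := (Cx R).
Local Notation toCm := (map_mx (@toC R)).
Local Notation e := (emb A P).
Local Notation ptR y := (pt P (toCm y)).
Hypothesis N_gt0 : (0 < N)%N.
Hypothesis repA : is_representation A.
Hypothesis A_cont : continuous (fun t => GLmx (A t) : 'M[R]_N).
Hypothesis A_eig : forall (t : R) (a : Cx R), t != 0 -> eigenvalue (map_mx (@toC R) (A t)) a -> `|a| != 1.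
Hypothesis A_fix : forall t (v : V), t != 0 -> A t *m v = v -> v = 0.
Variables (m : {measure set (Brl X) -> \bar R}) (D H : set X).
Hypothesis ld : lattice_data A m D H.
Variable Gam : set (PGL R (N + 1)).
Hypothesis HE : forall x, H x <-> Gam (e x).

Let LR := [set z | momz P z = 0] `&` real_points R (N + 1).
Let Pi := invmx (GLmx P).

Lemma toCm_inj p q : injective (toCm : 'M[R]_(p, q) -> 'M[C]_(p, q)).
Proof. exact: (@map_mx_inj _ _ (@real_complex R)). Qed.

Lemma dense_limit_points (y y' : V) : dense_orbit A H y -> limit_point (orbit_of Gam (ptR y)) (ptR y').
Proof.
move=> dy U nU.
have [W WU [oW Wy]] : exists2 W : set V, W `<=` (fun x : V => ptR x) @^-1` U & open W /\ W y'.
  have c : (fun x : V => ptR x) @ nbhs y' --> ptR y' by exact: (@cvg_ptR R N P V (nbhs y') (nbhs_filter y') (fun x => x) y' cvg_id).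
  have : nbhs y' ((fun x : V => ptR x) @^-1` U) := c _ nU.
  by rewrite nbhsE => -[W [oW Wy] WU]; exists W.
(* A limit point needs orbit points other than itself, so y' is removed from W; the rest is nonempty
   because N > 0. *)
have oW' : open (W `\` [set y']).
  rewrite setDE; apply: openI => //; apply: closed_openC.
  exact: (compact_closed (@norm_hausdorff R V) (@compact_set1 V y')).
have ne : W `\` [set y'] !=set0.
  have c : (fun n : nat => y' + n.+1%:R^-1 *: const_mx 1) @ \oo --> y'.
    rewrite -[X in _ --> X]addr0; apply: cvgD; first exact: cvg_cst.
    rewrite -(scale0r (const_mx 1 : V)); apply: cvgZr_tmp; exact: cvg_harmonic.
  have [n _ nW] := c _ (open_nbhs_nbhs (conj oW Wy)).
  exists (y' + n.+1%:R^-1 *: const_mx 1); split; first exact: (nW n (leqnn n)).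
  move=> /= /(congr1 (fun v : V => v (Ordinal N_gt0) 0))/eqP.
  by rewrite !mxE mulr1 -subr_eq0 addrAC subrr add0r invr_eq0 pnatr_eq0.
have [h Hh [hW hy]] := dy _ oW' ne.
have actE : act (e h) (ptR y) = ptR (A h.2 *m y + h.1).
  by rewrite act_pt -map_mxM -map_mxD.
exists (act (e h) (ptR y)); split.
- rewrite actE; apply: contra_notN hy => /eqP/pt_inj/toCm_inj.
  by [].
- by exists (e h) => //; exact/HE.
- by rewrite actE; exact: WU.
Qed.

Lemma toCmM p q r (M : 'M[R]_(p, q)) (M' : 'M[R]_(q, r)) : toCm (M *m M') = toCm M *m toCm M'.
Proof. exact: (@map_mxM _ _ (@real_complex R)). Qed.

Lemma toCm_col (a : V) (b : 'M[R]_1) : toCm (col_mx a b) = col_mx (toCm a) (const_mx (toC (b 0 0))).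
Proof.
rewrite map_col_mx; congr col_mx; apply/matrixP => i j.
by rewrite !mxE !ord1.
Qed.

Lemma toCm_col1 (a : V) : toCm (col_mx a (const_mx 1 : 'M[R]_1)) = col_mx (toCm a) (const_mx 1).
Proof. by rewrite toCm_col [X in toC X]mxE. Qed.

Lemma toCm_col0 (a : V) : toCm (col_mx a (0 : 'M[R]_1)) = col_mx (toCm a) (const_mx 0).
Proof. by rewrite toCm_col [X in toC X]mxE. Qed.

Section RealStructure.
Variables (mu : C) (Q : 'M[R]_(N + 1)).
Hypotheses (mu0 : mu != 0) (PiE : Pi = mu *: toCm Q).

Lemma real_structure_unit : Q \in unitmx.
Proof.
have : toCm Q \in unitmx.
  by rewrite -[toCm Q](scalerK mu0) -PiE unitmxZ ?unitfE ?invr_eq0// unitmx_inv GLmx_unit.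
by rewrite -[@toC R]/(fun x : R => x%:C%C) map_unitmx.
Qed.

Lemma real_structureE (v : 'cV[R]_(N + 1)) : toCm v = mu *: (P *m toCm (Q *m v)).
Proof.
rewrite -[LHS](mulKVmx (GLmx_unit P)) -/Pi PiE -scalemxAl -scalemxAr.
by rewrite toCmM.
Qed.

Lemma real_ptR (a : V) : real_points R (N + 1) (ptR a).
Proof.
have [v vE] : exists v : 'cV[R]_(N + 1), Q *m v = col_mx a (const_mx 1).
  by exists (invmx Q *m col_mx a (const_mx 1)); rewrite mulKVmx// real_structure_unit.
have E : toCm v = mu *: (P *m col_mx (toCm a) (const_mx 1)).
  by rewrite real_structureE vE toCm_col1.
have v0 : toCm v != 0 by rewrite E scaler_eq0 (negbTE mu0) pt_proof.
exists (MkNz v0); split; last by exists v.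
by apply/esym/(@toproj_eq _ _ _ _ mu mu0).
Qed.

Lemma LR_ptR (a : V) : LR (ptR a).
Proof. by split; [exact: momz_real|exact: real_ptR]. Qed.

Lemma dense_orbit_dense_in (y : V) : dense_orbit A H y -> dense_in LR (limit_point (orbit_of Gam (ptR y))).
Proof.
move=> dy z [z0 [w [wz [v vE]]]].
have ok x : (LR `&` limit_point (orbit_of Gam (ptR y))) (ptR x).
  by split; [exact: LR_ptR|exact: dense_limit_points].
have [b0|[x ->]] := momz_eq0 z0; last by apply: subset_closure; exact: ok.
have wE := real_structureE v; rewrite -vE in wE.
pose p := usubmx (Q *m v); pose q := dsubmx (Q *m v).
have q0 : q = 0.
  have [c c0 cE] : exists2 c : C, c != 0 & nzvec_val (repr z) = c *: nzvec_val w.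
    by apply/toprojP; rewrite toproj_repr wz.
  move: b0; rewrite cE hbotZ wE hbotZ -[Q *m v]vsubmxK -/p -/q toCm_col hbotE mxE.
  move=> /eqP; rewrite !mulf_eq0 (negbTE c0) (negbTE mu0)/= fmorph_eq0 => /eqP q0.
  by apply/matrixP => i j; rewrite !ord1 q0 mxE.
have {}wE : nzvec_val w = mu *: (P *m col_mx (toCm p) (const_mx 0)).
  by rewrite wE -[Q *m v]vsubmxK -/p -/q q0 toCm_col0.
have p0 : ((0 : C) != 0) || (toCm p != 0).
  apply/orP; right; apply: contraNneq (nzvecP w) => p0; rewrite wE p0.
  by rewrite (_ : const_mx 0 = 0) ?col_mx0 ?mulmx0 ?scaler0//; apply/matrixP => i j; rewrite !mxE.
have zE : z = toproj (MkNz (pt_subproof P p0)).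
  by rewrite -wz; apply/esym/(@toproj_eq _ _ _ _ mu mu0).
(* A real point (p : 0) at infinity is the limit of the affine real points (p : 1 / (n + 1)). *)
have pn n : (toC (n.+1%:R^-1 : R) != 0) || (toCm p != 0).
  by rewrite fmorph_eq0 invr_eq0 pnatr_eq0.
apply: (@closure_seq _ _ (fun n => toproj (MkNz (pt_subproof P (pn n))))).
  rewrite zE; apply: cvg_toproj => /=; apply: cvg_mulmx; first exact: cvg_cst.
  apply: cvg_mx => i j; case: (fintype.splitP i) => k ik.
    have -> : i = lshift 1 k by apply: val_inj.
    by under eq_fun do rewrite col_mxEu; rewrite col_mxEu; exact: cvg_cst.
  have -> : i = rshift N k by apply: val_inj.
  under eq_fun do rewrite col_mxEd mxE; rewrite col_mxEd mxE.
  rewrite -[0]/(toC (0 : R)); apply: cvg_toC; exact: cvg_harmonic.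
move=> n; rewrite (_ : toproj _ = ptR (n.+1%:R *: p)); first exact: ok.
apply/esym/(@toproj_eq _ _ _ _ (toC (n.+1%:R^-1 : R))).
  by rewrite fmorph_eq0 invr_eq0 pnatr_eq0.
rewrite /= scalemxAr scale_col_mx; congr (_ *m col_mx _ _).
  by apply/matrixP => i j; rewrite !mxE /toC -rmorphM/= mulKf// pnatr_eq0.
by apply/matrixP => i j; rewrite !mxE mulr1.
Qed.

End RealStructure.

Lemma affine_pointE (j : 'I_(N + 1)) (x : 'rV[R]_(N + 1).-1) : nzvec_val (MkNz (affine_vec_neq0 j x)) = toCm (real_vec j x).
Proof. exact: affine_vecE. Qed.

Lemma real_vec_neq0 j (x : 'rV[R]_(N + 1).-1) : real_vec j x != 0.
Proof. by apply/eqP => /matrixP/(_ j 0)/eqP; rewrite real_vec_eq mxE oner_eq0. Qed.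

Lemma ae_dense : ae_real LR [set z | dense_in LR (limit_point (orbit_of Gam z))].
Proof.
have Piu : Pi \in unitmx by rewrite unitmx_inv GLmx_unit.
have bottom (w : 'cV[C]_(N + 1)) : hbot P w = (dsubmx (Pi *m w)) 0 0 by [].
have inv := slab_inv repA ld; have fin := slab_fin ld; have pos := slab_pos repA ld.
move=> j; have [[mu [Q [mu0 PiE]]]|[s [s0 sP]]] := real_or_hyperplanes Piu.
  have Qu := real_structure_unit mu0 PiE.
  pose F n := if unpickle n is Some kz then avoiding A H kz.1 kz.2 else set0.
  have cF n : closed (F n) by rewrite /F; case: unpickle => [kz|]; [exact: avoiding_closed|exact: closed0].
  have F0 n : slab_measure m 0 1 (F n) = 0%E.
    rewrite /F; case: unpickle => [kz|]; last exact: measure0.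
    exact: (avoiding_null repA A_cont A_eig A_fix ld).
  pose c : 'rV[R]_(N + 1) := row (rshift N 0) Q.
  have cE (v : 'cV[R]_(N + 1)) : (c *m v) 0 0 = dsubmx (Q *m v) 0 0 by rewrite /c -row_mul !mxE.
  have c0 : c != 0.
    apply: contraTneq Qu => E; apply/negP => Qu; have := cE (invmx Q *m delta_mx (rshift N 0) 0).
    rewrite mulKVmx// E mul0mx !mxE !eqxx => /esym/eqP.
    by rewrite oner_eq0.
  (* Index 0 covers the points with q = 0; the later indices cover the countably many avoiding sets,
     read in the chart j. *)
  pose Z n : set 'rV[R]_(N + 1).-1 := if n is n'.+1 then [set x | let w := Q *m real_vec j x in
      dsubmx w 0 0 != 0 /\ F n' ((dsubmx w 0 0)^-1 *: usubmx w)] else [set x | c *m real_vec j x = 0].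
  apply: (@lebesgue_null_sub _ _ _ (\bigcup_n Z n)); last first.
    apply: (@null_bigcup R _ Z) => -[|n] /=.
      exact: (hyperplane_null N_gt0 inv fin pos j c0).
    exact: (affine_chart_null N_gt0 inv fin pos j Qu (cF n) (F0 n)).
  move=> x [_ nd]; have [q0|q0] := eqVneq (dsubmx (Q *m real_vec j x) 0 0) 0.
    by exists 0%N => //=; apply/matrixP => a b; rewrite !ord1 cE q0 mxE.
  have xE : affine_point j x = ptR ((dsubmx (Q *m real_vec j x) 0 0)^-1 *: usubmx (Q *m real_vec j x)).
    have [w wE] : exists w, w = Q *m real_vec j x by exists (Q *m real_vec j x).
    rewrite -wE in q0 *.
    have k0 : mu * toC (dsubmx w 0 0) != 0 by rewrite mulf_neq0// fmorph_eq0.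
    apply/esym/(@toproj_eq _ _ _ _ _ k0); rewrite affine_pointE (real_structureE PiE) -wE /=.
    rewrite -[in LHS](vsubmxK w) toCm_col -scalerA [in RHS]scalemxAr scale_col_mx.
    congr (_ *: (_ *m col_mx _ _)); apply/matrixP => a b; last by rewrite !mxE mulr1.
    by move: q0; rewrite !mxE => q0; rewrite /toC -rmorphM/= mulVKf.
  have : ~ dense_orbit A H ((dsubmx (Q *m real_vec j x) 0 0)^-1 *: usubmx (Q *m real_vec j x)).
    by move=> dy; apply: nd; rewrite /= xE; exact: (dense_orbit_dense_in mu0 PiE).
  move=> /not_dense_avoiding[k [z kz]]; exists (pickle (k, z)).+1 => //=.
  by split => //; rewrite /F pickleK.
have b0 : row (rshift N 0) Pi != 0.
  apply: contraTneq Piu => E; apply/negP => Piu.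
  have := congr1 (fun M : 'rV[C]_(N + 1) => (M *m (invmx Pi *m delta_mx (rshift N 0) 0 : 'cV[C]_(N + 1))) 0 0) E.
  rewrite /= -row_mul mulKVmx// mul0mx !mxE !eqxx => /eqP.
  by rewrite oner_eq0.
have [c c0 cP] := real_kernel_row b0.
(* The default value matters: indices beyond the length of s give c, whose hyperplane contains the
   points with q = 0. *)
pose Z n : set 'rV[R]_(N + 1).-1 := [set x | nth c s n *m real_vec j x = 0].
apply: (@lebesgue_null_sub _ _ _ (\bigcup_n Z n)); last first.
  apply: (@null_bigcup R _ Z) => n; apply: (hyperplane_null N_gt0 inv fin pos).
  by have [ns|ns] := ltnP n (size s); [exact/s0/mem_nth|rewrite nth_default].
move=> x [[x0 _] _].
have [k k0 kE] : exists2 k : C, k != 0 & toCm (real_vec j x) = k *: nzvec_val (repr (affine_point j x)).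
  by rewrite -affine_pointE; apply/toprojP; rewrite toproj_repr.
have [q0|[y yE]] := momz_eq0 x0.
  exists (size s) => //; rewrite /Z/= nth_default//; apply: cP.
  apply/matrixP => a b; rewrite !ord1 -row_mul mxE [RHS]mxE kE -scalemxAr mxE.
  by move: q0; rewrite bottom mxE => ->; rewrite mulr0.
have /eqP/toprojP[k' k'0 k'E] : toproj (MkNz (pt_proof P (toCm y))) = toproj (MkNz (affine_vec_neq0 j x)).
  by rewrite -[RHS]/(affine_point j x) yE.
rewrite affine_pointE /= in k'E.
(* P^-1 sends the real coordinate vector to k' times the real vector (y : 1), so conjugation
   multiplies the image by k'^* / k'. *)
have [|d ds dE] := sP (real_vec j x) (k'^* / k') (real_vec_neq0 j x).
  rewrite k'E -scalemxAr /Pi mulKmx ?GLmx_unit// scalerA divfK//.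
  apply/matrixP => a b; rewrite !mxE rmorphM; congr (_ * _); case: (fintype.split a) => i; rewrite !mxE.
    by apply: complexP => //=; rewrite oppr0.
  exact: conjC1.
by exists (index d s) => //; rewrite /Z/= nth_index.
Qed.

End RealPoints.

(** * Assembly of the theorem *)

Section Representations.
Variables (R : realType) (N : nat) (A : R -> GL N R).
Hypothesis N_gt0 : (0 < N)%N.
Hypothesis repA : is_representation A.
Hypothesis A_eig : forall (t : R) (a : Cx R), t != 0 ->
  eigenvalue (map_mx (@toC R) (A t)) a -> `|a| != 1.

Lemma hyperbolic_fix t (v : 'cV[R]_N) : t != 0 -> A t *m v = v -> v = 0.
Proof.
move=> t0 Av; have u : map_mx (@toC R) (A t) - 1%:M \in unitmx.
  rewrite -row_free_unit -kermx_eq0; apply/negPn/negP => ker.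
  by have := @A_eig t 1 t0 ker; rewrite normr1 eqxx.
apply: toCm_inj; rewrite -[LHS](mulKmx u) mulmxBl mul1mx -toCmM Av subrr mulmx0.
by apply/matrixP => i j; rewrite !mxE.
Qed.

Lemma representation_splitting N1 N2 :
  N1 = count (fun a => `|a| < 1) (eigenvalues (A 1)) ->
  N2 = count (fun a => 1 < `|a|) (eigenvalues (A 1)) ->
  exists (Ss : 'M[R]_(N1, N)) (Ts : 'M[R]_(N, N1)) (Su : 'M[R]_(N2, N)) (Tu : 'M[R]_(N, N2)),
    [/\ [/\ Ss *m Ts = 1%:M, Ss *m Tu = 0, Su *m Ts = 0, Su *m Tu = 1%:M & Ts *m Ss + Tu *m Su = 1%:M],
        (forall t, Ss *m A t = Ss *m A t *m Ts *m Ss) /\ (forall t, Su *m A t = Su *m A t *m Tu *m Su),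
        forall i j, (fun l : nat => (Ss *m A l%:R) i j) @ \oo --> (0 : R) &
        forall i j, (fun l : nat => (Su *m A (- l%:R)) i j) @ \oo --> (0 : R)].
Proof.
case: N N_gt0 A repA A_eig => // n _ B repB B_eig N1E N2E.
have [Ss [Ts [Su [Tu [S1 comm d1 d2]]]]] :=
  hyperbolic_splitting (repN repB 1) (fun a => @B_eig 1 a (oner_neq0 R)) N1E N2E.
have BX l : GLmx (B l%:R) = GLmx (B 1) ^+ l :> 'M[R]_n.+1.
  elim: l => [|l IH]; first by rewrite rep0.
  by rewrite -natr1 repD// IH exprSr.
have BXN l : GLmx (B (- l%:R)) = GLmx (B (- 1)) ^+ l :> 'M[R]_n.+1.
  elim: l => [|l IH]; first by rewrite oppr0 rep0.
  by rewrite -natr1 opprD repD// IH exprSr.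
have cB t : comm_mx (GLmx (B 1)) (GLmx (B t)) by rewrite /comm_mx -!repD// addrC.
exists Ss, Ts, Su, Tu; split => //.
- by split=> t; have [? ?] := comm _ (cB t).
- by move=> i j; under eq_fun do rewrite BX; exact: d1.
- by move=> i j; under eq_fun do rewrite BXN; exact: d2.
Qed.

End Representations.

Lemma lift_range (R : realType) (N : nat) (A : R -> GL N R) (P : GL (N + 1) (Cx R)) :
  @toPGL R (N + 1) @` [set (P * h * P^-1)%g | h in range (rho A)] = range (emb A P).
Proof.
apply/seteqP; split => g; first by move=> [_ [_ [x _ <-] <-] <-]; exists x.
by move=> [x _ <-]; exists (P * rho A x * P^-1)%g => //; exists (rho A x) => //; exists x.
Qed.

Theorem theorem1p1 (R : realType) (N : nat) (N_gt0 : (0 < N)%N)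
    (A : R -> GL N R)
    (A_rep : is_representation A)
    (A_smooth : smooth setT (fun t : R => GLmx (A t)))
    (A_faithful : injective A)
    (A_closed : closed (range A))
    (A_eig : forall (t : R) (a : Cx R), t != 0 ->
       eigenvalue (map_mx (@toC R) (A t)) a -> `|a| != 1)
    (G : set (PGL R (N + 1)))
    (G_lift : exists Gt : set (GL (N + 1) (Cx R)), is_lift Gt G /\
       exists P : GL (N + 1) (Cx R),
         Gt = [set (P * h * P^-1)%g | h in range (rho A)])
    (N1 N2 : nat)
    (N1_def : N1 = count (fun a => `|a| < 1) (eigenvalues (A 1)))
    (N2_def : N2 = count (fun a => 1 < `|a|) (eigenvalues (A 1))) :
  exists Omega1 Omega2 : set (projsp R (N + 1)),
  let L := ~` (Omega1 `|` Omega2) in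
  [/\ (* (1) *)
      ((0 < N1)%N ->
         [/\ open Omega1, is_invariant G Omega1 & product_action G N1 Omega1]) /\
      ((0 < N2)%N ->
         [/\ open Omega2, is_invariant G Omega2 & product_action G N2 Omega2]),
      (* (2) *)
      (forall Omega : set (projsp R (N + 1)),
         open Omega -> is_invariant G Omega -> proper_action G Omega ->
         ((0 < N1)%N /\ Omega `<=` Omega1) \/
         ((0 < N2)%N /\ Omega `<=` Omega2))
    & (* (3) *)
      (forall Gamma : set (PGL R (N + 1)), is_lattice G Gamma ->
         [/\ forall t, \det (A t) = 1,
             [/\ (0 < N1)%N, (0 < N2)%N & Omega1 <> Omega2],
             closed L /\ is_invariant G L,
             dense_in L (L `&` infinite_isotropy Gamma)
           & let LR := L `&` real_points R (N + 1) in
             ae_real LR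
               [set z | dense_in LR (limit_point (orbit_of Gamma z))]])].
Proof.
have [Gt [[_ GE] [P GtE]]] := G_lift.
have {}GE : G = range (emb A P) by rewrite -GE GtE lift_range.
have A_cont : continuous (fun t => GLmx (A t) : 'M[R]_N) by move=> t; exact: (A_smooth 0%N t I).
have A_fix := hyperbolic_fix A_eig.
have [Ss [Ts [Su [Tu [[ST1 ST2 ST3 ST4 TS] [SsA SuA] d1 d2]]]]] :=
  representation_splitting N_gt0 A_rep A_eig N1_def N2_def.
have inv1 : is_invariant G (Omega P Ss).
  by rewrite GE; apply: (Omega_invariant A_rep (As := fun t => Ss *m A t *m Ts)).
have inv2 : is_invariant G (Omega P Su).
  by rewrite GE; apply: (Omega_invariant A_rep (As := fun t => Su *m A t *m Tu)).
have Omega0 k (S : 'M[R]_(k, N)) : ~~ (0 < k)%N -> Omega P S = set0.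
  by case: k S => // S _; apply/seteqP; split => // z; rewrite /Omega/= flatmx0 eqxx.
have LE : ~` (Omega P Ss `|` Omega P Su) = [set z | momz P z = 0].
  apply/seteqP; split => z /=.
    move=> nz; rewrite -[momz P z]mul1mx -TS mulmxDl -!mulmxA.
    have -> : Ss *m momz P z = 0 by apply/eqP; apply: contrapT => /negP h; apply: nz; left.
    have -> : Su *m momz P z = 0 by apply/eqP; apply: contrapT => /negP h; apply: nz; right.
    by rewrite !mulmx0 addr0.
  by move=> z0 []; rewrite /Omega/= z0 mulmx0 eqxx.
have noncontracting k (S : 'M[R]_(k, N)) (T : 'M[R]_(N, k)) (eps : R) : (forall t, \det (A t) = 1) -> T *m S = 1%:M ->
    (forall i j, (fun l : nat => (S *m A (eps * l%:R)) i j) @ \oo --> (0 : R)) -> False.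
  move=> det1 TS1 dS; apply: (contracting_det N_gt0 det1 (eps := eps)) => i j.
  have AE l : GLmx (A (eps * l%:R)) = T *m (S *m A (eps * l%:R)) by rewrite mulmxA TS1 mul1mx.
  under eq_fun do rewrite AE; have -> : (0 : R) = (T *m (0 : 'M[R]_(k, N))) i j by rewrite mulmx0 mxE.
  apply: cvg_entry; apply: cvg_mulmx; first exact: cvg_cst.
  by apply: cvg_mx => a b; rewrite [X in _ --> X]mxE; exact: dS.
exists (Omega P Ss), (Omega P Su); split.
- split=> _; split => //; try exact: open_Omega.
    rewrite GE; apply: (@product_action_Omega R N A P A_rep A_smooth N1 N2 Ss Ts Su Tu 1 ST1 ST2 ST3 ST4 TS SsA (mulr1 1)).
    by move=> i j; under eq_fun do rewrite mul1r; exact: d1.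
  (* The second domain is the first one with the two subspaces exchanged and time reversed, eps =
     -1. *)
  rewrite addrC in TS; have e1 : - 1 * - 1 = 1 :> R by rewrite mulrNN mulr1.
  rewrite GE; apply: (@product_action_Omega R N A P A_rep A_smooth N2 N1 Su Tu Ss Ts (- 1) ST4 ST3 ST2 ST1 TS SuA e1).
  by move=> i j; under eq_fun do rewrite mulN1r; exact: d2.
- move=> O oO _; rewrite GE => pO.
  have N12 : ~~ (0 < N1)%N -> (0 < N2)%N.
    move=> N1z; rewrite lt0n; apply/eqP => N2z.
    have z1 : Ss = 0 by apply/matrixP => i; exfalso; move: (ltn_ord i); case: (N1) N1z i.
    have z2 : Su = 0 by apply/matrixP => i; exfalso; have := ltn_ord i; rewrite {2}N2z.
    have := TS; rewrite z1 z2 !mulmx0 addr0 => /matrixP/(_ (Ordinal N_gt0) (Ordinal N_gt0))/eqP.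
    by rewrite !mxE eqxx eq_sym oner_eq0.
  have [OO1|OO2] := proper_dichotomy A_rep TS SsA SuA d1 d2 N_gt0 oO pO.
    (* If N1 = 0 the first domain is empty, hence so is O, and the other alternative holds trivially
       with N2 > 0; the case N2 = 0 is symmetric. *)
    have [N1p|N1z] := boolP (0 < N1)%N; [by left|right].
    by split; [exact: N12|rewrite Omega0// in OO1; exact: subset_trans OO1 (@sub0set _ _)].
  have [N2p|N2z] := boolP (0 < N2)%N; [by right|left].
  split; first by apply: contraNT N2z => /N12.
  by rewrite Omega0// in OO2; exact: subset_trans OO2 (@sub0set _ _).
move=> Gamma; rewrite LE GE => lat.
have [m [D ld]] := lattice_dataP A_rep A_faithful A_cont lat.
have HE x : (emb A P @^-1` Gamma) x <-> Gamma (emb A P x) by [].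
have [S [g0 [M [M' [_ _ _ _ det1]]]]] := lattice_frame A_rep A_cont A_fix ld.
have N1p : (0 < N1)%N.
  rewrite lt0n; apply/eqP => N1z; apply: (noncontracting _ Su Tu (- 1) det1).
    by move: TS; rewrite (_ : Ss = 0) ?mulmx0 ?add0r//; apply/matrixP => i; exfalso; have := ltn_ord i; rewrite {2}N1z.
  by move=> i j; under eq_fun do rewrite mulN1r; exact: d2.
have N2p : (0 < N2)%N.
  rewrite lt0n; apply/eqP => N2z; apply: (noncontracting _ Ss Ts 1 det1).
    by move: TS; rewrite (_ : Su = 0) ?mulmx0 ?addr0//; apply/matrixP => i; exfalso; have := ltn_ord i; rewrite {2}N2z.
  by move=> i j; under eq_fun do rewrite mul1r; exact: d1.
split => //.
- split => // OE; pose u : 'cV[R]_N1 := const_mx 1.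
  (* A point whose imaginary part is a nonzero vector of the first subspace lies in the first domain
     and not in the second. *)
  pose z := pt P (map_mx (fun x : R => (0 +i* x)%C : Cx R) (Ts *m u)).
  have [c c0 cE] := momz_pt P (map_mx (fun x : R => (0 +i* x)%C : Cx R) (Ts *m u)).
  have {}cE : momz P z = c *: (Ts *m u) by rewrite cE; congr (_ *: _); apply/colP => i; rewrite !mxE.
  have : Omega P Ss z.
    rewrite /Omega/= cE -scalemxAr mulmxA ST1 mul1mx scaler_eq0 gt_eqF//=.
    by apply/eqP => /matrixP/(_ (Ordinal N1p) 0)/eqP; rewrite !mxE oner_eq0.
  by rewrite OE /Omega/= cE -scalemxAr mulmxA ST3 mul0mx scaler0 eqxx.
- split; first by rewrite -LE; apply: open_closedC; apply: openU; exact: open_Omega.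
  move=> g z [x _ <-] z0; rewrite /=; have [c _ ->] := momz_act A P x z.
  by rewrite z0 mulmx0 scaler0.
- exact: (isotropy_dense N_gt0 A_rep A_faithful A_cont A_fix ld HE).
- exact: (ae_dense N_gt0 A_rep A_cont A_eig A_fix ld HE).
Qed.
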